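(* Let $(M,g,\mu)$ be a smooth connected weighted Riemannian manifold without boundary, $V:M\to[0,\infty)$ smooth and $\rho:M\to(0,\infty)$ smooth. (a) If $Q_{\rho,0}$ is conservative, then $Q_{\rho,V}$ is conservative in the generalized sense. In particular, if $(M,g,\mu)$ is stochastically complete, then $Q_{1,V}$ is conservative in the generalized sense. (b) The Dirichlet form $Q_{\rho,V}$ on $L^2(M,\rho\mu)$ is conservative in the generalized sense if and only if the Dirichlet form $Q_{\rho+V,0}$ on $L^2(M,(\rho+V)\mu)$ is conservative.
   Context: All functions are real-valued. The measure is $\mu=\Psi\,\mathrm{vol}_g$ with $\Psi$ smooth and strictly positive, $\mathrm{vol}_g$ the Riemannian measure. For a smooth $w:M\to(0,\infty)$ let $W^1(M,w)=\{f\in L^2(M,w\mu): |\nabla f|\in L^2(M,\mu)\}$ (distributional gradient) with norm $\|f\|_{W^1}=(\int_M|\nabla f|^2d\mu+\int_M f^2 w\,d\mu)^{1/2}$, and let $W^1_0(M,w)$ be the closure of $C_c^\infty(M)$ in it. For any smooth density $\rho>0$ and smooth potential $V\ge0$, the quadratic form $Q_{\rho,V}$ with domain $W_0^1(M,\rho+V)$, $Q_{\rho,V}(f,h)=\int_M\langle\nabla f,\nabla h\rangle d\mu+\int_M fhV\,d\mu$, is a Dirichlet form on $L^2(M,\rho\mu)$. Let $L_{\rho,V}$ be the associated nonpositive self-adjoint operator on $L^2(M,\rho\mu)$ and $T^{\rho,V}_t=e^{tL_{\rho,V}}$, $t>0$, the associated positivity preserving Markovian semigroup. $L^+(M)$ denotes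 the cone of $[0,\infty]$-valued, $\mu$-a.e. defined measurable functions. Any positivity preserving linear operator $T$ on $L^2(M,\rho\mu)$ is extended to $L^+(M)$ by $Tf=\lim_{n\to\infty}Tf_n$, where $(f_n)$ is any increasing sequence of nonnegative functions in $L^2(M,\rho\mu)$ with $f_n\to f$ $\mu$-a.e. (this is well defined). $Q_{\rho,V}$ is called conservative if $T_t^{\rho,V}1=1$ for all $t>0$. $(M,g,\mu)$ is called stochastically complete if $Q_{1,0}$ on $L^2(M,\mu)$ is conservative. $Q_{\rho,V}$ is called conservative in the generalized sense if $$T_t^{\rho,V}1+\int_0^tT_s^{\rho,V}(V/\rho)\,ds=1\quad\text{for all }t>0,$$ where the integral denotes the $L^+(M)$-extension of the positivity preserving operator $f\mapsto\int_0^tT_s^{\rho,V}f\,ds$ on $L^2(M,\rho\mu)$, applied to $V/\rho$. *)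

(* Defs.v *)
From HB Require Import structures.
From mathcomp Require Import all_boot all_order all_algebra.
From mathcomp Require Import all_classical all_reals all_analysis.
From mathcomp Require Import measurable_realfun.

Set Implicit Arguments.
Unset Strict Implicit.
Unset Printing Implicit Defensive.
Import Order.TTheory GRing.Theory Num.Theory.
Import numFieldNormedType.Exports.

Local Open Scope classical_set_scope.
Local Open Scope ring_scope.

Notation borel T := (g_sigma_algebraType (@open T)).

Section Euclidean.
Context {R : realType} {n : nat}.

Definition partial (k : 'I_n) (f : 'rV[R]_n -> R) : 'rV[R]_n -> R :=
  fun x => 'D_(delta_mx 0 k) f x.

(* meant for open U only *)
Definition smooth_on (U : set 'rV[R]_n) (f : 'rV[R]_n -> R) : Prop :=
  forall (s : seq 'I_n) x, U x ->
    {for x, continuous (foldr partial f s)} /\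
    forall k, derivable (foldr partial f s) x (delta_mx 0 k).

Definition is_lebesgue (lam : {measure set (borel 'rV[R]_n) -> \bar R}) : Prop :=
  forall a b : 'rV[R]_n, (forall k, a 0 k <= b 0 k) ->
    lam [set x | forall k, a 0 k <= x 0 k <= b 0 k]
    = (\prod_k (b 0 k - a 0 k))%:E.

End Euclidean.

Record smoothManifold (R : realType) (n : nat) := SmoothManifold {
  carrier :> ptopologicalType;
  manifold_hausdorff : hausdorff_space carrier;
  manifold_second_countable : @second_countable carrier;
  chart_index : Type;
  dom : chart_index -> set carrier;
  coord : chart_index -> carrier -> 'rV[R]_n;
  param : chart_index -> 'rV[R]_n -> carrier;
  (* an arbitrary selection of a chart around each point, used to evaluate
     chart-independent quantities *)
  chart_at : carrier -> chart_index;
  dom_chart_at : forall p, dom (chart_at p) p;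
  dom_open : forall i, open (dom i);
  codom_open : forall i, open (coord i @` dom i);
  coordK : forall i p, dom i p -> param i (coord i p) = p;
  coord_continuous : forall i p, dom i p -> {for p, continuous (coord i)};
  param_continuous : forall i x, (coord i @` dom i) x ->
    {for x, continuous (param i)};
  transition_smooth : forall i j k,
    smooth_on (coord i @` (dom i `&` dom j))
      (fun x => coord j (param i x) 0 k)
}.

Section Smooth.
Context {R : realType} {n : nat} (M : smoothManifold R n).
Implicit Types (i j : chart_index M) (f : M -> R).

Definition codom i : set 'rV[R]_n := coord i @` dom i.

Definition chart_partial i (k : 'I_n) f (p : M) : R :=
  partial k (f \o param i) (coord i p).

Definition smooth f : Prop := forall i, smooth_on (codom i) (f \o param i).

(* tangent vectors are row vectors: a vector v at p in the chart i becomes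
   v *m chart_change i j p in the chart j *)
Definition chart_change i j (p : M) : 'M[R]_n :=
  \matrix_(a, b) chart_partial i a (fun q => coord j q 0 b) p.

Definition test_function f : Prop :=
  smooth f /\ compact (closure [set p | f p != 0]).

(* X i p is the coordinate vector of the field at p in the chart i;
   its value outside dom i is irrelevant *)
Definition is_vector_field (X : chart_index M -> M -> 'rV[R]_n) : Prop :=
  forall i j p, dom i p -> dom j p -> X j p = X i p *m chart_change i j p.

End Smooth.

Record riemannianManifold (R : realType) (n : nat) := RiemannianManifold {
  rm_manifold :> smoothManifold R n;
  metric : chart_index rm_manifold -> rm_manifold -> 'M[R]_n;
  metric_sym : forall i p, dom i p -> (metric i p)^T = metric i p;
  metric_pos : forall i p, dom i p -> forall v : 'rV[R]_n, v != 0 ->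
    0 < (v *m metric i p *m v^T) 0 0;
  metric_smooth : forall i a b,
    smooth_on (codom i) (fun x => metric i (param i x) a b);
  metric_change : forall i j p, dom i p -> dom j p ->
    metric i p = chart_change i j p *m metric j p *m (chart_change i j p)^T
}.

Section Riemannian.
Context {R : realType} {n : nat} (M : riemannianManifold R n).
Implicit Types (i : chart_index M).

Definition volume_density i (p : M) : R := Num.sqrt (\det (metric i p)).

Definition is_riemannian_measure (vol : {measure set (borel M) -> \bar R}) :
    Prop :=
  exists2 lam : {measure set (borel 'rV[R]_n) -> \bar R}, is_lebesgue lam &
    forall i (A : set (borel M)), measurable A -> A `<=` dom i ->
      vol A = (\int[lam]_(x in (coord i @` A : set (borel 'rV[R]_n)))
                 (volume_density i (param i x))%:E)%E.

Definition inner (X Y : chart_index M -> M -> 'rV[R]_n) (p : M) : R :=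
  (X (chart_at p) p *m metric (chart_at p) p *m (Y (chart_at p) p)^T) 0 0.

End Riemannian.

Record weightedManifold (R : realType) (n : nat) := WeightedManifold {
  wm_manifold :> riemannianManifold R n;
  vol : {measure set (borel wm_manifold) -> \bar R};
  volP : is_riemannian_measure vol;
  weight : wm_manifold -> R;
  weight_smooth : smooth weight;
  weight_gt0 : forall p, 0 < weight p;
  mu : {measure set (borel wm_manifold) -> \bar R};
  muE : forall A, measurable A -> mu A = (\int[vol]_(p in A) (weight p)%:E)%E
}.

Section Weighted.
Context {R : realType} {n : nat} (M : weightedManifold R n).
Implicit Types (i : chart_index M) (f h u phi rho w V : M -> R).

Local Notation mu := (mu M).

(* L^2(M, w mu); elements are represented by functions *)
Definition in_L2 w f : Prop :=
  measurable_fun [set: borel M] f /\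
  (\int[mu]_p ((f p) ^+ 2 * w p)%:E < +oo)%E.

Definition L2_dot w f h : R := \int[mu]_p (f p * h p * w p).

Definition L2_norm w f : R := Num.sqrt (L2_dot w f f).

Definition weighted_density i (p : M) : R := weight p * volume_density i p.

(* the divergence with respect to mu of the field with components X in the
   chart i *)
Definition divergence i (X : M -> 'rV[R]_n) (p : M) : R :=
  (weighted_density i p)^-1 *
  \sum_k chart_partial i k (fun q => weighted_density i q * X q 0 k) p.

Definition chart_test_field i (X : M -> 'rV[R]_n) : Prop :=
  [/\ forall k, smooth (fun p => X p 0 k),
      compact (closure [set p | X p != 0]) &
      closure [set p | X p != 0] `<=` dom i].

Definition is_L2_gradient f (G : chart_index M -> M -> 'rV[R]_n) : Prop :=
  [/\ is_vector_field G,
      forall i k,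
        measurable_fun (dom i : set (borel M)) (fun p => G i p 0 k),
      (\int[mu]_p (inner G G p)%:E < +oo)%E &
      forall i X, chart_test_field i X ->
        \int[mu]_(p in dom i) (G i p *m metric i p *m (X p)^T) 0 0
        = - \int[mu]_(p in dom i) (f p * divergence i X p)].

(* determined up to a null set when it exists *)
Definition grad f : chart_index M -> M -> 'rV[R]_n :=
  xget (fun _ _ => 0) [set G | is_L2_gradient f G].

Definition in_W1 w f : Prop := in_L2 w f /\ exists G, is_L2_gradient f G.

Definition W1_norm w f : R :=
  Num.sqrt ((\int[mu]_p inner (grad f) (grad f) p) +
            (\int[mu]_p ((f p) ^+ 2 * w p))).

Definition in_W10 w f : Prop :=
  in_W1 w f /\
  forall e : R, 0 < e -> exists2 phi, test_function phi & W1_norm w (f \- phi) < e.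

Definition form V f h : R :=
  (\int[mu]_p inner (grad f) (grad h) p) + (\int[mu]_p (f p * h p * V p)).

(* f belongs to the domain of L_{rho,V}, and h = L_{rho,V} f *)
Definition is_generator rho V f h : Prop :=
  [/\ in_W10 (rho \+ V) f, in_L2 rho h &
      forall phi, in_W10 (rho \+ V) phi -> form V f phi = - L2_dot rho h phi].

(* T t, for t > 0, is exp(t L_{rho,V}): the strongly continuous symmetric
   contraction semigroup on L^2(M, rho mu) whose generator is L_{rho,V} *)
Record is_semigroup rho V (T : R -> (M -> R) -> (M -> R)) : Prop := {
  semigroup_L2 : forall (t : R) f, 0 < t -> in_L2 rho f -> in_L2 rho (T t f);
  semigroup_linear : forall (t a : R) f h, 0 < t -> in_L2 rho f -> in_L2 rho h ->
    T t (fun p => a * f p + h p) = (fun p => a * T t f p + T t h p) %[ae mu];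
  semigroup_sym : forall (t : R) f h, 0 < t -> in_L2 rho f -> in_L2 rho h ->
    L2_dot rho (T t f) h = L2_dot rho f (T t h);
  semigroup_contraction : forall (t : R) f, 0 < t -> in_L2 rho f ->
    L2_norm rho (T t f) <= L2_norm rho f;
  semigroup_add : forall (s t : R) f, 0 < s -> 0 < t -> in_L2 rho f ->
    T (s + t) f = T s (T t f) %[ae mu];
  semigroup_continuous : forall f, in_L2 rho f ->
    L2_norm rho (T t f \- f) @[t --> 0^'+] --> (0 : R);
  semigroup_generator : forall f h, in_L2 rho f -> in_L2 rho h ->
    is_generator rho V f h <->
    L2_norm rho (fun p => t^-1 * (T t f p - f p) - h p) @[t --> 0^'+]
      --> (0 : R)
}.

(* the L^2(M, rho mu)-valued integral of s |-> T s f over ]0, t] *)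
Definition time_integral rho (T : R -> (M -> R) -> (M -> R)) (t : R) f : M -> R :=
  xget (cst 0) [set h | in_L2 rho h /\
    forall phi, in_L2 rho phi ->
      L2_dot rho h phi
      = \int[lebesgue_measure]_(s in `]0, t]) L2_dot rho (T s f) phi].

Definition approximates rho (fs : nat -> M -> R) (f : M -> \bar R) : Prop :=
  [/\ forall m, in_L2 rho (fs m),
      {ae mu, forall p, forall m, 0 <= fs m p <= fs m.+1 p} &
      {ae mu, forall p, (fs m p)%:E @[m --> \oo] --> f p}].

(* S is an operator on L^2(M, rho mu) and f is in L^+(M); the value is
   determined up to a null set when S is positivity preserving *)
Definition Lplus_ext rho (S : (M -> R) -> (M -> R)) (f : M -> \bar R) :
    M -> \bar R :=
  xget (cst 0%E) [set u |
    [/\ measurable_fun [set: borel M] u,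
        forall p : M, (0 <= u p)%E &
        forall fs, approximates rho fs f ->
          {ae mu, forall p, (S (fs m) p)%:E @[m --> \oo] --> u p}]].

Definition conservative rho (T : R -> (M -> R) -> (M -> R)) : Prop :=
  forall t : R, 0 < t -> Lplus_ext rho (T t) (cst 1%E) = cst 1%E %[ae mu].

Definition generalized_conservative rho V (T : R -> (M -> R) -> (M -> R)) :
    Prop :=
  forall t : R, 0 < t ->
    (Lplus_ext rho (T t) (cst 1%E) \+
     Lplus_ext rho (time_integral rho T t) (fun p => (V p / rho p)%:E))%E
    = cst 1%E %[ae mu].

End Weighted.

(* Main.v *)
(** Write w = rho + V and fix an exhaustion K_j of M by compact sets. Let u_j be the weak solution of
    u - w^-1 Lap u = 1_{K_j} in W^1_0(M, w), that is u_j = (1 - L)^-1 (f_j + h_j) with L = L_{rho,V},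
    f_j = 1_{K_j} and h_j = f_j V / rho. These solutions increase with j and are bounded by 1. The form
    Q_{rho,V} is conservative in the generalized sense iff u_j tends to 1 a.e., a condition on w alone,
    which gives (b) since V = 0 turns generalized conservativeness into conservativeness.

    For the equivalence, integrate T_t u_j - u_j = int_0^t T_s (u_j - f_j - h_j)
      ds. If u_j -> 1, the limit
    of this identity is T_t 1 + int_0^t T_s (V / rho) ds = 1. Conversely, the pairings W_j (t) of
    int_0^t T_s (f_j - u_j) ds with 1_K satisfy W_j' = c_j + W_j - eps_j, where c_j = <1 - u_j, 1_K>,
    eps_j -> 0 by generalized conservativeness and |W_j (t)| <= m t; the linear bound forces c_j -> 0.

    For (a), let u solve the equation for rho and a compact set, and let v solve the one for rho +
      V and K.
    If theta is a test function close to u and K contains its support, testing with (theta - v)^+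
      shows that
    (u - v)^+ is small in L^2; so if the solutions for rho tend to 1, so do those for rho + V. *)

Require Import Defs.
From HB Require Import structures.
From mathcomp Require Import all_boot all_order all_algebra.
From mathcomp Require Import all_classical all_reals all_analysis.
From mathcomp Require Import measurable_realfun.
From mathcomp Require Import perm.
From mathcomp Require Import ring lra.

Set Implicit Arguments.
Unset Strict Implicit.
Unset Printing Implicit Defensive.
Import Order.TTheory GRing.Theory Num.Theory.
Import numFieldNormedType.Exports.

Local Open Scope classical_set_scope.
Local Open Scope ring_scope.

(** * Weighted L^2 spaces *)

(** The semigroup is known only through the axioms of [is_semigroup], in which neither positivity
    nor the bound by 1 occurs. Both come from one comparison: a constant c >= 0 formally satisfies L
    c = - c V / rho, so the flow f' = L f + k preserves the condition f <= c as soon as rho k <= c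
    V. With c = 1 and k = h_j the same comparison bounds T_t f_j + int_0^t T_s h_j ds by 1. Elements
    of L^2 are functions, while gradients, time integrals and extensions to L^+ are selected by
    [xget]; all of them are pinned down only by pairings or almost everywhere. Identities in time
    are therefore scalar identities between pairings, vectors are recovered from them by the Riesz
    theorem, and every selection calls for a proof that a candidate exists. Test functions that are
    close to it in L^2 and have almost the right energy replace it, and each maximum principle is
    first an inequality up to epsilon. *)

Section WeightedL2.
Context d (T : measurableType d) (R : realType) (mu : {measure set T -> \bar R}).
Variable w : T -> R.
Hypothesis mw : measurable_fun setT w.
Hypothesis w_gt0 : forall p, 0 < w p.
Let w_ge0 p : 0 <= w p := ltW (w_gt0 p).
Implicit Types f g h : T -> R.

(** For the measurable space [borel M], [L2] and [dot] are convertible with [in_L2] and [L2_dot], so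
    the facts of this section apply on the manifold as they stand. *)
Definition L2 f := measurable_fun setT f /\
  (\int[mu]_p ((f p) ^+ 2 * w p)%:E < +oo)%E.
Definition dot f g : R := \int[mu]_p (f p * g p * w p).

Lemma scaleaddE a f g p : (a *: f + g) p = a * f p + g p.
Proof. by []. Qed.

Lemma L2_measurable f : L2 f -> measurable_fun setT f.
Proof. by case. Qed.

Lemma L2_sqr_integrable f : L2 f -> mu.-integrable setT (EFin \o (fun p => f p * f p * w p)).
Proof.
move=> [mf fi]; apply/integrableP; split.
  by apply/measurable_EFinP; apply: measurable_funM => //; apply: measurable_funM.
rewrite (eq_integral (fun p => ((f p) ^+ 2 * w p)%:E))// => p _ /=.
by rewrite ger0_norm ?expr2// mulr_ge0// -expr2 sqr_ge0.
Qed.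

Lemma integrable_L2 f : measurable_fun setT f ->
  mu.-integrable setT (EFin \o (fun p => f p * f p * w p)) -> L2 f.
Proof.
move=> mf /integrableP[_ fi]; split => //.
rewrite (eq_integral (fun p => `|(f p * f p * w p)%R%:E|%E))// => p _ /=.
by rewrite ger0_norm ?expr2// mulr_ge0// -expr2 sqr_ge0.
Qed.

Lemma L2_mul_integrable f g : L2 f -> L2 g ->
  mu.-integrable setT (EFin \o (fun p => f p * g p * w p)).
Proof.
move=> Lf Lg.
have := integrableD measurableT (L2_sqr_integrable Lf) (L2_sqr_integrable Lg).
apply: le_integrable => //.
  by apply/measurable_EFinP; apply: measurable_funM => //; apply: measurable_funM; [case: Lf|case: Lg].
move=> p _ /=; rewrite lee_fin.
have wp := w_ge0 p.
rewrite -mulrDl !normrM (ger0_norm wp) ler_wpM2r//.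
rewrite [leRHS]ger0_norm; last by rewrite addr_ge0// -expr2 sqr_ge0.
by rewrite -normrM ler_norml; apply/andP; split; nra.
Qed.

Lemma L2_dominated f g : measurable_fun setT f -> L2 g -> (forall p, `|f p| <= `|g p|) -> L2 f.
Proof.
move=> mf Lg fg; apply: integrable_L2 => //.
apply: le_integrable (L2_sqr_integrable Lg) => //.
  by apply/measurable_EFinP; apply: measurable_funM => //; apply: measurable_funM.
move=> p _ /=; rewrite lee_fin !normrM; apply: ler_wpM2r => //; exact: ler_pM.
Qed.

Lemma L2_lin a f g : L2 f -> L2 g -> L2 (a *: f + g).
Proof.
move=> Lf Lg.
have [mf mg] := (L2_measurable Lf, L2_measurable Lg).
have mh : measurable_fun setT (a *: f + g).
  by apply: measurable_funD => //; apply: measurable_funM.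
apply: integrable_L2 => //.
have i1 := integrableZl measurableT (a * a) (L2_sqr_integrable Lf).
have i2 := integrableZl measurableT (2 * a) (L2_mul_integrable Lf Lg).
have i3 := L2_sqr_integrable Lg.
have := integrableD measurableT (integrableD measurableT i1 i2) i3.
apply: eq_integrable => // p _ /=.
rewrite -!EFinM -!EFinD; congr EFin.
by rewrite scaleaddE; ring.
Qed.

Lemma L2_0 : L2 0.
Proof.
split; first exact: measurable_cst.
by rewrite integral0_eq ?ltry// => p _; rewrite /= expr0n mul0r.
Qed.

Lemma dotC f g : dot f g = dot g f.
Proof. by apply: eq_Rintegral => p _; rewrite (mulrC (f p)). Qed.

Lemma dot_linl a f g h : L2 f -> L2 g -> L2 h ->
  dot (a *: f + g) h = a * dot f h + dot g h.
Proof.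
move=> Lf Lg Lh; rewrite /dot.
rewrite -RintegralZl//; last exact: L2_mul_integrable.
rewrite -RintegralD//; last 2 first.
- have := integrableZl measurableT a (L2_mul_integrable Lf Lh).
  by apply: eq_integrable => // p _ /=; rewrite EFinM.
- exact: L2_mul_integrable.
by apply: eq_Rintegral => p _; rewrite scaleaddE; ring.
Qed.

Lemma dot_ge0 f : 0 <= dot f f.
Proof.
by apply: Rintegral_ge0 => p _; rewrite mulr_ge0// -expr2 sqr_ge0.
Qed.

Lemma dot_le f g f' g' : L2 f -> L2 g -> L2 f' -> L2 g' ->
  {ae mu, forall p, f p * g p <= f' p * g' p} -> dot f g <= dot f' g'.
Proof.
move=> Lf Lg Lf' Lg' fg.
have i1 := L2_mul_integrable Lf Lg; have i2 := L2_mul_integrable Lf' Lg'.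
have i3 := integrableB measurableT i2 i1.
rewrite -subr_ge0 /dot -RintegralB//.
apply: fine_ge0.
(* The inequality holds only almost everywhere; the positive part of the integrand is nonnegative
   everywhere and has the same integral. *)
rewrite (ae_eq_integral (fun p => (Num.max 0 ((f' p * g' p * w p) - f p * g p * w p))%:E))//.
- by apply: integral_ge0 => p _; rewrite lee_fin le_max lexx.
- by case/integrableP : i3.
- apply/measurable_EFinP; apply: measurable_maxr => //.
  apply: measurable_funB; apply/measurable_EFinP.
  + by case/integrableP : i2.
  + by case/integrableP : i1.
apply: filterS fg => p fgp _; congr EFin; apply/esym/max_idPr.
by rewrite subr_ge0 ler_wpM2r.
Qed.

Lemma dot_ae f f' g : L2 f -> L2 f' -> L2 g ->
  {ae mu, forall p, f p = f' p} -> dot f g = dot f' g.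
Proof.
move=> Lf Lf' Lg ff'; apply/eqP; rewrite eq_le !dot_le//.
- by apply: filterS ff' => p ->.
- by apply: filterS ff' => p ->.
Qed.

Lemma dot_eq0 f : L2 f -> dot f f = 0 -> {ae mu, forall p, f p = 0}.
Proof.
move=> Lf f0.
have i1 := L2_sqr_integrable Lf.
have : (\int[mu]_p `|(f p * f p * w p)%:E|)%E = 0%E.
  rewrite (eq_integral (fun p => (f p * f p * w p)%:E)); last first.
    by move=> p _; rewrite /= ger0_norm// mulr_ge0// -expr2 sqr_ge0.
  have := integrable_fin_num measurableT i1.
  by move=> /fineK <-; move: f0; rewrite /dot /Rintegral => ->.
move=> /(ae_eq_integral_abs mu measurableT) H.
have /H : measurable_fun setT (fun p => (f p * f p * w p)%:E).
  by case/integrableP : i1.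
apply: filterS => p /(_ I) [] /eqP.
by rewrite mulf_eq0 (gt_eqF (w_gt0 p)) orbF -expr2 sqrf_eq0 => /eqP.
Qed.

Lemma geometric_half_le n : \sum_(0 <= k < n) (2^-1 : R) ^+ k <= 2.
Proof.
have -> : \sum_(0 <= k < n) (2^-1 : R) ^+ k = 2 - 2 * 2^-1 ^+ n.
  elim: n => [|n IH]; first by rewrite big_geq// expr0; ring.
  rewrite big_nat_recr//= IH exprS; by field.
by rewrite lerBlDr lerDl mulr_ge0// exprn_ge0// invr_ge0.
Qed.

Lemma cvg_fast_cauchy (u : R ^nat) (C : R) : 
  (forall k, `|u k.+1 - u k| <= C * 2^-1 ^+ k) -> cvgn u.
Proof.
move=> uC.
have : cvgn [normed series (telescope u)].
  apply: (@series_le_cvg _ _ (fun k => C * 2^-1 ^+ k)) => //.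
  - by move=> k; rewrite /= normr_ge0.
  - by move=> k; apply: le_trans (uC k); rewrite normr_ge0.
  - apply: is_cvg_geometric_series.
    by rewrite ger0_norm ?invr_ge0// invf_lt1// ltr1n.
move=> /normed_cvg/cvg_ex[l].
rewrite telescopeK => ul; apply/cvg_ex; exists (l + u 0%N).
move/cvgrPdist_lt : ul => ul; apply/cvgrPdist_lt => e /ul.
by apply: filterS => k; rewrite opprB addrA.
Qed.

(** The series G of the terms 4^k |u_{k+1} - u_k|^2 w has integral at most the sum of 4^k 8^-k,
    hence at most 2. Where G is finite, |u_{k+1} - u_k| is bounded by a multiple of 2^-k and the
    sequence converges. *)
Lemma L2_fast_cvg (u : nat -> T -> R) : (forall k, L2 (u k)) ->
  (forall k, dot (u k.+1 - u k) (u k.+1 - u k) <= 8^-1 ^+ k) ->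
  exists f, measurable_fun setT f /\ {ae mu, forall p, u k p @[k --> \oo] --> f p}.
Proof.
move=> Lu du.
pose a k p := u k.+1 p - u k p.
pose G p : \bar R := (\sum_(k <oo) (4 ^+ k * (a k p * a k p * w p))%:E)%E.
have ma k : measurable_fun setT (a k).
  by apply: measurable_funB; exact: L2_measurable.
have La k : L2 (a k).
  have := L2_lin (-1) (Lu k) (Lu k.+1); congr L2.
  by apply/funext => p; rewrite scaleaddE /a mulN1r addrC.
have t0 k p : 0 <= 4 ^+ k * (a k p * a k p * w p).
  by rewrite mulr_ge0 ?exprn_ge0// mulr_ge0// -expr2 sqr_ge0.
have mG : measurable_fun setT G.
  apply: ge0_emeasurable_sum => [k p _ _|k _]; first by rewrite lee_fin.
  apply/measurable_EFinP; apply: measurable_funM => //.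
  by apply: measurable_funM => //; apply: measurable_funM.
have G0 p : (0 <= G p)%E.
  by apply: nneseries_ge0 => k _ _; rewrite lee_fin.
have IG : (\int[mu]_p G p < +oo)%E.
  have mt k : measurable_fun setT (fun p => (4 ^+ k * (a k p * a k p * w p))%:E).
    apply/measurable_EFinP; apply: measurable_funM => //.
    by apply: measurable_funM => //; apply: measurable_funM.
  have t0' k p : [set: T] p -> (0%R <= (4 ^+ k * (a k p * a k p * w p))%:E)%E.
    by rewrite lee_fin.
  rewrite integral_nneseries//.
  apply: (@le_lt_trans _ _ 2%:E); last exact: ltry.
  apply: lime_le.
    by apply: is_cvg_nneseries => k _ _; apply: integral_ge0 => p _; rewrite lee_fin.
  near=> n; apply: (@le_trans _ _ (\sum_(0 <= k < n) ((2^-1 : R) ^+ k)%:E)%E); last first.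
    by rewrite sumEFin lee_fin geometric_half_le.
  apply: lee_sum => k _.
  rewrite (eq_integral (fun p => ((4 ^+ k)%:E * (a k p * a k p * w p)%:E)%E))//.
  have mak : measurable_fun setT (fun p => (a k p * a k p * w p)%:E).
    apply/measurable_EFinP.
    by apply: measurable_funM => //; apply: measurable_funM.
  have ak0 p : [set: T] p -> (0%R <= (a k p * a k p * w p)%:E)%E.
    by rewrite lee_fin mulr_ge0// -expr2 sqr_ge0.
  rewrite ge0_integralZl//.
  have /fineK <- := integrable_fin_num measurableT (L2_sqr_integrable (La k)).
  rewrite -EFinM lee_fin.
  apply: (@le_trans _ _ (4 ^+ k * 8^-1 ^+ k)).
    by rewrite ler_pM2l ?exprn_gt0//; exact: du.
  by rewrite -exprMn lerXn2r// ?nnegrE; lra.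
have aeG : {ae mu, forall p, (G p < +oo)%E}.
  have : mu.-integrable setT G.
    apply/integrableP; split => //; apply: le_lt_trans IG.
    apply: ge0_le_integral => //=.
    - exact: measurableT_comp.
    - by move=> p _; rewrite gee0_abs.
  move=> /(integrable_ae measurableT); apply: filterS => p /(_ I).
  by rewrite fin_numE => /andP[_]; rewrite ltey.
(* The upper limit is measurable without any convergence; it equals the limit on the set where G is
   finite. *)
exists (fun p => fine (limn_esup (fun k => (u k p)%:E))); split.
  apply: measurableT_comp => //; apply: measurable_fun_limn_esup => k.
  by apply/measurable_EFinP; exact: L2_measurable.
apply: filterS aeG => p Gp.
have : cvgn (u ^~ p).
  pose g := fine (G p) / w p.
  have gk k : 4 ^+ k * (a k p * a k p) <= g.
    rewrite /g ler_pdivlMr// -mulrA -lee_fin fineK; last first.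
      by rewrite ge0_fin_numE.
    apply: le_trans (nneseries_lim_ge k.+1 _) => //=; last by move=> j _ _; rewrite lee_fin.
    rewrite big_nat_recr//= leeDr//.
    by apply: sume_ge0 => j _; rewrite lee_fin.
  have g0 : 0 <= g by apply: le_trans (gk 0%N); rewrite mulr_ge0 ?exprn_ge0// -expr2 sqr_ge0.
  (* The bound sqrt g is replaced by 1 + g, whose square also dominates g. *)
  apply: (@cvg_fast_cauchy _ (1 + g)) => k.
  rewrite -ler_sqr ?nnegrE//; last by rewrite mulr_ge0 ?exprn_ge0// addr_ge0.
  rewrite real_normK ?num_real// exprMn -exprM mulnC exprM.
  rewrite (_ : (2^-1 ^+ 2 : R) = 4^-1); last by field.
  rewrite exprVn ler_pdivlMr ?exprn_gt0// mulrC.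
  apply: le_trans (gk k) _; nra.
move=> /cvg_ex[l ul].
have ule : (u k p)%:E @[k --> \oo] --> l%:E by apply: cvg_EFin => //; exact: nearW.
by rewrite is_cvg_limn_esupE ?(cvg_lim _ ule)//; apply/cvg_ex; exists l%:E.
Unshelve. all: by end_near. Qed.

Lemma L2_sub f g : L2 f -> L2 g -> L2 (f - g).
Proof.
move=> Lf Lg; have := L2_lin (-1) Lg Lf; congr L2.
by apply/funext => p; rewrite scaleaddE mulN1r addrC.
Qed.

(** Riesz-Fischer: a rapidly convergent subsequence has an almost everywhere limit, and Fatou's
    lemma turns the Cauchy estimate for u_n - u_m into the same estimate for f - u_m. *)
Lemma L2_complete (u : nat -> T -> R) : (forall k, L2 (u k)) ->
  (forall e : R, 0 < e -> exists N, forall m n, (N <= m)%N -> (N <= n)%N ->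
     dot (u m - u n) (u m - u n) <= e) ->
  exists2 f, L2 f & dot (u n - f) (u n - f) @[n --> \oo] --> (0 : R).
Proof.
move=> Lu Cu.
have /choice[N NP] : forall k, exists N, forall m n, (N <= m)%N -> (N <= n)%N ->
    dot (u m - u n) (u m - u n) <= 8^-1 ^+ k.
  by move=> k; apply: Cu; rewrite exprn_gt0// invr_gt0.
(* The extracted indices increase strictly and stay beyond N k; in particular k <= s k. *)
pose s := fix s k := if k is j.+1 then maxn (s j).+1 (N j.+1) else N 0%N.
have sN k : (N k <= s k)%N by case: k => // k; rewrite /= leq_maxr.
have sS k : (s k < s k.+1)%N by rewrite /= leq_maxl.
have sk k : (k <= s k)%N by elim: k => // k IH; exact: leq_ltn_trans IH (sS k).
have [f [mf uf]] : exists f, measurable_fun setT f /\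
    {ae mu, forall p, (u (s k)) p @[k --> \oo] --> f p}.
  apply: (@L2_fast_cvg (fun k => u (s k))) => // k; apply: NP => //.
  exact: leq_trans (sN k) (ltnW (sS k)).
have key m e : (forall n, (m <= n)%N -> dot (u n - u m) (u n - u m) <= e) ->
    (\int[mu]_p ((u m p - f p) ^+ 2 * w p)%:E <= e%:E)%E.
  move=> me.
  pose F k p := ((u (s k) p - u m p) * (u (s k) p - u m p) * w p)%:E.
  have mF k : measurable_fun setT (F k).
    apply/measurable_EFinP; apply: measurable_funM => //; apply: measurable_funM;
    by apply: measurable_funB; exact: L2_measurable.
  have F0 k p : [set: T] p -> (0%R <= F k p)%E.
    by rewrite lee_fin mulr_ge0// -expr2 sqr_ge0.
  rewrite (ae_eq_integral (fun p => limn_einf (F ^~ p)))//.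
  - apply: le_trans (fatou mu measurableT mF F0) _.
    rewrite limn_einf_lim; apply: lime_le; first exact: is_cvg_einfs.
    near=> k; apply: ereal_inf_le.
    (* The index must be at least k to belong to the tail and at least m for the hypothesis on u_n -
       u_m to apply. *)
    exists (\int[mu]_p F (maxn k m) p)%E; first by exists (maxn k m) => //=; exact: leq_maxl.
    have /fineK <- := integrable_fin_num measurableT (L2_sqr_integrable (L2_sub (Lu (s (maxn k m)))
      (Lu m))).
    rewrite lee_fin; apply: me; apply: leq_trans (sk _); exact: leq_maxr.
  - apply/measurable_EFinP; apply: measurable_funM => //; apply: measurable_funX.
    by apply: measurable_funB => //; exact: L2_measurable.
  - rewrite (_ : (fun p => _) = (fun p => - limn_esup (fun k => - F k p))%E); last first.
      by apply/funext => p; rewrite (limn_esupN (F ^~ p)) oppeK.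
    apply: measurableT_comp => //; apply: measurable_fun_limn_esup => k.
    exact: measurableT_comp.
  apply: filterS uf => p up _.
  have c1 : u (s k) p - u m p @[k --> \oo] --> f p - u m p.
    by apply: cvgB => //; exact: cvg_cst.
  have c2 : (u (s k) p - u m p) * (u (s k) p - u m p) * w p @[k --> \oo]
      --> (f p - u m p) * (f p - u m p) * w p.
    by apply: cvgM; [exact: cvgM|exact: cvg_cst].
  have c3 : F k p @[k --> \oo] --> ((f p - u m p) * (f p - u m p) * w p)%:E.
    by apply: cvg_EFin => //; exact: nearW.
  rewrite is_cvg_limn_einfE; last by apply/cvg_ex; eexists; exact: c3.
  by rewrite (cvg_lim _ c3)// -(opprB (f p)) sqrrN expr2.
have Luf m e : (forall n, (m <= n)%N -> dot (u n - u m) (u n - u m) <= e) -> L2 (u m - f).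
  move=> /key me; split; last exact: le_lt_trans me (ltry _).
  by apply: measurable_funB => //; exact: L2_measurable.
have Lf : L2 f.
  have [M MP] := Cu 1 ltr01.
  have /(L2_sub (Lu M)) : L2 (u M - f) by apply: (@Luf _ 1) => n Mn; exact: MP.
  by rewrite opprB addrC subrK.
exists f => //; apply/cvgrPdist_le => e e0.
have [M MP] := Cu e e0; exists M => // n /= Mn.
rewrite sub0r normrN ger0_norm ?dot_ge0//.
have H := key n e (fun m nm => MP m n (leq_trans Mn nm) Mn).
rewrite /dot /Rintegral.
have /fineK E := integrable_fin_num measurableT (L2_sqr_integrable (L2_sub (Lu n) Lf)).
rewrite -lee_fin E; apply: le_trans H; rewrite le_eqVlt; apply/orP; left; apply/eqP.
by apply: eq_integral => p _; rewrite expr2.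
Unshelve. all: by end_near. Qed.

End WeightedL2.

(** * Semigroups in a semi-Hilbert space *)

Section Primitive.
Context {R : realType}.
Implicit Types (k f : R -> R) (t : R).
Local Notation leb := (@lebesgue_measure R).

(* The base point -1 makes [prim k] two-sided differentiable at 0. *)
Definition prim k t : R :=
  \int[leb]_(s in `]-1, t]) k s - \int[leb]_(s in `]-1, 0]) k s.

Lemma continuous_itv_integrable k a b : continuous k ->
  leb.-integrable `]a, b] (EFin \o k).
Proof.
move=> ck; apply: (@integrableS _ _ _ leb `[a, b]) => //.
  by apply: subset_itv; rewrite bnd_simp.
by apply: continuous_compact_integrable; [exact: segment_compact|exact: continuous_subspaceT].
Qed.

Lemma prim_int k t : continuous k -> 0 <= t ->
  \int[leb]_(s in `]0, t]) k s = prim k t.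
Proof.
move=> ck t0; rewrite /prim Rintegral_itvB//.
- exact: continuous_itv_integrable.
by rewrite bnd_simp.
Qed.

Lemma prim0 k : prim k 0 = 0.
Proof. by rewrite /prim subrr. Qed.

Lemma is_derive_prim k t : continuous k -> -1 < t -> is_derive t 1 (prim k) (k t).
Proof.
move=> ck t1.
have [||||d e] := @continuous_FTC1 R k (BRight (-1)) t (t + 1).
- by rewrite ltrDl.
- exact: continuous_itv_integrable.
- by rewrite lte_fin.
- exact: ck.
rewrite /prim -[k t]subr0; apply: is_deriveB.
by rewrite -e derive1E; apply: DeriveDef.
Qed.

Lemma derive_mvt (f df : R -> R) (a b : R) : a <= b ->
  (forall x : R, a <= x <= b -> is_derive x 1 f (df x)) ->
  exists2 c, a <= c <= b & f b - f a = df c * (b - a).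
Proof.
move=> ab fd.
have [||c] := @MVT_segment R f df a b ab.
- by move=> x; rewrite in_itv/= => /andP[ax xb]; apply: fd; rewrite !ltW.
- apply: derivable_within_continuous => x; rewrite in_itv/= => xab.
  by have := fd x xab => -[].
- by move=> cab E; exists c.
Qed.

(** Linearity, splitting and translation of the time integrals below are all obtained by comparing
    derivatives and initial values with this lemma. *)
Lemma derive_unique (f g h : R -> R) t : 0 <= t ->
  (forall x : R, 0 <= x -> is_derive x 1 f (h x)) ->
  (forall x : R, 0 <= x -> is_derive x 1 g (h x)) -> f 0 = g 0 -> f t = g t.
Proof.
move=> t0 fh gh fg0.
have [|c _] := @derive_mvt (f \- g) (fun=> 0) 0 t t0.
  move=> x /andP[x0 _]; rewrite -[0](subrr (h x)); apply: is_deriveB; [exact: fh|exact: gh].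
by rewrite mul0r/= fg0 subrr subr0 => /eqP; rewrite subr_eq0 => /eqP.
Qed.

Lemma is_derive_lincomb (f g : R -> R) (a x df dg : R) :
  is_derive x 1 f df -> is_derive x 1 g dg ->
  is_derive x 1 (fun y => a * f y + g y) (a * df + dg).
Proof. by move=> hf hg; apply: is_deriveD; apply: is_deriveZ. Qed.

Lemma is_derive_comp_addl (f : R -> R) (a x df : R) :
  is_derive (a + x) 1 f df -> is_derive x 1 (fun y => f (a + y)) df.
Proof.
move=> d1.
have d2 : is_derive x 1 (fun t : R => a + t) (1 : R).
  by rewrite -[X in is_derive _ _ _ X]add0r; apply: is_deriveD.
by have := @is_derive1_comp _ f (fun t : R => a + t) x df 1 d1 d2; rewrite mulr1.
Qed.

End Primitive.

Section SemiHilbert.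
Context (R : realType) (X : lmodType R) (D : X -> Prop) (dot : X -> X -> R).
Hypothesis D0 : D 0.
Hypothesis Dlin : forall a f g, D f -> D g -> D (a *: f + g).
Hypothesis dotC : forall f g, dot f g = dot g f.
Hypothesis dot_linl : forall a f g h, D f -> D g -> D h ->
  dot (a *: f + g) h = a * dot f h + dot g h.
Hypothesis dot_ge0 : forall f, 0 <= dot f f.
Implicit Types f g h : X.

(** The form is only semidefinite and lives on a predicate [D] of a larger space, since functions
    are not identified modulo null sets. The same lemmas then serve [L2_dot], [energy] and the full
    form on W^1. *)
Definition nrm f := Num.sqrt (dot f f).

Lemma hD f g : D f -> D g -> D (f + g).
Proof. by move=> Df Dg; rewrite -(scale1r f); exact: Dlin. Qed.

Lemma hZ a f : D f -> D (a *: f).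
Proof. by move=> Df; rewrite -(addr0 (a *: f)); exact: Dlin. Qed.

Lemma hN f : D f -> D (- f).
Proof. by move=> Df; rewrite -scaleN1r; exact: hZ. Qed.

Lemma hB f g : D f -> D g -> D (f - g).
Proof. by move=> Df Dg; apply: hD => //; exact: hN. Qed.

Lemma dotDl f g h : D f -> D g -> D h -> dot (f + g) h = dot f h + dot g h.
Proof. by move=> Df Dg Dh; rewrite -{1}(scale1r f) dot_linl// mul1r. Qed.

Lemma dot0l h : D h -> dot 0 h = 0.
Proof. by move=> Dh; have := dotDl D0 D0 Dh; rewrite addr0; lra. Qed.

Lemma dotZl a f h : D f -> D h -> dot (a *: f) h = a * dot f h.
Proof. by move=> Df Dh; rewrite -(addr0 (a *: f)) dot_linl// dot0l// addr0. Qed.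

Lemma dotNl f h : D f -> D h -> dot (- f) h = - dot f h.
Proof. by move=> Df Dh; rewrite -scaleN1r dotZl// mulN1r. Qed.

Lemma dotBl f g h : D f -> D g -> D h -> dot (f - g) h = dot f h - dot g h.
Proof. by move=> Df Dg Dh; rewrite dotDl ?dotNl//; exact: hN. Qed.

Lemma dotDr f g h : D f -> D g -> D h -> dot h (f + g) = dot h f + dot h g.
Proof. by move=> Df Dg Dh; rewrite !(dotC h) dotDl. Qed.

Lemma dotZr a f h : D f -> D h -> dot h (a *: f) = a * dot h f.
Proof. by move=> Df Dh; rewrite !(dotC h) dotZl. Qed.

Lemma dotBr f g h : D f -> D g -> D h -> dot h (f - g) = dot h f - dot h g.
Proof. by move=> Df Dg Dh; rewrite !(dotC h) dotBl. Qed.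

Lemma nrm_ge0 f : 0 <= nrm f.
Proof. exact: sqrtr_ge0. Qed.

Lemma nrm_sqr f : nrm f ^+ 2 = dot f f.
Proof. by rewrite sqr_sqrtr. Qed.

Lemma dot_sqr_le f g : D f -> D g -> dot f g ^+ 2 <= dot f f * dot g g.
Proof.
move=> Df Dg.
have H t : 0 <= dot f f + 2 * t * dot f g + t ^+ 2 * dot g g.
  have Dtg := hZ t Dg.
  have := dot_ge0 (f + t *: g).
  rewrite dotDl ?dotDr ?dotZl ?dotZr//; last exact: hD.
  by rewrite ?dotDr ?dotZl ?dotZr// (dotC g f); lra.
have [g0|g0] := eqVneq (dot g g) 0.
  (* When [dot g g] vanishes the polynomial is affine in t; unless [dot f g] is 0, this t gives it
     the value -1. *)
  rewrite g0 mulr0; have := H (- (dot f f + 1) / (2 * dot f g)).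
  rewrite g0 mulr0 addr0.
  have [->|n0] := eqVneq (dot f g) 0; first by rewrite expr0n.
  have -> : 2 * (- (dot f f + 1) / (2 * dot f g)) * dot f g = - (dot f f + 1) by field.
  lra.
have gp : 0 < dot g g by rewrite lt_neqAle eq_sym g0 dot_ge0.
have := H (- dot f g / dot g g).
have -> : dot f f + 2 * (- dot f g / dot g g) * dot f g + (- dot f g / dot g g) ^+ 2 * dot g g
   = (dot f f * dot g g - dot f g ^+ 2) / dot g g by field.
by rewrite pmulr_lge0 ?invr_gt0// subr_ge0.
Qed.

Lemma dot_le_nrm f g : D f -> D g -> `|dot f g| <= nrm f * nrm g.
Proof.
move=> Df Dg; rewrite -ler_sqr ?nnegrE ?mulr_ge0 ?nrm_ge0//.
by rewrite real_normK ?num_real// exprMn !nrm_sqr; exact: dot_sqr_le.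
Qed.

Lemma nrmD f g : D f -> D g -> nrm (f + g) <= nrm f + nrm g.
Proof.
move=> Df Dg; rewrite -ler_sqr ?nnegrE ?addr_ge0 ?nrm_ge0//.
rewrite nrm_sqr dotDl ?dotDr//; last exact: hD.
have := dot_le_nrm Df Dg; rewrite ler_norml => /andP[_ H].
rewrite sqrrD !nrm_sqr (dotC g f); lra.
Qed.

Lemma nrmZ a f : D f -> nrm (a *: f) = `|a| * nrm f.
Proof.
move=> Df; rewrite /nrm dotZl ?dotZr//; last exact: hZ.
by rewrite mulrA -expr2 sqrtrM ?sqr_ge0// sqrtr_sqr.
Qed.

Lemma nrmN f : D f -> nrm (- f) = nrm f.
Proof. by move=> Df; rewrite -scaleN1r nrmZ// normrN1 mul1r. Qed.

Lemma nrmB f g : D f -> D g -> nrm (f - g) <= nrm f + nrm g.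
Proof. by move=> Df Dg; rewrite -(nrmN Dg); apply: nrmD => //; exact: hN. Qed.

Lemma nrm_le_dot f C : D f -> 0 <= C ->
  (forall phi, D phi -> `|dot f phi| <= C * nrm phi) -> nrm f <= C.
Proof.
move=> Df C0 /(_ _ Df); rewrite ger0_norm// -nrm_sqr expr2.
have [->//|n0] := eqVneq (nrm f) 0.
by rewrite ler_pM2r// lt_neqAle eq_sym n0 nrm_ge0.
Qed.

Hypothesis complete : forall u : nat -> X, (forall k, D (u k)) ->
  (forall e : R, 0 < e -> exists N, forall m n, (N <= m)%N -> (N <= n)%N ->
     dot (u m - u n) (u m - u n) <= e) ->
  exists2 f, D f & dot (u n - f) (u n - f) @[n --> \oo] --> (0 : R).

(** The representative minimizes J f = |f|^2 - 2 l f. A minimizing sequence is Cauchy by the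
    parallelogram identity, and the first variation of J at the limit gives the pairing. *)
Lemma riesz (l : X -> R) C :
  (forall a f g, D f -> D g -> l (a *: f + g) = a * l f + l g) ->
  (forall f, D f -> `|l f| <= C * nrm f) ->
  exists2 h, D h & forall phi, D phi -> dot h phi = l phi.
Proof.
move=> ll lC.
have l0 : l 0 = 0 by have := ll 1 0 0 D0 D0; rewrite scale1r addr0; lra.
have lZ a f : D f -> l (a *: f) = a * l f.
  by move=> Df; rewrite -(addr0 (a *: f)) ll// l0 addr0.
have lD f g : D f -> D g -> l (f + g) = l f + l g.
  by move=> Df Dg; rewrite -{1}(scale1r f) ll// mul1r.
pose J f := dot f f - 2 * l f.
have C0 f : D f -> `|l f| <= `|C| * nrm f.
  by move=> Df; apply: le_trans (lC f Df) _; rewrite ler_wpM2r ?nrm_ge0// ler_norm.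
have JC f : D f -> - `|C| ^+ 2 <= J f.
  move=> Df; have := C0 f Df; rewrite ler_norml => /andP[_ H].
  by rewrite /J -nrm_sqr; have := sqr_ge0 (nrm f - `|C|); nra.
pose A := [set J f | f in D].
have hA : has_inf A.
  split; first by exists (J 0); exists 0.
  by exists (- `|C| ^+ 2) => _ [f Df <-]; exact: JC.
have JA f : D f -> inf A <= J f.
  by move=> Df; apply: ge_inf; [exact: (proj2 hA)|exists f].
(* The linear terms cancel in this combination, and the value at the midpoint is at least the
   infimum, so two almost minimizers are close. *)
have par f g : D f -> D g -> dot (f - g) (f - g) = 2 * J f + 2 * J g - 4 * J (2^-1 *: (f + g)).
  move=> Df Dg; have Dfg := hD Df Dg; have Dfg' := hB Df Dg.
  rewrite /J lZ// lD// dotZl ?dotZr//; last exact: hZ.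
  rewrite dotBl ?dotBr// dotDl ?dotDr// (dotC g f); by field.
have /choice[u uP] : forall k, exists f, D f /\ J f <= inf A + (k.+1%:R)^-1.
  move=> k; have [_ [f Df <-] Jf] := inf_adherent (ltac:(by rewrite invr_gt0 ltr0Sn)
    : 0 < (k.+1%:R : R)^-1) hA.
  by exists f; split => //; exact: ltW.
have Du k : D (u k) by case: (uP k).
have [h Dh uh] : exists2 f, D f & dot (u n - f) (u n - f) @[n --> \oo] --> (0 : R).
  apply: complete => // e e0.
  have : \forall n \near \oo, (n.+1%:R)^-1 < e / 4.
    by apply: near_infty_natSinv_lt (PosNum (ltac:(by rewrite divr_gt0) : 0 < e / 4)).
  move=> [N _ NP]; exists N => m n Nm Nn.
  have [/= Nm' Nn'] := (NP m Nm, NP n Nn).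
  have [_ Jm] := uP m; have [_ Jn] := uP n.
  rewrite par//; 
  move: (JA _ (hZ 2^-1 (hD (Du m) (Du n)))) Jm Jn Nm' Nn'.
  move: (J (u m)) (J (u n)) (J _) (inf A) (m.+1%:R^-1) (n.+1%:R^-1) => ? ? ? ? ? ?.
  lra.
(* Continuity of J along the sequence; c bounds the Lipschitz factor 2 |h| + 2 |C| from above and is
   at least 1, so it can be divided by. *)
have Jh : forall e : R, 0 < e -> J h <= inf A + e.
  move=> e e0.
  pose c := 2 * nrm h + 2 * `|C| + 1.
  have c1 : 1 <= c by rewrite /c; have := nrm_ge0 h; have := normr_ge0 C; lra.
  have c0 : 0 < c by lra.
  have e2 : 0 < (e / 2 / c) ^+ 2 by rewrite exprn_gt0// divr_gt0// divr_gt0.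
  have : \forall n \near \oo, (n.+1%:R)^-1 < e / 2.
    by apply: near_infty_natSinv_lt (PosNum (ltac:(by rewrite divr_gt0) : 0 < e / 2)).
  move=> [N _ NP].
  have /cvgrPdist_lt/(_ _ e2)[M _ MP] := uh.
  pose n := maxn N M.
  have /= Nn := NP n (leq_maxl _ _).
  have := MP n (leq_maxr _ _); rewrite /= sub0r normrN ger0_norm// -nrm_sqr.
  rewrite ltr_sqr ?nnegrE ?nrm_ge0//; last by rewrite divr_ge0 ?divr_ge0// ltW.
  have [_ Jn] := uP n.
  set d := u n - h => dn.
  have Dd : D d by exact: hB.
  have unE : u n = h + d by rewrite /d addrC subrK.
  clearbody d; have -> : J h = J (u n) - 2 * dot h d - dot d d + 2 * l d.
    rewrite /J unE; have Dhd := hD Dh Dd; rewrite lD// dotDl// !dotDr// (dotC d h); lra.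
  have := C0 d Dd; rewrite ler_norml => /andP[_ ld].
  have := dot_le_nrm Dh Dd; rewrite ler_norml => /andP[hd _].
  have dd := dot_ge0 d.
  have : (2 * nrm h + 2 * `|C|) * nrm d <= e / 2.
    apply: (@le_trans _ _ (c * (e / 2 / c))).
      apply: ler_pM.
      + by have := nrm_ge0 h; have := normr_ge0 C; lra.
      + exact: nrm_ge0.
      + by rewrite /c; lra.
      + exact: ltW.
    by rewrite mulrC divfK// gt_eqF.
  rewrite mulrDl -!mulrA.
  move: Jn Nn ld hd dd; move: (J _) (inf A) (n.+1%:R^-1) (`|C| * _) (nrm h * _) (l d) (dot _ _) (dot _ _).
  by move=> ? ? ? ? ? ? ? ? *; lra.
have Jmin f : D f -> J h <= J f.
  move=> Df; apply: le_trans (JA f Df).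
  by apply/ler_addgt0Pr => e /Jh.
exists h => // phi Dphi.
have H t : 0 <= t ^+ 2 * dot phi phi + 2 * t * (dot h phi - l phi).
  have Dt := hZ t Dphi.
  have := Jmin (h + t *: phi) (hD Dh Dt).
  rewrite /J lD// lZ// dotDl ?dotDr ?dotZl ?dotZr//; last exact: hD.
  by rewrite ?dotDr ?dotZl ?dotZr// (dotC phi h); lra.
apply/eqP; rewrite -subr_eq0; apply/eqP; set a := dot h phi - l phi in H *.
have p0 := dot_ge0 phi.
(* The denominator [1 + dot phi phi] is positive even when phi has norm 0. The value of the
   polynomial there is negative unless a = 0. *)
have := H (- a / (1 + dot phi phi)).
have -> : (- a / (1 + dot phi phi)) ^+ 2 * dot phi phi + 2 * (- a / (1 + dot phi phi)) * a =
  - (a ^+ 2 * (2 + dot phi phi) / (1 + dot phi phi) ^+ 2).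
  field; lra.
rewrite oppr_ge0 => H2.
have : a ^+ 2 * (2 + dot phi phi) <= 0.
  move: H2; rewrite pmulr_lle0// invr_gt0 exprn_gt0//; lra.
rewrite pmulr_lle0; last lra.
by move=> a2; apply/eqP; rewrite -sqrf_eq0 eq_le a2 sqr_ge0.
Qed.

(** * Symmetric contraction semigroups, with linearity and the semigroup law read off pairings *)

Variable T : R -> X -> X.
Hypothesis TD : forall (t : R) f, 0 < t -> D f -> D (T t f).
Hypothesis Tlin : forall (t a : R) f h phi, 0 < t -> D f -> D h -> D phi ->
  dot (T t (a *: f + h)) phi = a * dot (T t f) phi + dot (T t h) phi.
Hypothesis Tsym : forall (t : R) f h, 0 < t -> D f -> D h ->
  dot (T t f) h = dot f (T t h).
Hypothesis Tcontr : forall (t : R) f, 0 < t -> D f -> nrm (T t f) <= nrm f.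
Hypothesis Tadd : forall (s t : R) f phi, 0 < s -> 0 < t -> D f -> D phi ->
  dot (T (s + t) f) phi = dot (T s (T t f)) phi.
Hypothesis Tcont : forall f, D f -> nrm (T t f - f) @[t --> (0:R)^'+] --> (0 : R).

(** The axioms concern positive times only. The identity at nonpositive times makes the pairings
    continuous on the whole line, as the lemmas on [prim] require. *)
Definition sg (t : R) f := if 0 < t then T t f else f.

Lemma sgD t f : D f -> D (sg t f).
Proof. by move=> Df; rewrite /sg; case: ifPn => // t0; exact: TD. Qed.

Lemma sg_le0 t f : t <= 0 -> sg t f = f.
Proof. by move=> t0; rewrite /sg ltNge t0. Qed.

Lemma sg_lin t a f h phi : D f -> D h -> D phi ->
  dot (sg t (a *: f + h)) phi = a * dot (sg t f) phi + dot (sg t h) phi.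
Proof.
move=> Df Dh Dp; rewrite /sg; case: ifPn => t0; first exact: Tlin.
exact: dot_linl.
Qed.

Lemma sg_sub t f h phi : D f -> D h -> D phi ->
  dot (sg t (f - h)) phi = dot (sg t f) phi - dot (sg t h) phi.
Proof.
move=> Df Dh Dp; rewrite addrC -scaleN1r sg_lin//; lra.
Qed.

Lemma sg_sym t f h : D f -> D h -> dot (sg t f) h = dot f (sg t h).
Proof. by move=> Df Dh; rewrite /sg; case: ifPn => // t0; exact: Tsym. Qed.

Lemma sg_contr t f : D f -> nrm (sg t f) <= nrm f.
Proof. by move=> Df; rewrite /sg; case: ifPn => // t0; exact: Tcontr. Qed.

Lemma sg_add s t f phi : 0 <= s -> 0 <= t -> D f -> D phi ->
  dot (sg (s + t) f) phi = dot (sg s (sg t f)) phi.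
Proof.
rewrite le_eqVlt => /predU1P[<- _|s0]; first by rewrite add0r (@sg_le0 0).
rewrite le_eqVlt => /predU1P[<- _|t0]; first by rewrite addr0 (@sg_le0 0 f).
by move=> Df Dp; rewrite /sg addr_gt0// s0 t0; exact: Tadd.
Qed.

Lemma sg_subr t f h : D f -> D h -> nrm (sg t f - sg t h) <= nrm (f - h).
Proof.
move=> Df Dh; have Dfh := hB Df Dh; apply: nrm_le_dot.
- by apply: hB; exact: sgD.
- exact: nrm_ge0.
move=> phi Dp; rewrite dotBl//; [|exact: sgD|exact: sgD].
rewrite -sg_sub//; apply: le_trans (dot_le_nrm _ Dp) _; first exact: sgD.
by apply: ler_wpM2r; [exact: nrm_ge0|exact: sg_contr].
Qed.

Lemma sg_cont f (e : R) : D f -> 0 < e ->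
  exists2 d : R, 0 < d & forall r, r <= d -> nrm (sg r f - f) <= e.
Proof.
move=> Df e0; have /cvgrPdist_le/(_ _ e0) := Tcont Df.
move=> [d /= d0 dP]; exists (d / 2); first by rewrite divr_gt0.
move=> r rd; have [r0|r0] := ltP 0 r; last first.
  by rewrite sg_le0// subrr /nrm dot0l// sqrtr0 ltW.
have := dP r; rewrite /sg r0 /= sub0r normrN gtr0_norm//.
rewrite sub0r normrN ger0_norm ?nrm_ge0//; apply => //; lra.
Qed.

Lemma sg_max t f : sg t f = sg (Num.max t 0) f.
Proof. by have [t0|t0] := leP t 0; rewrite // !sg_le0. Qed.

(** Factoring T_s out and contracting leaves a modulus of continuity that depends on t - s only. *)
Lemma sg_mod f phi s t : D f -> D phi -> 0 <= s -> s <= t ->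
  `|dot (sg t f) phi - dot (sg s f) phi| <= nrm (sg (t - s) f - f) * nrm phi.
Proof.
move=> Df Dp s0 st.
have Dg := sgD (t - s) Df.
have {1}-> : t = s + (t - s) by rewrite addrC subrK.
rewrite sg_add//; last by rewrite subr_ge0.
rewrite -sg_sub//; apply: le_trans (dot_le_nrm _ Dp) _; first exact/sgD/hB.
by apply: ler_wpM2r; [exact: nrm_ge0|exact/sg_contr/hB].
Qed.

Definition kap f phi (t : R) : R := dot (sg t f) phi.

Lemma kap_continuous f phi : D f -> D phi -> continuous (kap f phi : R -> R).
Proof.
move=> Df Dp t; apply/cvgrPdist_le => e e0.
have p0 := nrm_ge0 phi.
have e1 : 0 < e / (1 + nrm phi) by rewrite divr_gt0//; lra.
have [d d0 dP] := sg_cont Df e1.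
exists d => //= s /= ts.
rewrite /kap (sg_max s) (sg_max t).
have H (a b : R) : `|a - b| < d -> Num.max a 0 <= Num.max b 0 ->
    `|dot (sg (Num.max b 0) f) phi - dot (sg (Num.max a 0) f) phi| <= e.
  move=> abd ab; apply: le_trans (sg_mod Df Dp _ ab) _.
    by rewrite le_max lexx orbT.
  apply: (@le_trans _ _ (e / (1 + nrm phi) * nrm phi)).
    apply: ler_wpM2r => //; apply: dP; move: abd ab.
    by rewrite ltr_norml => /andP[? ?]; case: (leP b 0); case: (leP a 0) => ? ? ?; lra.
  by rewrite mulrAC ler_pdivrMr; nra.
case/orP: (le_total (Num.max t 0) (Num.max s 0)) => st.
  by rewrite distrC; exact: H.
by apply: H => //; rewrite distrC.
Qed.

(** For t >= 0, [Pint f phi t] is the pairing of int_0^t T_s f ds with phi, obtained without a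
    vector-valued integral. *)
Definition Pint f phi := prim (kap f phi : R -> R).

Lemma is_derive_Pint f phi (t : R) : D f -> D phi -> 0 <= t ->
  is_derive t 1 (Pint f phi) (kap f phi t).
Proof.
move=> Df Dp t0; apply: is_derive_prim; first exact: kap_continuous.
exact: lt_le_trans t0.
Qed.

Lemma Pint0 f phi : Pint f phi 0 = 0.
Proof. exact: prim0. Qed.

Lemma Pint_linr (t a : R) f phi psi : 0 <= t -> D f -> D phi -> D psi ->
  Pint f (a *: phi + psi) t = a * Pint f phi t + Pint f psi t.
Proof.
move=> t0 Df Dp Ds.
refine (@derive_unique R (Pint f (a *: phi + psi)) (fun t => a * Pint f phi t + Pint f psi t)
  (kap f (a *: phi + psi)) t t0 _ _ _).
- by move=> x x0; apply: is_derive_Pint => //; exact: Dlin.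
- move=> x x0.
  have -> : kap f (a *: phi + psi) x = a * kap f phi x + kap f psi x.
    have Dx := sgD x Df.
    by rewrite /kap dotDr ?dotZr//; exact: hZ.
  by apply: is_derive_lincomb; exact: is_derive_Pint.
- by rewrite !Pint0 mulr0 addr0.
Qed.

Lemma Pint_linl (t a : R) f g phi : 0 <= t -> D f -> D g -> D phi ->
  Pint (a *: f + g) phi t = a * Pint f phi t + Pint g phi t.
Proof.
move=> t0 Df Dg Dp.
refine (@derive_unique R (Pint (a *: f + g) phi) (fun t => a * Pint f phi t + Pint g phi t)
  (kap (a *: f + g) phi) t t0 _ _ _).
- by move=> x x0; apply: is_derive_Pint => //; exact: Dlin.
- move=> x x0.
  have -> : kap (a *: f + g) phi x = a * kap f phi x + kap g phi x.
    by rewrite /kap sg_lin.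
  by apply: is_derive_lincomb; exact: is_derive_Pint.
- by rewrite !Pint0 mulr0 addr0.
Qed.

Lemma Pint_mvt (t : R) f phi : 0 <= t -> D f -> D phi ->
  exists2 c, 0 <= c <= t & Pint f phi t = kap f phi c * t.
Proof.
move=> t0 Df Dp.
have [|c ct] := @derive_mvt _ (Pint f phi) (kap f phi) 0 t t0.
  by move=> x /andP[x0 _]; exact: is_derive_Pint.
by rewrite Pint0 !subr0 => E; exists c.
Qed.

Lemma kap_add f phi (s t : R) : D f -> D phi -> 0 <= s -> 0 <= t ->
  kap f (sg s phi) t = kap f phi (s + t).
Proof.
move=> Df Dp s0 t0; have Dtf := sgD t Df.
by rewrite /kap sg_add// (sg_sym s).
Qed.

Lemma kap_bound f phi t : D f -> D phi -> `|kap f phi t| <= nrm f * nrm phi.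
Proof.
move=> Df Dp; apply: le_trans (dot_le_nrm (sgD t Df) Dp) _.
by apply: ler_wpM2r; [exact: nrm_ge0|exact: sg_contr].
Qed.

Lemma Pint_bound (t : R) f phi : 0 <= t -> D f -> D phi ->
  `|Pint f phi t| <= t * nrm f * nrm phi.
Proof.
move=> t0 Df Dp; have [c _ ->] := Pint_mvt t0 Df Dp.
rewrite normrM (ger0_norm t0) mulrC -mulrA; apply: ler_wpM2l => //.
exact: kap_bound.
Qed.

(* Integrated weak form of the statement that [g] is the generator applied to [u]; it needs no
   vector-valued derivative. *)
Definition gen u g := forall phi (t : R), D phi -> 0 <= t ->
  dot (sg t u) phi - dot u phi = Pint g phi t.

Lemma gen_lin a u g v h : D u -> D g -> D v -> D h -> gen u g -> gen v h ->
  gen (a *: u + v) (a *: g + h).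
Proof.
move=> Du Dg Dv Dh ug vh phi t Dp t0.
by rewrite sg_lin// dot_linl// Pint_linl// -ug// -vh//; lra.
Qed.

Lemma gen_sg (t : R) u g : 0 <= t -> D u -> D g -> gen u g -> gen (sg t u) (sg t g).
Proof.
move=> t0 Du Dg ug phi s Dp s0.
have Dtp := sgD t Dp; have Dtg := sgD t Dg.
have Dsu := sgD s Du.
rewrite -sg_add// (addrC s t) sg_add//.
rewrite !(sg_sym t)// ug//.
refine (@derive_unique R (Pint g (sg t phi)) (Pint (sg t g) phi) (kap g (sg t phi)) s s0 _ _ _).
- by move=> x x0; exact: is_derive_Pint.
- move=> x x0; have -> : kap g (sg t phi) x = kap (sg t g) phi x.
    by rewrite kap_add// /kap addrC sg_add.
  exact: is_derive_Pint.
- by rewrite !Pint0.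
Qed.

(** The mean value point depends on phi, but strong continuity at g is uniform over all times up to
    d, so duality turns the scalar estimates into one in norm. *)
Lemma gen_taylor u g (e : R) : D u -> D g -> gen u g -> 0 < e ->
  exists2 d : R, 0 < d & forall s, 0 <= s -> s <= d -> nrm (sg s u - u - s *: g) <= s * e.
Proof.
move=> Du Dg ug e0; have [d d0 dP] := sg_cont Dg e0.
exists d => // s s0 sd.
have Dsu := sgD s Du; have Dsg := hZ s Dg; have Dsuu := hB Dsu Du.
apply: nrm_le_dot; first exact: hB.
  by rewrite mulr_ge0// ltW.
move=> phi Dp; rewrite dotBl// dotBl// dotZl// ug//.
have [c /andP[c0 cs] ->] := Pint_mvt s0 Dg Dp.
have Dcg := sgD c Dg; have Dcgg := hB Dcg Dg.
rewrite mulrC -mulrBr normrM (ger0_norm s0) -mulrA; apply: ler_wpM2l => //.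
rewrite /kap -dotBl//; apply: le_trans (dot_le_nrm Dcgg Dp) _.
apply: ler_wpM2r; first exact: nrm_ge0.
by apply: dP; exact: le_trans sd.
Qed.

(** Passage from the integrated weak form to the strong derivative at 0, the form in which
    [is_semigroup] speaks of the generator. *)
Lemma gen_limit u g : D u -> D g -> gen u g ->
  nrm (s^-1 *: (T s u - u) - g) @[s --> (0:R)^'+] --> (0 : R).
Proof.
move=> Du Dg ug; apply/cvgrPdist_le => e e0.
have [d d0 dP] := gen_taylor Du Dg ug e0.
exists d => //= s /=; rewrite sub0r normrN => sd s0.
rewrite gtr0_norm// in sd.
have Dsu := sgD s Du; have Dsg := hZ s Dg; have Dsuu := hB Dsu Du.
rewrite sub0r normrN ger0_norm ?nrm_ge0//.
have := dP s (ltW s0) (ltW sd).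
have -> : sg s u - u - s *: g = s *: (s^-1 *: (T s u - u) - g).
  by rewrite scalerBr scalerA mulfV ?gt_eqF// scale1r /sg s0.
rewrite nrmZ; last by apply: hB => //; apply: hZ; move: Dsuu; rewrite /sg s0.
by rewrite gtr0_norm// ler_pM2l.
Qed.

(** The vector int_0^t T_s f ds, determined up to a vector of norm 0 by its pairings; the Riesz
    theorem supplies it. *)
Definition is_int (t : R) f h := D h /\ forall phi, D phi -> dot h phi = Pint f phi t.

Lemma int_ex (t : R) f : 0 <= t -> D f -> exists h, is_int t f h.
Proof.
move=> t0 Df.
have [||h Dh hP] := @riesz (fun phi => Pint f phi t) (t * nrm f).
- by move=> a phi psi Dp Ds; exact: Pint_linr.
- by move=> phi Dp; exact: Pint_bound.
by exists h; split.
Qed.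

Lemma is_derive_Pint_shift f phi (a t : R) : D f -> D phi -> 0 <= a -> 0 <= t ->
  is_derive t 1 (fun t => Pint f phi (a + t)) (kap f phi (a + t)).
Proof.
move=> Df Dp a0 t0.
by apply: is_derive_comp_addl; apply: is_derive_Pint => //; exact: addr_ge0.
Qed.

Lemma Pint_add f phi (a t : R) : D f -> D phi -> 0 <= a -> 0 <= t ->
  Pint f phi (a + t) = Pint f phi a + Pint f (sg a phi) t.
Proof.
move=> Df Dp a0 t0.
refine (@derive_unique R (fun t => Pint f phi (a + t))
  (fun t => Pint f phi a + Pint f (sg a phi) t) (fun t => kap f phi (a + t)) t t0 _ _ _).
- by move=> x x0; exact: is_derive_Pint_shift.
- move=> x x0; rewrite -[kap _ _ _]add0r -kap_add//; apply: is_deriveD.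
  by apply: is_derive_Pint => //; exact: sgD.
- by rewrite Pint0 !addr0.
Qed.

(** Both sides reduce to [Pint f phi] at s + t minus its values at s and at t, an expression
    symmetric in s and t. *)
Lemma int_gen (t : R) f h : 0 <= t -> D f -> is_int t f h -> gen h (sg t f - f).
Proof.
move=> t0 Df [Dh hP] phi s Dp s0.
have Dsp := sgD s Dp; have Dtf := sgD t Df.
rewrite sg_sym// !hP//.
have E1 := Pint_add Df Dp s0 t0.
have -> : Pint f (sg s phi) t = Pint f phi (s + t) - Pint f phi s by rewrite E1; lra.
have -> : Pint (sg t f - f) phi s = Pint (sg t f) phi s - Pint f phi s.
  by rewrite addrC -scaleN1r Pint_linl//; lra.
rewrite addrC (addrC s) Pint_add//.
suff -> : Pint f (sg t phi) s = Pint (sg t f) phi s by lra.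
refine (@derive_unique R (Pint f (sg t phi)) (Pint (sg t f) phi) (kap f (sg t phi)) s s0 _ _ _).
- by move=> x x0; apply: is_derive_Pint => //; exact: sgD.
- move=> x x0; rewrite kap_add//.
  have -> : kap f phi (t + x) = kap (sg t f) phi x by rewrite /kap addrC sg_add.
  exact: is_derive_Pint.
- by rewrite !Pint0.
Qed.

(** The numbers q s - C e^-s are bounded above by each q t + C e^-t, so their supremum lies within C
    e^-t of q t. This gives improper integrals together with a rate. *)
Lemma tail_limit (q : R -> R) (C : R) : 0 <= C ->
  (forall s t : R, 0 <= s -> s <= t ->
     `|q t - q s| <= C * (expR (- s) - expR (- t))) ->
  exists l, forall t, 0 <= t -> `|q t - l| <= C * expR (- t).
Proof.
move=> C0 qC.
have up (s t : R) : 0 <= s -> 0 <= t -> q s - C * expR (- s) <= q t + C * expR (- t).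
  move=> s0 t0; have Cs := mulr_ge0 C0 (expR_ge0 (- s)); have Ct := mulr_ge0 C0 (expR_ge0 (- t)).
  case/orP: (le_total s t) => st.
    have := qC s t s0 st; rewrite ler_norml => /andP[? ?]; lra.
  have := qC t s t0 st; rewrite ler_norml => /andP[? ?]; lra.
pose A := [set q s - C * expR (- s) | s in [set s : R | 0 <= s]].
have hA : has_sup A.
  split; first by exists (q 0 - C * expR (- 0)); exists 0 => //=.
  exists (q 0 + C * expR (- 0)) => _ [s /= s0 <-]; exact: up.
exists (sup A) => t t0.
have H1 : q t - C * expR (- t) <= sup A.
  by apply: ub_le_sup; [exact: (proj2 hA)|exists t].
have H2 : sup A <= q t + C * expR (- t).
  by apply: ge_sup; [exact: (proj1 hA)|move=> _ [s /= s0 <-]; exact: up].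
by rewrite ler_norml; lra.
Qed.

Lemma expRN_small (C a : R) : (forall t, 0 <= t -> `|a| <= C * expR (- t)) -> a = 0.
Proof.
move=> aC.
have C0 : 0 <= C.
  have := aC 0 (lexx _); rewrite oppr0 expR0 mulr1; apply: le_trans; exact: normr_ge0.
apply/eqP; rewrite -normr_eq0; apply/eqP/le_anti; rewrite normr_ge0 andbT.
apply/ler_addgt0Pr => e e0; rewrite add0r.
have t0 : 0 <= C / e by rewrite divr_ge0// ltW.
apply: le_trans (aC _ t0) _.
rewrite expRN ler_pdivrMr ?expR_gt0//.
have := expR_ge1Dx (C / e); rewrite -(ler_pM2l e0).
rewrite mulrDr mulrC [e * (C / e)]mulrC divfK ?gt_eqF//; lra.
Qed.

(** The Laplace transform of [kap f phi] at 1, truncated at time t; its limit is the pairing of (1 -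
    L)^-1 f with phi. *)
Definition Qint f phi := prim (fun s : R => expR (- s) * kap f phi s).

Lemma Qint_continuous f phi : D f -> D phi ->
  continuous (fun s : R => expR (- s) * kap f phi s).
Proof.
move=> Df Dp t; apply: cvgM; last exact: kap_continuous.
by apply: continuous_cvg; [exact: continuous_expR|apply: cvgN].
Qed.

Lemma is_derive_Qint f phi (t : R) : D f -> D phi -> 0 <= t ->
  is_derive t 1 (Qint f phi) (expR (- t) * kap f phi t).
Proof.
move=> Df Dp t0.
apply: (@is_derive_prim _ (fun s : R => expR (- s) * kap f phi s)).
  exact: Qint_continuous.
exact: lt_le_trans t0.
Qed.

Lemma Qint0 f phi : Qint f phi 0 = 0.
Proof. exact: prim0. Qed.

Lemma is_derive_expRN (t : R) : is_derive t 1 (fun t : R => expR (- t)) (- expR (- t)).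
Proof.
have d2 : is_derive t 1 (fun t : R => - t) (- 1 : R) by apply: is_deriveN.
have := @is_derive1_comp _ expR (fun t : R => - t) t (expR (- t)) (- 1) _ d2.
by rewrite mulrN1; apply; exact: is_derive_expR.
Qed.

(** Since |kap| <= |f| |phi|, adding |f| |phi| e^-x to [Qint] gives a nonincreasing function, and
    subtracting it gives a nondecreasing one. *)
Lemma Qint_mod f phi (s t : R) : D f -> D phi -> 0 <= s -> s <= t ->
  `|Qint f phi t - Qint f phi s| <= nrm f * nrm phi * (expR (- s) - expR (- t)).
Proof.
move=> Df Dp s0 st.
have kb x := kap_bound x Df Dp.
have [|c /andP[sc ct] E1] := @derive_mvt _ (fun x => (nrm f * nrm phi) * expR (- x) + Qint f phi x)
  (fun x => (nrm f * nrm phi) * (- expR (- x)) + expR (- x) * kap f phi x) s t st.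
  move=> x /andP[sx _]; apply: is_derive_lincomb; first exact: is_derive_expRN.
  by apply: is_derive_Qint => //; exact: le_trans sx.
have [|d /andP[sd dt] E2] := @derive_mvt _ (fun x => - (nrm f * nrm phi) * expR (- x) + Qint f phi x)
  (fun x => - (nrm f * nrm phi) * (- expR (- x)) + expR (- x) * kap f phi x) s t st.
  move=> x /andP[sx _]; apply: is_derive_lincomb; first exact: is_derive_expRN.
  by apply: is_derive_Qint => //; exact: le_trans sx.
have ts0 : 0 <= t - s by rewrite subr_ge0.
have e1 := expR_gt0 (- c); have e2 := expR_gt0 (- d).
have k1 : expR (- c) * kap f phi c <= nrm f * nrm phi * expR (- c).
  rewrite mulrC ler_pM2r//; apply: le_trans (kb c); exact: ler_norm.
have k2 : - (nrm f * nrm phi * expR (- d)) <= expR (- d) * kap f phi d.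
  rewrite -mulNr mulrC ler_pM2l//; have := kb d.
  by rewrite ler_norml => /andP[].
have H1 : (nrm f * nrm phi * - expR (- c) + expR (- c) * kap f phi c) * (t - s) <= 0.
  by apply: mulr_le0_ge0 => //; lra.
have H2 : 0 <= (- (nrm f * nrm phi) * - expR (- d) + expR (- d) * kap f phi d) * (t - s).
  by apply: mulr_ge0 => //; lra.
by rewrite ler_norml; lra.
Qed.

(** The resolvent at 1 is u = int_0^oo e^-s T_s f ds. The limits of [Qint] define a bounded
    functional, Riesz represents it by u, and differentiating the pairings of T_s u in s gives the
    equation L u = u - f. *)
Lemma res_ex f : D f -> exists2 u, D u & gen u (u - f).
Proof.
move=> Df.
have /choice[l lP] : forall phi, exists lphi, D phi ->
    forall t, 0 <= t -> `|Qint f phi t - lphi| <= nrm f * nrm phi * expR (- t).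
  move=> phi; have [Dp|nD] := pselect (D phi); last by exists 0.
  have [||lp lpP] := @tail_limit (Qint f phi) (nrm f * nrm phi).
    - by rewrite mulr_ge0// nrm_ge0.
    - by move=> s t s0 st; exact: Qint_mod.
  by exists lp.
(* A limit with exponential rate is unique; linearity of l and the translation rule below follow by
   exhibiting a candidate. *)
have l_uniq phi C a : D phi -> (forall t, 0 <= t -> `|Qint f phi t - a| <= C * expR (- t)) -> l phi = a.
  move=> Dp aP; apply/eqP; rewrite -subr_eq0; apply/eqP.
  apply: (@expRN_small (nrm f * nrm phi + C)) => t t0.
  have H1 := lP phi Dp t t0; have H2 := aP t t0.
  have -> : l phi - a = (Qint f phi t - a) - (Qint f phi t - l phi) by ring.
  by apply: le_trans (ler_normB _ _) _; rewrite mulrDl; lra.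
have Qlin (a : R) phi psi t : D phi -> D psi -> 0 <= t ->
    Qint f (a *: phi + psi) t = a * Qint f phi t + Qint f psi t.
  move=> Dp Ds t0.
  refine (@derive_unique R (Qint f (a *: phi + psi)) (fun t => a * Qint f phi t + Qint f psi t)
    (fun t => expR (- t) * kap f (a *: phi + psi) t) t t0 _ _ _).
  - by move=> x x0; apply: is_derive_Qint => //; exact: Dlin.
  - move=> x x0.
    have -> : expR (- x) * kap f (a *: phi + psi) x =
       a * (expR (- x) * kap f phi x) + expR (- x) * kap f psi x.
      have Dx := sgD x Df.
      by rewrite /kap dotDr ?dotZr//; [ring|exact: hZ].
    by apply: is_derive_lincomb; exact: is_derive_Qint.
  - by rewrite !Qint0 mulr0 addr0.
have [||u Du uP] := @riesz l (nrm f).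
- move=> a phi psi Dp Ds.
  apply: (@l_uniq _ (`|a| * (nrm f * nrm phi) + nrm f * nrm psi)); first exact: Dlin.
  move=> t t0; rewrite Qlin//.
  have -> : a * Qint f phi t + Qint f psi t - (a * l phi + l psi) =
    a * (Qint f phi t - l phi) + (Qint f psi t - l psi) by ring.
  apply: le_trans (ler_normD _ _) _; rewrite mulrDl normrM.
  by apply: lerD; [rewrite -mulrA ler_wpM2l//|]; exact: lP.
- move=> phi Dp; have := lP phi Dp 0 (lexx _).
  by rewrite Qint0 oppr0 expR0 mulr1 sub0r normrN.
exists u => //; move=> phi t Dp t0.
have Duf := hB Du Df.
(* By symmetry T_s moves to phi, and the Laplace integral translated by s picks up the factor e^s
   and loses its part over [0, s]. *)
have E (s : R) : 0 <= s -> dot (sg s u) phi = expR s * (dot u phi - Qint f phi s).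
  move=> s0; have Dsp := sgD s Dp.
  rewrite sg_sym// !uP//.
  have sh (x : R) : 0 <= x -> Qint f (sg s phi) x = expR s * (Qint f phi (s + x) - Qint f phi s).
    move=> x0; rewrite mulrBr addrC.
    refine (@derive_unique R (Qint f (sg s phi))
      (fun x => - (expR s * Qint f phi s) + expR s * Qint f phi (s + x))
      (fun x => expR (- x) * kap f (sg s phi) x) x x0 _ _ _).
    - by move=> y y0; exact: is_derive_Qint.
    - move=> y y0.
      have -> : expR (- y) * kap f (sg s phi) y = 0 + expR s * (expR (- (s + y)) * kap f phi (s + y)).
        rewrite add0r kap_add// mulrA -expRD; congr (expR _ * _); ring.
      apply: is_deriveD; apply: is_deriveZ; apply: is_derive_comp_addl.
      by apply: is_derive_Qint => //; exact: addr_ge0.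
    - by rewrite Qint0 addr0 addNr.
  apply: (@l_uniq _ (nrm f * nrm phi)) => // x x0; rewrite sh//.
  rewrite -mulrBr normrM gtr0_norm ?expR_gt0//.
  have -> : Qint f phi (s + x) - Qint f phi s - (l phi - Qint f phi s) = Qint f phi (s + x)
    - l phi by ring.
  have := lP phi Dp (s + x) (addr_ge0 s0 x0).
  rewrite opprD expRD (expRN s) => H.
  rewrite mulrC -ler_pdivlMr ?expR_gt0//; apply: le_trans H _.
  by rewrite le_eqVlt; apply/orP; left; apply/eqP; ring.
rewrite E//.
refine (@derive_unique R (fun t => expR t * (dot u phi - Qint f phi t) - dot u phi)
  (Pint (u - f) phi) (kap (u - f) phi) t t0 _ _ _).
- move=> x x0.
  have -> : kap (u - f) phi x = (expR x * (- (expR (- x) * kap f phi x))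
    + (dot u phi - Qint f phi x) * expR x) + - 0.
    rewrite /kap sg_sub// E// mulrN mulrA expRN divff ?gt_eqF ?expR_gt0//; ring.
  apply: is_deriveB.
  apply: is_deriveM.
  rewrite -[- (expR (- x) * _)]add0r; apply: is_deriveB; exact: is_derive_Qint.
- by move=> x x0; exact: is_derive_Pint.
- by rewrite Qint0 Pint0 expR0; ring.
Qed.

Lemma gen0 : gen 0 0.
Proof.
move=> phi s Dp s0.
have z t : dot (sg t 0) phi = 0 by rewrite sg_sym// dot0l//; exact: sgD.
have [c _ ->] := Pint_mvt s0 D0 Dp.
by rewrite /kap !z dot0l// subrr mul0r.
Qed.

(* Invariance of the convex set [J = 0] under the flow f' = L f + k: if [x - J x] is the projection
   of [x] onto it, dissipativity makes the squared distance [N] nonincreasing along Euler steps. *)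
Section Invariance.
Variables (J : X -> X) (k : X).
Hypothesis Dk : D k.
Hypothesis JD : forall x, D x -> D (J x).
Hypothesis J_le : forall x, D x -> nrm (J x) <= nrm x.
Hypothesis J_taylor : forall x y, D x -> D y ->
  dot (J y) (J y) <= dot (J x) (J x) + 2 * dot (J x) (y - x) + dot (y - x) (y - x).
Hypothesis J_diss : forall u g, D u -> D g -> gen u g -> dot (g + k) (J u) <= 0.

Let N x := dot (J x) (J x).

Lemma N_near x y : D x -> D y -> N y <= N x + 2 * nrm x * nrm (y - x) + nrm (y - x) ^+ 2.
Proof.
move=> Dx Dy; have Dyx := hB Dy Dx; apply: le_trans (J_taylor Dx Dy) _.
rewrite nrm_sqr lerD2r lerD2l -mulrA ler_pM2l//.
apply: le_trans (ler_norm _) _; apply: le_trans (dot_le_nrm (JD Dx) Dyx) _.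
by apply: ler_wpM2r; [exact: nrm_ge0|exact: J_le].
Qed.

(** Vectors with equal pairings may still differ as elements of [X], and nothing says that [J]
    respects this relation; [J_taylor] is what compares their values of N. *)
Lemma N_weak x y : D x -> D y -> (forall phi, D phi -> dot x phi = dot y phi) ->
  N y <= N x.
Proof.
move=> Dx Dy xy; have Dyx := hB Dy Dx; apply: le_trans (J_taylor Dx Dy) _.
have z phi : D phi -> dot (y - x) phi = 0 by move=> Dp; rewrite dotBl// xy// subrr.
by rewrite (dotC (J x)) !z//; [rewrite /N; lra|exact: JD].
Qed.

Lemma int_taylor (e : R) : 0 < e -> exists2 d : R, 0 < d & forall s h, 0 <= s -> s <= d ->
  is_int s k h -> nrm (h - s *: k) <= s * e.
Proof.
move=> e0; have [d d0 dP] := sg_cont Dk e0.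
exists d => // s h s0 sd [Dh hP].
have Dsk := hZ s Dk.
apply: nrm_le_dot; first exact: hB.
  by rewrite mulr_ge0// ltW.
move=> phi Dp; rewrite dotBl// hP// dotZl//.
have [c /andP[c0 cs] ->] := Pint_mvt s0 Dk Dp.
have Dck := sgD c Dk; have Dckk := hB Dck Dk.
rewrite mulrC -mulrBr normrM (ger0_norm s0) -mulrA; apply: ler_wpM2l => //.
rewrite /kap -dotBl//; apply: le_trans (dot_le_nrm Dckk Dp) _.
apply: ler_wpM2r; first exact: nrm_ge0.
by apply: dP; exact: le_trans sd.
Qed.

Lemma int_nrm (t : R) h : 0 <= t -> is_int t k h -> nrm h <= t * nrm k.
Proof.
move=> t0 [Dh hP]; apply: nrm_le_dot => //; first by rewrite mulr_ge0 ?nrm_ge0.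
by move=> phi Dp; rewrite hP//; exact: Pint_bound.
Qed.

(** For f in the domain, the whole trajectory W s = T_s f + int_0^s T_r k dr stays in the domain, so
    [J_diss] applies at every Euler point. *)
Lemma invariance_dom f g (t : R) h : D f -> D g -> gen f g -> 0 <= t ->
  is_int t k h -> N (sg t f + h) <= N f.
Proof.
move=> Df Dg fg t0 th.
have /choice[I0 I0P] : forall s : R, exists h, 0 <= s -> is_int s k h.
  move=> s; have [s0|s0] := leP 0 s; last by exists 0.
  by have [x xP] := int_ex s0 Dk; exists x.
have DI s : 0 <= s -> D (I0 s) by move=> /I0P[].
have IP (s : R) phi : 0 <= s -> D phi -> dot (I0 s) phi = Pint k phi s.
  by move=> /I0P[_]; apply.
pose W s := sg s f + I0 s.
have DW s : 0 <= s -> D (W s) by move=> s0; apply: hD; [exact: sgD|exact: DI].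
have Dgk := hD Dg Dk.
have genW (s : R) : 0 <= s -> gen (W s) (sg s g + (sg s k - k)).
  move=> s0; rewrite /W -(scale1r (sg s f)) -(scale1r (sg s g)).
  apply: gen_lin; try exact: sgD; try exact: DI; try by apply: hB => //; exact: sgD.
    exact: gen_sg.
  by apply: int_gen => //; exact: I0P.
(* The generator sends W s to T_s g + (T_s k - k); adding k back gives T_s (g + k), the velocity of
   the trajectory at time s. *)
have diss (s : R) : 0 <= s -> dot (sg s (g + k)) (J (W s)) <= 0.
  move=> s0; have Dsg := sgD s Dg; have Dsk := sgD s Dk; have DJ := JD (DW s s0).
  have -> : dot (sg s (g + k)) (J (W s)) = dot (sg s g + (sg s k - k) + k) (J (W s)).
    rewrite -addrA subrK (dotDl Dsg Dsk DJ) -{1}(scale1r g) sg_lin// mul1r//.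
  apply: J_diss; [exact: DW| |exact: genW].
  by apply: hD => //; exact: hB.
pose q r := sg r f - f + I0 r.
have Dq (r : R) : 0 <= r -> D (q r).
  by move=> r0; apply: hD; [apply: hB => //; exact: sgD|exact: DI].
pose B := nrm f + t * nrm k.
(* 4 B bounds the cross term, twice B times the Taylor error 2 r e; the square is the bound on |q r|
   / r, and r <= e turns r^2 into r e. *)
pose K := 4 * B + (nrm (g + k) + 2) ^+ 2.
have B0 : 0 <= B by rewrite addr_ge0 ?mulr_ge0 ?nrm_ge0.
have step (e : R) : 0 < e -> e <= 1 -> exists2 d : R, 0 < d &
    forall s r, 0 <= s -> s <= t -> 0 <= r -> r <= d -> N (W (s + r)) <= N (W s) + r * (K * e).
  move=> e0 e1.
  have [d1 d10 dP1] := gen_taylor Df Dg fg e0.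
  have [d2 d20 dP2] := int_taylor e0.
  exists (Num.min e (Num.min d1 d2)); first by rewrite !lt_min e0 d10.
  move=> s r s0 st r0; rewrite !le_min => /and3P[re rd1 rd2].
  have Drf := sgD r Df; have DIr := DI r r0.
  have Dqr := Dq r r0; have Dsq := sgD s Dqr.
  have DWs := DW s s0; have DJ := JD DWs.
  have Drgk := hZ r Dgk.
  pose z := q r - r *: (g + k).
  have Dz : D z by exact: hB.
  have nz : nrm z <= 2 * r * e.
    have -> : z = (sg r f - f - r *: g) + (I0 r - r *: k).
      by rewrite /z /q scalerDr opprD addrACA.
    apply: le_trans (nrmD _ _) _.
    - by apply: hB; [exact: hB|exact: hZ].
    - by apply: hB => //; exact: hZ.
    have := dP1 r r0 rd1; have := dP2 r _ r0 rd2 (I0P r r0); lra.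
  have nq : nrm (q r) <= r * (nrm (g + k) + 2).
    have -> : q r = r *: (g + k) + z by rewrite /z addrC subrK.
    apply: le_trans (nrmD Drgk Dz) _; rewrite nrmZ// ger0_norm//.
    rewrite mulrDr lerD2l; apply: le_trans nz _.
    have := ler_wpM2l r0 e1; lra.
  (* The increment of the trajectory is T_s applied to the increment q r from time 0, but only in
     the sense of pairings. *)
  have H1 : N (W (s + r)) <= N (W s + sg s (q r)).
    have DWr := DW (s + r) (addr_ge0 s0 r0).
    apply: N_weak; [exact: hD|exact: DWr|] => phi Dp.
    have Dsp := sgD s Dp; have Dsf := sgD s Df; have DIs := DI s s0.
    have DIsr := DI (s + r) (addr_ge0 s0 r0).
    have Dsrf := sgD (s + r) Df; have Drff := hB Drf Df.
    rewrite (dotDl DWs Dsq Dp) (dotDl Dsrf DIsr Dp) (dotDl Dsf DIs Dp).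
    rewrite (sg_sym s Dqr Dp) (dotDl Drff DIr Dsp) (dotBl Drf Df Dsp).
    rewrite !IP ?addr_ge0// Pint_add// sg_add// (sg_sym s Drf Dp) (sg_sym s Df Dp); lra.
  apply: le_trans H1 _.
  have Wq : W s + sg s (q r) - W s = sg s (q r) by rewrite addrC addKr.
  have DWq := hD DWs Dsq.
  apply: le_trans (J_taylor DWs DWq) _; rewrite Wq.
  have H2 : dot (J (W s)) (sg s (q r)) <= B * (2 * r * e).
    have -> : dot (J (W s)) (sg s (q r)) = r * dot (sg s (g + k)) (J (W s)) + dot (sg s z) (J (W s)).
      rewrite dotC -sg_lin//; congr (dot (sg s _) _).
      by rewrite /z addrC subrK.
    have h1 := mulr_ge0_le0 r0 (diss s s0).
    have Dsz := sgD s Dz.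
    have h2 := le_trans (ler_norm _) (dot_le_nrm Dsz DJ).
    have h3 : nrm (sg s z) * nrm (J (W s)) <= B * (2 * r * e).
      rewrite mulrC; apply: ler_pM; try exact: nrm_ge0.
        apply: le_trans (J_le DWs) _; have Dsf := sgD s Df; have DIs := DI s s0.
        apply: le_trans (nrmD Dsf DIs) _; apply: lerD; first exact: sg_contr.
        by apply: le_trans (int_nrm s0 (I0P s s0)) _; apply: ler_wpM2r => //; exact: nrm_ge0.
      by apply: le_trans nz; exact: sg_contr.
    lra.
  have H3 : dot (sg s (q r)) (sg s (q r)) <= r * e * (nrm (g + k) + 2) ^+ 2.
    rewrite -nrm_sqr; apply: (@le_trans _ _ ((r * (nrm (g + k) + 2)) ^+ 2)).
      rewrite ler_sqr ?nnegrE ?nrm_ge0//.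
        by apply: le_trans nq; exact: sg_contr.
      by rewrite mulr_ge0// addr_ge0 ?nrm_ge0.
    rewrite exprMn expr2; apply: ler_wpM2r; first exact: sqr_ge0.
    exact: ler_wpM2l.
  rewrite /K /N; lra.
have [Dh hP] := th.
have E0 : N (sg t f + h) <= N (W t).
  apply: N_weak; [exact: DW|by apply: hD => //; exact: sgD|] => phi Dp.
  have Dtf := sgD t Df; have DIt := DI t t0.
  by rewrite (dotDl Dtf DIt Dp) (dotDl Dtf Dh Dp) IP// hP.
have E1 : N (W 0) <= N f.
  apply: N_weak => //; first exact: DW.
  move=> phi Dp; rewrite /W sg_le0// (dotDl Df (DI 0 (lexx _)) Dp) IP// Pint0.
  by rewrite addr0.
apply: le_trans E0 _; apply: le_trans _ E1.
have K0 : 0 <= K by rewrite /K; apply: addr_ge0; [exact: mulr_ge0|exact: sqr_ge0].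
suff H (e : R) : 0 < e -> e <= 1 -> N (W t) <= N (W 0) + t * (K * e).
  apply/ler_addgt0Pr => e e0.
  pose e1 := Num.min 1 (e / (t * K + 1)).
  have tK : 0 < t * K + 1 by rewrite ltr_wpDl// mulr_ge0.
  have e10 : 0 < e1 by rewrite lt_min ltr01 divr_gt0.
  apply: le_trans (H e1 e10 _) _; first by rewrite ge_min lexx.
  rewrite lerD2l mulrA; apply: (@le_trans _ _ ((t * K + 1) * e1)).
    by apply: ler_wpM2r; [exact: ltW|rewrite lerDl].
  by rewrite mulrC -ler_pdivlMr// ge_min lexx orbT.
move=> e0 e1; have [d d0 dP] := step e e0 e1.
(* Enough equal steps for each to have length at most d; the errors add up to t K e. *)
pose n := (Num.truncn (t / d)).+1.
have n0 : 0 < (n%:R : R) by rewrite ltr0n.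
have nd : t / n%:R <= d.
  rewrite ler_pdivrMr// mulrC -ler_pdivrMr//; apply: ltW.
  by rewrite /n; apply: truncnS_gt.
have tn0 : 0 <= t / n%:R by rewrite divr_ge0.
have ind i : (i <= n)%N -> N (W (i%:R * (t / n%:R))) <= N (W 0) + i%:R * (t / n%:R) * (K * e).
  elim: i => [|i IH] ni; first by rewrite !mul0r addr0.
  have i0 : 0 <= i%:R * (t / n%:R) by rewrite mulr_ge0.
  have it : i%:R * (t / n%:R) <= t.
    rewrite mulrCA ler_piMr// ler_pdivrMr// mul1r ler_nat ltnW//.
  have := dP _ _ i0 it tn0 nd.
  have -> : i%:R * (t / n%:R) + t / n%:R = i.+1%:R * (t / n%:R).
    by rewrite -[i.+1]addn1 natrD mulrDl mul1r.
  move=> H; apply: le_trans H _; have := IH (ltnW ni).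
  rewrite -[i.+1]addn1 natrD !mulrDl mul1r; lra.
by have := ind n (leqnn _); rewrite mulrCA divff ?gt_eqF// mulr1.
Qed.

(** A general f is replaced by the average of T_s f over a short time, which lies in the domain and
    is close to f. Contractivity carries the closeness to time t, and [N_near] controls N at both
    ends. *)
Lemma invariance f (t : R) h : D f -> 0 <= t -> is_int t k h -> N f <= 0 ->
  N (sg t f + h) <= 0.
Proof.
move=> Df t0 th Nf; have [Dh hP] := th.
have Dtf := sgD t Df; have DW := hD Dtf Dh.
have key (e : R) : 0 < e -> N (sg t f + h) <=
    (2 * nrm f * e + e ^+ 2) + 2 * (nrm (sg t f + h) + e) * e + e ^+ 2.
  move=> e0.
  have [d d0 dP] := sg_cont Df e0.
  have [f1 [Df1 f1P]] := int_ex (ltW d0) Df.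
  pose f2 := d^-1 *: f1; have Df2 : D f2 by exact: hZ.
  have Dd := sgD d Df; have Dg := hB Dd Df.
  have gf2 : gen f2 (d^-1 *: (sg d f - f)).
    rewrite -(addr0 f2) -(addr0 (d^-1 *: (sg d f - f))); apply: gen_lin => //.
      by apply: int_gen => //; exact: ltW.
    exact: gen0.
  have near : nrm (f2 - f) <= e.
    have Df2f := hB Df2 Df; apply: nrm_le_dot => //; first exact: ltW.
    move=> phi Dp; rewrite dotBl// dotZl// f1P//.
    have [c /andP[c0 cd] ->] := Pint_mvt (ltW d0) Df Dp.
    have Dc := sgD c Df; have Dcf := hB Dc Df.
    rewrite mulrCA mulVf ?gt_eqF// mulr1 /kap -dotBl//.
    apply: le_trans (dot_le_nrm Dcf Dp) _; apply: ler_wpM2r; first exact: nrm_ge0.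
    exact: dP.
  have Df2f := hB Df2 Df.
  have Dtf2 := sgD t Df2; have DW2 := hD Dtf2 Dh.
  have H1 := invariance_dom Df2 (hZ _ Dg) gf2 t0 th.
  have H2 : N f2 <= 2 * nrm f * e + e ^+ 2.
    apply: le_trans (N_near Df Df2) _.
    have a0 := nrm_ge0 (f2 - f); have b0 := nrm_ge0 f; nra.
  have E : sg t f + h - (sg t f2 + h) = sg t f - sg t f2 by rewrite opprD addrACA subrr addr0.
  have n1 : nrm (sg t f + h - (sg t f2 + h)) <= e.
    rewrite E; apply: le_trans (sg_subr t Df Df2) _.
    by rewrite -nrmN ?opprB//; exact: hB.
  have n2 : nrm (sg t f2 + h) <= nrm (sg t f + h) + e.
    have -> : sg t f2 + h = (sg t f + h) - (sg t f + h - (sg t f2 + h)) by rewrite subKr.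
    have DWW := hB DW DW2.
    by apply: le_trans (nrmB DW DWW) _; rewrite lerD2l.
  apply: le_trans (N_near DW2 DW) _.
  have a0 := nrm_ge0 (sg t f + h - (sg t f2 + h)); have b0 := nrm_ge0 (sg t f2 + h).
  have c0 := nrm_ge0 (sg t f + h); nra.
apply/ler_addgt0Pr => e e0; rewrite add0r.
pose C := 2 * nrm f + 2 * nrm (sg t f + h) + 4.
have C0 : 0 < C by rewrite /C; have := nrm_ge0 f; have := nrm_ge0 (sg t f + h); lra.
pose r := Num.min 1 (e / C).
have r0 : 0 < r by rewrite lt_min ltr01 divr_gt0.
have r1 : r <= 1 by rewrite ge_min lexx.
have rC : C * r <= e by rewrite mulrC -ler_pdivlMr// ge_min lexx orbT.
apply: le_trans (key r r0) _; apply: le_trans rC; rewrite /C.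
have a0 := nrm_ge0 f; have b0 := nrm_ge0 (sg t f + h); nra.
Qed.

End Invariance.
End SemiHilbert.

(** * Smooth functions on Euclidean space *)

Section SmoothCalculus.
Context {R : realType} {n : nat}.
Local Notation E := 'rV[R]_n.
Implicit Types (U : set E) (f g : E -> R) (x : E) (k : 'I_n).
Local Notation basis k := (delta_mx 0 k : E).

(** Recursion on the order of differentiation gives the inductions that closure under sums, products
    and composition need, which lists of indices as in [smooth_on] do not offer directly. *)
Fixpoint Cn (m : nat) U f : Prop :=
  (forall x, U x -> {for x, continuous f}) /\
  if m is m'.+1 then
    (forall k x, U x -> derivable f x (basis k)) /\
    forall k, Cn m' U (partial k f)
  else True.

Lemma Cn_continuous m U f x : Cn m U f -> U x -> {for x, continuous f}.
Proof. by case: m => [|m] [fc _]; exact: fc. Qed.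

Lemma Cn_derivable m U f k x : Cn m.+1 U f -> U x -> derivable f x (basis k).
Proof. by move=> [_ [fd _]]; exact: fd. Qed.

Lemma Cn_partial m U f k : Cn m.+1 U f -> Cn m U (partial k f).
Proof. by move=> [_ [_]]; exact. Qed.

Lemma CnS m U f : Cn m.+1 U f -> Cn m U f.
Proof.
elim: m f => [|m IH] f fm; first by case: fm.
split; first by case: fm.
by split; [case: fm => _ []|move=> k; apply: IH; exact: Cn_partial].
Qed.

Lemma smooth_onP U f : smooth_on U f <-> forall m, Cn m U f.
Proof.
split.
  move=> fs m; elim: m f fs => [|m IH] f fs.
    by split=> // x Ux; case: (fs [::] x Ux).
  split; first by move=> x Ux; case: (fs [::] x Ux).
  split; first by move=> k x Ux; case: (fs [::] x Ux) => _; exact.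
  move=> k; apply: IH => s x Ux.
  by have := fs (rcons s k) x Ux; rewrite foldr_rcons.
move=> fC s; elim/last_ind: s f fC => [|s k IH] f fC x Ux.
  split; first exact: Cn_continuous (fC 0%N) Ux.
  by move=> k; exact: Cn_derivable (fC 1%N) Ux.
rewrite foldr_rcons; apply: IH => // m; exact: Cn_partial (fC m.+1).
Qed.

Lemma open_near U x : open U -> U x -> \forall y \near x, U y.
Proof. by move=> Uo Ux; exact: open_nbhs_nbhs. Qed.

Lemma continuous_near_eq f g x : (\near x, f x = g x) ->
  {for x, continuous f} -> {for x, continuous g}.
Proof.
move=> nfg fc; have fgx : f x = g x by exact: nbhs_singleton nfg.
have {}fc : f y @[y --> x] --> f x := fc.
suff : g y @[y --> x] --> g x by [].
have H : {near nbhs x, f =1 g} := nfg.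
by rewrite -fgx; exact: (cvg_trans (near_eq_cvg H) fc).
Qed.

Lemma Cn_eq m U f g : open U -> (forall x, U x -> f x = g x) -> Cn m U f -> Cn m U g.
Proof.
move=> Uo; elim: m f g => [|m IH] f g fg fm;
  have nfg x : U x -> \near x, f x = g x by
    move=> Ux; near=> y; apply: fg; near: y; exact: open_near.
  by split=> // x Ux; apply: continuous_near_eq (nfg x Ux) _; exact: Cn_continuous fm Ux.
split; first by move=> x Ux; apply: continuous_near_eq (nfg x Ux) _; exact: Cn_continuous fm Ux.
split; first by move=> k x Ux; apply: (near_eq_derivable (nfg x Ux)); exact: Cn_derivable fm Ux.
move=> k; apply: IH (Cn_partial k fm) => x Ux.
by rewrite /partial; apply: near_eq_derive; exact: nfg.
Unshelve. all: by end_near. Qed.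

Lemma CnS_intro m U f (g : 'I_n -> E -> R) : open U ->
  (forall x, U x -> {for x, continuous f}) ->
  (forall k x, U x -> is_derive x (basis k) f (g k x)) ->
  (forall k, Cn m U (g k)) -> Cn m.+1 U f.
Proof.
move=> Uo fc fd gm; split=> //; split.
  by move=> k x /(fd k)[].
move=> k; apply: Cn_eq (gm k) => // x Ux.
by have [_] := fd k x Ux.
Qed.

Lemma Cn_is_derive m U f k x : Cn m.+1 U f -> U x -> is_derive x (basis k) f (partial k f x).
Proof. by move=> fm Ux; apply: DeriveDef => //; exact: Cn_derivable fm Ux. Qed.

Lemma Cn_cst m U (c : R) : open U -> Cn m U (fun=> c).
Proof.
move=> Uo; elim: m c => [|m IH] c; first by split=> // x _; exact: cst_continuous.
apply: (@CnS_intro _ _ _ (fun _ _ => 0)) => // x _; exact: cst_continuous.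
Qed.

Lemma Cn_add m U f g : open U -> Cn m U f -> Cn m U g -> Cn m U (fun x => f x + g x).
Proof.
move=> Uo; elim: m f g => [|m IH] f g fm gm.
  by split=> // x Ux; apply: (@continuousD _ _ _ f g);
    [exact: Cn_continuous fm Ux|exact: Cn_continuous gm Ux].
apply: (@CnS_intro _ _ _ (fun k x => partial k f x + partial k g x)) => //.
- by move=> x Ux; apply: (@continuousD _ _ _ f g); [exact: Cn_continuous fm Ux|exact: Cn_continuous
  gm Ux].
- by move=> k x Ux; apply: is_deriveD; [exact: Cn_is_derive fm Ux|exact: Cn_is_derive gm Ux].
- by move=> k; apply: IH; exact: Cn_partial.
Qed.

Lemma Cn_mul m U f g : open U -> Cn m U f -> Cn m U g -> Cn m U (fun x => f x * g x).
Proof.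
move=> Uo; elim: m f g => [|m IH] f g fm gm.
  by split=> // x Ux; apply: (@continuousM _ _ f g);
    [exact: Cn_continuous fm Ux|exact: Cn_continuous gm Ux].
apply: (@CnS_intro _ _ _ (fun k x => f x * partial k g x + g x * partial k f x)) => //.
- by move=> x Ux; apply: (@continuousM _ _ f g); [exact: Cn_continuous fm Ux|exact: Cn_continuous gm Ux].
- by move=> k x Ux; apply: is_deriveM; [exact: Cn_is_derive fm Ux|exact: Cn_is_derive gm Ux].
- by move=> k; apply: Cn_add => //; apply: IH; by [exact: CnS|exact: Cn_partial].
Qed.

Lemma Cn_scale m U (c : R) f : open U -> Cn m U f -> Cn m U (fun x => c * f x).
Proof. by move=> Uo fm; apply: Cn_mul => //; exact: Cn_cst. Qed.

Lemma Cn_opp m U f : open U -> Cn m U f -> Cn m U (fun x => - f x).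
Proof.
move=> Uo fm; apply: Cn_eq (Cn_scale (-1) Uo fm) => // x _; exact: mulN1r.
Qed.

Lemma Cn_sub m U f g : open U -> Cn m U f -> Cn m U g -> Cn m U (fun x => f x - g x).
Proof. by move=> Uo fm gm; apply: Cn_add => //; exact: Cn_opp. Qed.

Lemma Cn_sum m U (I : Type) (s : seq I) (F : I -> E -> R) : open U ->
  (forall i, Cn m U (F i)) -> Cn m U (fun x => \sum_(i <- s) F i x).
Proof.
move=> Uo Fm; elim: s => [|i s IH].
  by apply: Cn_eq (Cn_cst m 0 Uo) => // x _; rewrite big_nil.
by apply: Cn_eq (Cn_add Uo (Fm i) IH) => // x _; rewrite big_cons.
Qed.

Lemma Cn_prod m U (I : Type) (s : seq I) (F : I -> E -> R) : open U ->
  (forall i, Cn m U (F i)) -> Cn m U (fun x => \prod_(i <- s) F i x).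
Proof.
move=> Uo Fm; elim: s => [|i s IH].
  by apply: Cn_eq (Cn_cst m 1 Uo) => // x _; rewrite big_nil.
by apply: Cn_eq (Cn_mul Uo (Fm i) IH) => // x _; rewrite big_cons.
Qed.

Lemma coord_continuous_rV (i : 'I_n) : continuous (fun x : E => x 0 i).
Proof. exact: coord_continuous. Qed.

Lemma derive_line f x (v : E) : 'D_v f x = 'D_1 (fun t : R => f (t *: v + x)) 0.
Proof.
rewrite /derive; set g1 := fun h => h^-1 *: _; set g2 := fun h => h^-1 *: _.
suff -> : g1 = g2 by [].
by rewrite funeqE /g1 /g2 => h /=; rewrite addr0 scale0r add0r [_%:A]mulr1.
Qed.

(** Only a directional derivative of f is at hand, so the chain rule is applied to its restriction
    to the line through x along v. *)
Lemma is_derive_comp1 (h : R -> R) (dh df : R) f x (v : E) :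
  is_derive (f x) 1 h dh -> is_derive x v f df -> is_derive x v (h \o f) (dh * df).
Proof.
move=> hd [fd fe].
pose c (t : R) := f (t *: v + x).
have cd : is_derive (0 : R) 1 c df.
  apply: DeriveDef; first exact: (proj1 (derivable1P _ _ _) fd).
  by rewrite -derive_line.
have c0 : c 0 = f x by rewrite /c scale0r add0r.
have [|hc1 hc2] := @is_derive1_comp _ h c 0 dh df _ cd; first by rewrite c0.
apply: DeriveDef; first exact: (proj2 (derivable1P (h \o f) x v) hc1).
by rewrite derive_line.
Qed.

Lemma Cn_comp1 m U f (h dh : R -> R) : open U ->
  (forall x, U x -> is_derive (f x) 1 h (dh (f x))) ->
  Cn m.+1 U f -> Cn m U (fun x => dh (f x)) -> Cn m.+1 U (fun x => h (f x)).
Proof.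
move=> Uo hd fm dhm.
apply: (@CnS_intro _ _ _ (fun k x => dh (f x) * partial k f x)) => //.
- move=> x Ux; apply: continuous_comp; first exact: Cn_continuous fm Ux.
  by apply: differentiable_continuous; apply/derivable1_diffP; have [] := hd x Ux.
- by move=> k x Ux; apply: is_derive_comp1; [exact: hd|exact: Cn_is_derive fm Ux].
- by move=> k; apply: Cn_mul => //; exact: Cn_partial.
Qed.

Lemma Cn_inv m U f : open U -> (forall x, U x -> f x != 0) -> Cn m U f ->
  Cn m U (fun x => (f x)^-1).
Proof.
move=> Uo f0; elim: m => [|m IH] fm.
  by split=> // x Ux; apply: (@continuousV _ _ f); [exact: f0|exact: Cn_continuous fm Ux].
apply: (@Cn_comp1 _ _ _ GRing.inv (fun y => - (y ^- 2))) => //.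
  move=> x Ux; have := @is_deriveV R id (f x) 1 1 (f0 x Ux) _.
  by rewrite [_%:A]mulr1; apply.
have Im := IH (CnS fm).
apply: Cn_eq (Cn_opp Uo (Cn_mul Uo Im Im)) => // x _.
by rewrite expr2 invfM.
Qed.

Lemma Cn_sqrt m U f : open U -> (forall x, U x -> 0 < f x) -> Cn m U f ->
  Cn m U (fun x => Num.sqrt (f x)).
Proof.
move=> Uo f0; elim: m => [|m IH] fm.
  split=> // x Ux; apply: continuous_comp; first exact: Cn_continuous fm Ux.
  exact: sqrt_continuous.
apply: (@Cn_comp1 _ _ _ Num.sqrt (fun y => (2 * Num.sqrt y)^-1)) => //.
  by move=> x Ux; apply: is_derive1_sqrt; exact: f0.
apply: Cn_inv => //; last by apply: Cn_scale => //; exact: IH (CnS fm).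
by move=> x Ux; rewrite mulf_neq0// gt_eqF// sqrtr_gt0 f0.
Qed.

(** The functions e^(-1/y) y^-j, extended by 0: their span is stable under differentiation, so one
    induction on the order proves all of them smooth. *)
Definition flat (j : nat) (y : R) : R := if 0 < y then expR (- y^-1) * y^-1 ^+ j else 0.

Lemma flat_gt0 j y : 0 < y -> 0 < flat j y.
Proof. by move=> y0; rewrite /flat y0 mulr_gt0 ?expR_gt0// exprn_gt0// invr_gt0. Qed.

Lemma flat_le0 j y : y <= 0 -> flat j y = 0.
Proof. by move=> y0; rewrite /flat ltNge y0. Qed.

Lemma flat_ge0 j y : 0 <= flat j y.
Proof. by have [/flat_le0 ->//|/(flat_gt0 j)/ltW] := leP y 0. Qed.

(** From e^x >= (x / (j+2))^(j+2) at x = 1 / y. The factor y^2 that remains makes the derivative at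
    0 vanish. *)
Lemma flat_bound j y : flat j y <= (j.+2%:R ^+ j.+2) * y ^+ 2.
Proof.
have [/flat_le0 ->|y0] := leP y 0; first by rewrite mulr_ge0 ?sqr_ge0// exprn_ge0.
rewrite /flat y0.
have H : (y^-1 / j.+2%:R) ^+ j.+2 <= expR (y^-1).
  set z := y^-1 / j.+2%:R; have -> : y^-1 = j.+2%:R * z by rewrite mulrC divfK.
  have z0 : 0 <= z by rewrite divr_ge0// invr_ge0 ltW.
  rewrite expRM_natl; apply: lerXn2r; rewrite ?nnegrE ?expR_ge0//.
  by apply: le_trans (expR_ge1Dx _); rewrite lerDr.
have z0 : 0 < y^-1 by rewrite invr_gt0.
rewrite expRN mulrC ler_pdivrMr ?expR_gt0//.
rewrite -[X in X <= _]mul1r.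
apply: (@le_trans _ _ (j.+2%:R ^+ j.+2 * y ^+ 2 * (y^-1 / j.+2%:R) ^+ j.+2)); last first.
  by rewrite ler_pM2l// mulr_gt0// exprn_gt0.
rewrite exprMn le_eqVlt; apply/orP; left; apply/eqP.
rewrite mul1r -addn2 [y^-1 ^+ (j + 2)]exprD !exprVn.
by field; rewrite !expf_neq0//= ?gt_eqF// ltr0n addn2.
Qed.

Lemma is_derive_flat j (y : R) : is_derive y 1 (flat j) (flat j.+2 y - j%:R * flat j.+1 y).
Proof.
have [y0|y0|->] := ltgtP y 0.
- rewrite !flat_le0 ?ltW// mulr0 subr0.
  apply: (@near_eq_is_derive _ _ _ (cst 0)).
  near=> z; rewrite /= flat_le0// ltW//; near: z; exact: lt_nbhsl.
- apply: (@near_eq_is_derive _ _ _ ((fun z => expR (- z^-1)) * (fun z => z^-1 ^+ j))).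
    near=> z; rewrite /flat ifT//; near: z; exact: lt_nbhsr.
  have yn0 : y != 0 by rewrite gt_eqF.
  have d1 : is_derive y 1 (fun z : R => z^-1) (- (y^-1 ^+ 2)).
    have := @is_deriveV R id y 1 1 yn0 (is_derive_id _ _).
    by rewrite [_%:A]mulr1 exprVn.
  have d2 : is_derive y 1 (fun z : R => expR (- z^-1)) (expR (- y^-1) * y^-1 ^+ 2).
    have d3 := @is_deriveN _ _ _ (fun z : R => z^-1) y 1 _ d1.
    have := @is_derive1_comp _ expR (fun z : R => - z^-1) y (expR (- y^-1)) _ (is_derive_expR _) d3.
    by rewrite opprK.
  rewrite /flat y0.
  case: j => [|j].
    rewrite mul0r subr0.
    have := @is_deriveM _ _ (fun z : R => expR (- z^-1)) (cst 1) y 1 _ 0 d2 (is_derive_cst _ _ _).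
    by rewrite scaler0 add0r /cst /= [1 *: _]mul1r.
  have d4 : is_derive y 1 (fun z : R => z^-1 ^+ j.+1) ((j.+1%:R * y^-1 ^+ j) *: - y^-1 ^+ 2).
    have := @is_deriveX _ _ (fun z : R => z^-1) j.+1 y 1 _ d1.
    congr is_derive; apply/funext => z; elim: (j.+1) => [|i IH]; first by rewrite !expr0.
    by rewrite !exprS -IH.
  have := @is_deriveM _ _ (fun z : R => expR (- z^-1)) (fun z : R => z^-1 ^+ j.+1) y 1 _ _ d2 d4.
  congr is_derive.
  rewrite /GRing.scale/= !exprS; ring.
- rewrite !flat_le0// mulr0 subr0.
  have H : h^-1 *: (flat j (h *: (1 : R) + 0) - flat j 0) @[h --> (0 : R)^'] --> (0 : R).
    pose C := j.+2%:R ^+ j.+2 : R.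
    have C0 : 0 < C by rewrite exprn_gt0.
    apply/cvgrPdist_le => e e0.
    exists (e / C) => /=; first by rewrite divr_gt0.
    move=> h /=; rewrite !sub0r !normrN => hd hn0.
    rewrite (flat_le0 _ (lexx 0)) subr0 addr0 [_%:A]mulr1 normrM normfV.
    rewrite mulrC ler_pdivrMr ?normr_gt0//.
    rewrite ger0_norm ?flat_ge0//; apply: le_trans (flat_bound _ _) _.
    rewrite -real_normK ?num_real// expr2 mulrA; apply: ler_wpM2r => //.
    by rewrite mulrC -ler_pdivlMr// ltW.
  by apply: DeriveDef; [apply/cvg_ex; exists 0|exact: cvg_lim H].
Unshelve. all: by end_near. Qed.

Lemma Cn_flat m j U f : open U -> Cn m U f -> Cn m U (fun x => flat j (f x)).
Proof.
move=> Uo; elim: m j => [|m IH] j fm.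
  split=> // x Ux; apply: continuous_comp; first exact: Cn_continuous fm Ux.
  by apply: differentiable_continuous; apply/derivable1_diffP; have [] := is_derive_flat j (f x).
apply: (@Cn_comp1 _ _ _ (flat j) (fun y => flat j.+2 y - j%:R * flat j.+1 y)) => //.
  by move=> x Ux; exact: is_derive_flat.
apply: Cn_sub => //; first exact: IH (CnS fm).
by apply: Cn_scale => //; exact: IH (CnS fm).
Qed.

Definition box_bump (a b x : E) : R :=
  \prod_(k < n) (flat 0 (x 0 k - a 0 k) * flat 0 (b 0 k - x 0 k)).

Lemma box_bump_ge0 a b x : 0 <= box_bump a b x.
Proof. by apply: prodr_ge0 => k _; rewrite mulr_ge0// flat_ge0. Qed.

Lemma box_bump_gt0 (a b : E) x : (forall k, a 0 k < x 0 k < b 0 k) -> 0 < box_bump a b x.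
Proof.
by move=> xab; apply: prodr_gt0 => k _; have /andP[ax xb] := xab k; rewrite mulr_gt0 ?flat_gt0 ?subr_gt0.
Qed.

Lemma box_bump_neq0 a b x : box_bump a b x != 0 -> forall k, a 0 k < x 0 k < b 0 k.
Proof.
move=> /prodf_neq0 H k; have := H k isT; rewrite mulf_eq0 negb_or => /andP[].
rewrite -[a 0 k < _]subr_gt0 -[x 0 k < _]subr_gt0.
by case: (ltP 0 (x 0 k - a 0 k)) => [_ _|/flat_le0->]; rewrite ?eqxx//;
  case: (ltP 0 (b 0 k - x 0 k)) => [//|/flat_le0->]; rewrite eqxx.
Qed.

Lemma is_derive_line f (z v : E) (s : R) : derivable f (s *: v + z) v ->
  is_derive s 1 (fun t : R => f (t *: v + z)) ('D_v f (s *: v + z)).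
Proof.
move=> fd; pose F t := f (t *: v + z).
have d0 : is_derive (- s + s) 1 (fun t : R => F (s + t)) ('D_v f (s *: v + z)).
  have E1 : (fun t => F (s + t)) = (fun t : R => f (t *: v + (s *: v + z))).
    by apply/funext => t; rewrite /F addrA -scalerDl (addrC t).
  rewrite addNr E1; apply: DeriveDef; first exact: (proj1 (derivable1P _ _ _) fd).
  by rewrite -derive_line.
have := @is_derive_comp_addl _ _ _ _ _ d0.
by congr is_derive; apply/funext => t; rewrite addNKr.
Qed.

(** The increment is travelled one coordinate at a time, with the mean value theorem on each segment
    and continuity of the partial derivatives at x. *)
Lemma C1_approx U f x (e : R) : open U -> Cn 1 U f -> U x -> 0 < e ->
  exists2 d : R, 0 < d & forall h : E, (forall k, `|h 0 k| <= d) ->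
    `|f (x + h) - f x - \sum_k h 0 k * partial k f x| <= e * \sum_k `|h 0 k|.
Proof.
move=> Uo fC Ux e0.
have : \forall y \near x, U y /\ forall k, `|partial k f x - partial k f y| <= e.
  near=> y; split; first by near: y; exact: open_near.
  near: y; apply: filter_forall => k.
  have /cvgrPdist_le/(_ _ e0) := Cn_continuous (Cn_partial k fC) Ux.
  exact.
move=> /nbhs_ballP[d /= d0 dP].
exists (d / 2) => [|h hd]; first by rewrite divr_gt0.
(* [hh i] keeps the first i coordinates of h, so consecutive points differ along one basis
   vector. *)
pose hh (i : nat) : E := \row_k (if (k < i)%N then h 0 k else 0).
have hhS (i : 'I_n) : hh i.+1 = h 0 i *: basis i + hh i.
  apply/rowP => k; rewrite !mxE eqxx /= ltnS leq_eqVlt.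
  have [->|ki] := eqVneq k i; first by rewrite eqxx ltnn mulr1 addr0.
  by rewrite mulr0 add0r -(inj_eq val_inj) in ki *; rewrite (negbTE ki).
have inball (i : 'I_n) (c : R) : 0 <= c <= 1 -> ball x d ((c * h 0 i) *: basis i + (x + hh i)).
  move=> /andP[c0 c1]; split => // a k; rewrite ord1 !mxE eqxx /=.
  rewrite -ball_normE /ball_ /= opprD addrCA opprD addNKr -opprD normrN;
    apply: (@le_lt_trans _ _ (d / 2)); last by lra.
  apply: le_trans (hd k).
  have [->|ki] := eqVneq k i.
    by rewrite ltnn addr0 mulr1 normrM ler_piMl// ger0_norm.
  by rewrite mulr0 add0r; case: ifP => // _; rewrite normr0.
have step (i : 'I_n) : `|f (x + hh i.+1) - f (x + hh i) - h 0 i * partial i f x| <= e * `|h 0 i|.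
  pose c (t : R) := f ((t * h 0 i) *: basis i + (x + hh i)).
  have [t /andP[t0 t1]|t t01] := @derive_mvt _ c (fun t => partial i f ((t * h 0 i)
    *: basis i + (x + hh i)) * h 0 i) 0 1 ler01.
    apply: (@is_derive1_comp _ (fun s => f (s *: basis i + (x + hh i))) (fun t => t * h 0 i)).
      apply: is_derive_line; apply: Cn_derivable fC _.
      by apply: (proj1 (dP _ _)); apply: inball; rewrite t0.
    have := @is_derive_lincomb R id (cst 0) (h 0 i) t 1 0 (is_derive_id _ _) (is_derive_cst _ _ _).
    rewrite mulr1 addr0; congr is_derive.
    by apply/funext => s; rewrite /= addr0 mulrC.
  rewrite /c mul1r mul0r scale0r add0r subr0 mulr1.
  have -> : h 0 i *: basis i + (x + hh i) = x + hh i.+1 by rewrite hhS addrCA.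
  move=> ->; rewrite mulrC -mulrBr normrM mulrC distrC; apply: ler_wpM2r => //.
  by apply: (proj2 (dP _ _)); exact: inball.
have hn : hh n = h by apply/rowP => k; rewrite mxE ltn_ord.
have h0 : hh 0%N = 0 by apply/rowP => k; rewrite !mxE.
have -> : f (x + h) - f x = \sum_(i < n) (f (x + hh i.+1) - f (x + hh i)).
  by rewrite -(big_mkord xpredT (fun i => f (x + hh i.+1) - f (x + hh i))) telescope_sumr// hn h0 addr0.
rewrite -sumrB; apply: le_trans (ler_norm_sum _ _ _) _.
by rewrite mulr_sumr; apply: ler_sum => i _; exact: step.
Unshelve. all: by end_near. Qed.

Lemma cvg_big_sum (I : Type) (s : seq I) (T : Type) (F : set_system T) (u : I -> T -> R) (l : I -> R) :
  Filter F -> (forall i, u i t @[t --> F] --> l i) ->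
  \sum_(i <- s) u i t @[t --> F] --> \sum_(i <- s) l i.
Proof.
move=> FF ul; elim: s => [|i s IH].
  by rewrite big_nil; under eq_fun do rewrite big_nil; exact: cvg_cst.
by rewrite big_cons; under eq_fun do rewrite big_cons; exact: cvgD.
Qed.

(** Chain rule along a curve from the first-order expansion of f: the difference quotients of the
    coordinates converge, and the remainder is small relative to their sum. *)
Lemma is_derive_C1_curve U f (c : R -> E) (dc : 'I_n -> R) : open U -> Cn 1 U f -> U (c 0) ->
  (forall k, is_derive (0 : R) 1 (fun t => c t 0 k) (dc k)) ->
  is_derive (0 : R) 1 (f \o c) (\sum_k dc k * partial k f (c 0)).
Proof.
move=> Uo fC Uc cd.
pose q k (t : R) := t^-1 * (c t 0 k - c 0 0 k).
have qc k : q k t @[t --> (0 : R)^'] --> dc k.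
  have [d1 d2] := cd k; rewrite -d2 /derive.
  have -> : q k = (fun h : R => h^-1 *: (c (h *: 1 + 0) 0 k - c 0 0 k)).
    by apply/funext => t; rewrite /q addr0 [_%:A]mulr1.
  exact: d1.
set L := \sum_k dc k * partial k f (c 0).
have H : h^-1 *: ((f \o c) (h *: (1 : R) + 0) - (f \o c) 0) @[h --> (0 : R)^'] --> L.
  have -> : (fun h : R => h^-1 *: ((f \o c) (h *: (1 : R) + 0) - (f \o c) 0)) =
      (fun h => (\sum_k q k h * partial k f (c 0)) +
        (h^-1 * (f (c h) - f (c 0)) - \sum_k q k h * partial k f (c 0))).
    by apply/funext => h /=; rewrite addr0 [_%:A]mulr1 subrKC.
  rewrite -[L]addr0; apply: cvgD.
    by apply: cvg_big_sum => k; apply: cvgM; [exact: qc|exact: cvg_cst].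
  apply/cvgrPdist_le => e e0.
  (* Near 0 each quotient is at most |dc k| + 1 in absolute value; the final 1 keeps K positive when
     n = 0. *)
  pose K := \sum_k (`|dc k| + 1) + 1.
  have K1 : 0 < K by rewrite ltr_wpDl// sumr_ge0// => k _; rewrite addr_ge0.
  have [d d0 dP] := C1_approx Uo fC Uc (divr_gt0 e0 K1).
  have nq : \forall h \near (0 : R)^', forall k, `|q k h| <= `|dc k| + 1.
    apply: filter_forall => k; have /cvgrPdist_le/(_ _ ltr01) := qc k.
    apply: filterS => h; rewrite -lerBlDl; apply: le_trans.
    by rewrite distrC; exact: lerB_dist.
  have nh : \forall h \near (0 : R)^', `|h| <= d / K.
    exists (d / K) => /=; first by rewrite divr_gt0.
    by move=> h /=; rewrite sub0r normrN => /ltW.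
  have nz : \forall h \near (0 : R)^', h != 0 by exact: nbhs_dnbhs_neq.
  suff key (h : R) : h != 0 -> `|h| <= d / K -> (forall k, `|q k h| <= `|dc k| + 1) ->
      `|h^-1 * (f (c h) - f (c 0)) - \sum_k q k h * partial k f (c 0)| <= e.
    by near=> h; rewrite sub0r normrN; apply: key; near: h.
  move=> hn0 hK qK.
  have hq k : (c h - c 0) 0 k = h * q k h by rewrite /q mulrA mulfV// mul1r !mxE.
  have H1 : (forall k, `|h * q k h| <= d) -> `|f (c h) - f (c 0) -
      h * \sum_k q k h * partial k f (c 0)| <= e / K * \sum_k `|h * q k h|.
    move=> hd; have := dP (c h - c 0); rewrite subrKC.
    have -> : \sum_k (c h - c 0) 0 k * partial k f (c 0) = h * \sum_k q k h * partial k f (c 0).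
      rewrite mulr_sumr; apply: eq_bigr => k _.
      by rewrite hq -mulrA.
    have -> : \sum_k `|(c h - c 0) 0 k| = \sum_k `|h * q k h|.
      by apply: eq_bigr => k _; rewrite hq.
    by apply=> k; rewrite hq.
  rewrite -[X in _ - X](mulKf hn0) -mulrBr normrM normfV.
  rewrite mulrC ler_pdivrMr ?normr_gt0//.
  apply: le_trans (H1 _) _.
    move=> k; rewrite normrM; apply: (@le_trans _ _ (d / K * (`|dc k| + 1))).
      exact: ler_pM.
    rewrite mulrAC ler_pdivrMr// ler_pM2l// /K (bigD1 k)//= -addrA lerDl addr_ge0// sumr_ge0//.
  rewrite mulrAC ler_pdivrMr// -mulrA ler_pM2l//.
  under eq_bigr do rewrite normrM.
  rewrite -mulr_sumr ler_wpM2l// /K; apply: ler_wpDr => //.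
  by apply: ler_sum => k _.
by apply: DeriveDef; [apply/cvg_ex; exists L|exact: cvg_lim H].
Unshelve. all: by end_near. Qed.

End SmoothCalculus.

(** * Lebesgue measure *)

Section Borel.
Context (T : ptopologicalType) (R : realType).

Lemma open_measurable_borel (A : set (borel T)) : open (A : set T) -> measurable A.
Proof. exact: sub_sigma_algebra. Qed.

Lemma closed_measurable_borel (A : set (borel T)) : closed (A : set T) -> measurable A.
Proof.
by move=> Ac; rewrite -(setCK A); apply: measurableC; apply: open_measurable_borel; exact: closed_openC.
Qed.

Lemma continuous_measurable_borel (U : set (borel T)) (f : T -> R) : open (U : set T) ->
  (forall x, U x -> {for x, continuous f}) -> measurable_fun U (f : borel T -> R).
Proof.
move=> Uo fc mU; apply: (measurability _ (RGenOInfty.measurableE R)) => //.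
move=> _ [_ [a ->] <-]; apply: open_measurable_borel.
rewrite openE => x [Ux fx]; rewrite /interior.
have H0 : nbhs (f x) [set` `]a, +oo[%R].
  by apply: open_nbhs_nbhs; split => //; exact: interval_open.
have H := fc x Ux _ H0.
near=> y; split; first by near: y; exact: open_nbhs_nbhs.
by near: y.
Unshelve. all: by end_near. Qed.

Lemma continuous_measurableT (f : T -> R) : continuous f ->
  measurable_fun [set: borel T] (f : borel T -> R).
Proof.
by move=> fc; apply: continuous_measurable_borel => [|x _]; [exact: (@openT T)|exact: fc].
Qed.

End Borel.

Lemma continuous_borel_measurable (T T' : ptopologicalType) (f : T -> T') :
  continuous f -> measurable_fun [set: borel T] (f : borel T -> borel T').
Proof.
move=> fc mU; apply: (measurability _ (erefl : @measurable _ (borel T') = <<s @open T' >>)) => //.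
move=> _ [A Ao <-]; rewrite setTI; apply: open_measurable_borel.
by move/continuousP : fc; exact.
Qed.

Lemma integrable_scaled_indic d (T : measurableType d) (R : realType)
    (mu : {measure set T -> \bar R}) (A : set T) (C : R) :
  measurable A -> (mu A < +oo)%E ->
  mu.-integrable setT (EFin \o (fun x => C * \1_A x)).
Proof.
move=> mA fA.
have : mu.-integrable setT (EFin \o (\1_A : T -> R)).
  apply/integrableP; split; first exact/measurable_EFinP.
  rewrite (eq_integral (fun x => (\1_A x)%:E)); last first.
    by move=> x _ /=; rewrite ger0_norm.
  by rewrite integral_indic// setIT.
move=> /(integrableZl measurableT C); apply: eq_integrable => // x _ /=.
Qed.

Section Lebesgue.
Context {R : realType} {n : nat}.
Local Notation E := 'rV[R]_n.

Definition cbox (a b : E) : set E := [set x | forall k, a 0 k <= x 0 k <= b 0 k].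

Lemma closed_cbox a b : closed (cbox a b).
Proof.
have -> : cbox a b = \bigcap_(k in [set: 'I_n]) (fun x : E => x 0 k) @^-1` `[a 0 k, b 0 k].
  apply/seteqP; split => x /= H; first by move=> k _ /=; rewrite in_itv; exact: H.
  by move=> k; have := H k I; rewrite /= in_itv.
apply: closed_bigI => k _; apply: closed_comp; last exact: interval_closed.
by move=> x _; exact: coord_continuous.
Qed.

Lemma compact_cbox a b : compact (cbox a b).
Proof.
have -> : cbox a b = [set v : E | forall k, `[a 0 k, b 0 k]%classic (v ord0 k)].
  by apply/seteqP; split => x /= H k; have := H k; rewrite /= in_itv.
apply: (@rV_compact _ _ (fun k => `[a 0 k, b 0 k]%classic)) => k; exact: segment_compact.
Qed.

Lemma measurable_cbox a b : measurable (cbox a b : set (borel E)).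
Proof. by apply: closed_measurable_borel; exact: closed_cbox. Qed.

(** The empty set is added to make the family stable under intersection, as [measure_unique]
    demands. *)
Definition boxes : set (set E) :=
  [set A | A = set0 \/ exists a b : E, (forall k, a 0 k <= b 0 k) /\ A = cbox a b].

Lemma boxes_setI : setI_closed boxes.
Proof.
move=> A B [->|[a [b [ab ->]]]]; first by rewrite set0I; left.
move=> [->|[c [d [cd ->]]]]; first by rewrite setI0; left.
pose l : E := \row_k Num.max (a 0 k) (c 0 k).
pose u : E := \row_k Num.min (b 0 k) (d 0 k).
have -> : cbox a b `&` cbox c d = cbox l u.
  apply/seteqP; split => x /=.
    move=> [H1 H2] k; rewrite !mxE ge_max le_min.
    by have /andP[-> ->] := H1 k; have /andP[-> ->] := H2 k.
  move=> H; split => k; have := H k; rewrite !mxE ge_max le_min => /andP[/andP[h1 h2] /andP[h3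
    h4]]; exact/andP.
have [lu|] := pselect (forall k, l 0 k <= u 0 k); first by right; exists l, u.
move=> nlu; left; rewrite -subset0 => x H; apply: nlu => k.
by have /andP[] := H k; exact: le_trans.
Qed.

(** The boxes with rational corners contained in U exhaust it; they are enumerated by [pickle], and
    indices without such a box give the empty set. *)
Lemma open_bigcup_boxes (U : set E) : open U ->
  exists F : nat -> set E, (forall i, boxes (F i)) /\ U = \bigcup_i F i.
Proof.
move=> Uo.
pose I := ('rV[rat]_n * 'rV[rat]_n)%type.
pose B (q : I) : set E := cbox (map_mx ratr q.1) (map_mx ratr q.2).
pose G (q : I) : set E := if `[< boxes (B q) /\ B q `<=` U >] then B q else set0.
exists (fun i => if unpickle i is Some q then G q else set0); split.
  move=> i; case: (unpickle i) => [q|]; last by left.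
  by rewrite /G; case: asboolP => [[]//|_]; left.
apply/seteqP; split => [x Ux|x [i _]]; last first.
  by case: (unpickle i) => [q|//]; rewrite /G; case: asboolP => // -[_]; exact.
have [e /= e0 eU] : nbhs_ball x U by apply/nbhs_ballP; exact: open_nbhs_nbhs.
have /choice[a aP] : forall k, exists q : rat, x 0 k - e < ratr q < x 0 k.
  move=> k; have [q] := rat_in_itvoo (ltac:(by rewrite ltrBlDr ltrDl) : x 0 k - e < x 0 k).
  by rewrite in_itv /=; exists q.
have /choice[b bP] : forall k, exists q : rat, x 0 k < ratr q < x 0 k + e.
  move=> k; have [q] := rat_in_itvoo (ltac:(by rewrite ltrDl) : x 0 k < x 0 k + e).
  by rewrite in_itv /=; exists q.
pose q : I := (\row_k a k, \row_k b k).
exists (pickle q) => //; rewrite pickleK /G.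
have xB : B q x.
  by move=> k; rewrite !mxE; have /andP[_ /ltW ->] := aP k; have /andP[/ltW ->] := bP k.
case: asboolP => // H; exfalso; apply: H; split.
  right; exists (map_mx ratr q.1), (map_mx ratr q.2); split => // k.
  by have /andP[] := xB k; exact: le_trans.
move=> y yB; apply: eU; split => // i k; rewrite ord1 -ball_normE /ball_ /=.
have /andP[] := yB k; rewrite !mxE => h1 h2.
have /andP[h3 h4] := aP k; have /andP[h5 h6] := bP k.
by rewrite ltr_norml; apply/andP; split; lra.
Qed.

Lemma borel_boxes : @measurable _ (borel E) = <<s boxes >>.
Proof.
apply/seteqP; split; last first.
  apply: smallest_sub; first exact: sigma_algebra_measurable.
  by move=> A [->//|[a [b [_ ->]]]]; exact: measurable_cbox.
apply: smallest_sub; first exact: smallest_sigma_algebra.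
move=> U /open_bigcup_boxes[F [FB ->]].
by apply: sigma_algebra_bigcup => i; apply: sub_sigma_algebra; exact: FB.
Qed.

Lemma measure_boxes_unique (m1 m2 : {measure set (borel E) -> \bar R}) :
  (forall a b : E, (forall k, a 0 k <= b 0 k) -> m1 (cbox a b) = m2 (cbox a b)) ->
  (forall a b : E, (m1 (cbox a b) < +oo)%E) ->
  forall A, measurable A -> m1 A = m2 A.
Proof.
move=> m12 fin; pose g (i : nat) : set E := cbox (const_mx (- i%:R)) (const_mx i%:R).
apply: (@measure_unique _ R (borel E) boxes g) => //.
- exact: borel_boxes.
- exact: boxes_setI.
- move=> i; right; exists (const_mx (- i%:R)), (const_mx i%:R); split => // k.
  by rewrite !mxE; apply: (@le_trans _ _ 0); rewrite ?oppr_le0.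
- apply/seteqP; split => // x _.
  pose K := \sum_k `|x 0 k|.
  exists (Num.truncn K).+1 => // k; rewrite !mxE -ler_norml.
  apply: (@le_trans _ _ K); first by rewrite /K (bigD1 k)//= lerDl sumr_ge0.
  by apply: ltW; exact: truncnS_gt.
- by move=> A [->|[a [b [ab ->]]]]; [rewrite !measure0|exact: m12].
- by move=> k; exact: fin.
Qed.

Lemma shift_measurable (v : E) : measurable_fun [set: borel E] ((fun x => x + v) : borel E -> borel E).
Proof.
apply: continuous_borel_measurable => x.
apply: (@continuousD _ _ _ (fun x : E => x) (cst v) x); last exact: cst_continuous.
by move=> A.
Qed.

Variable lam : {measure set (borel E) -> \bar R}.
Hypothesis lamP : is_lebesgue lam.

Lemma lam_cbox_fin a b : (lam (cbox a b) < +oo)%E.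
Proof.
have [ab|nab] := pselect (forall k, a 0 k <= b 0 k).
  by rewrite (lamP ab) ltry.
suff -> : cbox a b = set0 by rewrite measure0.
rewrite -subset0 => x H; apply: nab => k.
by have /andP[] := H k; exact: le_trans.
Qed.

(** [is_lebesgue] prescribes the measure of boxes only; translation invariance on Borel sets follows
    from uniqueness of a measure given on boxes. *)
Lemma lam_shift (v : E) (A : set (borel E)) : measurable A ->
  pushforward lam ((fun x => x + v) : borel E -> borel E) A = lam A.
Proof.
move=> mA; apply/esym.
apply: (@measure_boxes_unique lam
  (measure_function_pushforward__canonical__measure_function_Measure lam (shift_measurable v))) => //.
  move=> a b ab; rewrite (lamP ab) /= /pushforward.
  have -> : (fun x : E => x + v) @^-1` cbox a b = cbox (a - v) (b - v).
    by apply/seteqP; split => x /= H k; have := H k; rewrite !mxE lerBlDr lerBrDr.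
  rewrite lamP; last by move=> k; rewrite !mxE lerD2r.
  by congr (_%:E); apply: eq_bigr => k _; rewrite !mxE; ring.
exact: lam_cbox_fin.
Qed.

Lemma integral_shift (v : E) (f : E -> R) :
  lam.-integrable setT (EFin \o (f : borel E -> R)) ->
  lam.-integrable setT (EFin \o ((fun x => f (x + v)) : borel E -> R)) /\
  (\int[lam]_(x in setT) (f (x + v))%:E = \int[lam]_(x in setT) (f x)%:E)%E.
Proof.
move=> fi; have mf : measurable_fun [set: borel E] (EFin \o f) by case/integrableP : fi.
pose tau := (fun x => x + v) : borel E -> borel E.
have mtau := shift_measurable v : measurable_fun setT tau.
have ti : lam.-integrable setT ((EFin \o f) \o tau).
  apply/integrableP; split; first exact: measurableT_comp mf mtau.
  have := @ge0_integral_pushforward _ _ _ _ R tau mtau lam setT (abse \o (EFin \o f)) measurableT.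
  rewrite preimage_setT => /(_ _ _) <-.
  - rewrite (eq_measure_integral lam); first by case/integrableP : fi.
    by move=> A mA _; exact: lam_shift.
  - exact: measurableT_comp.
  - by move=> x _; exact: abse_ge0.
split => //.
have := @integral_pushforward _ _ _ _ R tau mtau lam setT (EFin \o f) mf.
rewrite preimage_setT => /(_ ti measurableT) <-.
by apply: eq_measure_integral => A mA _; exact: lam_shift.
Qed.

Lemma cbox_bounded_integrable a b (f : E -> R) (C : R) :
  measurable_fun [set: borel E] (f : borel E -> R) ->
  (forall x, ~ cbox a b x -> f x = 0) -> (forall x, `|f x| <= C) ->
  lam.-integrable setT (EFin \o (f : borel E -> R)).
Proof.
move=> mf f0 fC.
have mb := measurable_cbox a b.
have ic : lam.-integrable setT (EFin \o ((fun x => C * \1_(cbox a b) x) : borel E -> R)).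
  by apply: integrable_scaled_indic => //; exact: lam_cbox_fin.
apply: le_integrable ic => //; first exact/measurable_EFinP.
move=> x _ /=; rewrite lee_fin.
have C0 : 0 <= C by apply: le_trans (fC 0); exact: normr_ge0.
have [xb|nx] := pselect (cbox a b x).
  by rewrite indicE mem_set// mulr1 (ger0_norm C0).
by rewrite f0// normr0 normr_ge0.
Qed.

Lemma cbox_continuous_bounded a b (f : E -> R) : continuous f ->
  (forall x, ~ cbox a b x -> f x = 0) -> exists C, forall x, `|f x| <= C.
Proof.
move=> fc f0.
have : bounded_set (f @` cbox a b).
  apply: compact_bounded; apply: continuous_compact; last exact: compact_cbox.
  exact: continuous_subspaceT.
move=> [M [_ /(_ (M + 1))]]; rewrite ltrDl ltr01 => /(_ isT) H.
exists (Num.max 0 (M + 1)) => x.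
have [xb|nx] := pselect (cbox a b x); last by rewrite f0// normr0 le_max lexx.
by rewrite le_max; apply/orP; right; apply: H; exists x.
Qed.

(** The difference quotients of g along the basis vector have integral 0 by translation invariance,
    and they converge to the partial derivative with a common bound and a common compact support. *)
Lemma integral_partial0 a b (g : E -> R) (k : 'I_n) :
  continuous g -> (forall x, derivable g x (delta_mx 0 k)) -> continuous (partial k g) ->
  (forall x, ~ cbox a b x -> g x = 0) ->
  (\int[lam]_(x in setT) (partial k g x)%:E = 0)%E.
Proof.
move=> gc gd pc g0.
pose e_k : E := delta_mx 0 k.
pose t (j : nat) : R := (j.+1%:R)^-1.
have t0 j : 0 < t j by rewrite invr_gt0 ltr0n.
have t1 j : t j <= 1 by rewrite invf_le1// ?ler1n// ltr0n.
(* All increments t j are at most 1, so enlarging the box by 1 contains the supports of all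
   quotients. *)
pose a' : E := a - const_mx 1; pose b' : E := b + const_mx 1.
have out (s : R) x : `|s| <= 1 -> ~ cbox a' b' x -> ~ cbox a b (x + s *: e_k).
  move=> s1 nx xb; apply: nx => i; have := xb i; rewrite !mxE eqxx /=.
  have : - 1 <= s * (i == k)%:R <= 1.
    by rewrite -ler_norml normrM; case: eqP => _; rewrite ?normr1 ?mulr1// normr0 mulr0.
  by move=> /andP[h1 h2] /andP[h3 h4]; apply/andP; split; lra.
have p0 x : ~ cbox a b x -> partial k g x = 0.
  move=> nx; rewrite /partial.
  have <- : 'D_e_k (cst 0 : E -> R) x = 0 by exact: derive_cst.
  apply: near_eq_derive.
  have : open (~` cbox a b) by apply: closed_openC; exact: closed_cbox.
  move=> oc; near=> y; rewrite g0//.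
  by near: y; apply: open_nbhs_nbhs.
have [C gC] := cbox_continuous_bounded pc p0.
have C0 : 0 <= C by apply: le_trans (gC 0); exact: normr_ge0.
pose q j (x : E) : R := (t j)^-1 * (g (x + t j *: e_k) - g x).
have qC j x : `|q j x| <= C.
  have [|c _] := @derive_mvt _ (fun s : R => g (s *: e_k + x))
    (fun s => partial k g (s *: e_k + x)) 0 (t j) (ltW (t0 j)).
    by move=> s _; apply: is_derive_line; exact: gd.
  rewrite scale0r add0r subr0 [_ + x]addrC => E1.
  by rewrite /q E1 mulrC mulfK ?gt_eqF//.
have q0 j x : ~ cbox a' b' x -> q j x = 0.
  move=> nx; rewrite /q !g0 ?subrr ?mulr0//.
    by have := out 0 x; rewrite scale0r addr0; apply => //; rewrite normr0.
  by apply: out => //; rewrite gtr0_norm.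
have mg : measurable_fun [set: borel E] (g : borel E -> R).
  exact: continuous_measurableT.
have mp : measurable_fun [set: borel E] (partial k g : borel E -> R).
  exact: continuous_measurableT.
have gi : lam.-integrable setT (EFin \o (g : borel E -> R)).
  have [C' gC'] := cbox_continuous_bounded gc g0.
  exact: cbox_bounded_integrable mg g0 gC'.
have qi j : lam.-integrable setT (EFin \o (q j : borel E -> R)).
  have [gs _] := integral_shift (t j *: e_k) gi.
  have := integrableZl measurableT (t j)^-1 (integrableB measurableT gs gi).
  by apply: eq_integrable => // x _ /=.
have Iq j : (\int[lam]_(x in setT) (q j x)%:E = 0)%E.
  have [gs E1] := integral_shift (t j *: e_k) gi.
  rewrite (_ : (fun x => (q j x)%:E) = (fun x => ((t j)^-1)%:E * ((g (x + t j *: e_k))%:E - (g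
    x)%:E))%E); last first.
    by apply/funext => x; rewrite -EFinB -EFinM.
  rewrite integralZl//; last exact: integrableB.
  rewrite integralB// E1 subee ?mule0//.
  exact: integrable_fin_num.
have qp x : q j x @[j --> \oo] --> partial k g x.
  have [d1 d2] : is_derive x e_k g (partial k g x) by apply: DeriveDef.
  have H : h^-1 *: (g (h *: e_k + x) - g x) @[h --> (0 : R)^'] --> partial k g x.
    exact: (gd x).
  apply/cvgrPdist_lt => e e0.
  have /cvgrPdist_lt/(_ _ e0)[d /= d0 dP] := H.
  have : \forall j \near \oo, t j < d.
    exact: near_infty_natSinv_lt (PosNum d0).
  apply: filterS => j jd; rewrite /q [x + _]addrC.
  apply: dP; last by rewrite gt_eqF.
  by rewrite /= sub0r normrN gtr0_norm.
have := @dominated_cvg _ (borel E) R lam setT measurableT (fun j => EFin \o q j) (EFin \o partial k g)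
  (EFin \o (fun x => C * \1_(cbox a' b') x)).
move=> /(_ _ _ _ _ _) H.
have : (\int[lam]_(x in setT) (EFin \o q j) x)%E @[j --> \oo] --> (\int[lam]_(x in setT)
  (EFin \o partial k g) x)%E.
  apply: H => //.
  - by move=> j; case/integrableP : (qi j).
  - by move=> x _; apply: cvg_EFin; [exact: nearW|exact: qp].
  - apply: integrable_scaled_indic; [exact: measurable_cbox|exact: lam_cbox_fin].
  - move=> j x _ /=; rewrite lee_fin; have [xb|nx] := pselect (cbox a' b' x).
      by rewrite indicE mem_set// mulr1.
    by rewrite q0// normr0 mulr_ge0.
under eq_fun do rewrite Iq.
by move=> /cvg_lim <- //; rewrite lim_cst.
Unshelve. all: by end_near. Qed.

End Lebesgue.

(** * Smooth functions on a manifold *)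

Lemma Cn_local {R : realType} {n : nat} m (U : set 'rV[R]_n) (f : 'rV[R]_n -> R) :
  (forall x, U x -> exists2 V : set 'rV[R]_n, V x & Cn m V f) -> Cn m U f.
Proof.
elim: m f => [|m IH] f fU.
  by split=> // x /fU[V Vx fV]; exact: Cn_continuous fV Vx.
split; first by move=> x /fU[V Vx fV]; exact: Cn_continuous fV Vx.
split; first by move=> k x /fU[V Vx fV]; exact: Cn_derivable fV Vx.
by move=> k; apply: IH => x /fU[V Vx fV]; exists V => //; exact: Cn_partial.
Qed.

Lemma Cn_sub_set {R : realType} {n : nat} m (U V : set 'rV[R]_n) (f : 'rV[R]_n -> R) :
  V `<=` U -> Cn m U f -> Cn m V f.
Proof. by move=> VU fU; apply: Cn_local => x /VU Ux; exists U. Qed.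

Local Notation codom := Defs.codom.
Local Notation coord := Defs.coord.

Lemma open_obox {R : realType} {n : nat} (a b : 'rV[R]_n) :
  open [set y : 'rV[R]_n | forall k, a 0 k < y 0 k < b 0 k].
Proof.
rewrite openE => y yab; rewrite /interior.
near=> z; move=> /=; near: z; apply: filter_forall => k.
have : open ((fun y : 'rV[R]_n => y 0 k) @^-1` `]a 0 k, b 0 k[).
  by apply: open_comp; [move=> z _; exact: coord_continuous_rV|exact: interval_open].
move=> oU; apply: open_nbhs_nbhs; split => //=.
Unshelve. all: by end_near. Qed.
Arguments open_obox {R n} a b.

Section SmoothManifold.
Context {R : realType} {n : nat} (M : smoothManifold R n).
Local Notation E := 'rV[R]_n.
Implicit Types (i j : chart_index M) (f g : M -> R) (p q : M).

Lemma open_codom i : open (codom i).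
Proof. exact: codom_open. Qed.

Lemma codom_coord i p : dom i p -> codom i (coord i p).
Proof. by move=> ip; exists p. Qed.

Lemma dom_param i x : codom i x -> dom i (param i x).
Proof. by move=> [p ip <-]; rewrite coordK. Qed.

Lemma paramK i x : codom i x -> coord i (param i x) = x.
Proof. by move=> [p ip <-]; rewrite coordK. Qed.

Lemma smoothP f : smooth f <-> forall i m, Cn m (codom i) (f \o param i).
Proof.
split=> [fs i m|fs i]; last by apply/smooth_onP; exact: fs.
by move: m; apply/smooth_onP; exact: fs.
Qed.

Lemma open_dom_param i (V : set M) : open V -> open (codom i `&` param i @^-1` V).
Proof.
move=> Vo; rewrite openE => x [xc xV]; rewrite /interior.
have H : nbhs (param i x) V by exact: open_nbhs_nbhs.
have H1 := param_continuous xc H.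
have H2 : nbhs x (codom i) by apply: open_nbhs_nbhs; split => //; exact: open_codom.
exact: filterI H2 H1.
Qed.

Lemma open_coord_dom i (V : set E) : open V -> open (dom i `&` coord i @^-1` V).
Proof.
move=> Vo; rewrite openE => p [pd pV]; rewrite /interior.
have H : nbhs (coord i p) V by exact: open_nbhs_nbhs.
have H1 := Defs.coord_continuous pd H.
have H2 : nbhs p (dom i) by apply: open_nbhs_nbhs; split => //; exact: dom_open.
exact: filterI H2 H1.
Qed.

Lemma smooth_continuous f : smooth f -> continuous f.
Proof.
move=> /smoothP fs p.
pose i := chart_at p; have ip : dom i p := dom_chart_at p.
have fc : {for coord i p, continuous (f \o param i)}.
  by apply: Cn_continuous (fs i 0%N) _; exact: codom_coord.
have H : {near nbhs p, (f \o param i) \o coord i =1 f}.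
  have : nbhs p (dom i) by apply: open_nbhs_nbhs; split => //; exact: dom_open.
  by apply: filterS => q iq; rewrite /= coordK.
have E0 : f p = (f \o param i) (coord i p) by rewrite /= coordK.
suff : f y @[y --> p] --> f p by [].
have H1 : {for p, continuous ((f \o param i) \o coord i)}.
  by apply: continuous_comp => //; exact: Defs.coord_continuous.
by rewrite E0; exact: (cvg_trans (near_eq_cvg H) H1).
Qed.

Lemma smooth_cst (c : R) : smooth ((fun=> c) : M -> R).
Proof. by apply/smoothP => i m; apply: Cn_cst; exact: open_codom. Qed.

Lemma smoothD f g : smooth f -> smooth g -> smooth (fun p => f p + g p).
Proof.
move=> /smoothP fs /smoothP gs; apply/smoothP => i m.
by apply: (Cn_add _ (fs i m) (gs i m)); exact: open_codom.
Qed.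

Lemma smoothM f g : smooth f -> smooth g -> smooth (fun p => f p * g p).
Proof.
move=> /smoothP fs /smoothP gs; apply/smoothP => i m.
by apply: (Cn_mul _ (fs i m) (gs i m)); exact: open_codom.
Qed.

Lemma smoothZ (c : R) f : smooth f -> smooth (fun p => c * f p).
Proof. by move=> fs; exact: (smoothM (smooth_cst c) fs). Qed.

Lemma smoothB f g : smooth f -> smooth g -> smooth (fun p => f p - g p).
Proof.
move=> /smoothP fs /smoothP gs; apply/smoothP => i m.
by apply: (Cn_sub _ (fs i m) (gs i m)); exact: open_codom.
Qed.

Lemma smoothV f : smooth f -> (forall p, f p != 0) -> smooth (fun p => (f p)^-1).
Proof.
move=> /smoothP fs f0; apply/smoothP => i m.
by apply: (Cn_inv _ _ (fs i m)); [exact: open_codom|move=> x _; exact: f0].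
Qed.

Lemma smooth_sqrt f : smooth f -> (forall p, 0 < f p) -> smooth (fun p => Num.sqrt (f p)).
Proof.
move=> /smoothP fs f0; apply/smoothP => i m.
by apply: (Cn_sqrt _ _ (fs i m)); [exact: open_codom|move=> x _; exact: f0].
Qed.

Definition supp f : set M := closure [set p | f p != 0].

Lemma supp_neq0 f p : ~ supp f p -> f p = 0.
Proof.
move=> nfp; apply: contrapT => /eqP fp; apply: nfp.
exact: subset_closure.
Qed.

Lemma closed_compact_sub (A B : set M) : closed A -> compact B -> A `<=` B -> compact A.
Proof. by move=> cA cB AB; exact: subclosed_compact cA cB AB. Qed.

Lemma compact_closed_M (A : set M) : compact A -> closed A.
Proof. by move=> cA; apply: compact_closed => //; exact: manifold_hausdorff. Qed.

Lemma supp_sub f (K : set M) : compact K -> (forall p, f p != 0 -> K p) -> supp f `<=` K.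
Proof.
move=> cK fK; rewrite /supp closureE => p; apply; split; first exact: compact_closed_M.
exact: fK.
Qed.

Lemma test_function_sub f (K : set M) : smooth f -> compact K -> (forall p, ~ K p -> f p = 0) ->
  test_function f.
Proof.
move=> fs cK fK; split => //; apply: (closed_compact_sub _ cK); first exact: closed_closure.
apply: (supp_sub cK) => p fp; apply: contrapT => nK.
by move: fp; rewrite fK ?eqxx.
Qed.

Lemma test_function_comb (c : R) f g : test_function f -> test_function g ->
  test_function (fun p => c * f p + g p).
Proof.
move=> [fs cf] [gs cg].
have cK : compact (supp f `|` supp g) by exact: compactU.
have sfg := smoothD (smoothZ c fs) gs.
apply: (test_function_sub sfg cK) => p nK.
by rewrite (@supp_neq0 f) ?(@supp_neq0 g) ?mulr0 ?addr0// => H; apply: nK; [right|left].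
Qed.

Lemma param_compact i (K : set E) : compact K -> K `<=` codom i -> compact (param i @` K).
Proof.
move=> cK Kc; apply: continuous_compact => //.
apply: continuous_in_subspaceT => x; rewrite inE => Kx.
by apply: param_continuous; exact: Kc.
Qed.

Lemma compact_nbhs_chart i p (U : set M) : dom i p -> nbhs p U ->
  exists a b : E, [/\ cbox a b `<=` codom i, param i @` cbox a b `<=` U &
    forall k, a 0 k < coord i p 0 k < b 0 k].
Proof.
move=> ip pU; pose x := coord i p.
have xc : codom i x by exact: codom_coord.
have H1 : nbhs x (codom i `&` param i @^-1` U).
  apply: filterI; first by apply: open_nbhs_nbhs; split => //; exact: open_codom.
  by apply: (param_continuous xc); rewrite /x coordK.
have [e /= e0 eU] : nbhs_ball x (codom i `&` param i @^-1` U) by apply/nbhs_ballP.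
pose a : E := x - const_mx (e / 2); pose b : E := x + const_mx (e / 2).
have ab : cbox a b `<=` codom i `&` param i @^-1` U.
  move=> y yab; apply: eU; split => // u k; rewrite ord1 -ball_normE /ball_ /=.
  have := yab k; rewrite !mxE => /andP[h1 h2].
  by rewrite ltr_norml; apply/andP; split; lra.
exists a, b; split.
- by move=> y /ab[].
- by move=> _ [y /ab[_ yU] <-].
- by move=> k; rewrite !mxE; apply/andP; split; lra.
Qed.

(** Outside [dom i] the values of [coord i] carry no meaning, hence the explicit extension by 0. *)
Definition chart_bump i (a b : E) (p : M) : R :=
  if `[< dom i p >] then box_bump a b (coord i p) else 0.

Lemma chart_bump_dom i a b p : dom i p -> chart_bump i a b p = box_bump a b (coord i p).
Proof. by move=> ip; rewrite /chart_bump; case: asboolP. Qed.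

Lemma chart_bump_ge0 i a b p : 0 <= chart_bump i a b p.
Proof. by rewrite /chart_bump; case: asboolP => // _; exact: box_bump_ge0. Qed.

Lemma chart_bump_neq0 i (a b : E) p : chart_bump i a b p != 0 -> dom i p /\ cbox a b (coord i p).
Proof.
rewrite /chart_bump; case: asboolP => [ip /box_bump_neq0 H|_]; last by rewrite eqxx.
by split => // k; have /andP[/ltW -> /ltW ->] := H k.
Qed.

Lemma chart_bump_param i a b p : chart_bump i a b p != 0 -> (param i @` cbox a b) p.
Proof. by move=> /chart_bump_neq0[ip pab]; exists (coord i p) => //; rewrite coordK. Qed.

(** Smoothness is checked on two open sets: the chart domain, where transition maps apply, and the
    complement of the image of the closed box, which is closed because that image is compact in a
    Hausdorff space. *)
Lemma chart_bump_smooth i a b : cbox a b `<=` codom i -> smooth (chart_bump i a b).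
Proof.
move=> abc; apply/smoothP => j m; apply: Cn_local => x xj.
have cK := param_compact (@compact_cbox _ _ a b) abc.
have oK : open (~` (param i @` cbox a b)) by apply: closed_openC; exact: compact_closed_M.
have [ix|nix] := pselect (dom i (param j x)).
  exists (codom j `&` param j @^-1` dom i) => //.
  have oU := @open_dom_param j _ (dom_open i).
  have sU : codom j `&` param j @^-1` dom i `<=` coord j @` (dom j `&` dom i).
    move=> y [yj yi]; exists (param j y); last exact: paramK.
    by split => //; exact: dom_param.
  have tC k : Cn m (codom j `&` param j @^-1` dom i) (fun y => coord i (param j y) 0 k).
    exact: Cn_sub_set sU (proj1 (smooth_onP _ _) (@transition_smooth _ _ M j i k) m).
  apply: (@Cn_eq _ _ _ _ (fun y => box_bump a b (coord i (param j y)))) => //.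
    by move=> y [_ yi]; rewrite /= chart_bump_dom.
  apply: Cn_prod => // k; apply: Cn_mul => //; apply: Cn_flat => //; apply: Cn_sub => //;
    by exact: Cn_cst.
exists (codom j `&` param j @^-1` (~` (param i @` cbox a b))).
  by split => // -[y yab E]; apply: nix; rewrite -E; apply: dom_param; exact: abc.
apply: (@Cn_eq _ _ _ _ (fun=> 0)); first exact: open_dom_param.
- move=> y [_ ny]; apply/esym/eqP; apply: contrapT => /negP; rewrite /= => H.
  by apply: ny; exact: chart_bump_param.
- by apply: Cn_cst; exact: open_dom_param.
Qed.

Lemma countable_basis_seq : exists2 B : nat -> set M, (forall k, open (B k)) &
  forall (p : M) U, nbhs p U -> exists k, B k p /\ B k `<=` U.
Proof.
have [B Bc [Bo Bb]] := manifold_second_countable M.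
have H p U : nbhs p U -> exists2 V, B V & V p /\ V `<=` U.
  by move=> pU; have [V [BV Vp] VU] := Bb p U pU; exists V.
have [f fB] : exists f : nat -> set M, forall V, B V -> exists k, f k = V.
  have /countable_injP[g gi] := Bc.
  exists (fun k => if pselect (exists V, B V /\ g V = k) is left e then projT1 (cid e) else set0) => V BV.
  exists (g V); case: pselect => [e|]; last by case; exists V.
  case: cid => W [BW E] /=.
  by apply: gi => //; rewrite inE.
exists (fun k => if `[< open (f k) >] then f k else set0) => [k|p U pU].
  by case: asboolP => // _; exact: open0.
have [V BV [Vp VU]] := H p U pU; have [k fk] := fB V BV.
by exists k; rewrite fk; case: asboolP => // nV; exfalso; apply: nV; exact: Bo.
Qed.

(** Basic open sets that lie in some compact set cover M, since closed boxes in charts are compact.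
    The K k are unions of the first k compact sets chosen around them, and a compact set needs
    finitely many. *)
Lemma compact_exhaustion : exists K : nat -> set M,
  [/\ forall k, compact (K k), forall k, K k `<=` K k.+1 &
      forall C, compact C -> exists k, C `<=` K k].
Proof.
have [B Bo Bb] := countable_basis_seq.
have /choice[C CP] : forall k, exists C : set M, compact C /\
    ((exists2 C' : set M, compact C' & B k `<=` C') -> B k `<=` C).
  move=> k; have [[C' cC' BC']|nC] := pselect (exists2 C' : set M, compact C' & B k `<=` C').
    by exists C'.
  by exists set0; split => //; exact: compact0.
pose O k := if `[< B k `<=` C k >] then B k else set0.
have Oo k : open (O k) by rewrite /O; case: asboolP => // _; exact: open0.
have OC k : O k `<=` C k by rewrite /O; case: asboolP => // _ x.
exists (fun k => \bigcup_(i in `I_k) C i); split.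
- move=> k; rewrite bigcup_mkord; apply: bigsetU_compact => i _.
  by case: (CP i).
- by move=> k p [i /= ik Cp]; exists i => //=; exact: ltnW.
move=> A cA.
have AO : A `<=` \bigcup_(k in setT) O k.
  move=> p Ap; have ip := dom_chart_at p.
  have [a [b [abc _ pab]]] := compact_nbhs_chart ip (@filterT _ (nbhs p) _).
  have nK : nbhs p (param (chart_at p) @` cbox a b).
    have oU := open_obox a b.
    have H : nbhs p (dom (chart_at p) `&` coord (chart_at p)
      @^-1` [set y : E | forall k, a 0 k < y 0 k < b 0 k]).
      by apply: open_nbhs_nbhs; split => //; apply: open_coord_dom.
    apply: filterS H => q [iq qab]; exists (coord (chart_at p) q); last by rewrite coordK.
    by move=> k; have /andP[/ltW -> /ltW ->] := qab k.
  have [k [Bkp BkK]] := Bb p _ nK.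
  exists k => //; rewrite /O; case: asboolP => // nB; exfalso; apply: nB.
  apply: (proj2 (CP k)); exists (param (chart_at p) @` cbox a b) => //.
  exact: param_compact (@compact_cbox _ _ a b) abc.
move: cA; rewrite compact_cover => /(_ _ setT O (fun k _ => Oo k) AO)[D' _ AD].
exists (\max_(k <- finmap.enum_fset D') k).+1 => p /AD[k kD Ok].
exists k; last exact: OC.
by rewrite /= ltnS; apply: (@leq_bigmax_seq _ _ xpredT id).
Qed.

End SmoothManifold.

(** * The weighted Riemannian measure *)

Section Determinant.
Context {R : realType}.

Lemma cvg_big_prod (I : Type) (s : seq I) (T : Type) (F : set_system T) (u : I -> T -> R) (l : I -> R) :
  Filter F -> (forall i, u i t @[t --> F] --> l i) ->
  \prod_(i <- s) u i t @[t --> F] --> \prod_(i <- s) l i.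
Proof.
move=> FF ul; elim: s => [|i s IH].
  by rewrite big_nil; under eq_fun do rewrite big_nil; exact: cvg_cst.
by rewrite big_cons; under eq_fun do rewrite big_cons; exact: cvgM.
Qed.

Lemma det_continuous_line n (A B : 'M[R]_n) : continuous (fun t : R => \det (t *: A + B)).
Proof.
move=> t; rewrite /continuous_at /determinant.
apply: (@cvg_big_sum R _ _ _ _ (fun (s : 'S_n) t => (-1) ^+ s * \prod_(i < n) (t *: A + B) i (s i))).
move=> s; apply: cvgM; first exact: cvg_cst.
apply: (@cvg_big_prod _ _ _ _ (fun i t => (t *: A + B) i (s i))) => i.
under eq_fun do rewrite !mxE; rewrite !mxE.
apply: cvgD; last exact: cvg_cst.
by apply: cvgM; [exact: cvg_id|exact: cvg_cst].
Qed.

(** On the segment from the identity to A every matrix is positive definite, so the determinant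
    never vanishes there and keeps the sign it has at the identity. *)
Lemma posdef_det_gt0 n (A : 'M[R]_n) :
  (forall v : 'rV[R]_n, v != 0 -> 0 < (v *m A *m v^T) 0 0) -> 0 < \det A.
Proof.
move=> Apos.
pose B (t : R) := t *: (A - 1%:M) + 1%:M.
have Bn0 t : 0 <= t <= 1 -> \det (B t) != 0.
  move=> /andP[t0 t1]; apply/negP => /det0P[v v0 vB].
  have : (v *m B t *m v^T) 0 0 = t * (v *m A *m v^T) 0 0 + (1 - t) * (v *m v^T) 0 0.
    have -> : B t = t *: A + (1 - t) *: 1%:M.
      by rewrite /B scalerBr scalerBl scale1r addrAC addrA.
    by rewrite mulmxDr -!scalemxAr mulmx1 mulmxDl -!scalemxAl !mxE.
  rewrite vB mul0mx mxE => /eqP; apply/negP; rewrite eq_sym gt_eqF//.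
  have vv : 0 < (v *m v^T) 0 0.
    rewrite mxE lt_neqAle eq_sym; apply/andP; split; last first.
      by apply: sumr_ge0 => i _; rewrite mxE -expr2 sqr_ge0.
    apply: contraNneq v0 => H; apply/eqP/rowP => i; rewrite mxE.
    have := @psumr_eq0P _ _ xpredT (fun i => v 0 i * v^T i 0) _ H i isT.
    rewrite mxE => /(_ _)/eqP; rewrite mulf_eq0 orbb => H2; apply/eqP; apply: H2.
    by move=> j _; rewrite mxE -expr2 sqr_ge0.
  have [t0'|t0'] := eqVneq t 0; first by rewrite t0' mul0r add0r subr0 mul1r.
  apply: ltr_wpDr; first by rewrite mulr_ge0 ?subr_ge0// ltW.
  by rewrite mulr_gt0 ?Apos// lt_neqAle eq_sym t0'.
have B1 : B 1 = A by rewrite /B scale1r subrK.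
have B0 : B 0 = 1%:M by rewrite /B scale0r add0r.
rewrite ltNge; apply/negP => dA.
have [c] : exists2 c : R, c \in `[0, 1]%R & \det (B c) = 0.
  apply: IVT => //; first by apply: continuous_subspaceT; exact: det_continuous_line.
  by rewrite B0 B1 det1 minEle maxEle; case: (leP 1 (\det A)) => h; apply/andP; split; lra.
by rewrite in_itv/= => /Bn0/eqP.
Qed.

Lemma Cn_det {n} N m (U : set 'rV[R]_n) (A : 'rV[R]_n -> 'M[R]_m) : open U ->
  (forall a b, Cn N U (fun x => A x a b)) -> Cn N U (fun x => \det (A x)).
Proof.
move=> Uo AC; apply: Cn_sum => // s; apply: Cn_mul => //; first exact: Cn_cst.
by apply: Cn_prod => // i; exact: AC.
Qed.

Lemma Cn_invmx {n} N m (U : set 'rV[R]_n) (A : 'rV[R]_n -> 'M[R]_m) : open U ->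
  (forall a b, Cn N U (fun x => A x a b)) -> (forall x, U x -> \det (A x) != 0) ->
  forall a b, Cn N U (fun x => invmx (A x) a b).
Proof.
move=> Uo AC d0 a b.
apply: (@Cn_eq _ _ _ _ (fun x => (\det (A x))^-1 * cofactor (A x) b a)) => //.
  by move=> x Ux; rewrite /invmx unitmxE unitfE d0// !mxE.
apply: Cn_mul => //; first by apply: Cn_inv => //; exact: Cn_det.
apply: Cn_mul => //; first exact: Cn_cst.
by apply: Cn_det => // c d; apply: Cn_eq (AC (lift b c) (lift a d)) => // x _; rewrite !mxE.
Qed.

End Determinant.

(** * Change of variables for measures given by a density *)

Section Density.
Import HBNNSimple.
Context d1 d2 (X : measurableType d1) (Y : measurableType d2) (R : realType).
Variables (lam : {measure set X -> \bar R}) (nu : {measure set Y -> \bar R}).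
Variables (D : set X) (D' : set Y) (Phi : X -> Y) (h : X -> R).
Hypotheses (mD : measurable D) (mD' : measurable D') (mPhi : measurable_fun D Phi)
  (mh : measurable_fun D h).
Hypothesis DPhi : forall x, D x -> D' (Phi x).
Hypothesis h_ge0 : forall x, D x -> 0 <= h x.
Hypothesis nuE : forall A, measurable A ->
  (nu (A `&` D') = \int[lam]_(x in D `&` Phi @^-1` A) (h x)%:E)%E.

Local Open Scope ereal_scope.

(** Simple functions, then monotone convergence. It is used with [param i] as [Phi], once for the
    Riemannian measure and once for the weighted one. *)
Lemma density_integral (g : Y -> \bar R) : measurable_fun D' g -> (forall y, 0 <= g y) ->
  \int[nu]_(y in D') g y = \int[lam]_(x in D) (g (Phi x) * (h x)%:E).
Proof.
move=> mg g0.
have mhE : measurable_fun D (EFin \o h) by exact/measurable_EFinP.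
have step (f : {nnsfun Y >-> R}) :
    \int[nu]_(y in D') (f y)%:E = \int[lam]_(x in D) ((f (Phi x))%:E * (h x)%:E).
  under eq_integral do rewrite fimfunE -fsumEFin//.
  rewrite ge0_integral_fsum//; last 2 first.
  - by move=> r; apply/measurable_EFinP/measurableT_comp.
  - by move=> r y _; rewrite nnfun_muleindic_ge0.
  transitivity (\sum_(r \in range f) (\int[lam]_(x in D) (r%:E * (\1_(f @^-1` [set r])
    (Phi x))%:E * (h x)%:E))).
    apply: eq_fsbigr => r _.
    have mfr : measurable (f @^-1` [set r]) by exact: measurable_sfunP.
    have [r0|r0] := leP 0%R r; last first.
      have z : f @^-1` [set r] = set0.
        apply/seteqP; split => // y /= fy.
        by move: r0; rewrite -fy ltNge => /negP; apply; exact: fun_ge0.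
      rewrite z; under eq_integral do rewrite indic0 mulr0.
      rewrite integral0; apply/esym.
      by under eq_integral do rewrite indic0 mule0 mul0e; rewrite integral0.
    under eq_integral do rewrite EFinM.
    rewrite ge0_integralZl//; last by apply/measurable_EFinP.
    rewrite integral_indic// nuE//.
    under [RHS]eq_integral do rewrite -muleA.
    rewrite ge0_integralZl//; last 2 first.
    - apply: emeasurable_funM => //; apply/measurable_EFinP.
      exact: measurableT_comp.
    - by move=> x Dx; rewrite mule_ge0// lee_fin; exact: h_ge0.
    congr (_ * _); rewrite integral_mkcondr; apply: eq_integral => x _.
    rewrite /patch indicE/= (_ : (x \in _) = (Phi x \in f @^-1` [set r]))//.
    by case: ifPn => _; rewrite ?mul1e ?mul0e.
  rewrite -ge0_integral_fsum//; last 2 first.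
  - move=> r; apply: emeasurable_funM => //; apply: emeasurable_funM => //.
    by apply/measurable_EFinP; apply: measurableT_comp.
  - move=> r x Dx; rewrite mule_ge0//; last by rewrite lee_fin h_ge0.
    by rewrite -EFinM nnfun_muleindic_ge0.
  apply: eq_integral => x xD; rewrite fimfunE -fsumEFin// ge0_mule_fsuml//.
  by move=> r; rewrite nnfun_muleindic_ge0.
pose f_ := nnsfun_approx mD' mg.
have fcvg y : D' y -> (f_ n y)%:E @[n --> \oo] --> g y.
  by move=> D'y; apply: cvg_nnsfun_approx => //.
have fnd y : {homo (fun n => (f_ n y)%:E) : m n / (m <= n)%N >-> m <= n}.
  by move=> m n mn; rewrite lee_fin; apply/lefP; exact: nd_nnsfun_approx.
transitivity (limn (fun n => \int[nu]_(y in D') (f_ n y)%:E)).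
  rewrite -monotone_convergence//.
  - by apply: eq_integral => y; rewrite inE => D'y; apply/esym/cvg_lim => //; exact: fcvg.
  - by move=> n; apply/measurable_EFinP; exact: measurable_funTS.
  - by move=> n y _; rewrite lee_fin.
transitivity (limn (fun n => \int[lam]_(x in D) ((f_ n (Phi x))%:E * (h x)%:E))).
  by congr (limn _); apply/funext => n; exact: step.
rewrite -monotone_convergence//.
- apply: eq_integral => x; rewrite inE => Dx; apply/cvg_lim => //.
  by apply: cvgeZr => //; apply: fcvg; exact: DPhi.
- move=> n; apply: emeasurable_funM => //; apply/measurable_EFinP.
  exact: measurableT_comp.
- by move=> n x Dx; rewrite mule_ge0// lee_fin// h_ge0.
- move=> x Dx m n mn; apply: lee_wpmul2r; first by rewrite lee_fin h_ge0.
  exact: fnd.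
Qed.

End Density.

(** * The weighted measure in charts and on compact sets *)

Section WeightedMeasure.
Context {R : realType} {n : nat} (M : weightedManifold R n).
Local Notation E := 'rV[R]_n.
Local Notation mu := (mu M).
Implicit Types (i j : chart_index M) (p q : M).

Lemma metric_det_gt0 i p : dom i p -> 0 < \det (metric i p).
Proof. by move=> ip; apply: posdef_det_gt0 => v v0; exact: metric_pos. Qed.

Lemma weighted_density_gt0 i p : dom i p -> 0 < weighted_density i p.
Proof.
by move=> ip; rewrite mulr_gt0 ?weight_gt0// sqrtr_gt0; exact: metric_det_gt0.
Qed.

Lemma Cn_metric m i a b : Cn m (codom i) (fun x => metric i (param i x) a b).
Proof. by move: m; apply/smooth_onP; exact: metric_smooth. Qed.

Lemma Cn_weighted_density m i : Cn m (codom i) (fun x => weighted_density i (param i x)).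
Proof.
have oc := @open_codom _ _ M i.
apply: Cn_mul => //.
  by move/smoothP : (@weight_smooth _ _ M) => /(_ i m).
apply: Cn_sqrt => //; first by move=> x /dom_param; exact: metric_det_gt0.
by apply: Cn_det => // a b; exact: Cn_metric.
Qed.

Lemma smooth_measurable (f : M -> R) : smooth f ->
  measurable_fun [set: borel M] (f : borel M -> R).
Proof. by move=> fs; exact: (continuous_measurableT (smooth_continuous fs)). Qed.

Lemma measurable_dom i : measurable (dom i : set (borel M)).
Proof. by apply: open_measurable_borel; exact: dom_open. Qed.

Lemma measurable_codom i : measurable (codom i : set (borel E)).
Proof. by apply: open_measurable_borel; exact: open_codom. Qed.

Lemma measurable_param i :
  measurable_fun (codom i : set (borel E)) (param i : borel E -> borel M).
Proof.
move=> mU; apply: (measurability _ (erefl : @measurable _ (borel M) = <<s @open M >>)) => //.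
by move=> _ [A Ao <-]; apply: open_measurable_borel; exact: open_dom_param.
Qed.

Lemma measurable_Cn i (F : E -> R) : Cn 0 (codom i) F ->
  measurable_fun (codom i : set (borel E)) (F : borel E -> R).
Proof.
move=> FC; apply: continuous_measurable_borel; first exact: open_codom.
by move=> x; exact: Cn_continuous FC.
Qed.

Lemma image_coord i (A : set M) : coord i @` (A `&` dom i) = codom i `&` param i @^-1` A.
Proof.
apply/seteqP; split => x /=.
  by move=> [p [Ap ip] <-]; split; [exists p|rewrite coordK].
by move=> [xc Ax]; exists (param i x); [split => //; exact: dom_param|exact: paramK].
Qed.

(** The definitions give the two measures of sets only: [vol] by a density over a chart, [mu] by a
    density over [vol]. The formula for nonnegative functions is applied to [vol] to identify [mu],
    then to [mu], and signed functions follow by splitting. *)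
Lemma chart_integral : exists2 lam : {measure set (borel E) -> \bar R}, is_lebesgue lam &
  forall i (g : M -> \bar R), measurable_fun (dom i : set (borel M)) (g : borel M -> \bar R) ->
  (\int[mu]_(p in dom i) g p =
   \int[lam]_(x in codom i) (g (param i x) * (weighted_density i (param i x))%:E))%E.
Proof.
have [lam lamP volE] := volP M; exists lam => // i.
have mvd : measurable_fun (codom i : set (borel E))
    ((fun x => volume_density i (param i x)) : borel E -> R).
  apply: measurable_Cn; have oc := @open_codom _ _ M i.
  apply: Cn_sqrt => //; first by move=> x /dom_param; exact: metric_det_gt0.
  by apply: Cn_det => // a b; exact: Cn_metric.
have mwd : measurable_fun (codom i : set (borel E))
    ((fun x => weighted_density i (param i x)) : borel E -> R).
  by apply: measurable_Cn; exact: Cn_weighted_density.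
have mw : measurable_fun [set: borel M] (@weight _ _ M : borel M -> R).
  by apply: continuous_measurableT; apply: smooth_continuous; exact: weight_smooth.
have muA A : measurable A -> (mu (A `&` (dom i : set (borel M))) =
    \int[lam]_(x in (codom i : set (borel E)) `&` (param i : borel E -> borel M) @^-1` A)
      (weighted_density i (param i x))%:E)%E.
  move=> mA; rewrite muE; last exact: measurableI mA (measurable_dom i).
  rewrite setIC integral_mkcondr.
  rewrite (@density_integral _ _ _ _ _ lam (vol M) (codom i) (dom i) (param i : borel E -> borel M)
    (fun x => volume_density i (param i x))) => //.
  - rewrite [RHS]integral_mkcondr; apply: eq_integral => x _.
    rewrite /patch (_ : (x \in _) = (param i x \in A))//.
    by case: ifPn => _; rewrite ?mul0e// -EFinM.
  - exact: measurable_codom.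
  - exact: measurable_dom.
  - exact: measurable_param.
  - by move=> x; exact: dom_param.
  - by move=> x _; exact: sqrtr_ge0.
  - move=> B mB; rewrite (volE i)//; last exact: measurableI mB (measurable_dom i).
    by rewrite image_coord.
  - apply/measurable_restrict => //; first exact: measurable_dom.
    by apply/measurable_EFinP; exact: measurable_funTS.
  - by move=> p; rewrite /patch; case: ifP => // _; rewrite lee_fin ltW// weight_gt0.
have pos (g : M -> \bar R) : measurable_fun (dom i : set (borel M)) (g : borel M -> \bar R) ->
    (forall p, (0 <= g p)%E) ->
    (\int[mu]_(p in dom i) g p =
     \int[lam]_(x in codom i) (g (param i x) * (weighted_density i (param i x))%:E))%E.
  move=> mg g0.
  apply: (@density_integral _ _ _ _ _ lam mu (codom i) (dom i) (param i : borel E -> borel M)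
    (fun x => weighted_density i (param i x))) => //.
  - exact: measurable_codom.
  - exact: measurable_dom.
  - exact: measurable_param.
  - by move=> x; exact: dom_param.
  - by move=> x /dom_param xi; rewrite ltW// weighted_density_gt0.
move=> g mg; rewrite integralE [RHS]integralE; congr (_ - _)%E.
- rewrite pos//; last exact: measurable_funepos.
  apply: eq_integral => x; rewrite inE => /dom_param/weighted_density_gt0/ltW h.
  by rewrite !funeposE maxe_pMl// mul0e.
- rewrite pos//; last exact: measurable_funeneg.
  apply: eq_integral => x; rewrite inE => /dom_param/weighted_density_gt0/ltW h.
  by rewrite !funenegE -mulNe maxe_pMl// mul0e.
Qed.

Lemma mu_chart_box_fin i a b : cbox a b `<=` codom i -> (mu (param i @` cbox a b) < +oo)%E.
Proof.
move=> abc; have [lam lamP H] := chart_integral.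
set K : set (borel M) := param i @` cbox a b.
have mK : measurable K.
  apply: closed_measurable_borel; apply: compact_closed_M; apply: param_compact => //.
  exact: compact_cbox.
have Ki : K `<=` dom i by move=> _ [x /abc/dom_param xi <-].
have : bounded_set ((fun x => weighted_density i (param i x)) @` cbox a b).
  apply: compact_bounded; apply: continuous_compact; last exact: compact_cbox.
  apply: continuous_in_subspaceT => x; rewrite inE => /abc xc.
  exact: Cn_continuous (Cn_weighted_density 0 i) xc.
move=> [C0 [_ /(_ (C0 + 1))]]; rewrite ltrDl ltr01 => /(_ isT) C0P.
have -> : (mu K = \int[mu]_(p in dom i) (\1_K p)%:E)%E.
  by rewrite integral_indic// ?(setIidl Ki)//; exact: measurable_dom.
rewrite H; last by apply/measurable_EFinP; apply: measurable_funTS; exact: measurable_indic.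
apply: (@le_lt_trans _ _ (\int[lam]_(x in codom i) (`|C0 + 1| * \1_(cbox a b) x)%:E)%E).
  apply: ge0_le_integral => //.
  - exact: measurable_codom.
  - move=> x /dom_param/weighted_density_gt0/ltW h.
    by rewrite -EFinM lee_fin mulr_ge0.
  - apply: emeasurable_funM; apply/measurable_EFinP.
      apply: (measurable_comp (measurable_dom i)) => [_ [x xc <-]||]; first exact: dom_param.
        by apply: measurable_funTS; exact: measurable_indic.
      exact: measurable_param.
    by apply: measurable_Cn; exact: Cn_weighted_density.
  - apply/measurable_EFinP; apply: measurable_funM => //; apply: measurable_funTS.
    by apply: measurable_indic; exact: measurable_cbox.
  - move=> x xc; rewrite -EFinM lee_fin !indicE.
    case: (pselect (cbox a b x)) => xab.
      rewrite (mem_set xab) mulr1 (le_trans (ler_norm _))// normrM.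
      rewrite (@le_trans _ _ `|weighted_density i (param i x)|)//.
        by rewrite ler_piMl//; case: (_ \in _); rewrite /= ?normr0 ?normr1.
      rewrite (le_trans _ (ler_norm _))//; apply: C0P; exists x => //.
    rewrite memNset ?mul0r ?mulr_ge0// => -[y yab E1].
    by apply: xab; rewrite -(paramK xc) -E1 paramK//; exact: abc.
have [_] := integrableP _ _ _ (@integrable_scaled_indic _ _ _ lam _ `|C0 + 1| (measurable_cbox a b)
  (lam_cbox_fin lamP a b)).
apply: le_lt_trans; rewrite [leRHS](_ : _ = \int[lam]_(x in setT) (`|C0 + 1| * \1_(cbox a b)
  x)%:E)%E; last first.
  by apply: eq_integral => x _; rewrite /= normrM normr_id ger0_norm// indicE.
apply: ge0_subset_integral => //; first exact: measurable_codom.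
- apply/measurable_EFinP; apply: measurable_funM => //.
  by apply: measurable_indic; exact: measurable_cbox.
Qed.

Lemma mu_compact_fin (K : set M) : compact K -> (mu K < +oo)%E.
Proof.
move=> cK.
have /choice[B BP] : forall p, exists B : set (borel M),
    [/\ measurable B, (mu B < +oo)%E & nbhs p (B : set M)].
  move=> p; have ip := dom_chart_at p.
  have [a [b [abc _ pab]]] := compact_nbhs_chart ip (@filterT _ (nbhs p) _).
  exists (param (chart_at p) @` cbox a b); split.
  - apply: closed_measurable_borel; apply: compact_closed_M; apply: param_compact => //.
    exact: compact_cbox.
  - exact: mu_chart_box_fin.
  have oU := open_obox a b.
  have H : nbhs p (dom (chart_at p) `&` coord (chart_at p)
    @^-1` [set y : E | forall k, a 0 k < y 0 k < b 0 k]).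
    by apply: open_nbhs_nbhs; split => //; apply: open_coord_dom.
  apply: filterS H => q [iq qab]; exists (coord (chart_at p) q); last by rewrite coordK.
  by move=> k; have /andP[/ltW -> /ltW ->] := qab k.
have := cK; rewrite compact_cover => /(_ _ setT (fun p => interior (B p : set M))
  (fun p _ => open_interior _)) [].
  by move=> p _; exists p => //; have [] := BP p.
move=> D' _ KD.
have mK : measurable (K : set (borel M)).
  by apply: closed_measurable_borel; exact: compact_closed_M.
have mU (s : seq M) : measurable (\big[setU/set0]_(p <- s) B p).
  by apply: bigsetU_measurable => p _; have [] := BP p.
apply: (@le_lt_trans _ _ (mu (\big[setU/set0]_(p <- finmap.enum_fset D') B p))).
  apply: le_measure; rewrite ?inE//.
  by move=> q /KD[p pD pq]; rewrite -bigcup_seq; exists p => //; exact: interior_subset pq.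
elim: (finmap.enum_fset D') => [|p s IH]; first by rewrite big_nil measure0.
rewrite big_cons; have [mB Bf _] := BP p.
by apply: (le_lt_trans (measureU2 _ _ _)) => //; exact: lte_add_pinfty.
Qed.

Lemma compact_support_integrable (f : M -> R) (K : set M) (C : R) : compact K ->
  measurable_fun [set: borel M] (f : borel M -> R) ->
  (forall p, ~ K p -> f p = 0) -> (forall p, `|f p| <= C) ->
  mu.-integrable setT (EFin \o (f : borel M -> R)).
Proof.
move=> cK mf f0 fC.
have mK : measurable (K : set (borel M)).
  by apply: closed_measurable_borel; exact: compact_closed_M.
apply: (@le_integrable _ _ _ mu _ measurableT _ (EFin \o (fun p => C * \1_(K : set (borel M)) p))).
- exact/measurable_EFinP.
- move=> p _; rewrite /= lee_fin indicE.
  case: (pselect (K p)) => Kp; first by rewrite mem_set// mulr1 (le_trans (fC p))// ler_norm.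
  by rewrite f0// normr0.
- by apply: integrable_scaled_indic => //; exact: mu_compact_fin.
Qed.

Lemma compact_support_bounded (f : M -> R) (K : set M) : compact K -> continuous f ->
  (forall p, ~ K p -> f p = 0) -> exists C : R, forall p, `|f p| <= C.
Proof.
move=> cK fc f0.
have : bounded_set (f @` K).
  by apply: compact_bounded; apply: continuous_compact => //; exact: continuous_subspaceT.
move=> [C0 [_ /(_ (`|C0| + 1))]]; rewrite (le_lt_trans (ler_norm _)) ?ltrDl// => /(_ isT) C0P.
exists (`|C0| + 1) => p; case: (pselect (K p)) => Kp; first by apply: C0P; exists p.
by rewrite f0// normr0 addr_ge0.
Qed.

Lemma continuous_compact_integrable (f : M -> R) (K : set M) : compact K -> continuous f ->
  (forall p, ~ K p -> f p = 0) -> mu.-integrable setT (EFin \o (f : borel M -> R)).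
Proof.
move=> cK fc f0; have [C fC] := compact_support_bounded cK fc f0.
by apply: (compact_support_integrable cK) => //; exact: continuous_measurableT.
Qed.

Lemma countable_charts : exists c : nat -> chart_index M, forall p, exists k, dom (c k) p.
Proof.
have [B Bo Bb] := countable_basis_seq M.
have /choice[c cP] : forall k, exists i, (exists j, B k `<=` dom j) -> B k `<=` dom i.
  move=> k; have [[j kj]|nj] := pselect (exists j, B k `<=` dom j); first by exists j.
  by exists (chart_at (point : M)).
exists c => p; have pd : nbhs p (dom (chart_at p)).
  by apply: open_nbhs_nbhs; split; [exact: dom_open|exact: dom_chart_at].
have [k [Bp Bd]] := Bb p _ pd.
by exists k; apply: cP => //; exists (chart_at p).
Qed.

Lemma measurable_charts d (Y : measurableType d) (f : M -> Y) :
  (forall i, measurable_fun (dom i : set (borel M)) (f : borel M -> Y)) ->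
  measurable_fun [set: borel M] (f : borel M -> Y).
Proof.
move=> mf; have [c cP] := countable_charts.
have -> : [set: borel M] = \bigcup_k dom (c k).
  by apply/seteqP; split => // p _; have [k kp] := cP p; exists k.
by apply/measurable_fun_bigcup => // k; exact: measurable_dom.
Qed.

(** Each basic set on which some admissible bump is nonzero receives one by [xget]; the default is
    the zero function, which adds nothing to the union. *)
Lemma open_bumps (U : set M) : open U -> exists F : nat -> M -> R,
  (forall k, smooth (F k) /\ forall p, 0 <= F k p) /\
  U = \bigcup_k [set p | F k p != 0].
Proof.
move=> Uo; have [B Bo Bb] := countable_basis_seq M.
pose good k (f : M -> R) := [/\ smooth f, forall p, 0 <= f p & [set p | f p != 0] `<=` U] /\
  B k `<=` [set p | f p != 0].
pose F k := xget (cst 0) [set f | good k f].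
have FP k : [/\ smooth (F k), forall p, 0 <= F k p & [set p | F k p != 0] `<=` U].
  rewrite /F; case: xgetP => [f _ []//|_]; split => //; first exact: smooth_cst.
  by move=> p /=; rewrite eqxx.
exists F; split; first by move=> k; have [] := FP k.
apply/seteqP; split => p; last by move=> [k _]; have [_ _] := FP k; apply.
move=> Up; have ip := dom_chart_at p.
have pU : nbhs p U by exact: open_nbhs_nbhs.
have [a [b [abc abU pab]]] := compact_nbhs_chart ip pU.
pose f := chart_bump (chart_at p) a b.
have fo : open [set q | f q != 0].
  have -> : [set q | f q != 0] = f @^-1` (~` [set 0]) by apply/seteqP; split => q /=;
    [move/eqP|move=> H; apply/eqP].
  apply: open_comp; last by apply: closed_openC; exact: closed_eq.
  by move=> q _; apply: smooth_continuous; exact: chart_bump_smooth.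
have fp : nbhs p [set q | f q != 0].
  by apply: open_nbhs_nbhs; split => //=; rewrite /f chart_bump_dom// gt_eqF// box_bump_gt0.
have [k [Bp Bf]] := Bb p _ fp.
exists k => //=; have gf : good k f.
  split => //; split; [exact: chart_bump_smooth|by move=> q; exact: chart_bump_ge0|].
  by move=> q /chart_bump_param/abU.
suff [_] : good k (F k) by apply.
by rewrite /F; case: xgetP => [//|/(_ f)].
Qed.

(** Nonvanishing sets of nonnegative smooth functions are stable under intersection and generate the
    Borel sets. On each of them F has integral 0, so the same holds on all Borel sets by a Dynkin
    argument. *)
Lemma smooth_ae0 (F : M -> R) : mu.-integrable setT (EFin \o (F : borel M -> R)) ->
  (forall psi, smooth psi -> (forall p, 0 <= psi p <= 1) ->
    (\int[mu]_(p in setT) (F p * psi p)%:E = 0)%E) ->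
  {ae mu, forall p, F p = 0}.
Proof.
move=> Fi F0.
pose G : set (set (borel M)) := [set A | exists2 f : M -> R,
  (smooth f /\ forall p, 0 <= f p) & A = [set p | f p != 0]].
have GI : setI_closed G.
  move=> _ _ [f [fs f0] ->] [g [gs g0] ->]; exists (fun p => f p * g p).
    by split; [exact: smoothM|move=> p; rewrite mulr_ge0].
  by apply/seteqP; split => p /=; rewrite mulf_eq0 negb_or => /andP.
have Gm A : G A -> measurable A.
  move=> [f [fs f0] ->].
  apply: open_measurable_borel.
  have -> : [set q | f q != 0] = f @^-1` (~` [set 0]) by apply/seteqP; split => q /=;
    [move/eqP|move=> H; apply/eqP].
  apply: open_comp; last by apply: closed_openC; exact: closed_eq.
  by move=> q _; exact: smooth_continuous.
have borelG : @measurable _ (borel M) = <<s G >>.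
  apply/seteqP; split; apply: smallest_sub; try exact: smallest_sigma_algebra.
  - move=> A /open_bumps[f [fP ->]].
    apply: sigma_algebra_bigcup => k.
    by apply: sub_sigma_algebra; exists (f k).
  - exact: Gm.
have IG A : G A -> (\int[mu]_(p in A) (F p)%:E = 0)%E.
  move=> GA; have mA := Gm A GA; move: GA => [f [fs f0] E0].
  (* Smooth, with values in [0, 1], and convergent to the indicator of the set where f is
     nonzero. *)
  pose h m p := m%:R * f p / (1 + m%:R * f p).
  have den m p : 0 < 1 + m%:R * f p by rewrite ltr_pwDl// mulr_ge0.
  have h01 m p : 0 <= h m p <= 1.
    rewrite /h divr_ge0 ?mulr_ge0 ?(ltW (den _ _))//=.
    by rewrite ler_pdivrMr// mul1r lerDr.
  have hs m : smooth (h m).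
    apply: smoothM; first exact: smoothZ.
    apply: smoothV => [|p]; last by rewrite gt_eqF.
    by apply: smoothD; [exact: smooth_cst|exact: smoothZ].
  have hcvg p : h m p @[m --> \oo] --> (\1_A p : R).
    rewrite indicE; case: (pselect (A p)) => Ap; last first.
      rewrite memNset//; have fp : f p = 0.
        by apply: contrapT => /eqP fp; apply: Ap; rewrite E0.
      by under eq_fun do rewrite /h fp mulr0 mul0r; exact: cvg_cst.
    rewrite mem_set//; have fp : 0 < f p.
      by rewrite lt_neqAle f0 andbT eq_sym; move: Ap; rewrite E0.
    have -> : (fun m => h m p) = (fun m => 1 - (1 + m%:R * f p)^-1).
      apply/funext => m; rewrite /h; have := den m p => /lt0r_neq0 d0.
      by field.
    rewrite -[X in _ --> X]subr0; apply: cvgB; first exact: cvg_cst.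
    apply/gtr0_cvgV0; first by near=> m; exact: den.
    apply/cvgryPge => B; near=> m.
    have Bm : B / f p <= m%:R by near: m; exact: nbhs_infty_ger.
    by move: Bm; rewrite ler_pdivrMr// => /le_trans; apply; rewrite lerDr.
  have mh m : measurable_fun [set: borel M] (h m : borel M -> R).
    exact: smooth_measurable (hs m).
  have mF := measurable_int _ Fi.
  have z : (fun m => \int[mu]_(p in setT) (F p * h m p)%:E)%E = (fun=> 0%E).
    by apply/funext => m; exact: (F0 _ (hs m) (h01 m)).
  have H : (fun=> 0%E) @ \oo --> (\int[mu]_(p in setT) (F p * \1_A p)%:E)%E.
    rewrite -z; apply: (@dominated_cvg _ (borel M) R mu setT measurableT
      (fun m p => (F p * h m p)%:E) _ (fun p => `|F p|%:E)).
    - by move=> m; apply/measurable_EFinP; apply: measurable_funM => //; exact/measurable_EFinP.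
    - by move=> p _; apply/cvg_EFin; [exact: nearW|apply: cvgM; [exact: cvg_cst|exact: hcvg]].
    - by [].
    - exact: (integrable_abse Fi).
    - move=> m p _; rewrite lee_fin normrM ler_piMr// ger0_norm; by case/andP: (h01 m p).
  have E1 := cvg_unique _ (cvg_cst _) H.
  rewrite (integral_mkcond A) E1 //; apply: eq_integral => p _.
  by rewrite /patch indicE; case: ifP; rewrite ?mulr1 ?mulr0.
have dyn : dynkin [set A : set (borel M) | measurable A /\ (\int[mu]_(p in A) (F p)%:E = 0)%E].
  have IT : (\int[mu]_(p in setT) (F p)%:E = 0)%E.
    have := F0 (cst 1) (@smooth_cst _ _ M 1); under eq_integral do rewrite mulr1.
    by apply=> p; rewrite ler01 lexx.
  have mF := measurable_int _ Fi.
  split => //.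
  - move=> A [mA A0]; split; first exact: measurableC.
    have := @integral_setU _ _ _ mu A (~` A) _ mA (measurableC mA) _ _.
    move=> /(_ (fun p => (F p)%:E)); rewrite setUv IT A0 add0e => <- //.
    by apply/disj_setPS; rewrite setICr.
  - move=> B tB BP; split; first by apply: bigcupT_measurable => k; case: (BP k).
    rewrite integral_bigcup//.
    + by apply: eseries0 => k _ _; case: (BP k).
    + by move=> k; case: (BP k).
    + by apply: integrableS Fi => //; apply: bigcupT_measurable => k; case: (BP k).
have H0 A : measurable A -> (\int[mu]_(p in A) (F p)%:E = 0)%E.
  rewrite borelG -setI_closed_g_dynkin_g_sigma_algebra// => GA.
  suff [] : [set A : set (borel M) | measurable A /\ (\int[mu]_(p in A) (F p)%:E = 0)%E] A by [].
  by apply: GA; split => // B GB; split; [exact: Gm|exact: IG].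
have := @integral_ae_eq _ _ _ mu setT measurableT (cst 0%E) (EFin \o (F : borel M -> R)) Fi.
move=> /(_ _ _); case.
- exact: measurable_cst.
- by move=> A _ mA; rewrite integral0; exact: H0.
move=> N [mN N0 HN]; exists N; split => // p /= Fp; apply: HN => /= H; apply: Fp.
by have [] := H I.
Unshelve. all: by end_near. Qed.

End WeightedMeasure.

(** * Gradients *)

Lemma Rintegral_big_sum d (T : measurableType d) (R : realType) (mu : {measure set T -> \bar R})
    (D : set T) (I : Type) (s : seq I) (f : I -> T -> R) : measurable D ->
  (forall i, mu.-integrable D (EFin \o f i)) ->
  mu.-integrable D (EFin \o (fun x => \sum_(i <- s) f i x)) /\
  \int[mu]_(x in D) (\sum_(i <- s) f i x) = \sum_(i <- s) \int[mu]_(x in D) f i x.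
Proof.
move=> mD fi; elim: s => [|i s [IH1 IH2]].
  rewrite big_nil; under [X in EFin \o X]eq_fun do rewrite big_nil.
  under eq_Rintegral do rewrite big_nil.
  split; first exact: integrable0.
  by rewrite /Rintegral integral0.
rewrite big_cons -IH2 -RintegralD//.
under [X in EFin \o X]eq_fun do rewrite big_cons.
under eq_Rintegral do rewrite big_cons.
by split => //; exact: (integrableD mD (fi i) IH1).
Qed.

(** * Classical gradients of smooth functions *)

Section TestGradient.
Context {R : realType} {n : nat} (M : weightedManifold R n).
Local Notation E := 'rV[R]_n.
Local Notation mu := (mu M).
Implicit Types (i j : chart_index M) (p q : M) (phi : M -> R).

Lemma chart_partial_change i j p phi a : smooth phi -> dom i p -> dom j p ->
  chart_partial i a phi p = \sum_b chart_change i j p a b * chart_partial j b phi p.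
Proof.
move=> /smoothP phis ip jp; rewrite /chart_partial /partial.
set x := coord i p; pose v : E := delta_mx 0 a.
have oU := @open_dom_param _ _ M i _ (dom_open j).
have Ux : (codom i `&` param i @^-1` dom j) x.
  by split; [exact: codom_coord|rewrite /= /x coordK].
have cx : coord j (param i x) = coord j p by rewrite /x coordK.
pose c (t : R) : E := coord j (param i (t *: v + x)).
have c0 : c 0 = coord j p by rewrite /c scale0r add0r.
have lc : {for 0, continuous (fun t : R => t *: v + x)}.
  apply: (@continuousD _ _ _ (fun t : R => t *: v) (cst x)); last exact: cst_continuous.
  exact: scalel_continuous.
have Un : \forall t \near (0 : R), (codom i `&` param i @^-1` dom j) (t *: v + x).
  apply: lc; apply: open_nbhs_nbhs; split => //.
  by rewrite /= scale0r add0r.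
have sU : codom i `&` param i @^-1` dom j `<=` coord i @` (dom i `&` dom j).
  move=> y [yi yj]; exists (param i y); last exact: paramK.
  by split => //; exact: dom_param.
have cd k : is_derive (0 : R) 1 (fun t => c t 0 k) (chart_change i j p a k).
  rewrite mxE /chart_partial /partial -/x derive_line; apply: DeriveDef => //.
  have /(_ 0%N) Tk : forall m, Cn m.+1 (codom i `&` param i @^-1` dom j)
    (fun y => coord j (param i y) 0 k).
    by move=> m; exact: Cn_sub_set sU (proj1 (smooth_onP _ _) (@transition_smooth _ _ M i j k) m.+1).
  have d := Cn_derivable (k := a) Tk Ux.
  have := @is_derive_line _ _ (fun y => coord j (param i y) 0 k) x v 0.
  by rewrite scale0r add0r => /(_ d)[].
have D := @is_derive_C1_curve _ _ _ (phi \o param j) c (fun k => chart_change i j p a k)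
  (@open_codom _ _ M j) (phis j 1%N).
rewrite c0 in D; have {}D := D (codom_coord jp) cd.
rewrite derive_line -/v.
have eqn : \forall t \near (0 : R), ((phi \o param j) \o c) t = (phi \o param i) (t *: v + x).
  near=> t; rewrite /= /c coordK//.
  by have [] : (codom i `&` param i @^-1` dom j) (t *: v + x) by near: t; exact: Un.
by have [_ <-] := near_eq_is_derive eqn D.
Unshelve. all: by end_near. Qed.

(** The differential in the chart i, raised by the inverse metric; vectors are rows, so the matrix
    acts on the right. *)
Definition test_grad phi i p : E := (\row_k chart_partial i k phi p) *m invmx (metric i p).

Lemma metric_unit i p : dom i p -> metric i p \in unitmx.
Proof. by move=> ip; rewrite unitmxE unitfE gt_eqF// metric_det_gt0. Qed.

Lemma test_grad_metric phi i p : dom i p ->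
  test_grad phi i p *m metric i p = \row_k chart_partial i k phi p.
Proof. by move=> ip; rewrite mulmxKV// metric_unit. Qed.

(** By [metric_change] it is a factor of the invertible matrix [metric i p]. *)
Lemma chart_change_unit i j p : dom i p -> dom j p -> chart_change i j p \in unitmx.
Proof.
move=> ip jp; have := metric_unit ip; rewrite (metric_change ip jp).
by rewrite !unitmx_mul => /andP[/andP[]].
Qed.

(** Both candidates become the differential in the chart i after multiplication by the metric of j
    and the transposed chart change, and these matrices cancel. *)
Lemma test_grad_vector_field phi : smooth phi -> is_vector_field (test_grad phi).
Proof.
move=> phis i j p ip jp.
have C := chart_change_unit ip jp.
have H : test_grad phi j p *m metric j p *m (chart_change i j p)^T =
         test_grad phi i p *m chart_change i j p *m metric j p *m (chart_change i j p)^T.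
  rewrite -2!(mulmxA (test_grad phi i p)) -(metric_change ip jp).
  rewrite (test_grad_metric phi ip) (test_grad_metric phi jp).
  apply/rowP => a; rewrite !mxE (chart_partial_change a phis ip jp).
  by apply: eq_bigr => b _; rewrite !mxE mulrC.
have CT : (chart_change i j p)^T \in unitmx by rewrite unitmx_tr.
have := congr1 (fun A => A *m invmx (chart_change i j p)^T *m invmx (metric j p)) H.
by rewrite /= !(mulmxK CT) !(mulmxK (metric_unit jp)).
Qed.

Lemma inner_chart (X Y : chart_index M -> M -> E) i p : is_vector_field X -> is_vector_field Y ->
  dom i p -> inner X Y p = (X i p *m metric i p *m (Y i p)^T) 0 0.
Proof.
move=> VX VY ip; rewrite /inner; have jp := dom_chart_at p.
rewrite (VX _ _ _ ip jp) (VY _ _ _ ip jp) (metric_change ip jp).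
by rewrite trmx_mul !mulmxA.
Qed.

Lemma inner_sym (X Y : chart_index M -> M -> E) p : inner X Y p = inner Y X p.
Proof.
rewrite /inner; set A := metric _ _; set x := X _ _; set y := Y _ _.
have H : (x *m A *m y^T)^T = y *m A *m x^T.
  by rewrite !trmx_mul trmxK Defs.metric_sym ?mulmxA//; exact: dom_chart_at.
by have := congr1 (fun B : 'M[R]_1 => B 0 0) H; rewrite /= mxE.
Qed.

Lemma inner_lin (a : R) (X Y Z W : chart_index M -> M -> E) p :
  Z (chart_at p) p = a *: X (chart_at p) p + Y (chart_at p) p ->
  inner Z W p = a * inner X W p + inner Y W p.
Proof. by move=> ZE; rewrite /inner ZE !mulmxDl -!scalemxAl !mxE. Qed.

Lemma inner_ge0 (X : chart_index M -> M -> E) p : 0 <= inner X X p.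
Proof.
rewrite /inner; have [->|v0] := eqVneq (X (chart_at p) p) 0; first by rewrite !mul0mx mxE.
by rewrite ltW// metric_pos//; exact: dom_chart_at.
Qed.

Lemma continuous_coord_comp i (F : E -> R) p : Cn 0 (codom i) F -> dom i p ->
  {for p, continuous (F \o coord i)}.
Proof.
move=> FC ip; apply: continuous_comp; first exact: Defs.coord_continuous.
by apply: (Cn_continuous FC); exact: codom_coord.
Qed.

Lemma measurable_coord_comp i (F : E -> R) : Cn 0 (codom i) F ->
  measurable_fun (dom i : set (borel M)) ((fun p => F (coord i p)) : borel M -> R).
Proof.
move=> FC; apply: (@continuous_measurable_borel _ _ (dom i) (F \o coord i)); first exact: dom_open.
by move=> p; exact: continuous_coord_comp.
Qed.

Lemma Cn_partial_param m i k phi : smooth phi -> Cn m (codom i) (partial k (phi \o param i)).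
Proof. by move=> /smoothP phis; exact: Cn_partial (phis i m.+1). Qed.

Lemma measurable_chart_partial i k phi : smooth phi ->
  measurable_fun (dom i : set (borel M)) (chart_partial i k phi : borel M -> R).
Proof. by move=> phis; apply: measurable_coord_comp; exact: Cn_partial_param. Qed.

Lemma Cn_test_grad m i k phi : smooth phi ->
  Cn m (codom i) (fun x => test_grad phi i (param i x) 0 k).
Proof.
move=> phis; have oc := @open_codom _ _ M i.
apply: (@Cn_eq _ _ _ _ (fun x => \sum_a partial a (phi \o param i) x * invmx (metric i (param i x))
  a k)) => //.
  by move=> x xc; rewrite mxE; apply: eq_bigr => a _; rewrite mxE /chart_partial paramK.
apply: Cn_sum => // a; apply: Cn_mul => //; first exact: Cn_partial_param.
apply: Cn_invmx => // [b c|x /dom_param xi]; first exact: Cn_metric.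
by rewrite gt_eqF// metric_det_gt0.
Qed.

Lemma measurable_test_grad i k phi : smooth phi ->
  measurable_fun (dom i : set (borel M)) ((fun p => test_grad phi i p 0 k) : borel M -> R).
Proof.
move=> phis; have := measurable_coord_comp (@Cn_test_grad 0 i k phi phis).
by apply: eq_measurable_fun => p; rewrite inE => ip; rewrite coordK.
Qed.

Lemma chart_partial_supp phi i k p : dom i p -> ~ supp phi p -> chart_partial i k phi p = 0.
Proof.
move=> ip np; rewrite /chart_partial /partial.
have oU := @open_dom_param _ _ M i _ (closed_openC (@closed_closure _ [set q | phi q != 0])).
have -> : 'D_(delta_mx 0 k) (phi \o param i) (coord i p) = 'D_(delta_mx 0 k) (cst 0) (coord i p).
  apply: near_eq_derive.
  near=> y; rewrite /= supp_neq0//.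
  have [] : (codom i `&` param i @^-1` (~` supp phi)) y; last by [].
  near: y; apply: open_nbhs_nbhs; split => //; split; first exact: codom_coord.
  by rewrite /= coordK.
by rewrite derive_cst.
Unshelve. all: by end_near. Qed.

Lemma test_grad_inner phi (Y : chart_index M -> M -> E) i p :
  smooth phi -> is_vector_field Y -> dom i p ->
  inner (test_grad phi) Y p = \sum_k chart_partial i k phi p * Y i p 0 k.
Proof.
move=> phis VY ip; rewrite (inner_chart (test_grad_vector_field phis) VY ip).
by rewrite test_grad_metric// mxE; apply: eq_bigr => k _; rewrite !mxE.
Qed.

Lemma compact_cboxP (K : set E) : compact K -> exists a b : E, K `<=` cbox a b.
Proof.
move=> /compact_bounded[C0 [_ /(_ (`|C0| + 1))]].
rewrite (le_lt_trans (ler_norm _)) ?ltrDl// => /(_ isT) H.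
exists (const_mx (- (`|C0| + 1))), (const_mx (`|C0| + 1)) => x Kx k.
have xk : `|x 0 k| <= `|x|.
  by rewrite /Num.norm/= mx_normrE; apply: (le_bigmax _ (fun ij => `|x ij.1 ij.2|) (0, k)).
by rewrite !mxE -ler_norml (le_trans xk)//; exact: H.
Qed.

(** Carries a compactly supported function on a chart image to the whole Euclidean space, where
    translations are available. *)
Definition zero_ext i (F : E -> R) (x : E) : R := if `[< codom i x >] then F x else 0.

Lemma zero_extE i (F : E -> R) x : codom i x -> zero_ext i F x = F x.
Proof. by move=> xc; rewrite /zero_ext; case: asboolP. Qed.

Lemma Cn_zero_ext m i (F : E -> R) (K : set E) : compact K -> K `<=` codom i ->
  Cn m (codom i) F -> (forall x, codom i x -> ~ K x -> F x = 0) -> Cn m setT (zero_ext i F).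
Proof.
move=> cK Ki FC F0; apply: Cn_local => x _.
have [xc|nxc] := pselect (codom i x).
  exists (codom i) => //; apply: Cn_eq FC; first exact: open_codom.
  by move=> y yc; rewrite zero_extE.
have oK : open (~` K) by apply: closed_openC; apply: compact_closed => //; exact: norm_hausdorff.
exists (~` K); first by move=> /Ki.
apply: (@Cn_eq _ _ _ _ (fun=> 0)) => //; last exact: Cn_cst.
by move=> y nK; rewrite /zero_ext; case: asboolP => // yc; rewrite F0.
Qed.

Variable lam : {measure set (borel E) -> \bar R}.
Hypothesis lamP : is_lebesgue lam.
Hypothesis lamE : forall i (g : M -> \bar R),
  measurable_fun (dom i : set (borel M)) (g : borel M -> \bar R) ->
  (\int[mu]_(p in dom i) g p =
   \int[lam]_(x in codom i) (g (param i x) * (weighted_density i (param i x))%:E))%E.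

Lemma zero_ext_integral i (g : M -> R) (F : E -> R) :
  measurable_fun (dom i : set (borel M)) (g : borel M -> R) ->
  (forall x, codom i x -> g (param i x) * weighted_density i (param i x) = F x) ->
  (\int[mu]_(p in dom i) (g p)%:E = \int[lam]_(x in setT) (zero_ext i F x)%:E)%E.
Proof.
move=> mg gF; rewrite lamE; last exact/measurable_EFinP.
rewrite integral_mkcond; apply: eq_integral => x _.
rewrite /patch /zero_ext; case: asboolP => xc; first by rewrite mem_set// -EFinM gF.
by rewrite memNset.
Qed.

Lemma zero_ext_integrable i (F : E -> R) (K : set E) : compact K -> K `<=` codom i ->
  Cn 0 (codom i) F -> (forall x, codom i x -> ~ K x -> F x = 0) ->
  lam.-integrable setT (EFin \o (zero_ext i F : borel E -> R)).
Proof.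
move=> cK Ki FC F0; have [a [b Kab]] := compact_cboxP cK.
have Fc : continuous (zero_ext i F).
  by move=> x; exact: (Cn_continuous (Cn_zero_ext cK Ki FC F0)).
have Fs x : ~ cbox a b x -> zero_ext i F x = 0.
  move=> nx; rewrite /zero_ext; case: asboolP => // xc; apply: F0 => // /Kab; exact: nx.
have [C FC'] := cbox_continuous_bounded Fc Fs.
exact: (cbox_bounded_integrable lamP (continuous_measurableT Fc) Fs FC').
Qed.

Lemma zero_ext_partial0 i k (F : E -> R) (K : set E) : compact K -> K `<=` codom i ->
  Cn 1 (codom i) F -> (forall x, codom i x -> ~ K x -> F x = 0) ->
  (\int[lam]_(x in setT) (zero_ext i (partial k F) x)%:E = 0)%E.
Proof.
move=> cK Ki FC F0; have [a [b Kab]] := compact_cboxP cK.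
have eC := Cn_zero_ext cK Ki FC F0.
have oc := @open_codom _ _ M i.
have cC : closed K by apply: compact_closed => //; exact: norm_hausdorff.
rewrite -(@integral_partial0 _ _ _ lamP a b (zero_ext i F) k).
- apply: eq_integral => x _; congr EFin; rewrite /zero_ext.
  case: asboolP => xc.
    apply: near_eq_derive; near=> y; rewrite -/(zero_ext i F y) zero_extE//.
    by near: y; exact: open_near.
  transitivity (partial k (cst 0 : E -> R) x); first by rewrite /partial derive_cst.
  apply: near_eq_derive.
  near=> y; case: asboolP => // yc; apply/esym/F0 => //; near: y.
  by apply: (open_near (closed_openC cC)) => /Ki.
- by move=> x; exact: (Cn_continuous eC).
- by move=> x; exact: (Cn_derivable eC).
- by move=> x; exact: (Cn_continuous (Cn_partial k eC)).
- by move=> x nx; rewrite /zero_ext; case: asboolP => // xc; apply: F0 => // /Kab.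
Unshelve. all: by end_near. Qed.

(** In coordinates the two sides are integrals of the two terms in the k-th derivative of phi times
    the density times X_k, a compactly supported function whose partial derivative integrates to
    0. *)
Lemma test_grad_parts_chart i phi (X : M -> E) : smooth phi -> chart_test_field i X ->
  \int[mu]_(p in dom i) (test_grad phi i p *m metric i p *m (X p)^T) 0 0
    = - \int[mu]_(p in dom i) (phi p * divergence i X p).
Proof.
move=> phis [Xs cX Xi].
pose wd x := weighted_density i (param i x).
pose K := coord i @` closure [set p | X p != 0].
have oc := @open_codom _ _ M i.
have cK : compact K.
  apply: continuous_compact => //; apply: continuous_in_subspaceT => p; rewrite inE => /Xi.
  exact: Defs.coord_continuous.
have Ki : K `<=` codom i by move=> _ [p /Xi ip <-]; exact: codom_coord.
have X0 x : codom i x -> ~ K x -> X (param i x) = 0.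
  move=> xc nK; apply/eqP; apply: contrapT => /negP H; apply: nK.
  by exists (param i x); [exact: subset_closure|exact: paramK].
pose P k x := phi (param i x) * (wd x * X (param i x) 0 k).
pose F k x := partial k (phi \o param i) x * (wd x * X (param i x) 0 k).
pose H k x := phi (param i x) * partial k (fun y => wd y * X (param i y) 0 k) x.
have phiC m : Cn m (codom i) (phi \o param i) by move/smoothP : phis; apply.
have XC m k : Cn m (codom i) (fun x => wd x * X (param i x) 0 k).
  apply: Cn_mul => //; first exact: Cn_weighted_density.
  by move/smoothP : (Xs k) => /(_ i m).
have X1 k x : codom i x -> ~ K x -> wd x * X (param i x) 0 k = 0.
  by move=> xc nK; rewrite X0// mxE mulr0.
have FC k : Cn 0 (codom i) (F k).
  exact: (Cn_mul oc (Cn_partial k (phiC 1%N)) (XC 0%N k)).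
have F0 k x : codom i x -> ~ K x -> F k x = 0 by move=> xc nK; rewrite /F X1// mulr0.
have HC k : Cn 0 (codom i) (H k).
  exact: (Cn_mul oc (phiC 0%N) (Cn_partial k (XC 1%N k))).
have cC : closed K by apply: compact_closed => //; exact: norm_hausdorff.
have H0 k x : codom i x -> ~ K x -> H k x = 0.
  move=> xc nK; rewrite /H [X in _ * X](_ : _ = 0) ?mulr0//.
  have <- : partial k (cst 0 : E -> R) x = 0 by rewrite /partial derive_cst.
  apply: near_eq_derive.
  near=> y; rewrite X1//; first by near: y; exact: open_near.
  by near: y; apply: (open_near (closed_openC cC)).
have Fi k := zero_ext_integrable cK Ki (FC k) (F0 k).
have Hi k := zero_ext_integrable cK Ki (HC k) (H0 k).
have FH k : \int[lam]_(x in setT) zero_ext i (F k) x + \int[lam]_(x in setT) zero_ext i (H k) x = 0.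
  rewrite -RintegralD//= /Rintegral.
  have P0 x : codom i x -> ~ K x -> P k x = 0 by move=> xc nK; rewrite /P X1// mulr0.
  have := @zero_ext_partial0 i k (P k) K cK Ki (Cn_mul oc (phiC 1%N) (XC 1%N k)) P0.
  rewrite (_ : (fun x => (zero_ext i (partial k (P k)) x)%:E) =
      (fun x => (zero_ext i (F k) x + zero_ext i (H k) x)%:E)); first by move=> ->.
  apply/funext => x; congr EFin; rewrite /zero_ext; case: asboolP => xc; last by rewrite addr0.
  have d1 := Cn_is_derive k (phiC 1%N) xc; have d2 := Cn_is_derive k (XC 1%N k) xc.
  have [_ E1] := is_deriveM d1 d2; rewrite [LHS]E1.
  by rewrite /F /H /GRing.scale/= addrC mulrC.
have mX k : measurable_fun (dom i : set (borel M)) ((fun p => X p 0 k) : borel M -> R).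
  exact: (measurable_funTS (smooth_measurable (Xs k))).
have sumE (f : 'I_n -> E -> R) (g : M -> R) :
    (forall k, lam.-integrable setT (EFin \o (zero_ext i (f k) : borel E -> R))) ->
    measurable_fun (dom i : set (borel M)) (g : borel M -> R) ->
    (forall x, codom i x -> g (param i x) * weighted_density i (param i x) = \sum_k f k x) ->
    \int[mu]_(p in dom i) g p = \sum_k \int[lam]_(x in setT) zero_ext i (f k) x.
  move=> fi mg gf; rewrite -(proj2 (Rintegral_big_sum _ _ fi))//.
  rewrite /Rintegral (zero_ext_integral mg gf); congr fine; apply: eq_integral => x _.
  by congr EFin; rewrite /zero_ext; case: asboolP => // xc; rewrite big1.
rewrite (sumE F); last 3 first.
- exact: Fi.
- apply: (eq_measurable_fun (fun p : borel M => \sum_k chart_partial i k phi p * X p 0 k)).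
    move=> p; rewrite inE => ip; rewrite test_grad_metric// mxE.
    by apply: eq_bigr => k _; rewrite !mxE.
  apply: measurable_sum => k; apply: measurable_funM => //.
  exact: measurable_chart_partial.
- move=> x xc; rewrite test_grad_metric ?mxE; last exact: dom_param.
  rewrite big_distrl/=; apply: eq_bigr => k _.
  by rewrite !mxE /F /chart_partial paramK// -mulrA [X in _ * X]mulrC.
rewrite (sumE H); last 3 first.
- exact: Hi.
- apply: measurable_funM; first exact: (measurable_funTS (smooth_measurable phis)).
  apply: (eq_measurable_fun (fun p : borel M => (fun x => (wd x)^-1 * \sum_k partial k (fun y => wd
    y * X (param i y) 0 k) x) (coord i p))).
    move=> p; rewrite inE => ip; rewrite /divergence /wd coordK//; congr (_ * _).
  apply: (measurable_coord_comp (F := fun x => (wd x)^-1 *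
    \sum_k partial k (fun y => wd y * X (param i y) 0 k) x)).
  apply: Cn_mul => //.
    apply: Cn_inv => //; last exact: Cn_weighted_density.
    by move=> x /dom_param xi; rewrite gt_eqF// weighted_density_gt0.
  by apply: Cn_sum => // k; exact: Cn_partial (XC 1%N k).
- move=> x xc; rewrite /divergence.
  have w0 : weighted_density i (param i x) != 0.
    by rewrite gt_eqF// weighted_density_gt0//; exact: dom_param.
  rewrite -mulrA [X in _ * X]mulrC mulVKf// big_distrr/=; apply: eq_bigr => k _.
  by rewrite /chart_partial paramK.
apply/eqP; rewrite -subr_eq0 opprK -big_split/= big1// => k _; exact: FH.
Unshelve. all: by end_near. Qed.

End TestGradient.

Lemma Rintegral_ae d (T : measurableType d) (R : realType) (mu : {measure set T -> \bar R})
    (D : set T) (f g : T -> R) : measurable D -> measurable_fun D f -> measurable_fun D g ->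
  {ae mu, forall x, D x -> f x = g x} -> \int[mu]_(x in D) f x = \int[mu]_(x in D) g x.
Proof.
move=> mD mf mg fg; congr fine; apply: ae_eq_integral => //; try exact/measurable_EFinP.
by apply: filterS fg => x fg Dx; rewrite fg.
Qed.

(** * Weak gradients and their uniqueness *)

Section Gradient.
Context {R : realType} {n : nat} (M : weightedManifold R n).
Local Notation E := 'rV[R]_n.
Local Notation mu := (mu M).
Local Notation field := (chart_index M -> M -> E).
Implicit Types (i j : chart_index M) (p q : M) (phi f h : M -> R) (X Y Z G H : field).

Definition L2_field X := [/\ is_vector_field X,
  forall i k, measurable_fun (dom i : set (borel M)) (fun p => X i p 0 k) &
  (\int[mu]_p (inner X X p)%:E < +oo)%E].

Definition field_pair i (u v : E) p : R := (u *m metric i p *m v^T) 0 0.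

Lemma field_pair_lin i (a : R) (u v z : E) p :
  field_pair i (a *: u + v) z p = a * field_pair i u z p + field_pair i v z p.
Proof. by rewrite /field_pair !mulmxDl -!scalemxAl !mxE. Qed.

Lemma field_pair_sym i (u v : E) p : dom i p -> field_pair i u v p = field_pair i v u p.
Proof.
move=> ip; have H : (u *m metric i p *m v^T)^T = v *m metric i p *m u^T.
  by rewrite !trmx_mul trmxK Defs.metric_sym ?mulmxA.
by have := congr1 (fun B : 'M[R]_1 => B 0 0) H; rewrite /= mxE.
Qed.

Lemma field_pair_ge0 i (u : E) p : dom i p -> 0 <= field_pair i u u p.
Proof.
move=> ip; rewrite /field_pair; have [->|v0] := eqVneq u 0; first by rewrite !mul0mx mxE.
by rewrite ltW// metric_pos.
Qed.

Lemma field_pair_le i (u v : E) p : dom i p ->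
  `|field_pair i u v p| <= (field_pair i u u p + field_pair i v v p) / 2.
Proof.
move=> ip.
have h1 := field_pair_ge0 (1 *: u + v) ip.
have h2 := field_pair_ge0 (-1 *: u + v) ip.
move: h1 h2; rewrite !field_pair_lin !(field_pair_sym _ (_ + _) ip) !field_pair_lin.
rewrite (field_pair_sym v u ip) => h1 h2.
by rewrite ler_norml; apply/andP; split; lra.
Qed.

Lemma field_pairE i (u v : E) p : field_pair i u v p = \sum_b (\sum_a u 0 a * metric i p a b) * v 0 b.
Proof. by rewrite /field_pair mxE; apply: eq_bigr => b _; rewrite !mxE. Qed.

Lemma measurable_metric i a b :
  measurable_fun (dom i : set (borel M)) ((fun p => metric i p a b) : borel M -> R).
Proof.
apply: (eq_measurable_fun (fun p : borel M => (fun x => metric i (param i x) a b) (coord i p))).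
  by move=> p; rewrite inE => ip; rewrite coordK.
apply: (measurable_coord_comp (F := fun x => metric i (param i x) a b)); exact: Cn_metric.
Qed.

Lemma measurable_field_pair i (u v : M -> E) :
  (forall k, measurable_fun (dom i : set (borel M)) ((fun p => u p 0 k) : borel M -> R)) ->
  (forall k, measurable_fun (dom i : set (borel M)) ((fun p => v p 0 k) : borel M -> R)) ->
  measurable_fun (dom i : set (borel M)) ((fun p => field_pair i (u p) (v p) p) : borel M -> R).
Proof.
move=> mu' mv.
apply: (eq_measurable_fun (fun p : borel M => \sum_b (\sum_a u p 0 a * metric i p a b) * v p 0 b)).
  by move=> p _; rewrite field_pairE.
apply: measurable_sum => b; apply: measurable_funM => //.
by apply: measurable_sum => a; apply: measurable_funM => //; exact: measurable_metric.
Qed.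

Lemma measurable_inner X Y : L2_field X -> L2_field Y ->
  measurable_fun [set: borel M] (inner X Y : borel M -> R).
Proof.
move=> [VX mX _] [VY mY _]; apply: measurable_charts => i.
apply: (eq_measurable_fun (fun p : borel M => field_pair i (X i p) (Y i p) p)).
  by move=> p; rewrite inE => ip; rewrite (inner_chart VX VY ip).
exact: (measurable_field_pair (mX i) (mY i)).
Qed.

Lemma inner_le X Y p : `|inner X Y p| <= (inner X X p + inner Y Y p) / 2.
Proof. exact: field_pair_le (dom_chart_at p). Qed.

Lemma inner_sqr_integrable X : L2_field X ->
  mu.-integrable setT (EFin \o (inner X X : borel M -> R)).
Proof.
move=> LX; apply/integrableP; split; first by apply/measurable_EFinP; exact: measurable_inner.
case: LX => _ _; apply: le_lt_trans; rewrite le_eqVlt; apply/orP; left; apply/eqP.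
apply: eq_integral => p _ /=; by rewrite ger0_norm// inner_ge0.
Qed.

Lemma inner_integrable X Y : L2_field X -> L2_field Y ->
  mu.-integrable setT (EFin \o (inner X Y : borel M -> R)).
Proof.
move=> LX LY.
have := integrableD measurableT (inner_sqr_integrable LX) (inner_sqr_integrable LY).
apply: le_integrable => //; first by apply/measurable_EFinP; exact: measurable_inner.
move=> p _ /=; rewrite lee_fin (le_trans (inner_le _ _ _))//.
have h1 := inner_ge0 X p; have h2 := inner_ge0 Y p.
by rewrite ger0_norm ?addr_ge0//; lra.
Qed.

Lemma L2_field_lin (a : R) X Y : L2_field X -> L2_field Y ->
  L2_field (fun i p => a *: X i p + Y i p).
Proof.
move=> LX LY; have [VX mX iX] := LX; have [VY mY iY] := LY.
have VZ : is_vector_field (fun i p => a *: X i p + Y i p).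
  by move=> i j p ip jp; rewrite (VX _ _ _ ip jp) (VY _ _ _ ip jp) mulmxDl -scalemxAl.
have mZ i k : measurable_fun (dom i : set (borel M)) (fun p => (a *: X i p + Y i p) 0 k).
  apply: (eq_measurable_fun (fun p : borel M => a * X i p 0 k + Y i p 0 k)).
    by move=> p _; rewrite !mxE.
  by apply: measurable_funD => //; apply: measurable_funM.
split => //.
have zE p : inner (fun i p => a *: X i p + Y i p) (fun i p => a *: X i p + Y i p) p =
    a * (a * inner X X p) + a * inner X Y p + (a * inner X Y p + inner Y Y p).
  set Z := fun i p => a *: X i p + Y i p.
  have ZE W : inner Z W p = a * inner X W p + inner Y W p by exact: inner_lin.
  rewrite ZE (inner_sym X Z) (inner_sym Y Z) !ZE (inner_sym Y X).
  by ring.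
have H : mu.-integrable setT (EFin \o (fun p : borel M => a * (a * inner X X p)
  + a * inner X Y p + (a * inner X Y p + inner Y Y p))).
  have iZ f : mu.-integrable setT (EFin \o (f : borel M -> R)) ->
      mu.-integrable setT (EFin \o ((fun p => a * f p) : borel M -> R)).
    move=> fi; exact: (integrableZl measurableT a fi).
  have iD f g : mu.-integrable setT (EFin \o (f : borel M -> R))
    -> mu.-integrable setT (EFin \o (g : borel M -> R)) ->
      mu.-integrable setT (EFin \o ((fun p => f p + g p) : borel M -> R)).
    by move=> fi gi; exact: (integrableD measurableT fi gi).
  exact: (iD _ _ (iD _ _ (iZ _ (iZ _ (inner_sqr_integrable LX))) (iZ _ (inner_integrable LX LY)))
    (iD _ _ (iZ _ (inner_integrable LX LY)) (inner_sqr_integrable LY))).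
have [_] := integrableP _ _ _ H; apply: le_lt_trans; apply: ge0_le_integral => //.
- by move=> p _; rewrite lee_fin inner_ge0.
- apply/measurable_EFinP.
  apply: (eq_measurable_fun (fun p : borel M => a * (a * inner X X p)
    + a * inner X Y p + (a * inner X Y p + inner Y Y p))).
    by move=> p _; rewrite zE.
  by have /measurable_EFinP := measurable_int _ H.
- by apply: measurableT_comp => //; exact: (measurable_int _ H).
- by move=> p _ /=; rewrite lee_fin zE ler_norm.
Qed.

Lemma chart_compact_integrable i (g : M -> R) (K : set M) : compact K -> K `<=` dom i ->
  Cn 0 (codom i) (g \o param i) -> (forall p, dom i p -> ~ K p -> g p = 0) ->
  mu.-integrable (dom i : set (borel M)) (EFin \o (g : borel M -> R)).
Proof.
move=> cK Ki gC g0; have [lam lamP lamE] := chart_integral M.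
have mg : measurable_fun (dom i : set (borel M)) (g : borel M -> R).
  apply: (eq_measurable_fun (fun p : borel M => (g \o param i) (coord i p))).
    by move=> p; rewrite inE => ip; rewrite /= coordK.
  exact: (measurable_coord_comp gC).
apply/integrableP; split; first exact/measurable_EFinP.
rewrite lamE; last by apply/measurable_EFinP; exact: measurableT_comp.
pose F x := g (param i x) * weighted_density i (param i x).
have oc := @open_codom _ _ M i.
have FC : Cn 0 (codom i) F by apply: Cn_mul => //; exact: Cn_weighted_density.
have cK' : compact (coord i @` K).
  apply: continuous_compact => //; apply: continuous_in_subspaceT => p; rewrite inE => /Ki.
  exact: Defs.coord_continuous.
have Ki' : coord i @` K `<=` codom i by move=> _ [p /Ki ip <-]; exact: codom_coord.
have F0 x : codom i x -> ~ (coord i @` K) x -> F x = 0.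
  move=> xc nK; rewrite /F g0 ?mul0r//; first exact: dom_param.
  by move=> Kx; apply: nK; exists (param i x) => //; exact: paramK.
have [_] := integrableP _ _ _ (zero_ext_integrable lamP cK' Ki' FC F0).
apply: le_lt_trans; rewrite integral_mkcond le_eqVlt; apply/orP; left; apply/eqP.
apply: eq_integral => x _; rewrite /patch/= /zero_ext; case: asboolP => xc.
  by rewrite mem_set//= /F normrM EFinM (ger0_norm (ltW (weighted_density_gt0 (dom_param xc)))).
by rewrite memNset// normr0.
Qed.

Lemma chart_field_integrable X i (Y : M -> E) : L2_field X -> chart_test_field i Y ->
  mu.-integrable (dom i : set (borel M)) (EFin \o ((fun p => field_pair i (X i p) (Y p) p)
    : borel M -> R)).
Proof.
move=> LX [Ys cY Yi]; have [VX mX iX] := LX.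
have mD := measurable_dom i.
have mY k : measurable_fun (dom i : set (borel M)) ((fun p => Y p 0 k) : borel M -> R).
  exact: (measurable_funTS (smooth_measurable (Ys k))).
have YY : mu.-integrable (dom i : set (borel M)) (EFin \o ((fun p => field_pair i (Y p) (Y p) p)
  : borel M -> R)).
  apply: (chart_compact_integrable cY Yi).
    have oc := @open_codom _ _ M i.
    apply: (@Cn_eq _ _ _ _ (fun x => \sum_b (\sum_a Y (param i x) 0 a * metric i (param i x) a b)
      * Y (param i x) 0 b)) => //.
      by move=> x _; rewrite /= field_pairE.
    have YC k : Cn 0 (codom i) (fun x => Y (param i x) 0 k).
      by move/smoothP : (Ys k) => /(_ i 0%N).
    apply: Cn_sum => // b; apply: Cn_mul => //; apply: Cn_sum => // a; apply: Cn_mul => //.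
    exact: Cn_metric.
  move=> p _ np; have Y0 : Y p = 0.
    by apply/eqP; apply: contrapT => /negP H; apply: np; exact: subset_closure.
  by rewrite /field_pair Y0 !mul0mx mxE.
have XX := integrableS measurableT mD (@subsetT _ _) (inner_sqr_integrable LX).
have := integrableD mD XX YY; apply: le_integrable => //.
  by apply/measurable_EFinP; exact: measurable_field_pair.
move=> p ip /=; rewrite lee_fin (le_trans (field_pair_le _ _ ip))//.
have h1 := inner_ge0 X p; have h2 := field_pair_ge0 (Y p) ip.
have h3 : inner X X p = field_pair i (X i p) (X i p) p by rewrite (inner_chart VX VX ip).
by rewrite -h3 ger0_norm ?addr_ge0//; lra.
Qed.

Lemma countable_bumps : exists (c : nat -> chart_index M) (a b : nat -> E),
  (forall m, cbox (a m) (b m) `<=` codom (c m)) /\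
  forall p, exists m, chart_bump (c m) (a m) (b m) p != 0.
Proof.
have [B Bo Bb] := countable_basis_seq M.
pose ok (t : chart_index M * E * E) := cbox t.1.2 t.2 `<=` codom t.1.1.
pose nz (t : chart_index M * E * E) := [set p | chart_bump t.1.1 t.1.2 t.2 p != 0].
have ex p : exists t, ok t /\ nbhs p (nz t).
  have ip := dom_chart_at p.
  have [a [b [abc _ pab]]] := compact_nbhs_chart ip (@filterT _ (nbhs p) _).
  exists (chart_at p, a, b); split => //.
  have fo : open (nz (chart_at p, a, b)).
    have -> : nz (chart_at p, a, b) = chart_bump (chart_at p) a b @^-1` (~` [set 0]).
      by apply/seteqP; split => q /=; [move/eqP|move=> H; apply/eqP].
    apply: open_comp; last by apply: closed_openC; exact: closed_eq.
    by move=> q _; apply: smooth_continuous; exact: chart_bump_smooth.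
  by apply: open_nbhs_nbhs; split => //=; rewrite /nz/= chart_bump_dom// gt_eqF// box_bump_gt0.
have /choice[t tP] : forall k, exists t, ok t /\ ((exists2 s, ok s & B k `<=` nz s) -> B k `<=` nz t).
  move=> k; have [[s os Bs]|nB] := pselect (exists2 s, ok s & B k `<=` nz s); first by exists s.
  by have [t [ot _]] := ex point; exists t.
exists (fun m => (t m).1.1), (fun m => (t m).1.2), (fun m => (t m).2).
split; first by move=> m; have [] := tP m.
move=> p; have [s [os ps]] := ex p; have [k [Bp Bs]] := Bb p _ ps.
by exists k; have [_] := tP k; apply => //; exists s.
Qed.

(** Testing with a bump times a smooth psi in one coordinate direction isolates a component of X
    times the metric; [smooth_ae0] annihilates it wherever the bump is nonzero, countably many bumps
    cover M, and the metric is invertible. *)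
Lemma field_ae0 X : L2_field X ->
  (forall i (Y : M -> E), chart_test_field i Y -> \int[mu]_(p in dom i) field_pair i (X i p) (Y p)
    p = 0) ->
  {ae mu, forall p, X (chart_at p) p = 0}.
Proof.
move=> LX X0; have [VX mX _] := LX.
have [c [a [b [abc cov]]]] := countable_bumps.
pose F m k p := if `[< dom (c m) p >] then
  (X (c m) p *m metric (c m) p) 0 k * chart_bump (c m) (a m) (b m) p else 0.
pose Y m k (psi : M -> R) p : E := (psi p * chart_bump (c m) (a m) (b m) p) *: delta_mx 0 k.
have FY m k psi p : dom (c m) p -> field_pair (c m) (X (c m) p) (Y m k psi p) p = F m k p * psi p.
  move=> ip; rewrite /field_pair /F /Y; case: asboolP => // _.
  rewrite linearZ/= -scalemxAr mxE mxE (bigD1 k)//= big1 ?addr0; last first.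
    by move=> l lk; rewrite !mxE (negbTE lk) andbF mulr0.
  by rewrite !mxE !eqxx mulr1; ring.
have YT m k psi : smooth psi -> chart_test_field (c m) (Y m k psi).
  move=> psis.
  have cK := param_compact (@compact_cbox _ _ (a m) (b m)) (abc m).
  have sub : closure [set p | Y m k psi p != 0] `<=` param (c m) @` cbox (a m) (b m).
    rewrite closureE => p; apply; split; first exact: compact_closed_M.
    move=> q /=; rewrite /Y scaler_eq0 mulf_eq0 !negb_or => /andP[/andP[_ +] _].
    exact: chart_bump_param.
  split.
  - move=> l.
    have -> : (fun p => Y m k psi p 0 l) = (fun p => (delta_mx 0 k : E)
      0 l * (psi p * chart_bump (c m) (a m) (b m) p)).
      by apply/funext => p; rewrite /Y !mxE mulrC.
    exact: (smoothZ _ (smoothM psis (chart_bump_smooth (abc m)))).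
  - by apply: closed_compact_sub cK sub; exact: closed_closure.
  - by move=> p /sub[x /(abc m) xc <-]; exact: dom_param.
have Fint m k psi : smooth psi -> (\int[mu]_(p in setT) (F m k p * psi p)%:E =
    \int[mu]_(p in dom (c m)) (field_pair (c m) (X (c m) p) (Y m k psi p) p)%:E)%E.
  move=> _; rewrite [RHS]integral_mkcond; apply: eq_integral => p _.
  rewrite /patch; case: (pselect (dom (c m) p)) => ip; first by rewrite mem_set// FY.
  by rewrite memNset// /F; case: asboolP => // _; rewrite mul0r.
have Fi m k : mu.-integrable setT (EFin \o (F m k : borel M -> R)).
  have s1 := @smooth_cst _ _ M 1.
  have H := chart_field_integrable LX (YT m k _ s1).
  have := (proj1 (integrable_mkcond _ (measurable_dom (c m)))) H.
  congr (_ .-integrable _ _); apply/funext => p /=.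
  rewrite /patch; case: (pselect (dom (c m) p)) => ip.
    by rewrite mem_set//= FY// mulr1.
  by rewrite memNset//= /F; case: asboolP.
have H m k : {ae mu, forall p, F m k p = 0}.
  apply: smooth_ae0 => // psi psis _; rewrite Fint//.
  have := X0 _ _ (YT m k psi psis); rewrite /Rintegral => /eqP.
  have Hf := integrable_fin_num (measurable_dom (c m)) (chart_field_integrable LX (YT m k psi psis)).
  by rewrite fine_eq0// => /eqP.
have {}H : {ae mu, forall p, forall m k, F m k p = 0}.
  by apply: ae_foralln => m; apply: filter_forall => k; exact: H.
have := H; apply: (@filterS _ _ (ae_filter_ringOfSetsType mu)) => p {}H; have [m mp] := cov p.
have [ip _] := chart_bump_neq0 mp.
have X1 : X (c m) p *m metric (c m) p = 0.
  apply/rowP => k; have := H m k; rewrite /F; case: asboolP => // _ /eqP.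
  by rewrite mulf_eq0 (negbTE mp) orbF => /eqP ->; rewrite mxE.
have X2 : X (c m) p = 0 by rewrite -(mulmxK (metric_unit ip) (X (c m) p)) X1 mul0mx.
by rewrite (VX _ _ _ ip (dom_chart_at p)) X2 mul0mx.
Qed.

Lemma L2_gradient_field f G : is_L2_gradient f G -> L2_field G.
Proof. by case. Qed.

Lemma field_pair_integral_lin (a : R) X Y i (Z : M -> E) : L2_field X -> L2_field Y ->
  chart_test_field i Z ->
  \int[mu]_(p in dom i) field_pair i (a *: X i p + Y i p) (Z p) p =
  a * \int[mu]_(p in dom i) field_pair i (X i p) (Z p) p +
  \int[mu]_(p in dom i) field_pair i (Y i p) (Z p) p.
Proof.
move=> LX LY ZT; have mD := measurable_dom i.
have iX := chart_field_integrable LX ZT; have iY := chart_field_integrable LY ZT.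
rewrite -RintegralZl// -RintegralD//.
  by apply: eq_Rintegral => p _; rewrite field_pair_lin.
exact: (integrableZl mD a iX).
Qed.

Lemma L2_gradient_unique f G H : is_L2_gradient f G -> is_L2_gradient f H ->
  {ae mu, forall p, G (chart_at p) p = H (chart_at p) p}.
Proof.
move=> gG gH; have LG := L2_gradient_field gG; have LH := L2_gradient_field gH.
have := field_ae0 (L2_field_lin (-1) LH LG) _.
have Z0 i (Y : M -> E) : chart_test_field i Y ->
    \int[mu]_(p in dom i) field_pair i (-1 *: H i p + G i p) (Y p) p = 0.
  move=> YT; rewrite field_pair_integral_lin//.
  have [_ _ _ HY] := gH; have [_ _ _ GY] := gG.
  by have := HY i Y YT; have := GY i Y YT; rewrite /field_pair => -> ->; ring.
move=> /(_ Z0); apply: (@filterS _ _ (ae_filter_ringOfSetsType mu)) => p /eqP.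
by rewrite scaleN1r addrC subr_eq0 => /eqP.
Qed.

Lemma Cn_divergence m i (X : M -> E) : (forall k, smooth (fun p => X p 0 k)) ->
  Cn m (codom i) (divergence i X \o param i).
Proof.
move=> Xs; have oc := @open_codom _ _ M i.
apply: (@Cn_eq _ _ _ _ (fun x => (weighted_density i (param i x))^-1 *
    \sum_k partial k (fun y => weighted_density i (param i y) * X (param i y) 0 k) x)) => //.
  move=> x xc; rewrite /= /divergence; congr (_ * _); apply: eq_bigr => k _.
  by rewrite /chart_partial paramK.
apply: Cn_mul => //.
  apply: Cn_inv => //; last exact: Cn_weighted_density.
  by move=> x /dom_param xi; rewrite gt_eqF// weighted_density_gt0.
apply: Cn_sum => // k; apply: Cn_partial; apply: Cn_mul => //; first exact: Cn_weighted_density.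
by move/smoothP : (Xs k) => /(_ i m.+1).
Qed.

Lemma divergence_supp i (X : M -> E) p : dom i p -> ~ closure [set q | X q != 0] p ->
  divergence i X p = 0.
Proof.
move=> ip np; rewrite /divergence big1 ?mulr0// => k _.
apply: chart_partial_supp => // Hp; apply: np; move: Hp.
apply: closure_subset => q /=; apply: contraNneq => ->.
by rewrite mxE mulr0.
Qed.

(** With d the divergence, nonnegativity of (f w - d)^2 / w and (f w + d)^2 / w bounds |f d| by f^2
    w + d^2 / w; the second term is continuous with compact support in the chart. *)
Lemma divergence_integrable w f i (X : M -> E) : smooth w -> (forall p, 0 < w p) ->
  in_L2 w f -> chart_test_field i X ->
  mu.-integrable (dom i : set (borel M)) (EFin \o ((fun p => f p * divergence i X p) : borel M -> R)).
Proof.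
move=> ws w0 Lf [Xs cX Xi]; have mD := measurable_dom i.
have oc := @open_codom _ _ M i.
have DC := @Cn_divergence 0 i X Xs.
have iD : mu.-integrable (dom i : set (borel M))
    (EFin \o ((fun p => (divergence i X p * divergence i X p) * (w p)^-1) : borel M -> R)).
  apply: (chart_compact_integrable cX Xi).
    apply: Cn_mul => //; first by apply: Cn_mul => //.
    by have /smoothP/(_ i 0%N) := smoothV ws (fun p => lt0r_neq0 (w0 p)).
  by move=> p ip np; rewrite divergence_supp// !mul0r.
have iF := integrableS measurableT mD (@subsetT _ _) (L2_sqr_integrable (smooth_measurable ws) w0 Lf).
have := integrableD mD iF iD; apply: le_integrable => //.
  apply/measurable_EFinP; apply: measurable_funM.
    by apply: measurable_funTS; case: Lf.
  apply: (eq_measurable_fun (fun p : borel M => (divergence i X \o param i) (coord i p))).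
    by move=> p; rewrite inE => ip; rewrite /= coordK.
  exact: (measurable_coord_comp DC).
move=> p ip /=; rewrite lee_fin; set d := divergence i X p; set v := f p.
have wp := w0 p; set r := w p in wp *.
have r0 : r != 0 by rewrite gt_eqF.
have h1 : 0 <= (v * r - d) * (v * r - d) * r^-1 by apply: mulr_ge0; [rewrite -expr2;
  exact: sqr_ge0|rewrite invr_ge0 ltW].
have h2 : 0 <= (v * r + d) * (v * r + d) * r^-1 by apply: mulr_ge0; [rewrite -expr2;
  exact: sqr_ge0|rewrite invr_ge0 ltW].
have e1 : (v * r - d) * (v * r - d) * r^-1 = v * v * r + d * d * r^-1 - (v * d) *+ 2 by field.
have e2 : (v * r + d) * (v * r + d) * r^-1 = v * v * r + d * d * r^-1 + (v * d) *+ 2 by field.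
rewrite e1 in h1; rewrite e2 in h2; set A := v * v * r + d * d * r^-1 in h1 h2 *.
apply: le_trans (ler_norm _); rewrite mulr2n in h1 h2.
by rewrite ler_norml; apply/andP; split; lra.
Qed.

Lemma L2_gradient_lin w (a : R) f h G H : smooth w -> (forall p, 0 < w p) ->
  in_L2 w f -> in_L2 w h -> is_L2_gradient f G -> is_L2_gradient h H ->
  is_L2_gradient (a *: f + h) (fun i p => a *: G i p + H i p).
Proof.
move=> ws w0 Lf Lh gG gH; have LG := L2_gradient_field gG; have LH := L2_gradient_field gH.
have [V m I] := L2_field_lin a LG LH; split => // i X XT.
have mD := measurable_dom i.
have Ef := divergence_integrable ws w0 Lf XT; have Eh := divergence_integrable ws w0 Lh XT.
have -> : \int[mu]_(p in dom i) ((a *: f + h) p * divergence i X p) =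
    a * \int[mu]_(p in dom i) (f p * divergence i X p) + \int[mu]_(p in dom i) (h p * divergence i X p).
  rewrite -RintegralZl// -RintegralD//; last exact: (integrableZl mD a Ef).
  by apply: eq_Rintegral => p _; rewrite (_ : (a *: f + h) p = a * f p + h p)//; ring.
have := field_pair_integral_lin a LG LH XT; rewrite /field_pair => ->.
have [_ _ _ /(_ i X XT) ->] := gG; have [_ _ _ /(_ i X XT) ->] := gH.
by ring.
Qed.

Lemma L2_gradient_grad f G : is_L2_gradient f G -> is_L2_gradient f (grad f).
Proof. by move=> gG; rewrite /grad; case: xgetP => [G' -> //|/(_ G)]. Qed.

Lemma in_W1_grad w f : in_W1 w f -> is_L2_gradient f (grad f).
Proof. by move=> [_ [G /L2_gradient_grad]]. Qed.

Lemma in_W1_field w f : in_W1 w f -> L2_field (grad f).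
Proof. by move=> /in_W1_grad/L2_gradient_field. Qed.

Lemma in_W1_lin w (a : R) f h : smooth w -> (forall p, 0 < w p) ->
  in_W1 w f -> in_W1 w h -> in_W1 w (a *: f + h).
Proof.
move=> ws w0 Wf Wh; have [Lf _] := Wf; have [Lh _] := Wh; split.
  by apply: L2_lin => //; exact: smooth_measurable.
eexists; exact: (L2_gradient_lin a ws w0 Lf Lh (in_W1_grad Wf) (in_W1_grad Wh)).
Qed.

Lemma grad_lin w (a : R) f h : smooth w -> (forall p, 0 < w p) ->
  in_W1 w f -> in_W1 w h ->
  {ae mu, forall p, grad (a *: f + h) (chart_at p) p = a *: grad f (chart_at p)
    p + grad h (chart_at p) p}.
Proof.
move=> ws w0 Wf Wh; have [Lf _] := Wf; have [Lh _] := Wh.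
have gl := L2_gradient_lin a ws w0 Lf Lh (in_W1_grad Wf) (in_W1_grad Wh).
exact: (L2_gradient_unique (in_W1_grad (in_W1_lin a ws w0 Wf Wh)) gl).
Qed.

Definition energy f h : R := \int[mu]_p inner (grad f) (grad h) p.

Lemma energyC f h : energy f h = energy h f.
Proof. by apply: eq_Rintegral => p _; exact: inner_sym. Qed.

Lemma energy_ge0 f : 0 <= energy f f.
Proof. by apply: Rintegral_ge0 => p _; exact: inner_ge0. Qed.

Lemma energy_linl w (a : R) f h u : smooth w -> (forall p, 0 < w p) ->
  in_W1 w f -> in_W1 w h -> in_W1 w u ->
  energy (a *: f + h) u = a * energy f u + energy h u.
Proof.
move=> ws w0 Wf Wh Wu.
have Lf := in_W1_field Wf; have Lh := in_W1_field Wh; have Lu := in_W1_field Wu.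
have Wl := in_W1_lin a ws w0 Wf Wh.
rewrite /energy -RintegralZl//; last exact: (inner_integrable Lf Lu).
rewrite -RintegralD//; last 2 first.
- exact: (integrableZl measurableT a (inner_integrable Lf Lu)).
- exact: (inner_integrable Lh Lu).
apply: Rintegral_ae => //.
- exact: (measurable_inner (in_W1_field Wl) Lu).
- apply: measurable_funD; last exact: (measurable_inner Lh Lu).
  by apply: measurable_funM => //; exact: (measurable_inner Lf Lu).
have := grad_lin a ws w0 Wf Wh.
apply: (@filterS _ _ (ae_filter_ringOfSetsType mu)) => p gp _.
by rewrite (inner_lin _ gp).
Qed.

End Gradient.

Local Notation form := Defs.form.

(** * The energy form and truncation *)

Lemma Rintegral_le d (T : measurableType d) (R : realType) (mu : {measure set T -> \bar R})
    (D : set T) (f g : T -> R) : measurable D -> mu.-integrable D (EFin \o f) ->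
  mu.-integrable D (EFin \o g) -> (forall x, D x -> f x <= g x) ->
  \int[mu]_(x in D) f x <= \int[mu]_(x in D) g x.
Proof.
move=> mD fi gi fg; apply: fine_le; [exact: integrable_fin_num|exact: integrable_fin_num|].
by apply: (le_integral mD fi gi) => x; rewrite inE => Dx; rewrite lee_fin fg.
Qed.

Lemma pos_part_lipschitz (R : realDomainType) (a b c : R) :
  `|Num.max (a - c) 0 - Num.max (b - c) 0| <= `|a - b|.
Proof.
case: (leP (a - c) 0) => ac; case: (leP (b - c) 0) => bc.
- by rewrite subrr normr0.
- by rewrite sub0r normrN (gtr0_norm bc) distrC (le_trans _ (ler_norm _))//; lra.
- by rewrite subr0 (gtr0_norm ac) (le_trans _ (ler_norm _))//; lra.
- by rewrite opprB addrA subrK.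
Qed.

Section TestFunctions.
Context {R : realType} {n : nat} (M : weightedManifold R n).
Local Notation E := 'rV[R]_n.
Local Notation mu := (mu M).
Local Notation field := (chart_index M -> M -> E).
Implicit Types (i j : chart_index M) (p q : M) (phi psi f h u : M -> R).

(** [inner] evaluates at p in the chart [chart_at p], which may jump from point to point; near p
    chart independence allows a single chart. *)
Lemma inner_test_continuous phi psi : smooth phi -> smooth psi ->
  continuous (inner (test_grad phi) (test_grad psi)).
Proof.
move=> phis psis p; have ip := dom_chart_at p; set i := chart_at p in ip.
have oc := @open_codom _ _ M i.
pose F x := \sum_k partial k (phi \o param i) x * test_grad psi i (param i x) 0 k.
have FC : Cn 0 (codom i) F.
  apply: Cn_sum => // k; apply: Cn_mul => //; first exact: Cn_partial_param.
  exact: Cn_test_grad.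
have eqn : \forall q \near p, (F \o coord i) q = inner (test_grad phi) (test_grad psi) q.
  have : nbhs p (dom i) by apply: open_nbhs_nbhs; split => //; exact: dom_open.
  apply: filterS => q iq; rewrite (test_grad_inner phis (test_grad_vector_field psis) iq) /F/=.
  by apply: eq_bigr => k _; rewrite coordK.
apply: (cvg_trans (near_eq_cvg eqn)).
rewrite -(nbhs_singleton eqn); exact: (continuous_coord_comp FC ip).
Qed.

Lemma inner_test_supp phi (Y : field) p : smooth phi -> is_vector_field Y -> ~ supp phi p ->
  inner (test_grad phi) Y p = 0.
Proof.
move=> phis VY np; rewrite (test_grad_inner phis VY (dom_chart_at p)) big1// => k _.
by rewrite chart_partial_supp ?mul0r//; exact: dom_chart_at.
Qed.

Lemma test_L2_gradient phi : test_function phi -> is_L2_gradient phi (test_grad phi).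
Proof.
move=> [phis cphi]; have VY := test_grad_vector_field phis.
split => //; first by move=> i k; exact: measurable_test_grad.
- have Hi := continuous_compact_integrable cphi (inner_test_continuous phis phis)
    (fun p => @inner_test_supp phi _ p phis VY).
  have [_] := integrableP _ _ _ Hi; apply: le_lt_trans; apply: ge0_le_integral => //.
  + by move=> p _; rewrite lee_fin inner_ge0.
  + exact: (measurable_int _ Hi).
  + by apply: measurableT_comp => //; exact: (measurable_int _ Hi).
  + by move=> p _; rewrite lee_fin ler_norm.
- move=> i X XT; have [lam lamP lamE] := chart_integral M.
  exact: (test_grad_parts_chart lamP lamE phis XT).
Qed.

Lemma compact_L2 w f (K : set M) (C : R) : smooth w -> (forall p, 0 < w p) -> compact K ->
  measurable_fun [set: borel M] (f : borel M -> R) -> (forall p, `|f p| <= C) ->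
  (forall p, ~ K p -> f p = 0) -> in_L2 w f.
Proof.
move=> ws w0 cK mf fC f0.
have mw := smooth_measurable ws.
have mK : measurable (K : set (borel M)).
  by apply: closed_measurable_borel; exact: compact_closed_M.
have C0 : 0 <= C by exact: le_trans (fC point).
have : bounded_set (w @` K).
  apply: compact_bounded; apply: continuous_compact => //.
  by apply: continuous_subspaceT; exact: smooth_continuous.
move=> [C1 [_ /(_ (`|C1| + 1))]]; rewrite (le_lt_trans (ler_norm _)) ?ltrDl// => /(_ isT) wC.
apply: integrable_L2 => //.
apply: (@compact_support_integrable _ _ M (fun p => f p * f p * w p) K (C * C * (`|C1| + 1))) => //.
- by apply: measurable_funM => //; apply: measurable_funM.
- by move=> p nK; rewrite f0// !mul0r.
move=> p; case: (pselect (K p)) => Kp.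
  rewrite !normrM; apply: ler_pM => //; first exact: ler_pM.
  by apply: wC; exists p.
by rewrite f0// !mul0r normr0 mulr_ge0// ?addr_ge0// mulr_ge0.
Qed.

Lemma test_L2 w phi : smooth w -> (forall p, 0 < w p) -> test_function phi -> in_L2 w phi.
Proof.
move=> ws w0 [phis cphi].
have [C phiC] := compact_support_bounded cphi (smooth_continuous phis) (@supp_neq0 _ _ M phi).
exact: (compact_L2 ws w0 cphi (smooth_measurable phis) phiC (@supp_neq0 _ _ M phi)).
Qed.

Lemma test_W1 w phi : smooth w -> (forall p, 0 < w p) -> test_function phi -> in_W1 w phi.
Proof.
by move=> ws w0 pT; split; [exact: test_L2|exists (test_grad phi); exact: test_L2_gradient].
Qed.

Lemma test_energy phi (G : field) : test_function phi -> L2_field G ->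
  \int[mu]_p inner (grad phi) G p = \int[mu]_p inner (test_grad phi) G p.
Proof.
move=> pT LG; have gT := test_L2_gradient pT; have gG := L2_gradient_grad gT.
have LT := L2_gradient_field gT; have Lg := L2_gradient_field gG.
apply: Rintegral_ae => //; [exact: (measurable_inner Lg LG)|exact: (measurable_inner LT LG)|].
have := L2_gradient_unique gG gT.
by apply: (@filterS _ _ (ae_filter_ringOfSetsType mu)) => p gp _; rewrite /inner gp.
Qed.

Lemma test_energy2 phi psi : test_function phi -> test_function psi ->
  energy phi psi = \int[mu]_p inner (test_grad phi) (test_grad psi) p.
Proof.
move=> pT sT; rewrite /energy test_energy//; last first.
  exact: L2_gradient_field (L2_gradient_grad (test_L2_gradient sT)).
have LT := L2_gradient_field (test_L2_gradient pT).
transitivity (\int[mu]_p inner (grad psi) (test_grad phi) p).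
  by apply: eq_Rintegral => p _; exact: inner_sym.
by rewrite (test_energy sT LT); apply: eq_Rintegral => p _; exact: inner_sym.
Qed.

Lemma test0 : test_function (0 : M -> R).
Proof.
apply: (@test_function_sub _ _ M _ set0) => //; first exact: (@smooth_cst _ _ M 0).
exact: compact0.
Qed.

Lemma formE V f h : form V f h = energy f h + L2_dot V f h.
Proof. by []. Qed.

Section Weight.
Variable w : M -> R.
Hypotheses (ws : smooth w) (w0 : forall p, 0 < w p).

Lemma L2w_0 : in_L2 w (0 : M -> R).
Proof. exact: L2_0. Qed.

Lemma L2w_lin (a : R) f h : in_L2 w f -> in_L2 w h -> in_L2 w (a *: f + h).
Proof. by apply: L2_lin => //; exact: smooth_measurable. Qed.

Lemma L2w_dotC f h : L2_dot w f h = L2_dot w h f.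
Proof. exact: dotC. Qed.

Lemma L2w_dot_linl (a : R) f h u : in_L2 w f -> in_L2 w h -> in_L2 w u ->
  L2_dot w (a *: f + h) u = a * L2_dot w f u + L2_dot w h u.
Proof. by apply: dot_linl => //; exact: smooth_measurable. Qed.

Lemma L2w_dot_ge0 f : 0 <= L2_dot w f f.
Proof. exact: dot_ge0. Qed.

Lemma in_W1_0 : in_W1 w (0 : M -> R).
Proof. exact: test_W1 test0. Qed.

Lemma in_W1_linw (a : R) f h : in_W1 w f -> in_W1 w h -> in_W1 w (a *: f + h).
Proof. exact: in_W1_lin. Qed.

Lemma form_linl (a : R) f h u : in_W1 w f -> in_W1 w h -> in_W1 w u ->
  form w (a *: f + h) u = a * form w f u + form w h u.
Proof.
move=> Wf Wh Wu; rewrite !formE (energy_linl a ws w0 Wf Wh Wu).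
have [[Lf _] [Lh _] [Lu _]] := And3 Wf Wh Wu.
rewrite (L2w_dot_linl a Lf Lh Lu).
by move: (energy f u) (energy h u) (L2_dot w f u) (L2_dot w h u) => x y z t; ring.
Qed.

Lemma formC f h : form w f h = form w h f.
Proof. by rewrite !formE energyC L2w_dotC. Qed.

Lemma form_ge0 f : 0 <= form w f f.
Proof. by rewrite formE addr_ge0//; [exact: energy_ge0|exact: L2w_dot_ge0]. Qed.

Lemma W1_normE f : W1_norm w f = nrm (form w) f.
Proof.
by rewrite /W1_norm /nrm /form; congr (Num.sqrt (_ + _)); apply: eq_Rintegral => p _; rewrite expr2.
Qed.

Lemma test_W10 phi : test_function phi -> in_W10 w phi.
Proof.
move=> pT; split; first exact: test_W1.
move=> e e0; exists phi => //.
have -> : phi \- phi = 0 by apply/funext => p /=; rewrite subrr.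
(* [grad 0] is a selected gradient, so the norm of 0 is seen to vanish through linearity of the form
   and not by computation. *)
rewrite W1_normE /nrm -(scale0r (0 : M -> R)) -[X in form w X]addr0.
have h := form_linl 0 in_W1_0 in_W1_0 in_W1_0.
have -> : form w (0 *: 0 + 0) (0 *: 0) = 0.
  have := form_linl (-1) in_W1_0 in_W1_0 in_W1_0.
  by rewrite !scaler0 !addr0 => ->; ring.
by rewrite sqrtr0.
Qed.

Lemma in_W10_lin (a : R) f h : in_W10 w f -> in_W10 w h -> in_W10 w (a *: f + h).
Proof.
move=> [Wf fd] [Wh hd]; split; first exact: in_W1_lin.
move=> e e0.
have a0 : 0 < 2 * (`|a| + 1) by rewrite mulr_gt0// ltr_wpDl.
have [phi pT pf] := fd (e / (2 * (`|a| + 1))) (divr_gt0 e0 a0).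
have [psi sT sh] := hd (e / 2) (divr_gt0 e0 (ltr0Sn _ 1)).
exists (a *: phi + psi); first exact: test_function_comb.
have Wp := test_W1 ws w0 pT; have Wq := test_W1 ws w0 sT.
have -> : (a *: f + h) \- (a *: phi + psi) = a *: (f - phi) + (h - psi).
  by apply/funext => p; rewrite !fctE /GRing.scale/=; ring.
rewrite W1_normE in pf *; rewrite W1_normE in sh.
have W1 := hB in_W1_0 in_W1_linw Wf Wp; have W2 := hB in_W1_0 in_W1_linw Wh Wq.
have W3 := hZ in_W1_0 in_W1_linw a W1.
have := nrmD in_W1_0 in_W1_linw formC form_linl form_ge0 W3 W2.
rewrite (nrmZ in_W1_0 in_W1_linw formC form_linl)// => H.
apply: (le_lt_trans H).
have -> : e = e / 2 + e / 2 by field.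
apply: ler_ltD => //.
have : `|a| * nrm (form w) (f - phi) <= (`|a| + 1) * (e / (2 * (`|a| + 1))).
  by apply: ler_pM => //; [exact: sqrtr_ge0|rewrite lerDl|exact: ltW].
suff -> : (`|a| + 1) * (e / (2 * (`|a| + 1))) = e / 2 by [].
by field; rewrite gt_eqF// ltr_wpDl.
Qed.

Lemma in_W10_0 : in_W10 w (0 : M -> R).
Proof. exact: test_W10 test0. Qed.

Lemma W10_approx u (e : R) : in_W10 w u -> 0 < e ->
  exists2 phi, test_function phi &
    nrm (@energy _ _ M) (u - phi) < e /\ nrm (L2_dot w) (u - phi) < e.
Proof.
move=> [Wu ud] e0; have [phi pT H] := ud e e0; exists phi => //.
rewrite W1_normE in H; split; apply: le_lt_trans H; rewrite /nrm ler_wsqrtr// formE.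
  by rewrite lerDl; exact: L2w_dot_ge0.
by rewrite lerDr; exact: energy_ge0.
Qed.

Lemma energy_linlw (a : R) f h u : in_W1 w f -> in_W1 w h -> in_W1 w u ->
  energy (a *: f + h) u = a * energy f u + energy h u.
Proof. exact: energy_linl. Qed.

Local Opaque energy L2_dot.

(** Pointwise, c^2 <= c and c^2 <= 1 for c in [0, 1]. It is applied to a truncation, where c is the
    derivative of the truncating function. *)
Lemma test_energy_norm phi psi : test_function phi -> test_function psi ->
  (forall p, exists2 c : R, 0 <= c <= 1 &
    test_grad phi (chart_at p) p = c *: test_grad psi (chart_at p) p) ->
  energy phi phi <= energy psi phi /\ energy phi phi <= energy psi psi.
Proof.
move=> pT sT H.
have LP := L2_gradient_field (test_L2_gradient pT).
have LS := L2_gradient_field (test_L2_gradient sT).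
rewrite (test_energy2 pT pT) (test_energy2 sT pT) (test_energy2 sT sT).
have i11 := inner_integrable LP LP; have i12 := inner_integrable LS LP.
have i22 := inner_integrable LS LS.
have E0 p : exists2 c : R, 0 <= c <= 1 &
    inner (test_grad phi) (test_grad phi) p = c * (c * inner (test_grad psi) (test_grad psi) p) /\
    inner (test_grad psi) (test_grad phi) p = c * inner (test_grad psi) (test_grad psi) p.
  have [c c01 cE] := H p; exists c => //.
  have L W : inner (test_grad phi) W p = c * inner (test_grad psi) W p.
    by rewrite /inner cE -!scalemxAl mxE.
  by rewrite (inner_sym (test_grad psi) (test_grad phi)) !L (inner_sym (test_grad psi) (test_grad phi)) L.
have S p : 0 <= inner (test_grad psi) (test_grad psi) p by exact: inner_ge0.
split; [apply: (Rintegral_le measurableT i11 i12) => p _|apply: (Rintegral_le measurableT i11 i22)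
  => p _].
  have [c /andP[c0 c1] [-> ->]] := E0 p; have Sp := S p.
  by rewrite ler_piMl// mulr_ge0.
have [c /andP[c0 c1] [-> _]] := E0 p; have Sp := S p.
by rewrite mulrA ler_piMl// mulr_ile1.
Qed.

Section SmoothTruncation.
Variables (c e : R).
Hypotheses (c0 : 0 <= c) (e0 : 0 < e).

(* A smooth version of (s - c)^+, normalized to vanish at 0 so that it preserves compact supports. *)
Definition smooth_trunc (s : R) : R :=
  2^-1 * (s + Num.sqrt ((s - c) * (s - c) + e * e) - Num.sqrt (c * c + e * e)).

Let pos (s : R) : 0 < s * s + e * e.
Proof. by rewrite ltr_wpDl// ?mulr_gt0// -expr2 sqr_ge0. Qed.

Lemma smooth_trunc0 : smooth_trunc 0 = 0.
Proof. by rewrite /smooth_trunc sub0r mulrNN add0r subrr mulr0. Qed.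

Lemma sqrt_near_abs (a : R) : `|a| <= Num.sqrt (a * a + e * e) <= `|a| + e.
Proof.
have a0 := normr_ge0 a.
have aa : a * a = `|a| * `|a| by rewrite -normrM ger0_norm// -expr2 sqr_ge0.
apply/andP; split.
  rewrite -[leLHS]sqrtr_sqr ler_wsqrtr// expr2 lerDl mulr_ge0// ltW//.
rewrite -[leRHS]ger0_norm; last by rewrite addr_ge0// ltW.
rewrite -sqrtr_sqr ler_wsqrtr// aa expr2; have := ltW e0; nra.
Qed.

Lemma smooth_trunc_near (s : R) : `|smooth_trunc s - Num.max (s - c) 0| <= e.
Proof.
have /andP[h1 h2] := sqrt_near_abs (s - c); have /andP[h3 h4] := sqrt_near_abs c.
rewrite (ger0_norm c0) in h3 h4; rewrite /smooth_trunc.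
set A := Num.sqrt ((s - c) * (s - c) + e * e) in h1 h2 *.
set B := Num.sqrt (c * c + e * e) in h3 h4 *.
rewrite ler_norml; case: (leP (s - c) 0) => sc.
  rewrite (ler0_norm sc) in h1 h2.
  by apply/andP; split; lra.
rewrite (gtr0_norm sc) in h1 h2.
by apply/andP; split; lra.
Qed.

Definition smooth_trunc' (s : R) : R :=
  2^-1 * (1 + (s - c) / Num.sqrt ((s - c) * (s - c) + e * e)).

Lemma smooth_trunc'_itv (s : R) : 0 <= smooth_trunc' s <= 1.
Proof.
have /andP[h1 _] := sqrt_near_abs (s - c); rewrite /smooth_trunc'.
set A := Num.sqrt _ in h1 *.
have A0 : 0 < A by rewrite /A sqrtr_gt0 pos.
have : `|(s - c) / A| <= 1.
  by rewrite normrM normfV (gtr0_norm A0) ler_pdivrMr// mul1r.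
by rewrite ler_norml => /andP[h2 h3]; apply/andP; split; lra.
Qed.

Lemma is_derive_smooth_trunc (s : R) : is_derive s 1 smooth_trunc (smooth_trunc' s).
Proof.
have H : is_derive s 1 (fun s : R => 2^-1 * (s + Num.sqrt ((s - c) * (s - c) + e * e)
  - Num.sqrt (c * c + e * e)))
  (smooth_trunc' s).
  pose q (s : R) := (s - c) * (s - c) + e * e.
  have dl : is_derive s 1 (fun s : R => s - c) (1 - 0) by exact: is_deriveB.
  have dq : is_derive s 1 q ((s - c) *: (1 - 0 : R) + (s - c) *: (1 - 0 : R) + 0).
    by apply: is_deriveD; exact: is_deriveM.
  have ds := @is_derive1_comp _ Num.sqrt q s _ _ (is_derive1_sqrt (pos (s - c))) dq.
  have H := @is_deriveZ _ _ _ _ 2^-1 _ _ _ (is_deriveB (is_deriveD (is_derive_id s 1) ds)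
    (is_derive_cst (Num.sqrt (c * c + e * e)) s 1)).
  rewrite (_ : smooth_trunc' s = 2^-1 *: (1 + (2 * Num.sqrt ((s - c) * (s - c) + e * e))^-1 *
    ((s - c) *: (1 - 0 : R) + (s - c) *: (1 - 0 : R) + 0) - 0)); first exact: H.
  rewrite /smooth_trunc' /GRing.scale/=.
  have A0 : Num.sqrt ((s - c) * (s - c) + e * e) != 0 by rewrite gt_eqF// sqrtr_gt0 pos.
  by field.
exact: H.
Qed.

Lemma smooth_trunc_test phi : test_function phi -> test_function (smooth_trunc \o phi).
Proof.
move=> [phis cphi]; have sc := smoothB phis (@smooth_cst _ _ M c).
have sq : smooth (fun p => Num.sqrt ((phi p - c) * (phi p - c) + e * e)).
  apply: smooth_sqrt => [|p]; last exact: pos.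
  exact: (smoothD (smoothM sc sc) (@smooth_cst _ _ M (e * e))).
have ss := smoothZ 2^-1 (smoothB (smoothD phis sq) (@smooth_cst _ _ M (Num.sqrt (c * c + e * e)))).
apply: (@test_function_sub _ _ M (smooth_trunc \o phi) (supp phi)) => //.
by move=> p np; rewrite /= (supp_neq0 np) smooth_trunc0.
Qed.

Lemma smooth_trunc_grad phi i p : test_function phi -> dom i p ->
  test_grad (smooth_trunc \o phi) i p = smooth_trunc' (phi p) *: test_grad phi i p.
Proof.
move=> [phis cphi] ip; rewrite /test_grad scalemxAl; congr (_ *m _).
apply/rowP => k; rewrite !mxE /chart_partial.
have /smoothP/(_ i 1%N) pC := phis.
have d := Cn_is_derive k pC (codom_coord ip).
have E1 : phi p = (phi \o param i) (coord i p) by rewrite /= coordK.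
have := is_derive_comp1 (is_derive_smooth_trunc ((phi \o param i) (coord i p))) d.
by rewrite E1 => -[_ H]; rewrite [LHS]H.
Qed.

End SmoothTruncation.

Lemma indic_compact_L2 (K : set M) : compact K -> in_L2 w (\1_(K : set (borel M)) : M -> R).
Proof.
move=> cK; have mK : measurable (K : set (borel M)).
  by apply: closed_measurable_borel; exact: compact_closed_M.
apply: (@compact_L2 w _ K 1) => //.
  by move=> p; rewrite indicE; case: (_ \in _); rewrite /= ?normr1 ?normr0.
by move=> p nK; rewrite indicE memNset.
Qed.

Lemma pos_part_L2 (c : R) u : 0 <= c -> in_L2 w u -> in_L2 w (fun p => Num.max (u p - c) 0).
Proof.
move=> c0 Lu; refine (@L2_dominated _ _ _ mu w (smooth_measurable ws) w0 _ u _ Lu _).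
  apply: measurable_maxr => //; apply: measurable_funB => //; by case: Lu.
move=> p; case: (leP (u p - c) 0) => h; first by rewrite normr0.
by rewrite (gtr0_norm h) (le_trans _ (ler_norm _))// lerBlDr lerDl.
Qed.

Lemma L2_norm_le f h : in_L2 w f -> in_L2 w h -> (forall p, `|f p| <= `|h p|) ->
  nrm (L2_dot w) f <= nrm (L2_dot w) h.
Proof.
move=> Lf Lh fh; rewrite /nrm ler_wsqrtr//; apply: dot_le => //; first exact: smooth_measurable.
apply: (@aeW _ _ _ mu) => p.
have sq (x : R) : x * x = `|x| * `|x| by rewrite -normrM ger0_norm// -expr2 sqr_ge0.
by rewrite sq [leRHS]sq ler_pM.
Qed.

(* Passing from test functions to [z] loses the equality energy z z^+ = energy z^+ z^+; only this
   one-sided inequality survives. *)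
Lemma W10_trunc (c : R) z (e : R) : 0 <= c -> in_W10 w z -> 0 < e ->
  exists2 phi, test_function phi &
    nrm (L2_dot w) (phi - (fun p => Num.max (z p - c) 0)) < e /\
    energy phi phi - e <= energy z phi.
Proof.
move=> c0 Wz e0; pose N := nrm (@energy _ _ M) z.
have N0 : 0 <= N by exact: sqrtr_ge0.
(* d <= 1 keeps the energy norm of the approximant below N + 1; the other bound makes both d and d
   (N + 1) small against e. *)
pose d := Num.min 1 (e / (2 * (N + 2))).
have N2 : 0 < 2 * (N + 2) by rewrite mulr_gt0// ltr_wpDl.
have d0 : 0 < d by rewrite lt_min ltr01/= divr_gt0.
have d1 : d <= 1 by rewrite ge_min lexx.
have dN : d * (N + 2) <= e / 2.
  have : d <= e / (2 * (N + 2)) by rewrite ge_min lexx orbT.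
  by rewrite ler_pdivlMr// => h; lra.
have [eta eT [eE eL]] := W10_approx Wz d0.
have [Wz1 _] := Wz; have We := test_W1 ws w0 eT.
have [Lz _] := Wz1; have [Le _] := We.
have cK : compact (supp eta) by case: eT.
have LK := indic_compact_L2 cK.
set K : set (borel M) := supp eta in LK.
pose m := nrm (L2_dot w) (\1_K : M -> R).
have m0 : 0 <= m by exact: sqrtr_ge0.
(* The smooth truncation differs from the positive part by at most ep, and only on the support K of
   eta, so the L^2 error is at most ep m <= e / 2. *)
pose ep := e / (2 * (m + 1)).
have ep0 : 0 < ep by rewrite divr_gt0// mulr_gt0// ltr_wpDl.
exists (smooth_trunc c ep \o eta); first exact: smooth_trunc_test.
have pT := smooth_trunc_test c ep0 eT; set phi := smooth_trunc c ep \o eta in pT *.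
have Wp := test_W1 ws w0 pT; have [Lp _] := Wp.
have [h1 h2] := test_energy_norm pT eT (fun p =>
  ex_intro2 _ _ (smooth_trunc' c ep (eta p)) (smooth_trunc'_itv c ep0 (eta p))
    (smooth_trunc_grad c ep0 eT (dom_chart_at p))).
split.
  pose ze := fun p => Num.max (eta p - c) 0.
  pose zz := fun p => Num.max (z p - c) 0.
  have Lze := pos_part_L2 c0 Le; have Lzz := pos_part_L2 c0 Lz.
  have -> : phi - zz = (phi - ze) + (ze - zz) by rewrite addrA subrK.
  have B1 := hB L2w_0 L2w_lin Lp Lze; have B2 := hB L2w_0 L2w_lin Lze Lzz.
  apply: (le_lt_trans (nrmD L2w_0 L2w_lin L2w_dotC L2w_dot_linl L2w_dot_ge0 B1 B2)).
  have -> : e = e / 2 + e / 2 by field.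
  apply: ler_ltD.
    apply: (@le_trans _ _ (nrm (L2_dot w) (ep *: (\1_K : M -> R)))).
      apply: L2_norm_le => //; first exact: hZ L2w_0 L2w_lin _ _ LK.
      move=> p; have -> : (ep *: (\1_K : M -> R)) p = ep * \1_K p by [].
      have -> : (phi - ze) p = smooth_trunc c ep (eta p) - Num.max (eta p - c) 0 by [].
      rewrite indicE; case: (pselect (K p)) => Kp.
        by rewrite mem_set// mulr1 (gtr0_norm ep0) smooth_trunc_near.
      rewrite memNset// mulr0 (supp_neq0 Kp) smooth_trunc0 sub0r.
      by rewrite sub0r max_r ?oppr_le0// oppr0.
    rewrite (nrmZ L2w_0 L2w_lin L2w_dotC L2w_dot_linl)// (gtr0_norm ep0) -/m /ep.
    have arith (x : R) : 0 <= x -> e / (2 * (x + 1)) * x <= e / 2.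
      clear -ws w0 e0 => x0; have x1 : 0 < 2 * (x + 1) by lra.
      by rewrite mulrAC ler_pdivrMr//; nra.
    exact: arith.
  apply: (@le_lt_trans _ _ (nrm (L2_dot w) (z - eta))).
    apply: (L2_norm_le B2 (hB L2w_0 L2w_lin Lz Le)) => p;
      have -> : (ze - zz) p = Num.max (eta p - c) 0 - Num.max (z p - c) 0 by [].
    have -> : (z - eta) p = z p - eta p by [].
    rewrite (distrC (z p)).
    exact: pos_part_lipschitz.
  have arith (x y : R) : 0 < x -> 0 <= y -> x * (y + 2) <= e / 2 -> x <= e / 2 by clear -ws w0; nra.
  exact: (lt_le_trans eL (arith _ _ d0 N0 dN)).
(* The part with eta is at least the energy of phi by [test_energy_norm]; the part with z - eta
   costs at most d (N + 1). *)
have e1 : energy z phi = energy (z - eta) phi + energy eta phi.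
  have := dotBl in_W1_0 in_W1_linw energy_linlw Wz1 We Wp.
  by move=> ->; rewrite subrK.
have Wze := hB in_W1_0 in_W1_linw Wz1 We.
have := dot_le_nrm in_W1_0 in_W1_linw (@energyC _ _ M) energy_linlw (@energy_ge0 _ _ M) Wze Wp.
rewrite ler_norml => /andP[h3 _].
have h4 : nrm (@energy _ _ M) phi <= N + 1.
  apply: (@le_trans _ _ (nrm (@energy _ _ M) eta)); first exact: (ler_wsqrtr h2).
  rewrite (_ : eta = z - (z - eta)); last by rewrite opprB addrC subrK.
  apply: (le_trans (nrmB in_W1_0 in_W1_linw (@energyC _ _ M) energy_linlw (@energy_ge0 _ _ M) Wz1 Wze)).
  by rewrite lerD2l (le_trans (ltW eE)).
have h5 : nrm (@energy _ _ M) (z - eta) * nrm (@energy _ _ M) phi <= d * (N + 1).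
  exact: (ler_pM (sqrtr_ge0 _) (sqrtr_ge0 _) (ltW eE) h4).
have dN1 : d * (N + 1) <= e.
  have arith (x y : R) : 0 < x -> x * (y + 2) <= e / 2 -> 0 < e -> x * (y + 1) <= e by clear -ws w0; nra.
  exact: arith.
rewrite e1.
have arith (x y a b D : R) : - a <= x -> a <= D -> D <= e -> b <= y -> b - e <= x + y by clear -ws
  w0; lra.
exact: (arith _ _ _ _ _ h3 h5 dN1 h1).
Qed.

Lemma le0_eps (x C : R) : 0 <= C -> (forall e : R, 0 < e -> x <= C * e) -> x <= 0.
Proof.
move=> C0 H; rewrite leNgt; apply/negP => x0.
have C1 : 0 < 2 * (C + 1) by rewrite mulr_gt0// ltr_wpDl.
have := H (x / (2 * (C + 1))) (divr_gt0 x0 C1).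
rewrite mulrA ler_pdivlMr// => h; nra.
Qed.

(** Formally the pairing is the energy of u against (u - c)^+, which is nonnegative. With the
    approximants of [W10_trunc] it is at least - (|b| + 1) e for every e > 0. *)
Lemma W10_trunc_test_ge0 (c : R) u b : 0 <= c -> in_W10 w u -> in_L2 w b ->
  (forall phi, test_function phi -> energy u phi = L2_dot w b phi) ->
  0 <= L2_dot w b (fun p => Num.max (u p - c) 0).
Proof.
move=> c0 Wu Lb H; have [[Lu _] _] := Wu.
rewrite -oppr_le0; apply: (@le0_eps _ (nrm (L2_dot w) b + 1)).
  by rewrite addr_ge0// sqrtr_ge0.
move=> e e0; have [phi pT [h1 h2]] := W10_trunc c0 Wu e0.
have Lp := test_L2 ws w0 pT; have Lv := pos_part_L2 c0 Lu.
set v := (fun p => _) in h1 Lv *.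
have := dot_le_nrm L2w_0 L2w_lin L2w_dotC L2w_dot_linl L2w_dot_ge0 Lb (hB L2w_0 L2w_lin Lp Lv).
rewrite (dotBr L2w_0 L2w_lin L2w_dotC L2w_dot_linl Lp Lv Lb) -H// ler_norml => /andP[_ h3].
have h4 : nrm (L2_dot w) b * nrm (L2_dot w) (phi - v) <= nrm (L2_dot w) b * e.
  by apply: ler_wpM2l; [exact: sqrtr_ge0|exact: ltW].
have arith (x y z t N : R) : 0 <= x -> x - e <= y -> y - z <= t -> t <= N * e -> - z <= (N + 1) * e.
  by clear -ws w0; rewrite mulrDl mul1r; lra.
exact: (arith _ _ _ _ _ (energy_ge0 phi) h2 h3 h4).
Qed.

End Weight.

End TestFunctions.

(** * Solutions of the resolvent equation *)

Section L2Facts.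
Context {R : realType} {n : nat} (M : weightedManifold R n).
Local Notation mu := (mu M).
Implicit Types (f h : M -> R).
Variable w : M -> R.
Hypotheses (ws : smooth w) (w0 : forall p, 0 < w p).

Lemma L2w_dot_le f g f' g' : in_L2 w f -> in_L2 w g -> in_L2 w f' -> in_L2 w g' ->
  {ae mu, forall p, f p * g p <= f' p * g' p} -> L2_dot w f g <= L2_dot w f' g'.
Proof. by apply: dot_le => //; exact: smooth_measurable. Qed.

Lemma L2w_dot_ae f f' g : in_L2 w f -> in_L2 w f' -> in_L2 w g ->
  {ae mu, forall p, f p = f' p} -> L2_dot w f g = L2_dot w f' g.
Proof. by apply: dot_ae => //; exact: smooth_measurable. Qed.

Lemma L2w_dot_eq0 f : in_L2 w f -> L2_dot w f f = 0 -> {ae mu, forall p, f p = 0}.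
Proof. by apply: dot_eq0 => //; exact: smooth_measurable. Qed.

Lemma L2w_mul_integrable f g : in_L2 w f -> in_L2 w g ->
  mu.-integrable setT (EFin \o ((fun p => f p * g p * w p) : borel M -> R)).
Proof. by apply: L2_mul_integrable => //; exact: smooth_measurable. Qed.

Lemma L2w_dominated f g : measurable_fun [set: borel M] (f : borel M -> R) -> in_L2 w g ->
  (forall p, `|f p| <= `|g p|) -> in_L2 w f.
Proof. by apply: L2_dominated => //; exact: smooth_measurable. Qed.

Lemma L2w_eq f h : in_L2 w f -> in_L2 w h ->
  (forall phi, in_L2 w phi -> L2_dot w f phi = L2_dot w h phi) -> {ae mu, forall p, f p = h p}.
Proof.
move=> Lf Lh fh; have Ld := hB (L2w_0 w) (L2w_lin ws w0) Lf Lh.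
have := L2w_dot_eq0 Ld; rewrite (dotBl (L2w_0 w) (L2w_lin ws w0) (L2w_dot_linl ws w0) Lf Lh Ld)
  fh// subrr.
move=> /(_ erefl); apply: (@filterS _ _ (ae_filter_ringOfSetsType mu)) => p /eqP.
by rewrite subr_eq0 => /eqP.
Qed.

Lemma L2w_complete (u : nat -> M -> R) : (forall k, in_L2 w (u k)) ->
  (forall e : R, 0 < e -> exists N, forall k l, (N <= k)%N -> (N <= l)%N ->
     L2_dot w (u k - u l) (u k - u l) <= e) ->
  exists2 f, in_L2 w f & L2_dot w (u k - f) (u k - f) @[k --> \oo] --> (0 : R).
Proof. by apply: L2_complete => //; exact: smooth_measurable. Qed.

End L2Facts.

Lemma Rintegral_le_ae d (T : measurableType d) (R : realType) (mu : {measure set T -> \bar R})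
    (D : set T) (f g : T -> R) : measurable D -> mu.-integrable D (EFin \o f) ->
  mu.-integrable D (EFin \o g) -> {ae mu, forall x, D x -> f x <= g x} ->
  \int[mu]_(x in D) f x <= \int[mu]_(x in D) g x.
Proof.
move=> mD fi gi fg.
have /measurable_EFinP mf := measurable_int _ fi; have /measurable_EFinP mg := measurable_int _ gi.
have mfg := measurable_minr mf mg.
rewrite (@Rintegral_ae _ _ _ mu D f (fun x => Num.min (f x) (g x)))//; last first.
  by apply: filterS fg => x fg Dx; rewrite min_l// fg.
apply: Rintegral_le => //; last by move=> x _; rewrite ge_min lexx orbT.
have := integrableD mD (integrable_abse fi) (integrable_abse gi); apply: le_integrable => //.
  exact/measurable_EFinP.
move=> x Dx; rewrite /= lee_fin; case: (leP (f x) (g x)) => _.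
  by rewrite [leRHS]ger0_norm ?addr_ge0// lerDl.
by rewrite [leRHS]ger0_norm ?addr_ge0// lerDr.
Qed.

Lemma trunc_arith (R : realDomainType) (a b c x y z t : R) :
  a * x * z <= c * b * z -> c * z * b <= t * z * b ->
  - (y * z * a) - t * z * b <= - ((y + x) * z * a).
Proof.
move=> h1 h2; have -> : (y + x) * z * a = y * z * a + a * x * z by ring.
have : c * b * z = c * z * b by ring.
by lra.
Qed.

(** The right side is the square of y - min x c, and min x c is at most c, so it dominates the
    squared distance from y to the half-line below c. This is the inequality [J_taylor] for J x = (x
    - c)^+. *)
Lemma pos_part_taylor (R : realDomainType) (x y c : R) :
  Num.max (y - c) 0 * Num.max (y - c) 0 <=
  (Num.max (x - c) 0 + (y - x)) * (Num.max (x - c) 0 + (y - x)).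
Proof.
case: (leP (y - c) 0) => yc; first by rewrite mulr0 -expr2 sqr_ge0.
by case: (leP (x - c) 0) => xc; nra.
Qed.

Lemma L2_dotE {R : realType} {n : nat} (M : weightedManifold R n) (w f h : M -> R) :
  L2_dot w f h = \int[mu M]_p (f p * h p * w p).
Proof. by []. Qed.

Local Opaque energy L2_dot.

(** By Markov's inequality, the set where every F j is at least 1 / (k+1) has measure below any e >
    0. An index is found at each point without extracting a subsequence. *)
Lemma ae_small d (T : measurableType d) (R : realType) (mu : {measure set T -> \bar R})
    (F : nat -> T -> R) : (forall j, measurable_fun setT (F j)) -> (forall j p, 0 <= F j p) ->
  (forall e : R, 0 < e -> exists j, (\int[mu]_p (F j p)%:E <= e%:E)%E) ->
  {ae mu, forall p, forall e : R, 0 < e -> exists j, F j p < e}.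
Proof.
move=> mF F0 F_small.
have H (k : nat) : {ae mu, forall p, exists j, F j p < k.+1%:R^-1}.
  pose A := \bigcap_j [set p | k.+1%:R^-1 <= F j p].
  have mA : measurable A.
    apply: bigcap_measurable => // j _; rewrite -[X in measurable X]setTI.
    by apply: measurable_fun_le => //; exact: measurable_cst.
  exists A; split => //; last first.
    move=> p /= nH j _ /=; rewrite leNgt; apply/negP => h; apply: nH; by exists j.
  have k0 : 0 < (k.+1%:R : R)^-1 by rewrite invr_gt0.
  have bound (e : R) : 0 < e -> (mu A <= e%:E)%E.
    move=> e0; have [j Fj] := F_small (k.+1%:R^-1 * e) (mulr_gt0 k0 e0).
    have : ((k.+1%:R^-1)%:E * mu A <= (k.+1%:R^-1)%:E * e%:E)%E.
      apply: (le_trans _ Fj); rewrite -integral_cst//.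
      apply: (@le_trans _ _ (\int[mu]_(p in A) (F j p)%:E)%E).
        apply: ge0_le_integral => //.
        - by move=> p _; rewrite lee_fin ltW.
        - by apply/measurable_EFinP; exact: measurable_funTS.
        - by move=> p /(_ j I); rewrite lee_fin.
      apply: ge0_subset_integral => //; first exact/measurable_EFinP.
      by move=> p _; rewrite lee_fin.
    by rewrite lee_pmul2l// lte_fin.
  apply/eqP; rewrite eq_le measure_ge0 andbT.
  by apply/lee_addgt0Pr => e e0; rewrite add0e; exact: bound.
apply: filterS (ae_foralln H) => p Hp e e0.
have [k ke] : exists k : nat, (k.+1%:R : R)^-1 < e.
  have := near_infty_natSinv_lt (PosNum e0); move=> [N _ HN].
  by exists N; apply: HN => /=.
by have [j Fj] := Hp k; exists j; exact: lt_trans ke.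
Qed.

(** Each sequence is exceeded by the other up to e, so they have the same supremum, which is the
    limit of the monotone one. *)
Lemma interlace_cvg (R : realType) (a b : nat -> R) :
  (forall m, 0 <= a m) -> (forall m, b m <= b m.+1) ->
  (forall m (e : R), 0 < e -> exists j, a m < b j + e) ->
  (forall m (e : R), 0 < e -> exists j, b m < a j + e) ->
  (b m)%:E @[m --> \oo] --> ereal_sup (range (fun m => (Num.max 0 (a m))%:E)).
Proof.
move=> a0 b_nd ab ba.
have -> : ereal_sup (range (fun m => (Num.max 0 (a m))%:E)) = ereal_sup (range (fun m => (b m)%:E)).
  apply/eqP; rewrite eq_le; apply/andP; split; apply: ge_ereal_sup => _ [m _ <-].
    apply/lee_addgt0Pr => e e0; have [j] := ab m e e0.
    rewrite max_r// -lte_fin => /ltW/le_trans; apply; rewrite EFinD leeD2r//.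
    by apply: ereal_sup_ubound; exists j.
  apply/lee_addgt0Pr => e e0; have [j] := ba m e e0.
  rewrite -lte_fin => /ltW/le_trans; apply; rewrite EFinD leeD2r//.
  by apply: ereal_sup_ubound; exists j => //; rewrite max_r.
apply: ereal_nondecreasing_cvgn.
by apply/nondecreasing_seqP => m; rewrite lee_fin.
Qed.

(** * Extension of positive bounded operators to L^+ *)

Section Extension.
Context {R : realType} {n : nat} (M : weightedManifold R n).
Local Notation mu := (mu M).
Implicit Types (f h k u g phi : M -> R).
Variables (rho : M -> R) (S : (M -> R) -> (M -> R)) (C : R).
Hypotheses (rs : smooth rho) (r0 : forall p, 0 < rho p).
Local Notation D := (in_L2 rho).
Local Notation dot := (L2_dot rho).
Local Notation aeS := (@filterS _ _ (ae_filter_ringOfSetsType mu)).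
Local Notation aeS2 := (@filterS2 _ _ (ae_filter_ringOfSetsType mu)).
Local Notation aeS3 := (@filterS3 _ _ (ae_filter_ringOfSetsType mu)).
Hypothesis SD : forall f, D f -> D (S f).
Hypothesis S_ge0 : forall f, D f -> {ae mu, forall p, 0 <= f p} -> {ae mu, forall p, 0 <= S f p}.
Hypothesis SB : forall f h, D f -> D h -> {ae mu, forall p, S (f - h) p = S f p - S h p}.
Hypothesis S_bound : forall f, D f -> dot (S f) (S f) <= C * dot f f.
Hypothesis C0 : 0 < C.

Let ae_and (P Q : M -> Prop) : {ae mu, forall p, P p} -> {ae mu, forall p, Q p} ->
  {ae mu, forall p, P p /\ Q p}.
Proof. by apply: aeS2 => p. Qed.

Let D0 : D 0 := L2w_0 rho.
Let Dl := L2w_lin rs r0.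

Lemma ext_mono f h : D f -> D h -> {ae mu, forall p, f p <= h p} -> {ae mu, forall p, S f p <= S h p}.
Proof.
move=> Df Dh fh; have d0 : {ae mu, forall p, 0 <= (h - f) p}.
  by apply: aeS fh => p; rewrite -subr_ge0.
apply: aeS2 (SB Dh Df) (S_ge0 (hB D0 Dl Dh Df) d0) => p ->.
by rewrite subr_ge0.
Qed.

(** Pointwise, gs j eventually exceeds fs m - e because both sequences increase to f. The positive
    part of fs m - gs j is dominated by fs m, so it tends to 0 in L^2. *)
Lemma approximates_excess fs gs (f : M -> \bar R) m : approximates rho fs f -> approximates rho gs f ->
  dot (fun p => Num.max ((fs m - gs j) p - 0) 0) (fun p => Num.max ((fs m - gs j) p - 0) 0)
    @[j --> \oo] --> (0 : R).
Proof.
move=> [Lf fnd fc] [Lg gnd gc].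
pose d j p := Num.max ((fs m - gs j) p - 0) 0.
have Ld j : D (d j) by exact: (pos_part_L2 rs r0 (lexx 0) (hB D0 Dl (Lf m) (Lg j))).
have mdd j : measurable_fun [set: borel M] (fun p => d j p * d j p * rho p).
  by have /measurable_EFinP := measurable_int _ (L2w_mul_integrable rs r0 (Ld j) (Ld j)).
have iF := L2w_mul_integrable rs r0 (Lf m) (Lf m).
have := @dominated_convergence _ (borel M) R mu setT measurableT
  (fun j p => (d j p * d j p * rho p)%:E) (cst 0%E) (fun p => (fs m p * fs m p * rho p)%:E).
have -> : (fun j => dot (d j) (d j)) = (fun j => fine (\int[mu]_p (d j p * d j p * rho p)%:E)%E).
  by apply/funext => j; rewrite L2_dotE.
move=> /(_ _ _ _ iF _) [].
- by move=> j; exact/measurable_EFinP.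
- exact: measurable_cst.
- apply: aeS2 (ae_and fnd gnd) (ae_and fc gc) => p [h1 h2] [h3 h4] _.
  apply/cvg_EFin; first exact: nearW.
  rewrite -[X in _ --> X](mul0r (rho p)); apply: cvgMr_tmp.
  have dc : d j p @[j --> \oo] --> (0 : R).
    apply/cvgrPdist_le => e e0.
    have fle : ((fs m p)%:E <= f p)%E.
      apply: (cvge_ge _ h3); exists m => // j /= mj; rewrite lee_fin.
      by apply: (@homo_leq _ (fs^~ p) _ lexx le_trans) => // i; case/andP: (h1 i).
    have flt : ((fs m p - e)%:E < f p)%E.
      by apply: lt_le_trans fle; rewrite lte_fin ltrBlDr ltrDl.
    have : \forall j \near \oo, ((fs m p - e)%:E < (gs j p)%:E)%E.
      exact: (h4 _ (open_ereal_gt' flt)).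
    apply: filterS => j; rewrite lte_fin => hj.
    rewrite sub0r normrN /d subr0 !fctE.
    by case: (leP (fs m p - gs j p) 0) => hh; [rewrite normr0 ltW|rewrite gtr0_norm//; lra].
  by rewrite -[X in _ --> X](mul0r 0); exact: cvgM.
- apply: aeS2 fnd gnd => p h1 h2 j _ /=; rewrite lee_fin.
  have /andP[f0 _] := h1 m; have /andP[g0 _] := h2 j.
  rewrite ger0_norm; last by rewrite mulr_ge0 ?(ltW (r0 p))// -expr2 sqr_ge0.
  apply: ler_wpM2r; first exact: ltW.
  have dm : 0 <= d j p <= fs m p.
    by rewrite /d subr0 !fctE; case: (leP (fs m p - gs j p) 0) => hh; [rewrite lexx|rewrite ltW//=; lra].
  by case/andP: dm => dm0 dm1; exact: ler_pM.
move=> _ _ H; rewrite integral0 in H.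
by apply: (fine_cvg H).
Qed.

(** By positivity S (fs m) - S (gs j) is at most S of the positive part of fs m - gs j, and
    boundedness of S on L^2 makes this small. *)
Lemma ext_interlace fs gs (f : M -> \bar R) : approximates rho fs f -> approximates rho gs f ->
  {ae mu, forall p, forall m (e : R), 0 < e -> exists j, S (fs m) p < S (gs j) p + e}.
Proof.
move=> Fa Ga; have [Lf fnd fc] := Fa; have [Lg gnd gc] := Ga.
apply: ae_foralln => m.
pose d j p := Num.max ((fs m - gs j) p - 0) 0.
have Ld j : D (d j) by exact: (pos_part_L2 rs r0 (lexx 0) (hB D0 Dl (Lf m) (Lg j))).
have LS := SD (Lf m); have LG j := SD (Lg j).
pose v j p := Num.max ((S (fs m) - S (gs j)) p - 0) 0.
have Lv j : D (v j) by exact: (pos_part_L2 rs r0 (lexx 0) (hB D0 Dl LS (LG j))).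
have vd j : dot (v j) (v j) <= C * dot (d j) (d j).
  apply: le_trans (S_bound (Ld j)).
  have LSd := SD (Ld j); apply: (L2w_dot_le rs r0 (Lv j) (Lv j) LSd LSd).
  have Lfd := hB D0 Dl (Lf m) (Ld j).
  have dg : {ae mu, forall p, (fs m - d j) p <= gs j p}.
    apply: (@aeW _ _ _ mu) => p; rewrite !fctE /d subr0 !fctE.
    by case: (leP (fs m p - gs j p) 0) => hh; lra.
  have d0 : {ae mu, forall p, 0 <= d j p}.
    by apply: (@aeW _ _ _ mu) => p; rewrite /d le_max lexx orbT.
  apply: aeS3 (ext_mono Lfd (Lg j) dg) (SB (Lf m) (Ld j)) (S_ge0 (Ld j) d0) => p h1 h2 h3.
  rewrite h2 in h1; rewrite /v subr0 !fctE; case: (leP (S (fs m) p - S (gs j) p) 0) => hh;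
    first by rewrite mulr0 mulr_ge0.
  by apply: ler_pM; lra.
have mvv j : measurable_fun [set: borel M] (fun p => v j p * v j p * rho p).
  by have /measurable_EFinP := measurable_int _ (L2w_mul_integrable rs r0 (Lv j) (Lv j)).
have := @ae_small _ (borel M) R mu (fun j p => v j p * v j p * rho p) mvv _ _.
have vv0 j p : 0 <= v j p * v j p * rho p.
  by rewrite mulr_ge0 ?(ltW (r0 p))// -expr2 sqr_ge0.
move=> /(_ vv0) H; have {}H := H _; apply: aeS (H _) => [p Hp e e0|e e0].
  have [j] := Hp (e * e * rho p) (mulr_gt0 (mulr_gt0 e0 e0) (r0 p)).
  rewrite ltr_pM2r// => vj; exists j.
  have : v j p < e.
    by rewrite ltNge; apply/negP => ev; move: vj; rewrite ltNge (ler_pM (ltW e0) (ltW e0) ev ev).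
  by rewrite /v subr0 !fctE; case: (leP (S (fs m) p - S (gs j) p) 0) => hh; lra.
have eC : 0 < e / C by rewrite divr_gt0.
have /cvgrPdist_le/(_ _ eC)[N _ /(_ N (leqnn N))] := approximates_excess m Fa Ga.
rewrite sub0r normrN => dN; exists N.
have iv := integrable_fin_num measurableT (L2w_mul_integrable rs r0 (Lv N) (Lv N)).
rewrite -(fineK iv) lee_fin; apply: (le_trans (vd N)).
by rewrite mulrC -ler_pdivlMr//; exact: le_trans (ler_norm _) dN.
Qed.

(** The selection in [Lplus_ext] never falls back on its default: one approximating sequence gives a
    candidate, and interlacing shows that every other one has the same limit. *)
Lemma Lplus_extP fs (f : M -> \bar R) : approximates rho fs f ->
  [/\ measurable_fun [set: borel M] (Lplus_ext rho S f : borel M -> \bar R),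
    forall p, (0 <= Lplus_ext rho S f p)%E &
    forall gs, approximates rho gs f ->
      {ae mu, forall p, (S (gs m) p)%:E @[m --> \oo] --> Lplus_ext rho S f p}].
Proof.
move=> Fa; have [Lf fnd fc] := Fa.
rewrite /Lplus_ext; case: xgetP => [u _ //|].
(* S (fs m) is nonnegative only almost everywhere, while the candidate must be so at every point;
   hence the maximum with 0. *)
pose u0 (p : M) : \bar R := ereal_sup (range (fun m => (Num.max 0 (S (fs m) p))%:E)).
move=> /(_ u0) []; split.
- have -> : u0 = fun p => esups (fun m => (Num.max 0 (S (fs m) p))%:E) 0%N.
    apply/funext => p; congr ereal_sup; apply/seteqP.
    by split => [x [m _ <-]|x [m _ <-]]; exists m.
  apply: (@measurable_fun_esups _ (borel M) R setT (fun m p => (Num.max 0 (S (fs m) p))%:E)).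
  by move=> m; apply/measurable_EFinP; apply: measurable_maxr => //; case: (SD (Lf m)).
- move=> p; apply: (@le_trans _ _ (Num.max 0 (S (fs 0%N) p))%:E).
    by rewrite lee_fin le_max lexx.
  by apply: ereal_sup_ubound; exists 0%N.
move=> gs Ga; have [Lg gnd gc] := Ga.
have Sf0 : {ae mu, forall p, forall m, 0 <= S (fs m) p}.
  apply: ae_foralln => m; apply: S_ge0 => //.
  by apply: aeS fnd => p /(_ m)/andP[].
have Sgnd : {ae mu, forall p, forall m, S (gs m) p <= S (gs m.+1) p}.
  apply: ae_foralln => m; apply: ext_mono => //.
  by apply: aeS gnd => p /(_ m)/andP[].
apply: aeS2 (ae_and Sf0 Sgnd) (ae_and (ext_interlace Fa Ga) (ext_interlace Ga Fa)).
by move=> p [h1 h2] [h3 h4]; exact: interlace_cvg.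
Qed.

End Extension.

(* Duhamel gives c (e^t - 1) = W t + o(1) <= m t + o(1), and the exponential beats the line. *)
Lemma duhamel_limit (R : realType) (m : R) (c : nat -> R) (W eps : nat -> R -> R) : 0 <= m ->
  (forall n, W n 0 = 0) ->
  (forall n (s : R), 0 <= s -> is_derive s 1 (W n) (c n - eps n s + W n s)) ->
  (forall n, continuous (eps n)) -> (forall n s, 0 < s -> 0 <= eps n s <= m) ->
  (forall s, 0 < s -> eps n s @[n --> \oo] --> (0 : R)) ->
  (forall n s, 0 <= s -> `|W n s| <= m * s) ->
  forall e : R, 0 < e -> exists n, c n <= e.
Proof.
move=> m0 W0 dW ceps eps_m eps0 Wm e e0.
(* The integrating factor e^-s turns the differential equation for W into an explicit formula. *)
pose k n (s : R) := expR (- s) * eps n s.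
have ck n : continuous (k n).
  move=> s; apply: cvgM; last exact: ceps.
  apply: (@continuous_comp _ _ _ (@GRing.opp R) expR); first exact: opp_continuous.
  exact: continuous_expR.
have formula n (t : R) : 0 <= t -> c n * (1 - expR (- t)) = expR (- t) * W n t + prim (k n) t.
  move=> t0.
  refine (@derive_unique R (fun t => c n * (1 - expR (- t)))
    (fun t => expR (- t) * W n t + prim (k n) t) (fun t => c n * expR (- t)) t t0 _ _ _).
  - move=> s _; have := is_derive_expRN s => H.
    have H1 : is_derive s 1 (fun t => 1 - expR (- t)) (0 - (- expR (- s))) by exact: is_deriveB.
    have := is_deriveZ (c n) H1; by rewrite sub0r opprK.
  - move=> s s0; have := is_deriveD (is_deriveM (is_derive_expRN s) (dW n s s0))
      (is_derive_prim (ck n) (lt_le_trans (ltrN10 R) s0)).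
    move=> H; apply: (is_derive_eq H); rewrite /k /GRing.scale/=; ring.
  - by rewrite oppr0 expR0 subrr mulr0 W0 mulr0 prim0 addr0.
(* Chosen so that e t^2 / 4 = t (m + e). If c exceeded e, then c (t + t^2 / 4) would exceed m t + 2
   e t, against the upper bound m t + e t. *)
pose t := 4 * (m / e + 1).
have me : 0 <= m / e by rewrite divr_ge0// ltW.
have t0 : 0 < t by rewrite /t mulr_gt0// ltr_wpDl.
have prim_cvg : prim (k n) t @[n --> \oo] --> (0 : R).
  have k_m n s : 0 < s -> 0 <= k n s <= m.
    move=> s0; have /andP[h1 h2] := eps_m n s s0; rewrite /k mulr_ge0 ?expR_ge0//=.
    by rewrite -[m]mul1r ler_pM ?expR_ge0// expR_le1 oppr_le0 ltW.
  have := @dominated_cvg _ _ R lebesgue_measure `]0, t] (measurable_itv _)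
    (fun n s => (k n s)%:E) (cst 0%E) (fun=> m%:E).
  move=> H; have /fine_cvg/= : (\int[lebesgue_measure]_(s in `]0%R, t]) (k n s)%:E)%E
      @[n --> \oo] --> (0%:E : \bar R).
    have {H} := H; rewrite integral0; apply.
    - move=> n; apply/measurable_EFinP; apply: measurable_funTS.
      exact: continuous_measurable_fun.
    - move=> s; rewrite /= in_itv/= => /andP[s0 _]; apply/cvg_EFin; first exact: nearW.
      rewrite -[X in _ --> X](mulr0 (expR (- s))); apply: cvgM; [exact: cvg_cst|exact: eps0].
    - by [].
    - apply/integrableP; split; first exact: measurable_cst.
      rewrite integral_cst//= lebesgue_measure_itv/= lte_fin t0 -EFinD -EFinM; exact: ltry.
    - move=> n s; rewrite /= in_itv/= => /andP[s0 _].
      have /andP[h1 h2] := k_m n s s0; by rewrite lee_fin ger0_norm.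
  apply: cvg_trans; apply: near_eq_cvg; apply: nearW => n /=.
  by rewrite -(prim_int (ck n) (ltW t0)).
have et0 := expR_gt0 t.
have d0 : 0 < e * t / expR t by rewrite divr_gt0// mulr_gt0.
have := prim_cvg => /cvgrPdist_le/(_ _ d0)[N _ /(_ N (leqnn N))].
rewrite sub0r normrN => Y; exists N; rewrite leNgt; apply/negP => ce.
have := formula N t (ltW t0).
rewrite expRN => F.
have F1 : c N * (expR t - 1) = W N t + expR t * prim (k N) t.
  have -> : c N * (expR t - 1) = expR t * (c N * (1 - (expR t)^-1)) by field; rewrite lt0r_neq0.
  by rewrite F mulrDr mulrA mulfV ?mul1r// lt0r_neq0.
have YE : expR t * prim (k N) t <= e * t.
  have := le_trans (ler_norm _) Y; rewrite ler_pdivlMr// mulrC; exact.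
have WE := le_trans (ler_norm _) (Wm N t (ltW t0)).
have ex : 1 + t + t * t / 4 <= expR t.
  have h : 1 + t / 2 <= expR (t / 2) := expR_ge1Dx _.
  have -> : expR t = expR (t / 2) * expR (t / 2) by rewrite -expRD; congr expR; field.
  have -> : 1 + t + t * t / 4 = (1 + t / 2) * (1 + t / 2) by field.
  have p0 : 0 <= 1 + t / 2 by rewrite addr_ge0// divr_ge0// ltW.
  exact: ler_pM.
have Et : e * (t * t / 4) = t * (m + e) by rewrite /t; field; rewrite lt0r_neq0.
have h1 : c N * (t + t * t / 4) <= m * t + e * t.
  apply: (@le_trans _ _ (c N * (expR t - 1))).
    by rewrite ler_pM2l ?(lt_trans e0)//; move: ex; clear; lra.
  by rewrite F1 lerD.
have h2 : e * (t + t * t / 4) < c N * (t + t * t / 4).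
  by rewrite ltr_pM2r// ltr_wpDr// divr_ge0// mulr_ge0// ltW.
have et : 0 < e * t by rewrite mulr_gt0.
move: (lt_le_trans h2 h1); rewrite mulrDr Et; move: et; clear; nra.
Qed.

Lemma L2w_dot_cvg {R : realType} {n : nat} (M : weightedManifold R n) (w : M -> R)
    (N : nat -> M -> R) (f g h k : M -> R) : smooth w -> (forall p, 0 < w p) ->
  (forall j, in_L2 w (N j)) -> in_L2 w f -> in_L2 w g -> in_L2 w h -> in_L2 w k ->
  {ae mu M, forall p, forall j, `|N j p * g p| <= h p * k p} ->
  {ae mu M, forall p, N j p * g p @[j --> \oo] --> f p * g p} ->
  L2_dot w (N j) g @[j --> \oo] --> L2_dot w f g.
Proof.
move=> ws w0 LN Lf Lg Lh Lk Nhk Nf.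
have ifg := L2w_mul_integrable ws w0 Lf Lg; have ihk := L2w_mul_integrable ws w0 Lh Lk.
have := @dominated_convergence _ (borel M) R (mu M) setT measurableT
  (fun j p => (N j p * g p * w p)%:E) (fun p => (f p * g p * w p)%:E) (fun p => (h p * k p * w p)%:E).
move=> /(_ _ _ _ ihk _) [].
- by move=> j; exact: measurable_int (L2w_mul_integrable ws w0 (LN j) Lg).
- exact: measurable_int ifg.
- apply: (@filterS _ _ (ae_filter_ringOfSetsType (mu M))) Nf => p H _.
  by apply/cvg_EFin; [exact: nearW|apply: cvgMr_tmp].
- apply: (@filterS _ _ (ae_filter_ringOfSetsType (mu M))) Nhk => p H j _.
  by rewrite /= lee_fin normrM (gtr0_norm (w0 p)); apply: ler_wpM2r; [exact: ltW|exact: H].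
move=> _ _ H; rewrite L2_dotE.
have -> : (fun j => L2_dot w (N j) g) = (fun j => fine (\int[mu M]_p (N j p * g p * w p)%:E)%E).
  by apply/funext => j; rewrite L2_dotE.
apply: fine_cvg; rewrite /Rintegral fineK//; exact: (integrable_fin_num measurableT ifg).
Qed.

Lemma cvg_sum_to_one (R : realType) (a b : nat -> R) (A B : \bar R) :
  (a j)%:E @[j --> \oo] --> A -> (b j)%:E @[j --> \oo] --> B -> (0 <= A)%E -> (0 <= B)%E ->
  (A + B = 1)%E -> a j + b j @[j --> \oo] --> (1 : R).
Proof.
move=> aA bB A0 B0 AB.
have AB' : (A +? B)%E by apply: ge0_adde_def; rewrite inE.
have H := @cvgeD _ \oo _ _ _ _ _ _ AB' aA bB; rewrite AB in H.
have H' : (a j + b j)%:E @[j --> \oo] --> (1%:E : \bar R) by exact: H.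
by move/fine_cvg: H'.
Qed.

Lemma duhamel_arith (R : realType) (m x1 x2 y1 y2 y3 z : R) : x2 - z = y2 - (y1 + y3) ->
  x1 - x2 = m - z - (m - x1 - y3) + (y1 - y2).
Proof. lra. Qed.

(** * Weak maximum principle for the resolvent equation *)

Section Solutions.
Context {R : realType} {n : nat} (M : weightedManifold R n).
Local Notation mu := (mu M).
Implicit Types (u v z b phi : M -> R) (K : set M).
Variable w : M -> R.
Hypotheses (ws : smooth w) (w0 : forall p, 0 < w p).
Local Notation aeS := (@filterS _ _ (ae_filter_ringOfSetsType mu)).
Local Notation aeS2 := (@filterS2 _ _ (ae_filter_ringOfSetsType mu)).
Let D0 : in_L2 w (0 : M -> R) := L2w_0 w.
Let Dl := L2w_lin ws w0.
Let dl := L2w_dot_linl ws w0.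

(* The equation u - w^-1 Lap u = 1_K on L^2(M, w mu); for w = rho + V it is also the resolvent
   equation (1 - L_{rho,V}) u = 1_K (1 + V / rho), which is how rho and V enter only through w. *)
Definition is_solution K u := in_W10 w u /\
  forall phi, test_function phi -> energy u phi = L2_dot w ((\1_K : M -> R) - u) phi.

Lemma W10_le (c : R) z b : 0 <= c -> in_W10 w z -> in_L2 w b ->
  (forall phi, test_function phi -> energy z phi = L2_dot w b phi) ->
  (forall p, c < z p -> b p <= c - z p) -> {ae mu, forall p, z p <= c}.
Proof.
move=> c0 Wz Lb zb bc; have [[Lz _] _] := Wz.
have Lv := pos_part_L2 ws w0 c0 Lz; have H := W10_trunc_test_ge0 ws w0 c0 Wz Lb zb.
set v := (fun p => _) in Lv H.
have Lnv := hN D0 Dl Lv.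
have H1 : L2_dot w b v <= L2_dot w (- v) v.
  apply: (L2w_dot_le ws w0 Lb Lv Lnv Lv); apply: (@aeW _ _ _ mu) => p; rewrite !fctE /v.
  case: (leP (z p - c) 0) => h; first by rewrite !mulr0.
  by rewrite ler_wpM2r ?(ltW h)//; move: h; rewrite subr_gt0 => /bc; rewrite opprB.
have vv : L2_dot w v v <= 0.
  by move: (le_trans H H1); rewrite (dotNl D0 dl Lv Lv) oppr_ge0.
have := L2w_dot_eq0 ws w0 Lv (le_anti (andb_true_intro (conj vv (L2w_dot_ge0 w0 v)))).
apply: aeS => p; rewrite /v -subr_le0.
by case: (leP (z p - c) 0) => // h E0; rewrite E0 ltxx in h.
Qed.

Lemma indic_itv K p : 0 <= (\1_K p : R) <= 1.
Proof. by rewrite indicE; case: (_ \in _); rewrite /= ?ler01 ?lexx. Qed.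

Lemma solution_le1 K u : compact K -> is_solution K u -> {ae mu, forall p, u p <= 1}.
Proof.
move=> cK [Wu uE]; have [[Lu _] _] := Wu.
apply: (W10_le ler01 Wu (hB D0 Dl (indic_compact_L2 ws w0 cK) Lu) uE) => p _.
by rewrite !fctE lerB//; case/andP: (indic_itv K p).
Qed.

Lemma solution_sub K K' u v phi : compact K -> compact K' -> is_solution K u -> is_solution K' v ->
  test_function phi ->
  energy (u - v) phi = L2_dot w ((\1_K : M -> R) - (\1_K' : M -> R) - (u - v)) phi.
Proof.
move=> cK cK' [Wu uE] [Wv vE] pT; have [[Lu _] _] := Wu; have [[Lv _] _] := Wv.
have LK := indic_compact_L2 ws w0 cK; have LK' := indic_compact_L2 ws w0 cK'.
have W0 := in_W1_0 ws w0; have Wl := in_W1_linw ws w0; have Wp := test_W1 ws w0 pT.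
have Lp := test_L2 ws w0 pT.
rewrite (dotBl W0 Wl (energy_linlw ws w0) (proj1 Wu) (proj1 Wv) Wp) uE// vE//.
rewrite -(dotBl D0 Dl dl (hB D0 Dl LK Lu) (hB D0 Dl LK' Lv) Lp).
by congr (L2_dot w _ phi); apply/funext => p; rewrite !fctE; ring.
Qed.

(** The maximum principle at level 0 for u - v, whose source is nonpositive. With K = K' in both
    orders it also gives uniqueness almost everywhere. *)
Lemma solution_mono K K' u v : compact K -> compact K' -> K `<=` K' ->
  is_solution K u -> is_solution K' v -> {ae mu, forall p, u p <= v p}.
Proof.
move=> cK cK' KK' us vs; have [Wu _] := us; have [Wv _] := vs.
have [[Lu _] _] := Wu; have [[Lv _] _] := Wv.
have LK := indic_compact_L2 ws w0 cK; have LK' := indic_compact_L2 ws w0 cK'.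
have Wd : in_W10 w (u - v) by exact: (hB (in_W10_0 ws w0) (in_W10_lin ws w0) Wu Wv).
have := W10_le (lexx 0) Wd (hB D0 Dl (hB D0 Dl LK LK') (hB D0 Dl Lu Lv))
  (fun phi => @solution_sub K K' u v phi cK cK' us vs).
have H p : 0 < (u - v) p -> ((\1_K : M -> R) - (\1_K' : M -> R) - (u - v)) p <= 0 - (u - v) p.
  move=> _; rewrite !fctE sub0r gerDr subr_le0 !indicE ler_nat.
  by case: (pselect (K p)) => Kp; [rewrite !mem_set//; exact: KK'|rewrite memNset].
by move=> /(_ H); apply: aeS => p; rewrite !fctE subr_le0.
Qed.

Lemma solution0 : is_solution set0 (0 : M -> R).
Proof.
split; first exact: in_W10_0.
move=> phi pT; have Wp := test_W1 ws w0 pT.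
rewrite (dot0l (in_W1_0 ws w0) (energy_linlw ws w0) Wp).
have -> : (\1_(set0 : set M) : M -> R) - 0 = 0.
  by rewrite subr0; apply/funext => p; rewrite indicE in_set0.
by rewrite (dot0l D0 dl (test_L2 ws w0 pT)).
Qed.

Lemma solution_ge0 K u : compact K -> is_solution K u -> {ae mu, forall p, 0 <= u p}.
Proof.
move=> cK us; exact: (solution_mono compact0 cK (@sub0set _ _) solution0 us).
Qed.

End Solutions.

(** * Generalized conservativeness in terms of solutions *)

Section Semigroup.
Context {R : realType} {n : nat} (M : weightedManifold R n).
Local Notation mu := (mu M).
Implicit Types (f h k u g phi : M -> R).
Variables (rho V : M -> R) (T : R -> (M -> R) -> (M -> R)).
Hypotheses (rs : smooth rho) (r0 : forall p, 0 < rho p).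
Hypotheses (Vs : smooth V) (V0 : forall p, 0 <= V p).
Hypothesis ST : is_semigroup rho V T.
Local Notation w := (rho \+ V).
Local Notation D := (in_L2 rho).
Local Notation dot := (L2_dot rho).

Lemma smooth_total : smooth w.
Proof. exact: (smoothD rs Vs). Qed.

Lemma total_gt0 p : 0 < w p.
Proof. by rewrite /= ltr_wpDr. Qed.

Let D0 : D 0 := L2w_0 rho.
Let Dl := L2w_lin rs r0.
Let dC := L2w_dotC rho.
Let dl := L2w_dot_linl rs r0.
Let dge := L2w_dot_ge0 r0.
Let cp := L2w_complete rs r0.

Let TD (t : R) f : 0 < t -> D f -> D (T t f) := @semigroup_L2 _ _ _ _ _ _ ST t f.

Let Tlin (t a : R) f h phi : 0 < t -> D f -> D h -> D phi ->
  dot (T t (a *: f + h)) phi = a * dot (T t f) phi + dot (T t h) phi.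
Proof.
move=> t0 Df Dh Dp; have Dt1 := TD t0 Df; have Dt2 := TD t0 Dh.
rewrite -(dl a Dt1 Dt2 Dp); apply: (L2w_dot_ae rs r0 (TD t0 (Dl a Df Dh)) (Dl a Dt1 Dt2) Dp).
have := semigroup_linear ST a t0 Df Dh.
by apply: (@filterS _ _ (ae_filter_ringOfSetsType mu)) => p; exact.
Qed.

Let Tsym (t : R) f h : 0 < t -> D f -> D h -> dot (T t f) h = dot f (T t h).
Proof. exact: (@semigroup_sym _ _ _ _ _ _ ST t f h). Qed.

Let Tcontr (t : R) f : 0 < t -> D f -> nrm dot (T t f) <= nrm dot f.
Proof. exact: (@semigroup_contraction _ _ _ _ _ _ ST t f). Qed.

Let Tadd (s t : R) f phi : 0 < s -> 0 < t -> D f -> D phi ->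
  dot (T (s + t) f) phi = dot (T s (T t f)) phi.
Proof.
move=> s0 t0 Df Dp; have st0 : 0 < s + t by exact: addr_gt0.
apply: (L2w_dot_ae rs r0 (TD st0 Df) (TD s0 (TD t0 Df)) Dp).
have := semigroup_add ST s0 t0 Df.
by apply: (@filterS _ _ (ae_filter_ringOfSetsType mu)) => p; exact.
Qed.

Let Tcont f : D f -> nrm dot (T t f - f) @[t --> (0:R)^'+] --> (0 : R).
Proof. exact: (@semigroup_continuous _ _ _ _ _ _ ST f). Qed.

(** The link between the abstract semigroup and the form: it is through this lemma that rho, V and
    the energy enter the analysis of T. *)
Lemma gen_is_generator u g : D u -> D g -> gen D dot T u g -> is_generator rho V u g.
Proof.
move=> Du Dg ug; apply/(semigroup_generator ST Du Dg).
exact: (gen_limit D0 Dl dC dl dge TD Tlin Tcontr Tadd Tcont Du Dg ug).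
Qed.

Lemma L2_total f : in_L2 w f -> D f.
Proof.
move=> [mf fi]; split => //; apply: le_lt_trans fi; apply: ge0_le_integral => //.
- by move=> p _; rewrite lee_fin mulr_ge0 ?sqr_ge0 ?ltW.
- by apply/measurable_EFinP; apply: measurable_funM; [exact: measurable_funX|exact: smooth_measurable].
- by apply/measurable_EFinP; apply: measurable_funM;
  [exact: measurable_funX|exact: (smooth_measurable smooth_total)].
- by move=> p _; rewrite lee_fin ler_wpM2l ?sqr_ge0//= lerDl.
Qed.

(** The form identity says that the energy of u against phi is minus the integral of (rho g + V u)
    phi. Written with respect to w mu its density is square integrable, because rho^2 / w <= rho and
    V / w <= 1. *)
Lemma generator_density u g : in_W10 w u -> D g ->
  in_L2 w (fun p => - (rho p * g p + V p * u p) / w p).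
Proof.
move=> [[Lu _] _] Lg.
have wp := total_gt0; have ws := smooth_total.
have mws := smooth_measurable (smoothV ws (fun p => lt0r_neq0 (wp p))).
have mr := smooth_measurable rs; have mV := smooth_measurable Vs.
have mw := smooth_measurable ws.
have mg : measurable_fun [set: borel M] (g : borel M -> R) by case: Lg.
have mu' : measurable_fun [set: borel M] (u : borel M -> R) by case: Lu.
have Lrg : in_L2 w (fun p => rho p * g p / w p).
  split; first by apply: measurable_funM => //; exact: measurable_funM.
  case: Lg => _; apply: le_lt_trans; apply: ge0_le_integral => //.
  - by move=> p _; rewrite lee_fin mulr_ge0 ?sqr_ge0// ltW.
  - apply/measurable_EFinP; apply: measurable_funM => //; apply: measurable_funX.
    by apply: measurable_funM => //; exact: measurable_funM.
  - by apply/measurable_EFinP; apply: measurable_funM => //; exact: measurable_funX.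
  move=> p _; rewrite lee_fin; have := wp p; have := r0 p; have := V0 p.
  rewrite /=; move: (rho p) (V p) (g p) => a b x b0 a0 ab0.
  have -> : (a * x / (a + b)) ^+ 2 * (a + b) = (x ^+ 2 * a) * (a / (a + b)).
    by field; rewrite gt_eqF.
  rewrite ler_piMr//; first by rewrite mulr_ge0 ?sqr_ge0// ltW.
  by rewrite ler_pdivrMr// mul1r lerDl.
have LVu : in_L2 w (fun p => V p * u p / w p).
  apply: (L2w_dominated ws wp _ Lu).
    by apply: measurable_funM => //; exact: measurable_funM.
  move=> p; have := wp p; have := r0 p; have := V0 p.
  rewrite /=; move: (rho p) (V p) (u p) => a b x b0 a0 ab0.
  rewrite mulrAC normrM ler_piMl// ger0_norm; last by rewrite divr_ge0// ltW.
  by rewrite ler_pdivrMr// mul1r lerDr ltW.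
have := Dl; have H := L2w_lin ws wp (-1) Lrg (hZ (L2w_0 w) (L2w_lin ws wp) (-1) LVu).
move=> _; move: H; congr (in_L2 _ _); apply/funext => p.
rewrite !fctE /GRing.scale/=; have /lt0r_neq0 := wp p; rewrite /= => wn0.
by field.
Qed.

Lemma density_dot u g f : in_W10 w u -> D g -> in_L2 w f ->
  [/\ mu.-integrable setT (EFin \o ((fun p => g p * f p * rho p) : borel M -> R)),
      mu.-integrable setT (EFin \o ((fun p => u p * f p * V p) : borel M -> R)) &
      L2_dot w (fun p => - (rho p * g p + V p * u p) / w p) f =
        \int[mu]_p (- (g p * f p * rho p) - u p * f p * V p)].
Proof.
move=> [[Lu _] _] Lg Lf; have ws := smooth_total; have wp := total_gt0; split.
- exact: (L2w_mul_integrable rs r0 Lg (L2_total Lf)).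
- have := L2w_mul_integrable ws wp Lu Lf; apply: le_integrable => //.
    apply/measurable_EFinP; apply: measurable_funM; last exact: smooth_measurable.
    by apply: measurable_funM; [case: Lu|case: Lf].
  move=> p _; rewrite /= lee_fin !normrM ler_wpM2l ?mulr_ge0//.
  by rewrite !ger0_norm// ?lerDr ?addr_ge0// ltW.
- apply: eq_Rintegral => p _; have /lt0r_neq0 := wp p; rewrite /= => wn0.
  by field.
Qed.

Lemma generator_energy u g phi : is_generator rho V u g -> test_function phi ->
  energy u phi = L2_dot w (fun p => - (rho p * g p + V p * u p) / w p) phi.
Proof.
move=> [Wu Lg ug] pT; have ws := smooth_total; have wp := total_gt0.
have Lp := test_L2 ws wp pT; have := ug phi (test_W10 ws wp pT).
have [ir iV ->] := density_dot Wu Lg Lp.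
rewrite formE => E0; have irN := integrableN ir.
rewrite RintegralB//.
rewrite (_ : \int[mu]_x - (g x * phi x * rho x) = - L2_dot rho g phi); last first.
  by rewrite -mulN1r -[in RHS](_ : \int[mu]_x (g x * phi x * rho x) = L2_dot rho g phi)// -RintegralZl//;
    apply: eq_Rintegral => x _; rewrite mulN1r.
rewrite -E0 -[X in _ - X](_ : L2_dot V u phi = _)//.
by rewrite addrK.
Qed.

(** Where u > c, the killing term V u is at least c V and absorbs the source rho k. *)
Lemma generator_trunc u g k (c : R) : 0 <= c -> is_generator rho V u g -> D k ->
  {ae mu, forall p, rho p * k p <= c * V p} ->
  dot (g + k) (fun p => Num.max (u p - c) 0) <= 0.
Proof.
move=> c0 [Wu Lg ug] Lk kV; have ws := smooth_total; have wp := total_gt0.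
have Lb := generator_density Wu Lg; set b := (fun p => _) in Lb.
have [[Lu _] _] := Wu.
have Lv := pos_part_L2 ws wp c0 Lu; set v := (fun p => Num.max (u p - c) 0) in Lv *.
have bt phi : test_function phi -> energy u phi = L2_dot w b phi.
  by move=> pT; apply: generator_energy => //; split.
have H := W10_trunc_test_ge0 ws wp c0 Wu Lb bt; rewrite -/v in H.
have [irv iVv bE] := density_dot Wu Lg Lv; rewrite bE in H.
have Lgk := hD Dl Lg Lk; have Lv' := L2_total Lv.
rewrite -oppr_ge0; apply: (le_trans H).
have iN : mu.-integrable setT (EFin \o ((fun p => - ((g p + k p) * v p * rho p)) : borel M -> R)).
  exact: (integrableN (L2w_mul_integrable rs r0 Lgk Lv')).
have -> : - dot (g + k) v = \int[mu]_p (- ((g p + k p) * v p * rho p)).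
  rewrite -mulN1r -[in LHS](_ : \int[mu]_x ((g x + k x) * v x * rho x) = dot (g + k) v)// -RintegralZl//.
    by apply: eq_Rintegral => x _; rewrite mulN1r.
  exact: (L2w_mul_integrable rs r0 Lgk Lv').
apply: Rintegral_le_ae => //.
  exact: (integrableB measurableT (integrableN irv) iVv).
move: kV; apply: (@filterS _ _ (ae_filter_ringOfSetsType mu)) => p kV _.
have h0 : 0 <= (u p - c) * v p * V p - (u p - c) * v p * V p by rewrite subrr.
have v0 : 0 <= v p by rewrite /v le_max lexx orbT.
have uv : c * v p <= u p * v p.
  rewrite -subr_ge0 -mulrBl /v; case: (leP (u p - c) 0) => h; first by rewrite mulr0.
  by rewrite mulr_ge0// ltW.
have h1 : rho p * k p * v p <= c * V p * v p by rewrite ler_wpM2r.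
have h2 : c * v p * V p <= u p * v p * V p by rewrite ler_wpM2r.
exact: (trunc_arith _ h1 h2).
Qed.

(** The common source of all order properties: k = 0 gives the bound by c, f = 0 and c = 0 give
    positivity of the time integral, and k = h_j with c = 1 gives the bound for the truncated total
    mass. *)
Lemma markov f k (c t : R) h : 0 <= c -> 0 <= t -> D f -> D k ->
  {ae mu, forall p, f p <= c} -> {ae mu, forall p, rho p * k p <= c * V p} ->
  is_int D dot T t k h -> {ae mu, forall p, sg T t f p + h p <= c}.
Proof.
move=> c0 t0 Df Dk fc kV kh.
pose J x : M -> R := fun p => Num.max (x p - c) 0.
have JD x : D x -> D (J x) by exact: pos_part_L2.
have J_le x : D x -> nrm dot (J x) <= nrm dot x.
  move=> Dx; apply: (L2_norm_le rs r0 (JD _ Dx) Dx) => p.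
  by rewrite /J; case: (leP (x p - c) 0) => hx; rewrite ?normr0// (gtr0_norm hx)
    (le_trans _ (ler_norm _))// lerBlDr lerDl.
have J_taylor x y : D x -> D y ->
    dot (J y) (J y) <= dot (J x) (J x) + 2 * dot (J x) (y - x) + dot (y - x) (y - x).
  move=> Dx Dy; have Dyx := hB D0 Dl Dy Dx; have DJ := JD x Dx.
  have Ds := hD Dl DJ Dyx.
  have <- : dot (J x + (y - x)) (J x + (y - x)) =
      dot (J x) (J x) + 2 * dot (J x) (y - x) + dot (y - x) (y - x).
    rewrite (dotDl dl DJ Dyx Ds) (dotDr dC dl DJ Dyx DJ) (dotDr dC dl DJ Dyx Dyx) (dC (y - x) (J x)).
    by move: (dot _ _) (dot _ _) (dot _ _) => a1 a2 a3; ring.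
  apply: (L2w_dot_le rs r0 (JD y Dy) (JD y Dy) Ds Ds).
  apply: (@aeW _ _ _ mu) => p; rewrite !fctE; exact: pos_part_taylor.
have J_diss u g : D u -> D g -> gen D dot T u g -> dot (g + k) (J u) <= 0.
  by move=> Du Dg ug; apply: generator_trunc => //; exact: gen_is_generator.
have Jf : dot (J f) (J f) <= 0.
  have Z : {ae mu, forall p, J f p = (0 : M -> R) p}.
    move: fc; apply: (@filterS _ _ (ae_filter_ringOfSetsType mu)) => p fp.
    by rewrite /J max_r// subr_le0.
  by rewrite (L2w_dot_ae rs r0 (JD f Df) D0 (JD f Df) Z) (dot0l D0 dl (JD f Df)).
have := invariance D0 Dl dC dl dge cp TD Tlin Tsym Tcontr Tadd Tcont Dk JD J_le J_taylor J_diss Df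
  t0 kh Jf.
have [Dh _] := kh; have Ds := hD Dl (sgD TD t Df) Dh => H.
have := L2w_dot_eq0 rs r0 (JD _ Ds) (le_anti (andb_true_intro (conj H (dge _)))).
apply: (@filterS _ _ (ae_filter_ringOfSetsType mu)) => p; rewrite /J.
rewrite -[X in X <= c]/((sg T t f + h) p) -subr_le0.
by case: leP => // hp E0; rewrite E0 ltxx in hp.
Qed.

Lemma is_int0 (t : R) : 0 <= t -> is_int D dot T t 0 0.
Proof.
move=> t0; split => // phi Dp; have [c _ ->] := Pint_mvt D0 Dl dC dl dge TD Tlin Tcontr Tadd Tcont
  t0 D0 Dp.
rewrite /kap (sg_sym Tsym _ D0 Dp) !(dot0l D0 dl) ?mul0r//.
exact: (sgD TD).
Qed.

Lemma semigroup_le (c t : R) f : 0 <= c -> 0 < t -> D f -> {ae mu, forall p, f p <= c} ->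
  {ae mu, forall p, T t f p <= c}.
Proof.
move=> c0 t0 Df fc; have h0 : {ae mu, forall p, rho p * (0 : M -> R) p <= c * V p}.
  by apply: (@aeW _ _ _ mu) => p; rewrite mulr0 mulr_ge0.
have := markov c0 (ltW t0) Df D0 fc h0 (is_int0 (ltW t0)).
by rewrite /sg t0; apply: (@filterS _ _ (ae_filter_ringOfSetsType mu)) => p; rewrite addr0.
Qed.

Lemma semigroup_opp (t : R) f : 0 < t -> D f ->
  {ae mu, forall p, T t (- f) p = - T t f p}.
Proof.
move=> t0 Df; have := semigroup_linear ST (-1) t0 Df D0.
(* Linearity with both arguments 0 shows that T t 0 vanishes almost everywhere. *)
have := semigroup_linear ST (-1) t0 D0 D0.
apply: (@filterS2 _ _ (ae_filter_ringOfSetsType mu)) => p.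
rewrite (_ : (fun p => -1 * (0 : M -> R) p + (0 : M -> R) p) = 0); last first.
  by apply/funext => q; change (-1 * (0 : R) + 0 = 0); rewrite mulr0 addr0.
rewrite (_ : (fun p => -1 * f p + (0 : M -> R) p) = - f); last first.
  by apply/funext => q; change (-1 * f q + 0 = - f q); rewrite mulN1r addr0.
by move=> /(_ I) h1 /(_ I) ->; rewrite h1; ring.
Qed.

Lemma semigroup_ge0 (t : R) f : 0 < t -> D f -> {ae mu, forall p, 0 <= f p} ->
  {ae mu, forall p, 0 <= T t f p}.
Proof.
move=> t0 Df f0; have f0' : {ae mu, forall p, (- f) p <= 0}.
  by move: f0; apply: (@filterS _ _ (ae_filter_ringOfSetsType mu)) => p; rewrite !fctE oppr_le0.
have := semigroup_le (lexx 0) t0 (hN D0 Dl Df) f0'; have := semigroup_opp t0 Df.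
apply: (@filterS2 _ _ (ae_filter_ringOfSetsType mu)) => p.
by move=> ->; rewrite oppr_le0.
Qed.

(** The set searched by [time_integral] is inhabited by the Riesz representative, so the selected
    function has the right pairings. *)
Lemma time_integralP (t : R) f : 0 < t -> D f -> is_int D dot T t f (time_integral rho T t f).
Proof.
move=> t0 Df.
have E phi : D phi -> \int[lebesgue_measure]_(s in `]0, t]) L2_dot rho (T s f) phi = Pint dot T f phi t.
  move=> Dp; have kc := kap_continuous D0 Dl dC dl dge TD Tlin Tcontr Tadd Tcont Df Dp.
  rewrite /Pint -(prim_int (k := kap dot T f phi) kc (ltW t0)).
  apply: eq_Rintegral => s; rewrite inE/= in_itv/= => /andP[s0 _].
  by rewrite /kap /sg s0.
have [h [Dh hP]] := int_ex D0 Dl dC dl dge cp TD Tlin Tcontr Tadd Tcont (ltW t0) Df.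
rewrite /time_integral; case: xgetP => [g _ [Dg gP]|/(_ h)].
  by split => // phi Dp; rewrite gP// E.
by case; split => // phi Dp; rewrite hP// E.
Qed.

Lemma time_integral_L2 (t : R) f : 0 < t -> D f -> D (time_integral rho T t f).
Proof. by move=> t0 Df; have [] := time_integralP t0 Df. Qed.

Lemma time_integral_opp (t : R) f : 0 < t -> D f ->
  {ae mu, forall p, time_integral rho T t (- f) p = - time_integral rho T t f p}.
Proof.
move=> t0 Df; have DNf := hN D0 Dl Df.
have [D1 E1] := time_integralP t0 Df; have [D2 E2] := time_integralP t0 DNf.
apply: (L2w_eq rs r0 D2 (hN D0 Dl D1)) => phi Dp.
rewrite E2// (dotNl D0 dl D1 Dp) E1//.
have := Pint_linl D0 Dl dC dl dge TD Tlin Tcontr Tadd Tcont (-1) (ltW t0) Df D0 Dp.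
have [_ <-] := is_int0 (ltW t0) => //; rewrite (dot0l D0 dl Dp) scaleN1r !addr0 => ->.
by rewrite mulN1r.
Qed.

Lemma time_integral_ge0 (t : R) f : 0 < t -> D f -> {ae mu, forall p, 0 <= f p} ->
  {ae mu, forall p, 0 <= time_integral rho T t f p}.
Proof.
move=> t0 Df f0.
have f0' : {ae mu, forall p, rho p * (- f) p <= 0 * V p}.
  move: f0; apply: (@filterS _ _ (ae_filter_ringOfSetsType mu)) => p f0.
  by rewrite mul0r !fctE mulrN oppr_le0 mulr_ge0// ltW.
have z0 : {ae mu, forall p, (0 : M -> R) p <= 0} by apply: (@aeW _ _ _ mu).
have DNf := hN D0 Dl Df.
have := markov (lexx 0) (ltW t0) D0 DNf z0 f0' (time_integralP t0 DNf).
have Z : {ae mu, forall p, sg T t 0 p = 0}.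
  rewrite /sg t0; have := semigroup_opp t0 D0; rewrite oppr0.
  apply: (@filterS _ _ (ae_filter_ringOfSetsType mu)) => p.
  by move: (T t 0 p) => x; lra.
move: Z; apply: (@filterS3 _ _ (ae_filter_ringOfSetsType mu)) (time_integral_opp t0 Df) => p.
by move=> -> ->; rewrite add0r oppr_le0.
Qed.

Local Opaque time_integral.

Local Notation aeS := (@filterS _ _ (ae_filter_ringOfSetsType mu)).
Local Notation aeS2 := (@filterS2 _ _ (ae_filter_ringOfSetsType mu)).
Local Notation aeS3 := (@filterS3 _ _ (ae_filter_ringOfSetsType mu)).

Lemma sg_le1 (s : R) f : D f -> {ae mu, forall p, f p <= 1} -> {ae mu, forall p, sg T s f p <= 1}.
Proof.
by move=> Df f1; rewrite /sg; case: ifPn => // s0; exact: semigroup_le.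
Qed.

Lemma kap_le1 f g (s : R) : D f -> D g -> {ae mu, forall p, f p <= 1} -> (forall p, 0 <= g p) ->
  mu.-integrable setT (EFin \o ((fun p => g p * rho p) : borel M -> R)) ->
  kap dot T f g s <= \int[mu]_p (g p * rho p).
Proof.
move=> Df Dg f1 g0 gi; have Ds := sgD TD s Df.
rewrite /kap L2_dotE; apply: Rintegral_le_ae => //.
  exact: (L2w_mul_integrable rs r0 Ds Dg).
apply: aeS (sg_le1 s Df f1) => p h _.
by rewrite -mulrA ler_piMl// mulr_ge0// ltW.
Qed.

(** With I the time integral and g = (I - t)^+, the pairing of I with g equals t int g rho + |g|^2,
    while the Markov bound gives at most t int g rho. *)
Lemma time_integral_le (t : R) f : 0 < t -> D f -> {ae mu, forall p, f p <= 1} ->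
  {ae mu, forall p, time_integral rho T t f p <= t}.
Proof.
move=> t0 Df f1; set I := time_integral rho T t f.
have [DI IP] : is_int D dot T t f I by exact: time_integralP.
have Dg : D (fun p => Num.max (I p - t) 0) by exact: (pos_part_L2 rs r0 (ltW t0) DI).
set g := (fun p => _) in Dg.
have g0 p : 0 <= g p by rewrite /g le_max lexx orbT.
have Ig p : I p * g p = t * g p + g p * g p.
  by rewrite /g; case: (leP (I p - t) 0) => h; rewrite ?mulr0 ?addr0//; ring.
have iIg := L2w_mul_integrable rs r0 DI Dg; have igg := L2w_mul_integrable rs r0 Dg Dg.
(* Constants need not be in L^2, so integrability of g rho is read off the identity t g = I g -
   g^2. *)
have gi : mu.-integrable setT (EFin \o ((fun p => g p * rho p) : borel M -> R)).
  have := integrableZl measurableT t^-1 (integrableB measurableT iIg igg).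
  congr (_ .-integrable _ _); apply/funext => p /=; rewrite -EFinB -EFinM; congr EFin.
  have tn0 : t != 0 by rewrite gt_eqF.
  by rewrite Ig; field.
have [c _ Pc] := Pint_mvt D0 Dl dC dl dge TD Tlin Tcontr Tadd Tcont (ltW t0) Df Dg.
have h1 : dot I g <= t * \int[mu]_p (g p * rho p).
  by rewrite IP// Pc mulrC ler_pM2l//; exact: kap_le1.
have h2 : dot I g = t * \int[mu]_p (g p * rho p) + dot g g.
  rewrite !L2_dotE -RintegralZl// -RintegralD//; last exact: (integrableZl measurableT t gi).
  by apply: eq_Rintegral => p _; rewrite Ig; ring.
have gg : dot g g <= 0 by move: h1; rewrite h2 gerDl.
have := L2w_dot_eq0 rs r0 Dg (le_anti (andb_true_intro (conj gg (dge _)))).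
apply: aeS => p; rewrite /g -subr_le0.
by case: (leP (I p - t) 0) => // h E0; rewrite E0 ltxx in h.
Qed.

Lemma time_integral_lin (t a : R) f h : 0 < t -> D f -> D h ->
  {ae mu, forall p, time_integral rho T t (a *: f + h) p =
                    a * time_integral rho T t f p + time_integral rho T t h p}.
Proof.
move=> t0 Df Dh; have [D1 E1] := time_integralP t0 Df; have [D2 E2] := time_integralP t0 Dh.
have [D3 E3] := time_integralP t0 (Dl a Df Dh).
apply: (L2w_eq rs r0 D3 (Dl a D1 D2)) => phi Dp.
apply: (etrans (E3 _ Dp)); apply/esym; apply: (etrans (dl a D1 D2 Dp)).
apply: (etrans (congr2 (fun x y => a * x + y) (E1 _ Dp) (E2 _ Dp))); apply/esym.
exact: (Pint_linl D0 Dl dC dl dge TD Tlin Tcontr Tadd Tcont a (ltW t0) Df Dh Dp).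
Qed.

Lemma time_integral_sub (t : R) f h : 0 < t -> D f -> D h ->
  {ae mu, forall p, time_integral rho T t (f - h) p =
                    time_integral rho T t f p - time_integral rho T t h p}.
Proof.
move=> t0 Df Dh; rewrite (_ : f - h = -1 *: h + f); last by rewrite scaleN1r addrC.
by apply: aeS (time_integral_lin (-1) t0 Dh Df) => p ->; rewrite mulN1r addrC.
Qed.

Lemma time_integral_bound (t : R) f : 0 < t -> D f ->
  dot (time_integral rho T t f) (time_integral rho T t f) <= t * t * dot f f.
Proof.
move=> t0 Df; have [D1 E1] := time_integralP t0 Df.
have N0 : 0 <= nrm dot f by exact: nrm_ge0.
have := nrm_le_dot dC dge D1 (mulr_ge0 (ltW t0) N0).
have H phi : D phi -> `|dot (time_integral rho T t f) phi| <= t * nrm dot f * nrm dot phi.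
  move=> Dp; rewrite E1//.
  exact: (Pint_bound D0 Dl dC dl dge TD Tlin Tcontr Tadd Tcont (ltW t0) Df Dp).
move=> /(_ H) H1; rewrite -(nrm_sqr dC dge (time_integral rho T t f)) -(nrm_sqr dC dge f).
have -> : t * t * nrm dot f ^+ 2 = (t * nrm dot f) ^+ 2 by ring.
by rewrite ler_sqr// nnegrE ?mulr_ge0 ?nrm_ge0// ltW.
Qed.

Lemma semigroup_sub (t : R) f h : 0 < t -> D f -> D h ->
  {ae mu, forall p, T t (f - h) p = T t f p - T t h p}.
Proof.
move=> t0 Df Dh; have := semigroup_linear ST (-1) t0 Dh Df; apply: aeS => p /(_ I).
rewrite (_ : (fun q => -1 * h q + f q) = f - h); last first.
  by apply/funext => q; rewrite !fctE; ring.
by move=> ->; ring.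
Qed.

Lemma semigroup_bound (t : R) f : 0 < t -> D f -> dot (T t f) (T t f) <= 1 * dot f f.
Proof.
move=> t0 Df; rewrite mul1r -(nrm_sqr dC dge f) -(nrm_sqr dC dge (T t f)).
by rewrite ler_sqr ?nnegrE ?nrm_ge0//; exact: Tcontr.
Qed.

Lemma semigroup_extP (t : R) fs (f : M -> \bar R) : 0 < t -> approximates rho fs f ->
  [/\ measurable_fun [set: borel M] (Lplus_ext rho (T t) f : borel M -> \bar R),
    forall p, (0 <= Lplus_ext rho (T t) f p)%E &
    forall gs, approximates rho gs f ->
      {ae mu, forall p, (T t (gs m) p)%:E @[m --> \oo] --> Lplus_ext rho (T t) f p}].
Proof.
move=> t0; apply: (@Lplus_extP _ _ M rho (T t) 1 rs r0) => //.
- by move=> g; exact: TD.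
- by move=> g; exact: semigroup_ge0.
- by move=> g h; exact: semigroup_sub.
- by move=> g; exact: semigroup_bound.
Qed.

Lemma time_integral_extP (t : R) fs (f : M -> \bar R) : 0 < t -> approximates rho fs f ->
  [/\ measurable_fun [set: borel M] (Lplus_ext rho (time_integral rho T t) f : borel M -> \bar R),
    forall p, (0 <= Lplus_ext rho (time_integral rho T t) f p)%E &
    forall gs, approximates rho gs f ->
      {ae mu, forall p, (time_integral rho T t (gs m) p)%:E @[m --> \oo] -->
        Lplus_ext rho (time_integral rho T t) f p}].
Proof.
move=> t0; apply: (@Lplus_extP _ _ M rho (time_integral rho T t) (t * t) rs r0) => //.
- by move=> g; exact: time_integral_L2.
- by move=> g; exact: time_integral_ge0.
- by move=> g h; exact: time_integral_sub.
- by move=> g; exact: time_integral_bound.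
- exact: mulr_gt0.
Qed.

(** [is_derive_Pint] covers nonnegative times; composing with the maximum with 0 gives a function
    continuous on the whole line, as [duhamel_limit] requires. *)
Lemma Pint_max_continuous f g : D f -> D g -> continuous (fun s : R => Pint dot T f g (Num.max s 0)).
Proof.
move=> Df Dg s; have kc := kap_continuous D0 Dl dC dl dge TD Tlin Tcontr Tadd Tcont Df Dg.
apply: (@continuous_comp _ _ _ (fun s : R => Num.max s 0) (Pint dot T f g)).
  by apply: continuous_max; [exact: cvg_id|exact: cvg_cst].
have s0 : 0 <= Num.max s 0 by rewrite le_max lexx orbT.
have [d _] := is_derive_Pint D0 Dl dC dl dge TD Tlin Tcontr Tadd Tcont Df Dg s0.
by apply: differentiable_continuous; apply/derivable1_diffP.
Qed.

Lemma kap_sub f h g (s : R) : D f -> D h -> D g ->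
  kap dot T (f - h) g s = kap dot T f g s - kap dot T h g s.
Proof. by move=> Df Dh Dg; exact: (sg_sub dl Tlin s Df Dh Dg). Qed.

Lemma Pint_sub f h g (s : R) : 0 <= s -> D f -> D h -> D g ->
  Pint dot T (f - h) g s = Pint dot T f g s - Pint dot T h g s.
Proof.
move=> s0 Df Dh Dg; rewrite (_ : f - h = -1 *: h + f); last by rewrite scaleN1r addrC.
rewrite (Pint_linl D0 Dl dC dl dge TD Tlin Tcontr Tadd Tcont (-1) s0 Dh Df Dg).
by rewrite mulN1r addrC.
Qed.

(** The sequences c and d share the limit C, which cancels only because it is finite; the bounds on
    d and a guarantee that C and A are. *)
Lemma balance_limit (t : R) (a b c d u : nat -> R) (A B C : \bar R) :
  (a j)%:E @[j --> \oo] --> A -> (b j)%:E @[j --> \oo] --> B ->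
  (c j)%:E @[j --> \oo] --> C -> (d j)%:E @[j --> \oo] --> C -> u j @[j --> \oo] --> (1 : R) ->
  (forall j, a j - u j = c j - (d j + b j)) -> (forall j, 0 <= a j <= 1) ->
  (forall j, 0 <= d j <= t) -> (A + B = 1)%E.
Proof.
move=> aA bB cC dC' u1 E a01 d0t.
have fin (x : nat -> R) (X : \bar R) (y : R) : (x j)%:E @[j --> \oo] --> X -> (forall j, 0 <= x j <= y) ->
    X \is a fin_num.
  move=> xX xy; rewrite fin_real//; apply/andP; split.
    apply: (@lt_le_trans _ _ 0%E); first exact: ltNy0.
    by apply: (cvge_ge _ xX); apply: nearW => j; rewrite lee_fin; case/andP: (xy j).
  apply: (@le_lt_trans _ _ y%:E); last exact: ltry.
  by apply: (cvge_le _ xX); apply: nearW => j; rewrite lee_fin; case/andP: (xy j).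
have fA := fin _ _ _ aA a01; have fC := fin _ _ _ dC' d0t.
have real (x : nat -> R) (X : \bar R) : X \is a fin_num -> (x j)%:E @[j --> \oo] --> X ->
    x j @[j --> \oo] --> fine X.
  by move=> fX; rewrite -{1}(fineK fX) => /fine_cvg.
have aA' := real _ _ fA aA; have cC' := real _ _ fC cC; have dC'' := real _ _ fC dC'.
have b1 : b j @[j --> \oo] --> (1 - fine A + fine C - fine C : R).
  have -> : b = fun j => u j - a j + c j - d j by apply/funext => j; have := E j; lra.
  by apply: cvgB => //; apply: cvgD => //; exact: cvgB.
have bB' : B = (1 - fine A + fine C - fine C)%:E.
  by apply: (cvg_unique _ bB) => //; apply/cvg_EFin => //; exact: nearW.
by rewrite bB' -(fineK fA) -EFinD; congr EFin; ring.
Qed.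

(** * Resolvents along an exhaustion by compact sets *)

Section Exhaustion.
Variable K : nat -> set M.
Hypotheses (cK : forall j, compact (K j)) (K_nd : forall j, K j `<=` K j.+1)
  (Kcov : forall C, compact C -> exists j, C `<=` K j).
Let ws := smooth_total.
Let w0 := total_gt0.

Let f_ j : M -> R := \1_(K j).
Let h_ j : M -> R := fun p => f_ j p * (V p / rho p).

Lemma cut_Df j : D (f_ j).
Proof. exact: indic_compact_L2. Qed.

Lemma cut_f01 j p : 0 <= f_ j p <= 1.
Proof. exact: indic_itv. Qed.

Lemma cut_f1 j p : K j p -> f_ j p = 1.
Proof. by move=> Kjp; rewrite /f_ indicE mem_set. Qed.

Lemma cut_f0 j p : ~ K j p -> f_ j p = 0.
Proof. by move=> Kjp; rewrite /f_ indicE memNset. Qed.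

Lemma cut_Vr_ge0 p : 0 <= V p / rho p.
Proof. by rewrite divr_ge0// ltW. Qed.

Lemma cut_Dh j : D (h_ j).
Proof.
have Vrs : smooth (fun p => V p / rho p).
  by apply: (smoothM Vs); exact: (smoothV rs (fun p => lt0r_neq0 (r0 p))).
have : bounded_set ((fun p => V p / rho p) @` K j).
  apply: compact_bounded; apply: continuous_compact => //.
  by apply: continuous_subspaceT; exact: (smooth_continuous Vrs).
move=> [C1 [_ /(_ (`|C1| + 1))]]; rewrite (le_lt_trans (ler_norm _)) ?ltrDl// => /(_ isT) VC.
refine (@compact_L2 _ _ M rho (h_ j) (K j) (`|C1| + 1) rs r0 (@cK j) _ _ _).
- apply: measurable_funM; [by case: (cut_Df j)|exact: smooth_measurable].
- move=> p; case: (pselect (K j p)) => Kjp; last by rewrite /h_ cut_f0// mul0r normr0 addr_ge0.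
  by rewrite /h_ cut_f1// mul1r; apply: VC; exists p.
- by move=> p nK; rewrite /h_ cut_f0// mul0r.
Qed.

Lemma cut_K_mono m j : (m <= j)%N -> K m `<=` K j.
Proof.
by elim: j => [|j IH]; [rewrite leqn0 => /eqP ->|rewrite leq_eqVlt => /predU1P[->//|/IH H p /H/K_nd]].
Qed.

Lemma cut_Kp p : exists j, K j p.
Proof. by have [j Kj] := Kcov (@compact_set1 _ p); exists j; exact: Kj. Qed.

Lemma cut_f_nd j p : f_ j p <= f_ j.+1 p.
Proof.
case: (pselect (K j p)) => Kjp; first by rewrite !cut_f1//; exact: K_nd.
by rewrite cut_f0//; case/andP: (cut_f01 j.+1 p).
Qed.

Lemma cut_f_cvg p : (f_ j p)%:E @[j --> \oo] --> (1%E : \bar R).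
Proof.
have [m Km] := cut_Kp p; apply: cvg_near_cst; exists m => // j /= mj.
by rewrite cut_f1//; exact: cut_K_mono mj _ Km.
Qed.

Lemma cut_f_approx : approximates rho f_ (cst 1%E).
Proof.
split; first exact: cut_Df.
- apply: (@aeW _ _ _ mu) => p j; rewrite cut_f_nd andbT; by case/andP: (cut_f01 j p).
- by apply: (@aeW _ _ _ mu) => p; exact: cut_f_cvg.
Qed.

Lemma cut_h_ge0 j p : 0 <= h_ j p.
Proof. by apply: mulr_ge0 (cut_Vr_ge0 p); case/andP: (cut_f01 j p). Qed.

Lemma cut_h_approx : approximates rho h_ (fun p => (V p / rho p)%:E).
Proof.
split; first exact: cut_Dh.
- by apply: (@aeW _ _ _ mu) => p j; rewrite cut_h_ge0/=; exact: (ler_wpM2r (cut_Vr_ge0 p) (cut_f_nd j p)).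
- apply: (@aeW _ _ _ mu) => p; have [m Km] := cut_Kp p; apply: cvg_near_cst; exists m => // j /= mj.
  by rewrite /h_ cut_f1 ?mul1r//; exact: cut_K_mono mj _ Km.
Qed.

(** f_j + h_j equals 1_{K_j} w / rho, so with g = u - (f_j + h_j) the expression rho g + V u is w (u
    - 1_{K_j}), and rho and V survive only through w. *)
Lemma resolvent_solution j u : D u -> gen D dot T u (u - (f_ j + h_ j)) -> is_solution w (K j) u.
Proof.
move=> Du ug; have Dk := hD Dl (cut_Df j) (cut_Dh j).
have ig := gen_is_generator Du (hB D0 Dl Du Dk) ug; have [Wu _ _] := ig.
split => // phi pT; rewrite (generator_energy ig pT); congr (L2_dot _ _ phi).
apply/funext => p; rewrite !fctE /h_; have /lt0r_neq0 := w0 p; have /lt0r_neq0 := r0 p.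
by rewrite /= -/(f_ j) => rn wn; field; rewrite rn wn.
Qed.

Lemma resolvent_ex j : exists2 u, D u & gen D dot T u (u - (f_ j + h_ j)).
Proof.
exact: (res_ex D0 Dl dC dl dge cp TD Tlin Tsym Tcontr Tadd Tcont (hD Dl (cut_Df j) (cut_Dh j))).
Qed.

Lemma cut_markov j (t : R) : 0 < t ->
  {ae mu, forall p, 0 <= T t (f_ j) p + time_integral rho T t (h_ j) p <= 1}.
Proof.
move=> t0; have f1' : {ae mu, forall p, f_ j p <= 1}.
  by apply: (@aeW _ _ _ mu) => p; case/andP: (cut_f01 j p).
have hV : {ae mu, forall p, rho p * h_ j p <= 1 * V p}.
  apply: (@aeW _ _ _ mu) => p; have rn := lt0r_neq0 (r0 p).
  have -> : rho p * h_ j p = f_ j p * V p by rewrite /h_; field.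
  by rewrite ler_wpM2r//; case/andP: (cut_f01 j p).
have := markov ler01 (ltW t0) (cut_Df j) (cut_Dh j) f1' hV (time_integralP t0 (cut_Dh j)).
rewrite /sg t0 => H.
have f0' : {ae mu, forall p, 0 <= f_ j p}.
  by apply: (@aeW _ _ _ mu) => p; case/andP: (cut_f01 j p).
have h0' : {ae mu, forall p, 0 <= h_ j p} by apply: (@aeW _ _ _ mu) => p; exact: cut_h_ge0.
apply: aeS3 H (semigroup_ge0 t0 (cut_Df j) f0') (time_integral_ge0 t0 (cut_Dh j) h0') => p -> h1 h2.
by rewrite addr_ge0.
Qed.

Section Resolvents.
Variable u : nat -> M -> R.
Hypotheses (Du : forall j, D (u j)) (ug : forall j, gen D dot T (u j) (u j - (f_ j + h_ j))).

Let us j : is_solution w (K j) (u j) := resolvent_solution (Du j) (ug j).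

Lemma resolvent_bounds : {ae mu, forall p, forall j, 0 <= u j p <= 1 /\ u j p <= u j.+1 p}.
Proof.
apply: ae_foralln => j.
apply: aeS3 (solution_ge0 ws w0 (@cK j) (@us j)) (solution_le1 ws w0 (@cK j) (@us j))
  (solution_mono ws w0 (@cK j) (@cK j.+1) (@K_nd j) (@us j) (@us j.+1)) => p h1 h2 h3.
by rewrite h1 h2 h3.
Qed.

Lemma resolvent_balance (t : R) : 0 < t -> {ae mu, forall p, forall j,
  T t (u j) p - u j p = time_integral rho T t (u j) p -
    (time_integral rho T t (f_ j) p + time_integral rho T t (h_ j) p)}.
Proof.
move=> t0; apply: ae_foralln => j; have Dk := hD Dl (cut_Df j) (cut_Dh j).
have [D1 E1] := time_integralP t0 (hB D0 Dl (Du j) Dk).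
have Dt := TD t0 (Du j).
have H : {ae mu, forall p, (T t (u j) - u j) p = time_integral rho T t (u j - (f_ j + h_ j)) p}.
  apply: (L2w_eq rs r0 (hB D0 Dl Dt (Du j)) D1) => phi Dp.
  apply: (etrans (dotBl D0 Dl dl Dt (Du j) Dp)); apply/esym; apply: (etrans (E1 _ Dp)).
  by have := ug j Dp (ltW t0); rewrite /sg t0.
have L1 := time_integral_sub t0 (Du j) Dk.
have := time_integral_lin 1 t0 (cut_Df j) (cut_Dh j); rewrite scale1r => L2.
apply: aeS3 H L1 L2 => p; rewrite !fctE => -> -> ->.
by rewrite mul1r.
Qed.

(** If u_j tends to 1, then u_j approximates 1 in the sense of [approximates], as f_j does. The time
    integrals of both have the same finite limit and drop out of the balance. *)
Lemma resolvents_to_one_gen_conservative :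
  {ae mu, forall p, u j p @[j --> \oo] --> (1 : R)} -> generalized_conservative rho V T.
Proof.
move=> u1 t t0.
have u_approx : approximates rho u (cst 1%E).
  split; first exact: Du.
  - by apply: aeS resolvent_bounds => p H j; have [/andP[h1 h2] h3] := H j; rewrite h1 h3.
  - by apply: aeS u1 => p up; apply/cvg_EFin => //; exact: nearW.
have [_ _ A1] := semigroup_extP t0 cut_f_approx; have [_ _ B1] := time_integral_extP t0 cut_h_approx.
have [_ _ C1] := time_integral_extP t0 cut_f_approx.
have Tu01 : {ae mu, forall p, forall j, 0 <= T t (u j) p <= 1}.
  apply: ae_foralln => j.
  have u0j : {ae mu, forall p, 0 <= u j p} by exact: (solution_ge0 ws w0 (@cK j) (@us j)).
  have u1j : {ae mu, forall p, u j p <= 1} by exact: (solution_le1 ws w0 (@cK j) (@us j)).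
  by apply: aeS2 (semigroup_ge0 t0 (Du j) u0j) (semigroup_le ler01 t0 (Du j) u1j) => p -> ->.
have If0t : {ae mu, forall p, forall j, 0 <= time_integral rho T t (f_ j) p <= t}.
  apply: ae_foralln => j.
  have f0' : {ae mu, forall p, 0 <= f_ j p}.
    by apply: (@aeW _ _ _ mu) => p; case/andP: (cut_f01 j p).
  have f1' : {ae mu, forall p, f_ j p <= 1}.
    by apply: (@aeW _ _ _ mu) => p; case/andP: (cut_f01 j p).
  by apply: aeS2 (time_integral_ge0 t0 (cut_Df j) f0') (time_integral_le t0 (cut_Df j) f1') => p -> ->.
have ae_and (P Q : M -> Prop) : {ae mu, forall p, P p} -> {ae mu, forall p, Q p} ->
  {ae mu, forall p, P p /\ Q p} by apply: aeS2 => p.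
apply: aeS3 (ae_and _ _ (A1 _ u_approx) (B1 _ cut_h_approx))
  (ae_and _ _ (ae_and _ _ (C1 _ u_approx) (C1 _ cut_f_approx)) (ae_and _ _ u1 (resolvent_balance t0)))
  (ae_and _ _ Tu01 If0t) => p [h1 h2] [[h3 h4] [h5 h6]] [h7 h8] _.
exact: (balance_limit h1 h2 h3 h4 h5 h6 h7 h8).
Qed.

(** * From generalized conservativeness to the resolvents *)

Section Converse.
Hypothesis gc : generalized_conservative rho V T.
Variable j0 : nat.
Let g := f_ j0.
Let Dg : D g := cut_Df j0.
Let m := dot g g.

Let gg p : g p * g p = g p.
Proof. by rewrite /g /f_ indicE; case: (_ \in _); rewrite ?mulr1 ?mulr0. Qed.

Let g0 p : 0 <= g p.
Proof. by case/andP: (cut_f01 j0 p). Qed.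

Let g_int : mu.-integrable setT (EFin \o ((fun p => g p * rho p) : borel M -> R)).
Proof.
have := L2w_mul_integrable rs r0 Dg Dg; congr (_.-integrable _ _).
by apply/funext => p /=; rewrite gg.
Qed.

Let mE : \int[mu]_p (g p * rho p) = m.
Proof. by rewrite /m L2_dotE; apply: eq_Rintegral => p _; rewrite gg. Qed.

(** The pairing with g of the mass missing from T_s f_i + int_0^s T_r h_i dr, where m is the rho mu
    measure of K j0. *)
Let eps i (s : R) : R := m - kap dot T (f_ i) g s - Pint dot T (h_ i) g (Num.max s 0).
Let W i (s : R) : R := Pint dot T (f_ i - u i) g s.
Let N (s : R) i : M -> R := T s (f_ i) + time_integral rho T s (h_ i).

Let DN (s : R) i : 0 < s -> D (N s i).
Proof. by move=> s0; apply: (hD Dl); [exact: TD (cut_Df i)|exact: time_integral_L2 (cut_Dh i)]. Qed.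

Let epsE i (s : R) : 0 < s -> eps i s = m - dot (N s i) g.
Proof.
move=> s0; have [DI IE] := time_integralP s0 (cut_Dh i).
rewrite /eps /N (max_idPl (ltW s0)) -(IE _ Dg) /kap /sg s0.
rewrite (dotDl dl (TD s0 (cut_Df i)) DI Dg); set x := dot _ _; set y := dot _ _.
by rewrite opprD addrA.
Qed.

Let N01 s i : 0 < s -> {ae mu, forall p, 0 <= N s i p * g p <= g p * g p}.
Proof.
move=> s0; apply: aeS (cut_markov i s0) => p /andP[h1 h2].
by rewrite gg mulr_ge0//= ler_piMl.
Qed.

Let eps_bounds i (s : R) : 0 < s -> 0 <= eps i s <= m.
Proof.
move=> s0; rewrite epsE//; have DNs := DN i s0.
have h1 : dot (N s i) g <= m.
  by apply: (L2w_dot_le rs r0 DNs Dg Dg Dg); apply: aeS (N01 i s0) => p /andP[].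
have h2 : 0 <= dot (N s i) g.
  rewrite -(dot0l D0 dl Dg); apply: (L2w_dot_le rs r0 D0 Dg DNs Dg).
  by apply: aeS (N01 i s0) => p /andP[h _]; change (0 * g p <= N s i p * g p); rewrite mul0r.
by apply/andP; split; [rewrite subr_ge0|rewrite gerBl].
Qed.

Let eps_cvg (s : R) : 0 < s -> eps i s @[i --> \oo] --> (0 : R).
Proof.
move=> s0; rewrite (_ : eps ^~ s = fun i => m - dot (N s i) g); last first.
  by apply/funext => i; exact: epsE.
rewrite -(subrr m); apply: cvgB; first exact: cvg_cst.
apply: (L2w_dot_cvg rs r0 (fun i => DN i s0) Dg Dg Dg Dg).
  apply: ae_foralln => i; apply: aeS (N01 i s0) => p /andP[h1 h2]; by rewrite ger0_norm.
have [_ A0 A1] := semigroup_extP s0 cut_f_approx; have [_ B0 B1] := time_integral_extP s0 cut_h_approx.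
apply: aeS3 (A1 _ cut_f_approx) (B1 _ cut_h_approx) (gc s0) => p h1 h2 /(_ I) h3.
rewrite [X in _ --> X](_ : _ = 1 * g p); last by rewrite mul1r gg.
apply: cvgMr_tmp.
exact: (cvg_sum_to_one h1 h2 (A0 p) (B0 p) h3).
Qed.

Let c i : R := m - dot (u i) g.

(** The derivative is the pairing of T_s f_i - T_s u_i with g. The resolvent equation rewrites T_s
    u_i as u_i plus time integrals, among which W itself reappears. *)
Let W_derive i (s : R) : 0 <= s -> is_derive s 1 (W i) (c i - eps i s + W i s).
Proof.
move=> s0; have Df := cut_Df i; have Dh := cut_Dh i; have Dfu := hB D0 Dl Df (Du i).
have H := is_derive_Pint D0 Dl dC dl dge TD Tlin Tcontr Tadd Tcont Dfu Dg s0.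
apply: (is_derive_eq H); rewrite /W (kap_sub s Df (Du i) Dg) (Pint_sub s0 Df (Du i) Dg).
have := ug i Dg s0; rewrite (Pint_sub s0 (Du i) (hD Dl Df Dh) Dg).
have := Pint_linl D0 Dl dC dl dge TD Tlin Tcontr Tadd Tcont 1 s0 Df Dh Dg.
rewrite scale1r mul1r => ->; rewrite /eps /c (max_idPl s0) -/(kap dot T (u i) g s).
set x1 := kap _ _ _ _ _; set x2 := kap _ _ _ _ _; set y1 := Pint _ _ _ _ _.
set y2 := Pint _ _ _ _ _; set y3 := Pint _ _ _ _ _; set z := dot (u i) g.
exact: duhamel_arith.
Qed.

(** f_i and u_i take values in [0, 1], so f_i - u_i and its opposite are at most 1, and T_s keeps
    them so. *)
Let W_bound i (s : R) : 0 <= s -> `|W i s| <= m * s.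
Proof.
move=> s0; have Df := cut_Df i; have Dfu := hB D0 Dl Df (Du i).
have [r _ Wr] := Pint_mvt D0 Dl dC dl dge TD Tlin Tcontr Tadd Tcont s0 Dfu Dg.
rewrite /W Wr normrM (ger0_norm s0); apply: ler_wpM2r => //.
have h1 : kap dot T (f_ i - u i) g r <= m.
  rewrite -mE; apply: kap_le1 => //; apply: aeS resolvent_bounds => p /(_ i)[/andP[h _] _].
  by rewrite !fctE; have /andP[_ h2] := cut_f01 i p; rewrite lerBlDr (le_trans h2)// lerDl.
have h2 : kap dot T (u i - f_ i) g r <= m.
  rewrite -mE; apply: kap_le1 => //; first exact: (hB D0 Dl (Du i) Df).
  apply: aeS resolvent_bounds => p /(_ i)[/andP[_ h] _].
  by rewrite !fctE; have /andP[h2 _] := cut_f01 i p; rewrite lerBlDr (le_trans h)// lerDl.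
move: h1 h2; rewrite (kap_sub r Df (Du i) Dg) (kap_sub r (Du i) Df Dg).
by rewrite -[X in X <= m -> _ <= _]opprB lerNl ler_norml => h1 h2; rewrite h2 h1.
Qed.

Let c_small (e : R) : 0 < e -> exists i, c i <= e.
Proof.
move: e; apply: (duhamel_limit (m := m) (W := W) (eps := eps)).
- exact: dge.
- by move=> i; exact: Pint0.
- by move=> i s; exact: W_derive.
- move=> i s; apply: cvgB; last exact: (Pint_max_continuous (cut_Dh i) Dg).
  apply: cvgB; first exact: cvg_cst.
  exact: (kap_continuous D0 Dl dC dl dge TD Tlin Tcontr Tadd Tcont (cut_Df i) Dg).
- by move=> i s; exact: eps_bounds.
- by move=> s; exact: eps_cvg.
- by move=> i s; exact: W_bound.
Qed.

(** c i is the integral over K j0 of the nonnegative function (1 - u_i) rho; smallness in L^1 passes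
    to points by [ae_small], and rho is divided out. *)
Lemma resolvent_defect_small :
  {ae mu, forall p, K j0 p -> forall e : R, 0 < e -> exists i, 1 - u i p < e}.
Proof.
have iF i := L2w_mul_integrable rs r0 (hB D0 Dl Dg (Du i)) Dg.
pose F i p := `|(g - u i) p * g p * rho p|.
have mF i : measurable_fun setT (F i : borel M -> R).
  have /measurable_EFinP := measurable_int _ (iF i); exact: measurableT_comp.
have F_int i : (\int[mu]_p (F i p)%:E = (c i)%:E)%E.
  have -> : c i = dot (g - u i) g by rewrite /c (dotBl D0 Dl dl Dg (Du i) Dg).
  rewrite L2_dotE /Rintegral fineK; last exact: (integrable_fin_num measurableT (iF i)).
  apply: ae_eq_integral => //.
  - exact/measurable_EFinP.
  - exact: measurable_int (iF i).
  apply: aeS resolvent_bounds => p /(_ i)[/andP[_ h] _] _; congr EFin; apply: ger0_norm.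
  apply: mulr_ge0; last exact: ltW.
  by rewrite mulrBl gg subr_ge0 ler_piMl.
have := @ae_small _ (borel M) R mu F mF (fun i p => normr_ge0 _).
have H (e : R) : 0 < e -> exists i, (\int[mu]_p (F i p)%:E <= e%:E)%E.
  by move=> /c_small[i cn]; exists i; rewrite F_int lee_fin.
move=> /(_ H); apply: aeS => p Fp Kp e e0.
have [i] := Fp _ (mulr_gt0 e0 (r0 p)); rewrite /F !fctE /g cut_f1// mulr1 normrM (gtr0_norm (r0 p)).
by rewrite ltr_pM2r// => h; exists i; exact: le_lt_trans (ler_norm _) h.
Qed.

End Converse.

Lemma gen_conservative_resolvents_to_one :
  generalized_conservative rho V T -> {ae mu, forall p, u j p @[j --> \oo] --> (1 : R)}.
Proof.
move=> gc; have := ae_foralln (fun j => resolvent_defect_small gc j).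
move=> H; apply: aeS2 H resolvent_bounds => p h1 h2.
have [j Kj] := cut_Kp p; apply/cvgrPdist_lt => e e0.
have [i un] := h1 j Kj e e0; exists i => // k /= nk.
have unk : u i p <= u k p.
  by apply: (@homo_leq _ (u^~ p) _ lexx le_trans) => // l; case: (h2 l).
rewrite ger0_norm; first exact: le_lt_trans (lerB (lexx _) unk) un.
by rewrite subr_ge0; case: (h2 k) => /andP[].
Qed.

End Resolvents.

(** The criterion quantifies over all families of solutions, so that it mentions w and the
    exhaustion but not the semigroup; uniqueness of solutions carries it over from the
    resolvents. *)
Lemma gen_conservativeP : generalized_conservative rho V T <->
  forall u : nat -> M -> R, (forall j, is_solution w (K j) (u j)) ->
    {ae mu, forall p, u j p @[j --> \oo] --> (1 : R)}.
Proof.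
have /choice[r rP] j : exists r, D r /\ gen D dot T r (r - (f_ j + h_ j)).
  by have [r] := resolvent_ex j; exists r.
have Dr j : D (r j) by case: (rP j).
have rg j : gen D dot T (r j) (r j - (f_ j + h_ j)) by case: (rP j).
have rs' j : is_solution w (K j) (r j) := resolvent_solution (Dr j) (rg j).
split=> [gc u us|H]; last by apply: (resolvents_to_one_gen_conservative Dr rg); exact: H.
have ur : {ae mu, forall p, forall j, u j p = r j p}.
  apply: ae_foralln => j.
  apply: aeS2 (solution_mono ws w0 (@cK j) (@cK j) (@subset_refl _ _) (us j) (rs' j))
    (solution_mono ws w0 (@cK j) (@cK j) (@subset_refl _ _) (rs' j) (us j)) => p h1 h2.
  by apply: le_anti; rewrite h1.
apply: aeS2 ur (gen_conservative_resolvents_to_one Dr rg gc) => p E.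
by rewrite (_ : u ^~ p = r ^~ p)//; apply/funext => j; exact: E.
Qed.

Lemma solution_ex j : exists u, is_solution w (K j) u.
Proof. by have [r Dr rg] := resolvent_ex j; exists r; exact: resolvent_solution. Qed.

End Exhaustion.

End Semigroup.

(** * Comparison of the solutions for rho and rho + V *)

(** Completing the square, y^2 - d y >= - d^2 / 4, removes the unknown energy norm y of the
    approximant. *)
Lemma gap_arith (R : realType) (d y e' a b A B C1 C2 E1 E2 : R) :
  - (d * y) <= E1 -> y ^+ 2 - e' <= E2 -> E1 + E2 = a - b -> a - A <= C1 * e' -> B - b <= C2 * e' ->
  B - A - d ^+ 2 / 4 <= (1 + C1 + C2) * e'.
Proof.
move=> h1 h2 h3 h4 h5; have := sqr_ge0 (y - d / 2).
have -> : (y - d / 2) ^+ 2 = y ^+ 2 - d * y + d ^+ 2 / 4 by field.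
lra.
Qed.

(** 2 d is a round bound for the larger root d (1 + sqrt 2) / 2. *)
Lemma gap_quadratic (R : realType) (d x : R) : 0 <= d -> x ^+ 2 <= d * x + d ^+ 2 / 4 -> x <= 2 * d.
Proof. move=> d0 H; rewrite leNgt; apply/negP => h; move: H; rewrite !expr2; nra. Qed.

Lemma square_small (R : realType) (d e : R) : 0 < d -> d <= 1 -> d * 9 <= e -> (3 * d) ^+ 2 <= e.
Proof. by rewrite expr2; nra. Qed.

Lemma half_gap (R : realType) (x y z e : R) : 1 - x < e / 2 -> x - y < e / 2 -> y <= z -> 1 - z < e.
Proof. lra. Qed.

Section Comparison.
Context {R : realType} {n : nat} (M : weightedManifold R n).
Local Notation mu := (mu M).
Implicit Types (f h u v phi theta : M -> R) (K : set M).
Variables (rho V : M -> R).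
Hypotheses (rs : smooth rho) (r0 : forall p, 0 < rho p).
Hypotheses (Vs : smooth V) (V0 : forall p, 0 <= V p).
Local Notation w := (rho \+ V).
Local Notation aeS := (@filterS _ _ (ae_filter_ringOfSetsType mu)).
Local Notation aeS2 := (@filterS2 _ _ (ae_filter_ringOfSetsType mu)).
Local Notation aeS3 := (@filterS3 _ _ (ae_filter_ringOfSetsType mu)).
Let ws := smooth_total rs Vs.
Let w0 := total_gt0 r0 V0.
Let wl f : in_L2 w f -> in_L2 rho f := @L2_total _ _ M rho V rs r0 Vs V0 f.
Local Notation D := (in_L2 rho).
Local Notation Dw := (in_L2 w).
Let D0 := L2w_0 rho.
Let Dl := L2w_lin rs r0.
Let dC := L2w_dotC rho.
Let dl := L2w_dot_linl rs r0.
Let dge := L2w_dot_ge0 r0.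
Let D0w := L2w_0 w.
Let Dlw := L2w_lin ws w0.
Let dCw := L2w_dotC w.
Let dlw := L2w_dot_linl ws w0.
Let dgew := L2w_dot_ge0 w0.
Let W0 := in_W1_0 rs r0.
Let Wl := in_W1_linw rs r0.
Let el := energy_linlw rs r0.

Lemma total_dot_le f h : Dw f -> Dw h -> {ae mu, forall p, 0 <= f p * h p} ->
  L2_dot rho f h <= L2_dot w f h.
Proof.
move=> Lf Lh fh; rewrite !L2_dotE; apply: Rintegral_le_ae => //.
- exact: (L2w_mul_integrable rs r0 (wl Lf) (wl Lh)).
- exact: (L2w_mul_integrable ws w0 Lf Lh).
by apply: aeS fh => p h0 _; apply: ler_wpM2l => //=; rewrite lerDl.
Qed.

Lemma total_nrm_le f : Dw f -> nrm (L2_dot rho) f <= nrm (L2_dot w) f.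
Proof.
move=> Lf; rewrite /nrm ler_wsqrtr//; apply: total_dot_le => //.
by apply: (@aeW _ _ _ mu) => p; rewrite -expr2 sqr_ge0.
Qed.

Lemma total_W1 f : in_W1 w f -> in_W1 rho f.
Proof. by move=> [Lf G]; split => //; exact: wl. Qed.

(* Testing the difference of the two equations against z^+, where z = theta - v: since z > 0 forces
   the point into the support of theta, hence into K, the terms with V have a favourable sign
   there, and completing the square absorbs the energy of u - theta. *)
Section Gap.
Variables (K0 K : set M) (u v theta : M -> R) (d : R).
Hypotheses (cK0 : compact K0) (cK : compact K) (K0K : K0 `<=` K).
Hypotheses (us : is_solution rho K0 u) (vs : is_solution w K v).
Hypotheses (tT : test_function theta) (theta0 : forall p, ~ K p -> theta p = 0).
Hypotheses (d0 : 0 <= d) (en_d : nrm (@energy _ _ M) (u - theta) <= d)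
  (L2_d : nrm (L2_dot rho) (u - theta) <= d).
Let zp p := Num.max ((theta - v) p - 0) 0.

Let Wu : in_W10 rho u. Proof. by case: us. Qed.
Let Wv : in_W10 w v. Proof. by case: vs. Qed.
Let Lu : D u. Proof. by case: Wu => -[]. Qed.
Let Lvw : Dw v. Proof. by case: Wv => -[]. Qed.
Let Lv : D v. Proof. exact: wl. Qed.
Let Wz : in_W10 w (theta - v).
Proof. exact: (hB (in_W10_0 ws w0) (in_W10_lin ws w0) (test_W10 ws w0 tT) Wv). Qed.
Let Lzp : Dw zp.
Proof. by apply: (pos_part_L2 ws w0 (lexx 0)); case: Wz => -[]. Qed.
Let L0 : D ((\1_K0 : M -> R) - u).
Proof. exact: (hB D0 Dl (indic_compact_L2 rs r0 cK0) Lu). Qed.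
Let L1 : Dw ((\1_K : M -> R) - v).
Proof. exact: (hB D0w Dlw (indic_compact_L2 ws w0 cK) Lvw). Qed.
Let zp_ge0 p : 0 <= zp p.
Proof. by rewrite /zp le_max lexx orbT. Qed.

Let zpM p : (theta - v) p * zp p = zp p * zp p.
Proof. by rewrite /zp subr0; case: (leP ((theta - v) p) 0) => _; rewrite ?mulr0. Qed.

(** The two equations subtracted give the energy of u - v against an approximant phi of z^+. Its
    part from u - theta is at least - d |phi| by Cauchy-Schwarz, and its part from z is at least
    |phi|^2 - e. *)
Let gap_test (e : R) : 0 < e ->
  L2_dot w ((\1_K : M -> R) - v) zp - L2_dot rho ((\1_K0 : M -> R) - u) zp - d ^+ 2 / 4 <=
  (1 + nrm (L2_dot rho) ((\1_K0 : M -> R) - u) + nrm (L2_dot w) ((\1_K : M -> R) - v)) * e.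
Proof.
move=> e0; have [phi pT [h1 h2]] := W10_trunc ws w0 (lexx 0) Wz e0.
have Lpw := test_L2 ws w0 pT; have Lp := test_L2 rs r0 pT; have Wp := test_W1 rs r0 pT.
have Wut : in_W1 rho (u - theta) := hB W0 Wl (proj1 Wu) (test_W1 rs r0 tT).
have Wz' : in_W1 rho (theta - v) := total_W1 (proj1 Wz).
have ey := nrm_sqr (@energyC _ _ M) (@energy_ge0 _ _ M) phi.
have y0 : 0 <= nrm (@energy _ _ M) phi by exact: nrm_ge0.
have E1 : - (d * nrm (@energy _ _ M) phi) <= energy (u - theta) phi.
  have := dot_le_nrm W0 Wl (@energyC _ _ M) el (@energy_ge0 _ _ M) Wut Wp.
  rewrite ler_norml => /andP[H _]; apply: le_trans H; rewrite lerN2.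
  exact: ler_wpM2r.
have E2 : nrm (@energy _ _ M) phi ^+ 2 - e <= energy (theta - v) phi.
  rewrite ey; exact: h2.
have E3 : energy (u - theta) phi + energy (theta - v) phi =
    L2_dot rho ((\1_K0 : M -> R) - u) phi - L2_dot w ((\1_K : M -> R) - v) phi.
  have [_ uE] := us; have [_ vE] := vs.
  have A : energy (u - theta + (theta - v)) phi = energy (u - theta) phi + energy (theta - v) phi.
    exact: (dotDl el Wut Wz' Wp).
  have B : energy (u - v) phi = energy u phi - energy v phi.
    exact: (dotBl W0 Wl el (proj1 Wu) (total_W1 (proj1 Wv)) Wp).
  have C : u - theta + (theta - v) = u - v by rewrite addrA subrK.
  apply: (etrans (esym A)); apply: (etrans (congr1 (fun x => energy x phi) C)).
  exact: (etrans B (congr2 (fun x y : R => x - y) (uE _ pT) (vE _ pT))).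
have E4 : L2_dot rho ((\1_K0 : M -> R) - u) phi - L2_dot rho ((\1_K0 : M -> R) - u) zp <=
    nrm (L2_dot rho) ((\1_K0 : M -> R) - u) * e.
  rewrite -(dotBr D0 Dl dC dl Lp (wl Lzp) L0); apply: le_trans (ler_norm _) _.
  apply: le_trans (dot_le_nrm D0 Dl dC dl dge L0 (hB D0 Dl Lp (wl Lzp))) _.
  apply: ler_wpM2l; first exact: nrm_ge0.
  exact: le_trans (total_nrm_le (hB D0w Dlw Lpw Lzp)) (ltW h1).
have E5 : L2_dot w ((\1_K : M -> R) - v) zp - L2_dot w ((\1_K : M -> R) - v) phi <=
    nrm (L2_dot w) ((\1_K : M -> R) - v) * e.
  rewrite -opprB -(dotBr D0w Dlw dCw dlw Lpw Lzp L1); apply: le_trans (ler_norm _) _.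
  rewrite normrN; apply: le_trans (dot_le_nrm D0w Dlw dCw dlw dgew L1 (hB D0w Dlw Lpw Lzp)) _.
  apply: ler_wpM2l; first exact: nrm_ge0.
  exact: ltW h1.
exact: (gap_arith E1 E2 E3 E4 E5).
Qed.

Let gap_w : L2_dot w ((\1_K : M -> R) - v) zp - L2_dot rho ((\1_K0 : M -> R) - u) zp <= d ^+ 2 / 4.
Proof.
rewrite -subr_le0; apply: le0_eps gap_test.
by apply: addr_ge0; [apply: addr_ge0 => //|]; exact: nrm_ge0.
Qed.

Let gap_rho : L2_dot rho (u - v) zp <= d ^+ 2 / 4.
Proof.
apply: le_trans gap_w.
have v0 := solution_ge0 ws w0 cK vs; have v1 := solution_le1 ws w0 cK vs.
have h1 : L2_dot rho ((\1_K : M -> R) - v) zp <= L2_dot w ((\1_K : M -> R) - v) zp.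
  apply: total_dot_le => //; apply: aeS2 v0 v1 => p p0 p1; rewrite !fctE.
  case: (pselect (K p)) => Kp.
    by rewrite indicE mem_set//= mulr_ge0// subr_ge0.
  (* Outside K theta vanishes and v is nonnegative, so z^+ = 0. Inside K, 1 - v is nonnegative and
     enlarging the weight from rho to w only increases the integral. *)
  rewrite /zp !fctE theta0// sub0r subr0.
  by case: (leP (- v p) 0) => h; [rewrite mulr0|move: h; rewrite oppr_gt0 ltNge p0].
apply: le_trans (lerB h1 (lexx _)).
rewrite -(dotBl D0 Dl dl (wl L1) L0 (wl Lzp)).
apply: (L2w_dot_le rs r0 (hB D0 Dl Lu Lv) (wl Lzp) (hB D0 Dl (wl L1) L0) (wl Lzp)).
apply: (@aeW _ _ _ mu) => p; apply: ler_wpM2r => //; rewrite !fctE [leLHS]addrC.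
have -> : (\1_K p : R) - v p - (\1_K0 p - u p) = - v p + u p + (\1_K p - \1_K0 p) by ring.
rewrite lerDl subr_ge0 !indicE ler_nat.
by case: (pselect (K0 p)) => Kp; [rewrite !mem_set//; exact: K0K|rewrite memNset].
Qed.

(** |z^+|^2 splits into the pairings of theta - u and u - v with z^+; the first is at most d |z^+|
    and the second at most d^2 / 4. *)
Lemma gap_nrm : nrm (L2_dot rho) zp <= 2 * d.
Proof.
apply: gap_quadratic => //; rewrite (nrm_sqr dC dge).
have Lt := test_L2 rs r0 tT; have Lz := wl Lzp; have Lut := hB D0 Dl Lu Lt.
have Ltu := hB D0 Dl Lt Lu; have Luv := hB D0 Dl Lu Lv.
have -> : L2_dot rho zp zp = L2_dot rho (theta - u) zp + L2_dot rho (u - v) zp.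
  rewrite -(dotDl dl Ltu Luv Lz) addrA subrK !L2_dotE.
  by apply: eq_Rintegral => p _; rewrite zpM.
apply: lerD gap_rho; apply: le_trans (ler_norm _) _.
apply: le_trans (dot_le_nrm D0 Dl dC dl dge Ltu Lz) _.
apply: ler_wpM2r; first exact: nrm_ge0.
by rewrite -opprB (nrmN D0 Dl dC dl).
Qed.

End Gap.

(** C is the support of a test function theta near u. The bound does not depend on the solution v,
    because (u - v)^+ is dominated by |u - theta| + (theta - v)^+. *)
Lemma solution_approx K0 u (e : R) : compact K0 -> is_solution rho K0 u -> 0 < e ->
  exists2 C : set M, compact C & forall K v, compact K -> K0 `<=` K -> C `<=` K ->
    is_solution w K v ->
    L2_dot rho (fun p => Num.max ((u - v) p - 0) 0) (fun p => Num.max ((u - v) p - 0) 0) <= e.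
Proof.
move=> cK0 us e0; have [Wu _] := us; have [[Lu _] _] := Wu.
(* The two terms have norms at most d and 2 d, and (3 d)^2 <= 9 d <= e since d <= 1. *)
pose d := Num.min 1 (e / 9).
have d0 : 0 < d by rewrite lt_min ltr01 divr_gt0.
have de : (3 * d) ^+ 2 <= e.
  have h1 : d <= 1 by rewrite ge_min lexx.
  have h2 : d * 9 <= e by rewrite -ler_pdivlMr// ge_min lexx orbT.
  exact: square_small.
have [theta tT [h1 h2]] := W10_approx r0 Wu d0.
have [ts cs] := tT; exists (supp theta) => // K v cK K0K sK vs.
have theta0 p : ~ K p -> theta p = 0 by move=> nK; apply: supp_neq0 => /sK.
have gap := gap_nrm cK0 cK K0K us vs tT theta0 (ltW d0) (ltW h1) (ltW h2).
have [[[Lvw _] _] _] := vs; have Lv := wl Lvw; have Lt := test_L2 rs r0 tT.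
have Lut := hB D0 Dl Lu Lt; have Lf := pos_part_L2 rs r0 (lexx 0) (hB D0 Dl Lu Lv).
have Lz := pos_part_L2 rs r0 (lexx 0) (hB D0 Dl Lt Lv).
set f := (fun p => Num.max ((u - v) p - 0) 0) in Lf *.
set z := (fun p => Num.max ((theta - v) p - 0) 0) in Lz gap.
have La : D (fun p => `|(u - theta) p|).
  apply: (L2w_dominated rs r0 _ Lut); last by move=> p; rewrite normr_id.
  by apply: measurableT_comp => //; case: Lut.
set a := (fun p => _) in La.
have a_d : nrm (L2_dot rho) a <= d.
  apply: le_trans (ltW h2); apply: (L2_norm_le rs r0 La Lut) => p.
  by rewrite /a normr_id.
have faz p : `|f p| <= `|(a + z) p|.
  have a0 : 0 <= a p by exact: normr_ge0.
  have z0 : 0 <= z p by rewrite /z le_max lexx orbT.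
  have az0 : 0 <= a p + z p by exact: addr_ge0.
  rewrite !fctE (ger0_norm az0) ger0_norm; last by rewrite /f le_max lexx orbT.
  rewrite /f ge_max az0 andbT subr0 !fctE.
  have h : u p - theta p <= a p by exact: ler_norm.
  have h' : theta p - v p <= z p by rewrite /z subr0 !fctE le_max lexx.
  by rewrite -(subrK (theta p) (u p)) -addrA lerD.
rewrite -(nrm_sqr dC dge f); apply: le_trans de; apply: lerXn2r; rewrite ?nnegrE.
- exact: nrm_ge0.
- by apply: mulr_ge0 => //; exact: ltW.
apply: le_trans (L2_norm_le rs r0 Lf (hD Dl La Lz) faz) _.
apply: le_trans (nrmD D0 Dl dC dl dge La Lz) _.
by have -> : 3 * d = d + 2 * d by [ring]; exact: lerD.
Qed.

Section Exhaustion.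
Variable K : nat -> set M.
Hypotheses (cK : forall j, compact (K j)) (K_nd : forall j, K j `<=` K j.+1)
  (Kcov : forall C, compact C -> exists j, C `<=` K j).
Variables (u v : nat -> M -> R).
Hypotheses (us : forall j, is_solution rho (K j) (u j)) (vs : forall j, is_solution w (K j) (v j)).

Let approx i : {ae mu, forall p, forall e : R, 0 < e -> exists j, u i p - v j p < e}.
Proof.
have [[[Lu _] _] _] := us i.
have Lv j : D (v j) by have [[[Lvw _] _] _] := vs j; exact: wl.
pose f j p := Num.max ((u i - v j) p - 0) 0.
have Lf j : D (f j) by exact: (pos_part_L2 rs r0 (lexx 0) (hB D0 Dl Lu (Lv j))).
have iF j := L2w_mul_integrable rs r0 (Lf j) (Lf j).
pose F j p := f j p * f j p * rho p.
have mF j : measurable_fun setT (F j : borel M -> R).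
  by have /measurable_EFinP := measurable_int _ (iF j).
have F0 j p : 0 <= F j p by rewrite /F mulr_ge0 ?(ltW (r0 p))// -expr2 sqr_ge0.
have H (e : R) : 0 < e -> exists j, (\int[mu]_p (F j p)%:E <= e%:E)%E.
  move=> e0; have [C cC CP] := solution_approx (@cK i) (us i) e0.
  have [j Cj] := Kcov cC; exists (maxn i j).
  have := CP (K (maxn i j)) (v (maxn i j)) (@cK _) (cut_K_mono K_nd (leq_maxl _ _))
    (subset_trans Cj (cut_K_mono K_nd (leq_maxr _ _))) (vs _).
  rewrite L2_dotE -lee_fin /Rintegral fineK//.
  exact: (integrable_fin_num measurableT (iF _)).
have := @ae_small _ (borel M) R mu F mF F0 H; apply: aeS => p Fp e e0.
have [j Fj] := Fp _ (mulr_gt0 (mulr_gt0 e0 e0) (r0 p)); exists j.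
move: Fj; rewrite /F ltr_pM2r// -!expr2 ltr_sqr ?nnegrE ?(ltW e0)//; last first.
  by rewrite /f le_max lexx orbT.
by apply: le_lt_trans; rewrite /f subr0 !fctE le_max lexx.
Qed.

(** At almost every point some u_i is within e / 2 of 1, some v_j is above u_i - e / 2, and v
    increases and stays at most 1. *)
Lemma solutions_to_one_total : {ae mu, forall p, u j p @[j --> \oo] --> (1 : R)} ->
  {ae mu, forall p, v j p @[j --> \oo] --> (1 : R)}.
Proof.
move=> u1.
have v_bounds : {ae mu, forall p, forall j, v j p <= 1 /\ v j p <= v j.+1 p}.
  apply: ae_foralln => j; apply: aeS2 (solution_le1 ws w0 (@cK j) (vs j))
    (solution_mono ws w0 (@cK j) (@cK j.+1) (@K_nd j) (vs j) (vs j.+1)) => p; by [].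
apply: aeS3 u1 v_bounds (ae_foralln approx) => p u1p vb ap.
apply/cvgrPdist_lt => e e0; have e2 : 0 < e / 2 by rewrite divr_gt0.
move/cvgrPdist_lt: u1p => /(_ _ e2)[i _ /(_ i (leqnn i))/= ui].
have [j vj] := ap i _ e2; exists j => // k /= jk.
have vjk : v j p <= v k p.
  by apply: (@homo_leq _ (v^~ p) _ lexx le_trans) => // l; case: (vb l).
rewrite ger0_norm; last by rewrite subr_ge0; case: (vb k).
exact: (half_gap (le_lt_trans (ler_norm _) ui) vj vjk).
Qed.

End Exhaustion.

End Comparison.

(** V / rho is 0, and the constant sequence 0 approximates it, so its extended time integral
    vanishes almost everywhere. *)
Lemma conservative_generalized (R : realType) (n : nat) (M : weightedManifold R n) (rho : M -> R)
    (T : R -> (M -> R) -> (M -> R)) : smooth rho -> (forall p, 0 < rho p) ->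
  is_semigroup rho (cst 0) T -> conservative rho T <-> generalized_conservative rho (cst 0) T.
Proof.
move=> rs r0 ST.
have Vs : smooth (cst 0 : M -> R) := @smooth_cst _ _ M 0.
have V0 (p : M) : 0 <= (cst 0 : M -> R) p by [].
have approx0 : approximates rho (fun _ => (0 : M -> R)) (fun p => ((cst 0 : M -> R) p / rho p)%:E).
  split; first by move=> _; exact: L2w_0.
    by apply: (@aeW _ _ _ (mu M)) => p j; rewrite lexx.
  by apply: (@aeW _ _ _ (mu M)) => p; rewrite /cst/= mul0r; exact: cvg_cst.
have ext0 (t : R) : 0 < t -> {ae mu M, forall p, Lplus_ext rho (time_integral rho T t)
    (fun p => ((cst 0 : M -> R) p / rho p)%:E) p = 0%E}.
  move=> t0; have [_ _ H] := time_integral_extP rs r0 Vs V0 ST t0 approx0.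
  have D0 := L2w_0 (M := M) rho.
  apply: (@filterS2 _ _ (ae_filter_ringOfSetsType (mu M))) (H _ approx0)
    (* The selected time integral of 0 need not be the zero function; additivity at 0 - 0 shows that
       it vanishes almost everywhere. *)
    (time_integral_sub rs r0 ST t0 D0 D0) => p h1; rewrite !subrr => h2.
  by rewrite h2 in h1; apply/esym; apply: (cvg_unique _ _ h1) => //; exact: cvg_cst.
by split=> H t t0; apply: (@filterS2 _ _ (ae_filter_ringOfSetsType (mu M))) (H t t0) (ext0 t t0) => p
  /(_ I) h1 h2 _; move: h1; rewrite h2 adde0.
Qed.

Theorem theorem3p5 (R : realType) (n : nat) (M : weightedManifold R n)
  (M_connected : connected [set: M])
  (T : (M -> R) -> (M -> R) -> R -> (M -> R) -> (M -> R))
  (T_semigroup : forall rho V : M -> R,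
     smooth rho -> (forall p, 0 < rho p) ->
     smooth V -> (forall p, 0 <= V p) -> is_semigroup rho V (T rho V))
  (rho V : M -> R)
  (rho_smooth : smooth rho) (rho_gt0 : forall p, 0 < rho p)
  (V_smooth : smooth V) (V_ge0 : forall p, 0 <= V p) :
  ((conservative rho (T rho (cst 0)) ->
      generalized_conservative rho V (T rho V)) /\
   (conservative (cst 1) (T (cst 1) (cst 0)) ->
      generalized_conservative (cst 1) V (T (cst 1) V))) /\
  (generalized_conservative rho V (T rho V) <->
     conservative (rho \+ V) (T (rho \+ V) (cst 0))).
Proof.
have [K [cK K_nd Kcov]] := compact_exhaustion M.
pose crit (w : M -> R) := forall u : nat -> M -> R, (forall j, is_solution w (K j) (u j)) ->
  {ae mu M, forall p, u j p @[j --> \oo] --> (1 : R)}.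
have s0 : smooth (cst 0 : M -> R) := @smooth_cst _ _ M 0.
have z0 (p : M) : 0 <= (cst 0 : M -> R) p by [].
have gcP (r U : M -> R) : smooth r -> (forall p, 0 < r p) -> smooth U -> (forall p, 0 <= U p) ->
    generalized_conservative r U (T r U) <-> crit (r \+ U).
  by move=> rs r0 Us U0; exact: (gen_conservativeP rs r0 Us U0 (T_semigroup _ _ rs r0 Us U0)
    cK K_nd Kcov).
have addr_cst0 (r : M -> R) : r \+ cst 0 = r by apply/funext => p /=; rewrite addr0.
have cP (r : M -> R) : smooth r -> (forall p, 0 < r p) -> conservative r (T r (cst 0)) <-> crit r.
  move=> rs r0; have := gcP r _ rs r0 s0 z0; rewrite addr_cst0 => <-.
  exact: (conservative_generalized rs r0 (T_semigroup _ _ rs r0 s0 z0)).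
have part_a (r : M -> R) : smooth r -> (forall p, 0 < r p) -> conservative r (T r (cst 0)) ->
    generalized_conservative r V (T r V).
  move=> rs r0 /(cP _ rs r0) u1; apply/gcP => // v vs.
  (* Solutions for r come from the resolvents of the semigroup with zero potential; the criterion
     says nothing until such a family is exhibited. *)
  have /choice[u us] j : exists u, is_solution r (K j) u.
    rewrite -(addr_cst0 r).
    exact: (solution_ex rs r0 s0 z0 (T_semigroup _ _ rs r0 s0 z0) cK j).
  exact: (solutions_to_one_total rs r0 V_smooth V_ge0 cK K_nd Kcov us vs (u1 u us)).
split; first split; first exact: part_a.
  by apply: part_a => [|p]; [exact: (@smooth_cst _ _ M 1)|exact: ltr01].
(* The pairs (rho, V) and (rho + V, 0) have the same sum, so both sides are the criterion for rho +
   V. *)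
rewrite gcP// cP//; [exact: smooth_total|exact: total_gt0].
Qed.
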